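(* Let $(\mathbb B,\ltimes,\rtimes)$ be a left/right/purely central premonoidal double category such that its associativity and unity constraints are liftable vertical transformations and such that the 2-cells $-\rtimes u|_U$ are trivial. Then for its underlying horizontal bicategory $\mathcal H(\mathbb B)$ (equipped with the companion-lifts $\hat\alpha,\hat\lambda,\hat\rho$ of the constraints): 1. $\mathcal H(\mathbb B)$ is a left/right/purely central premonoidal bicategory with structure $\mathcal H(\ltimes,\rtimes)$; 2. $\mathcal H(\mathbb B)$ is a monoidal bicategory with structure $\mathcal H(\otimes_r)$; 3. $\mathcal H(\mathbb Z_p^{st}(\mathbb B)_{hm})$ is a monoidal bicategory and $C_p(\mathcal H(\mathbb B))$ inherits a monoidal structure from it (via the pseudofunctor $hor_p:\mathcal H(\mathbb Z_p^{st}(\mathbb B)_{hm})\to C_p(\mathcal H(\mathbb B))$).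
   Context: Double categories are strict: objects, 1h-cells (horizontal), 1v-cells (vertical), squares (2-cells). $[a|b]$: horizontal composition ($a$ left); $a/b$: vertical composition ($a$ on top), also for 1v-cells and transformations. $\mathcal H(\mathbb B)$: 2-category of objects, 1h-cells and horizontally globular 2-cells (vertical sides identities); $\mathcal H$ also denotes restriction of functors, horizontal transformations and modifications. Pseudodouble functors preserve vertical structure strictly and horizontal composition up to coherent natural invertible compositors and unitors. A horizontal pseudonatural transformation $\alpha:F\Rightarrow G$ has 1h-components $\alpha(A)$, squares $\alpha^u$ (top $\alpha(A)$, bottom $\alpha(\tilde A)$, left $F(u)$, right $G(u)$) and invertible horizontally globular 2-cells $\alpha(B)F(f)\Rightarrow G(f)\alpha(A)$, coherent and natural. A vertical pseudonatural transformation has 1v-components, squares $\alpha_f$ (top $F(f)$, bottom $G(f)$) and horizontally invertible vertically globular 2-cells between $\alpha(A)/G(u)$ and $F(u)/\alpha(\tilde A)$, coherent and natural; strict if these are identities, and then invertible if all $\alpha_f$ are vertically invertible. Modifications between two horizontal and two vertical transformations: families of squares compatible with all structure cells; horizontal modification: the vertical transformations are identities. $\mathrm{Pseudo}_{ps}(\mathbb B,\mathbb B)$: double category of pseudodouble endofunctors, horizontal/vertical pseudonatural transformations, modifications. Companion of a 1v-cell $u:A\to B$: a 1h-cell $\hat u:A\to B$ with 2-cells $\varepsilon_u$ (top $\hat u$, left $u$, other sides identities), $\eta_u$ (bottom $\hat u$, right $u$, other sides identities), $[\eta_u|\varepsilon_u]=\mathrm{Id}$, $\eta_u/\varepsilon_u=\mathrm{Id}$.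 A vertical transformation is liftable if its 1v-components have companions; the companion-lift $\hat\alpha$ of an invertible liftable vertical strict $\alpha$ has components $\hat\alpha(A)$ and $[\eta_{\alpha(A)}|\alpha_f|\varepsilon_{\alpha(B)}]$, and is a pseudonatural equivalence on $\mathcal H$. Binoidal: pseudodouble functors $A\ltimes-,-\rtimes B$ with $A\ltimes B=A\rtimes B=:A\bowtie B$ $(=AB)$. A 1h-cell (1v-cell) $p:A\to A'$ is left central via a horizontal (vertical) pseudonatural $p\ltimes-:A\ltimes-\Rightarrow A'\ltimes-$ with $p\ltimes B=p\rtimes B$; right central via $-\rtimes p:-\rtimes A\Rightarrow-\rtimes A'$ with $B\rtimes p=B\ltimes p$; a 2-cell $a$ is left (right) central if the cells $a\rtimes B$ (resp. $B\ltimes a$) form a modification $a\ltimes-$ (resp. $-\rtimes a$). Inversely central 1v-cell: invertible, it and its inverse left and right central with mutually inverse components at 1h-cells. Purely central: all cells have chosen left and right centrality structures with $K\ltimes-|_k=(-\rtimes k|_K)^{-1}$, $U\ltimes-|_u=(-\rtimes u|_U)^{-1}$, $K\ltimes-|_u=-\rtimes u|_K$, $U\ltimes-|_k=-\rtimes k|_U$ ($K,k$ horizontal, $U,u$ vertical). Left central: all cells have left centrality structures such that $A\mapsto A\ltimes-$, $b\mapsto b\ltimes-$ is a pseudodouble functor $\mathbb B\to\mathrm{Pseudo}_{ps}(\mathbb B,\mathbb B)$ whose compositor and unitor have components those of the $-\rtimes B$; right central symmetrically. (These three notions are equivalent: each determines the others.) Premonoidal: binoidal with an object $I$ and invertible vertical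 strict transformations $\lambda:I\ltimes-\Rightarrow\mathrm{Id}$, $\rho:-\rtimes I\Rightarrow\mathrm{Id}$, $\alpha_{-,B,C}:(-\rtimes B)\rtimes C\Rightarrow-\rtimes(B\bowtie C)$, $\alpha_{A,-,C}:(A\ltimes-)\rtimes C\Rightarrow A\ltimes(-\rtimes C)$, $\alpha_{A,B,-}:(A\bowtie B)\ltimes-\Rightarrow A\ltimes(B\ltimes-)$ with inversely central 1v-components, the $\alpha$'s having common 1v-components, satisfying the pentagon $\alpha_{W,X,Y}Z/\alpha_{W,XY,Z}/W\alpha_{X,Y,Z}=\alpha_{WX,Y,Z}/\alpha_{W,X,YZ}$ in each variable and $\alpha_{W,I,Y}/W\lambda_Y=\rho_WY$, $\alpha_{I,W,Y}/\lambda_{WY}=\lambda_WY$, $\alpha_{W,Y,I}/W\rho_Y=\rho_{WY}$ in each of $W,Y$; for left/right/purely central ones the associativity is also compatible with the chosen exchange cells $p\ltimes-|_q$. $\otimes_r:\mathbb B\times\mathbb B\to\mathbb B$: $A\otimes_rB=A\bowtie B$, $K\otimes_rk=(A'\ltimes k)(K\rtimes B)$ for 1h-cells $K:A\to A'$, $k:B\to B'$, $U\otimes_ru=(U\rtimes B)/(\tilde A\ltimes u)$ for 1v-cells, and on 2-cells $\sigma$ (top $K$, bottom $\tilde K$, left $U$, right $U'$), $\delta$ (top $k$, left $u$): $[(\sigma\rtimes B)/(-\rtimes u|_{\tilde K})\,|\,(-\rtimes k|_{U'})/(\tilde A'\ltimes\delta)]$. Premonoidal bicategory: bicategory with pseudofunctors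 $A\ltimes-,-\rtimes B$ agreeing on objects ($A\ltimes B=A\rtimes B=:A\bowtie B$), a unit object $I$, pseudonatural equivalences $\lambda:I\ltimes-\Rightarrow\mathrm{Id}$, $\rho:-\rtimes I\Rightarrow\mathrm{Id}$, $\alpha_{-,B,C}:(-\rtimes B)\rtimes C\Rightarrow-\rtimes(B\bowtie C)$, $\alpha_{A,-,C}:(A\ltimes-)\rtimes C\Rightarrow A\ltimes(-\rtimes C)$, $\alpha_{A,B,-}:(A\bowtie B)\ltimes-\Rightarrow A\ltimes(B\ltimes-)$ with central 1-cell components, and invertible 2-cells $p,m,l,r$ forming modifications in each argument, subject to the same equations as in a monoidal bicategory. Left/right/purely central bicategories are defined as for double categories, dropping 1v-cells (e.g. pure: $f\ltimes-|_g=(-\rtimes g|_f)^{-1}$). $\mathbb Z_p^{st}(\mathbb B)$: pseudodouble category with the objects of $\mathbb B$ and 1h-, 1v-, 2-cells the triples $(b,b\ltimes-,-\rtimes b)$ of cells of $\mathbb B$ with their chosen centrality structures; $\mathbb Z_p^{st}(\mathbb B)_{hm}$ has only those 2-cells $(a,a\ltimes-,-\rtimes a)$ for which $a\ltimes-$ and $-\rtimes a$ are horizontal modifications. For a premonoidal bicategory $\mathcal B$ with functorially chosen pure centrality structures ($f\ltimes-|_g=(-\rtimes g|_f)^{-1}$), structural 1-cells included, $C_p(\mathcal B)$ (bicategory of pure maps) has the same objects and 1-, 2-cells the triples $(b,b\ltimes-,-\rtimes b)$. $hor_p$ is the identity on objects and sends $(b,b\ltimes-,-\rtimes b)$ to $(b,\mathcal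 H(b\ltimes-),\mathcal H(-\rtimes b))$.
   Formalization: ''Liftable'' for the invertible constraints is taken to require companions also for the inverses of their 1v-components; without this the companion-lifts need not be equivalences and the claim fails, and the condition is necessary for the conclusion. *)

(* Defs.v *)
(* Conventions.  All compositions are written in diagrammatic order: [f · g] is
   [f] followed by [g], so the 1-cell usually written [g f].  Structures are
   given as raw data (records) together with predicates [is_...] collecting the
   axioms; this lets composites of functors and transformations be formed
   before their axioms are proved.  Object assignments of functors, and
   components of transformations, are parameters of the types, so that the
   requirements such as [A ⋉ B = A ⋊ B] or [p ⋉ B = p ⋊ B] hold by typing. *)

Set Implicit Arguments.
Unset Strict Implicit.

Reserved Notation "f · g" (at level 40, left associativity).
Reserved Notation "f ⇣ g" (at level 40, left associativity).
Reserved Notation "a • b" (at level 60, right associativity).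
Reserved Notation "f ◁ a" (at level 50, no associativity).
Reserved Notation "a ▷ f" (at level 50, no associativity).
Reserved Notation "a ∥ b" (at level 51, left associativity).
Reserved Notation "a ⫽ b" (at level 52, left associativity).
Reserved Notation "a ≈ b" (at level 70, no associativity).
Reserved Notation "F @1 f" (at level 30, no associativity).
Reserved Notation "F @2 a" (at level 30, no associativity).

Record bicat (O : Type) := Bicat {
  hom : O -> O -> Type;
  cell : forall A B, hom A B -> hom A B -> Type;
  id1 : forall A, hom A A;
  comp1 : forall A B C, hom A B -> hom B C -> hom A C;
  id2 : forall A B (f : hom A B), cell f f;
  comp2 : forall A B (f g h : hom A B), cell f g -> cell g h -> cell f h;
  whiskl : forall A B C (f : hom A B) (g h : hom B C),
    cell g h -> cell (comp1 f g) (comp1 f h);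
  whiskr : forall A B C (f g : hom A B) (h : hom B C),
    cell f g -> cell (comp1 f h) (comp1 g h);
  assoc : forall A B C D (f : hom A B) (g : hom B C) (h : hom C D),
    cell (comp1 (comp1 f g) h) (comp1 f (comp1 g h));
  associ : forall A B C D (f : hom A B) (g : hom B C) (h : hom C D),
    cell (comp1 f (comp1 g h)) (comp1 (comp1 f g) h);
  lun : forall A B (f : hom A B), cell (comp1 (id1 A) f) f;
  luni : forall A B (f : hom A B), cell f (comp1 (id1 A) f);
  run : forall A B (f : hom A B), cell (comp1 f (id1 B)) f;
  runi : forall A B (f : hom A B), cell f (comp1 f (id1 B)) }.

Arguments hom {O} b A B.
Arguments cell {O} b {A B} f g : rename.
Arguments comp1 {O} b {A B D} f g : rename.
Arguments comp2 {O} C {A B f g h} a b : rename.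
Arguments id1 {O} b A.
Arguments id2 {O} {b} {A B} f.
Arguments assoc {O} {b} {A B C D} f g h.
Arguments associ {O} {b} {A B C D} f g h.
Arguments lun {O} {b} {A B} f.
Arguments luni {O} {b} {A B} f.
Arguments run {O} {b} {A B} f.
Arguments runi {O} {b} {A B} f.
Arguments whiskl {O} {b} {A B C} f {g h} a : rename.
Arguments whiskr {O} {b} {A B C} {f g} h a : rename.

Declare Scope bicat_scope.
Notation "f · g" := (comp1 _ f g) : bicat_scope.
Notation "a • b" := (comp2 _ a b) : bicat_scope.
Notation "f ◁ a" := (whiskl f a) : bicat_scope.
Notation "a ▷ f" := (whiskr f a) : bicat_scope.
Local Open Scope bicat_scope.

Record is_bicat {O} (C : bicat O) : Prop := {
  bc_idl : forall A B (f g : hom C A B) (a : cell C f g), id2 f • a = a;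
  bc_idr : forall A B (f g : hom C A B) (a : cell C f g), a • id2 g = a;
  bc_assoc : forall A B (f g h k : hom C A B)
    (a : cell C f g) (b : cell C g h) (c : cell C h k),
    a • (b • c) = (a • b) • c;
  bc_wl_id : forall A B D (f : hom C A B) (g : hom C B D),
    f ◁ id2 g = id2 (f · g);
  bc_wr_id : forall A B D (f : hom C A B) (g : hom C B D),
    id2 f ▷ g = id2 (f · g);
  bc_wl_comp : forall A B D (f : hom C A B) (g h k : hom C B D)
    (a : cell C g h) (b : cell C h k), f ◁ (a • b) = (f ◁ a) • (f ◁ b);
  bc_wr_comp : forall A B D (f g h : hom C A B) (k : hom C B D)
    (a : cell C f g) (b : cell C g h), (a • b) ▷ k = (a ▷ k) • (b ▷ k);
  bc_lun : forall A B (f g : hom C A B) (a : cell C f g),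
    (id1 C A ◁ a) • lun g = lun f • a;
  bc_run : forall A B (f g : hom C A B) (a : cell C f g),
    (a ▷ id1 C B) • run g = run f • a;
  bc_wl_wl : forall A B D E (f : hom C A B) (g : hom C B D) (h k : hom C D E)
    (a : cell C h k),
    assoc f g h • (f ◁ (g ◁ a)) = ((f · g) ◁ a) • assoc f g k;
  bc_wl_wr : forall A B D E (f : hom C A B) (g h : hom C B D) (k : hom C D E)
    (a : cell C g h),
    assoc f g k • (f ◁ (a ▷ k)) = ((f ◁ a) ▷ k) • assoc f h k;
  bc_wr_wr : forall A B D E (f g : hom C A B) (h : hom C B D) (k : hom C D E)
    (a : cell C f g),
    assoc f h k • (a ▷ (h · k)) = ((a ▷ h) ▷ k) • assoc g h k;
  bc_exchange : forall A B D (f g : hom C A B) (h k : hom C B D)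
    (a : cell C f g) (b : cell C h k), (a ▷ h) • (g ◁ b) = (f ◁ b) • (a ▷ k);
  bc_assoc_associ : forall A B D E (f : hom C A B) (g : hom C B D) (h : hom C D E),
    assoc f g h • associ f g h = id2 _;
  bc_associ_assoc : forall A B D E (f : hom C A B) (g : hom C B D) (h : hom C D E),
    associ f g h • assoc f g h = id2 _;
  bc_lun_luni : forall A B (f : hom C A B), lun f • luni f = id2 _;
  bc_luni_lun : forall A B (f : hom C A B), luni f • lun f = id2 _;
  bc_run_runi : forall A B (f : hom C A B), run f • runi f = id2 _;
  bc_runi_run : forall A B (f : hom C A B), runi f • run f = id2 _;
  bc_triangle : forall A B D (f : hom C A B) (g : hom C B D),
    assoc f (id1 C B) g • (f ◁ lun g) = run f ▷ g;
  bc_pentagon : forall A B D E F (f : hom C A B) (g : hom C B D)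
    (h : hom C D E) (k : hom C E F),
    assoc (f · g) h k • assoc f g (h · k)
    = (assoc f g h ▷ k) • (assoc f (g · h) k • (f ◁ assoc g h k)) }.

Definition iso2 {O} (C : bicat O) {A B} {f g : hom C A B} (a : cell C f g) : Prop :=
  exists b : cell C g f, a • b = id2 f /\ b • a = id2 g.

Definition is_equiv {O} (C : bicat O) {A B} (f : hom C A B) : Prop :=
  exists (g : hom C B A) (a : cell C (f · g) (id1 C A)) (b : cell C (g · f) (id1 C B)),
    iso2 a /\ iso2 b.

(* Equality of 2-cells whose boundaries are only propositionally equal. *)
Inductive celleq {O} (C : bicat O) {A B} {f g : hom C A B} (a : cell C f g) :
    forall {f' g' : hom C A B}, cell C f' g' -> Prop :=
  celleq_refl : celleq a a.

Definition bprod {O P} (C : bicat O) (D : bicat P) : bicat (O * P) := {|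
  hom := fun X Y => (hom C (fst X) (fst Y) * hom D (snd X) (snd Y))%type;
  cell := fun X Y f g => (cell C (fst f) (fst g) * cell D (snd f) (snd g))%type;
  id1 := fun X => (id1 C (fst X), id1 D (snd X));
  comp1 := fun X Y Z f g => (fst f · fst g, snd f · snd g);
  id2 := fun X Y f => (id2 (fst f), id2 (snd f));
  comp2 := fun X Y f g h a b => (fst a • fst b, snd a • snd b);
  whiskl := fun X Y Z f g h a => (fst f ◁ fst a, snd f ◁ snd a);
  whiskr := fun X Y Z f g h a => (fst a ▷ fst h, snd a ▷ snd h);
  assoc := fun X Y Z W f g h =>
    (assoc (fst f) (fst g) (fst h), assoc (snd f) (snd g) (snd h));
  associ := fun X Y Z W f g h =>
    (associ (fst f) (fst g) (fst h), associ (snd f) (snd g) (snd h));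
  lun := fun X Y f => (lun (fst f), lun (snd f));
  luni := fun X Y f => (luni (fst f), luni (snd f));
  run := fun X Y f => (run (fst f), run (snd f));
  runi := fun X Y f => (runi (fst f), runi (snd f)) |}.

Record pf {O P} (C : bicat O) (D : bicat P) (fo : O -> P) := Pf {
  on1 : forall A B, hom C A B -> hom D (fo A) (fo B);
  on2 : forall A B (f g : hom C A B), cell C f g -> cell D (on1 f) (on1 g);
  fc : forall A B E (f : hom C A B) (g : hom C B E),
    cell D (on1 f · on1 g) (on1 (f · g));
  fci : forall A B E (f : hom C A B) (g : hom C B E),
    cell D (on1 (f · g)) (on1 f · on1 g);
  fu : forall A, cell D (id1 D (fo A)) (on1 (id1 C A));
  fui : forall A, cell D (on1 (id1 C A)) (id1 D (fo A)) }.

Arguments Pf {O P} C D fo on1 on2 fc fci fu fui.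
Arguments on1 {O P C D fo} p A B f : rename.
Arguments on2 {O P C D fo} p A B f g a : rename.
Arguments fc {O P C D fo} p {A B E} f g : rename.
Arguments fci {O P C D fo} p {A B E} f g : rename.
Arguments fu {O P C D fo} p A : rename.
Arguments fui {O P C D fo} p A : rename.
Notation "F @1 f" := (on1 F _ _ f) : bicat_scope.
Notation "F @2 a" := (on2 F _ _ _ _ a) : bicat_scope.

Record is_pf {O P} {C : bicat O} {D : bicat P} {fo} (F : pf C D fo) : Prop := {
  pf_id2 : forall A B (f : hom C A B), F @2 (id2 f) = id2 (F @1 f);
  pf_comp2 : forall A B (f g h : hom C A B) (a : cell C f g) (b : cell C g h),
    F @2 (a • b) = (F @2 a) • (F @2 b);
  pf_fc_natl : forall A B E (f f' : hom C A B) (g : hom C B E) (a : cell C f f'),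
    (F @2 a ▷ F @1 g) • fc F f' g = fc F f g • F @2 (a ▷ g);
  pf_fc_natr : forall A B E (f : hom C A B) (g g' : hom C B E) (a : cell C g g'),
    (F @1 f ◁ F @2 a) • fc F f g' = fc F f g • F @2 (f ◁ a);
  pf_fc_fci : forall A B E (f : hom C A B) (g : hom C B E),
    fc F f g • fci F f g = id2 _;
  pf_fci_fc : forall A B E (f : hom C A B) (g : hom C B E),
    fci F f g • fc F f g = id2 _;
  pf_fu_fui : forall A, fu F A • fui F A = id2 _;
  pf_fui_fu : forall A, fui F A • fu F A = id2 _;
  pf_assoc : forall A B E G (f : hom C A B) (g : hom C B E) (h : hom C E G),
    (fc F f g ▷ F @1 h) • (fc F (f · g) h • F @2 (assoc f g h))
    = assoc _ _ _ • ((F @1 f ◁ fc F g h) • fc F f (g · h));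
  pf_lun : forall A B (f : hom C A B),
    (fu F A ▷ F @1 f) • (fc F (id1 C A) f • F @2 (lun f)) = lun (F @1 f);
  pf_run : forall A B (f : hom C A B),
    (F @1 f ◁ fu F B) • (fc F f (id1 C B) • F @2 (run f)) = run (F @1 f) }.

Definition pf_id {O} (C : bicat O) : pf C C (fun A => A) := {|
  on1 := fun A B f => f;
  on2 := fun A B f g a => a;
  fc := fun A B E f g => id2 (f · g);
  fci := fun A B E f g => id2 (f · g);
  fu := fun A => id2 (id1 C A);
  fui := fun A => id2 (id1 C A) |}.

(* [F] followed by [G] *)
Definition pf_comp {O P Q} {C : bicat O} {D : bicat P} {E : bicat Q} {fo go}
    (F : pf C D fo) (G : pf D E go) : pf C E (fun A => go (fo A)) := {|
  on1 := fun A B f => G @1 (F @1 f);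
  on2 := fun A B f g a => G @2 (F @2 a);
  fc := fun A B X f g => fc G (F @1 f) (F @1 g) • G @2 (fc F f g);
  fci := fun A B X f g => G @2 (fci F f g) • fci G (F @1 f) (F @1 g);
  fu := fun A => fu G (fo A) • G @2 (fu F A);
  fui := fun A => G @2 (fui F A) • fui G (fo A) |}.

Definition pf_fst {O P} {C : bicat O} {D : bicat P} : pf (bprod C D) C fst := {|
  on1 := fun (A B : O * P) (f : hom (bprod C D) A B) => fst f;
  on2 := fun (A B : O * P) (f g : hom (bprod C D) A B) (a : cell _ f g) => fst a;
  fc := fun (A B E : O * P) (f : hom (bprod C D) A B) (g : hom (bprod C D) B E) =>
    id2 (fst f · fst g);
  fci := fun (A B E : O * P) (f : hom (bprod C D) A B) (g : hom (bprod C D) B E) =>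
    id2 (fst f · fst g);
  fu := fun A => id2 (id1 C (fst A));
  fui := fun A => id2 (id1 C (fst A)) |}.

Definition pf_snd {O P} {C : bicat O} {D : bicat P} : pf (bprod C D) D snd := {|
  on1 := fun (A B : O * P) (f : hom (bprod C D) A B) => snd f;
  on2 := fun (A B : O * P) (f g : hom (bprod C D) A B) (a : cell _ f g) => snd a;
  fc := fun (A B E : O * P) (f : hom (bprod C D) A B) (g : hom (bprod C D) B E) =>
    id2 (snd f · snd g);
  fci := fun (A B E : O * P) (f : hom (bprod C D) A B) (g : hom (bprod C D) B E) =>
    id2 (snd f · snd g);
  fu := fun A => id2 (id1 D (snd A));
  fui := fun A => id2 (id1 D (snd A)) |}.

Definition pf_pair {O P Q} {E : bicat O} {C : bicat P} {D : bicat Q} {fo go}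
    (F : pf E C fo) (G : pf E D go) : pf E (bprod C D) (fun A => (fo A, go A)) :=
  Pf E (bprod C D) (fun A => (fo A, go A))
    (fun A B f => (F @1 f, G @1 f))
    (fun A B f g a => (F @2 a, G @2 a))
    (fun A B X f g => (fc F f g, fc G f g))
    (fun A B X f g => (fci F f g, fci G f g))
    (fun A => (fu F A, fu G A))
    (fun A => (fui F A, fui G A)).

(* The raw data of a pseudonatural transformation only mention the actions of the
   two functors on 1-cells, so that e.g. [(F G) H] and [F (G H)], which have the
   same actions but compositors equal only up to the bicategory axioms, can be
   interchanged. *)

Record pn {O P} (C : bicat O) (D : bicat P) {fo go : O -> P}
    (F : forall A B, hom C A B -> hom D (fo A) (fo B))
    (G : forall A B, hom C A B -> hom D (go A) (go B))
    (c : forall A, hom D (fo A) (go A)) := Pn {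
  nat1 : forall A B (f : hom C A B), cell D (F A B f · c B) (c A · G A B f);
  nat1i : forall A B (f : hom C A B), cell D (c A · G A B f) (F A B f · c B) }.

Arguments pn {O P} C D {fo go} F G c.
Arguments Pn {O P} C D {fo go} F G c nat1 nat1i.
Arguments nat1 {O P C D fo go F G c} p {A B} f : rename.
Arguments nat1i {O P C D fo go F G c} p {A B} f : rename.

Notation "'pn_of' F G c" := (pn _ _ (on1 F) (on1 G) c)
  (at level 10, F at level 9, G at level 9, c at level 9).

Record is_pn {O P} {C : bicat O} {D : bicat P} {fo go} (F : pf C D fo) (G : pf C D go)
    {c} (s : pn_of F G c) : Prop := {
  pn_inv : forall A B (f : hom C A B), nat1 s f • nat1i s f = id2 _;
  pn_invi : forall A B (f : hom C A B), nat1i s f • nat1 s f = id2 _;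
  pn_nat2 : forall A B (f g : hom C A B) (a : cell C f g),
    (F @2 a ▷ c B) • nat1 s g = nat1 s f • (c A ◁ G @2 a);
  pn_fc : forall A B E (f : hom C A B) (g : hom C B E),
    (fc F f g ▷ c E) • nat1 s (f · g)
    = assoc _ _ _ • ((F @1 f ◁ nat1 s g) • (associ _ _ _ •
        ((nat1 s f ▷ G @1 g) • (assoc _ _ _ • (c A ◁ fc G f g)))));
  pn_fu : forall A, (fu F A ▷ c A) • nat1 s (id1 C A)
    = lun _ • (runi _ • (c A ◁ fu G A)) }.

Arguments is_pn {O P C D fo go} F G {c} s.

Definition is_pneq {O P} {C : bicat O} {D : bicat P} {fo go} (F : pf C D fo)
    (G : pf C D go) {c} (s : pn_of F G c) : Prop :=
  is_pn F G s /\ forall A, is_equiv (c A).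

Arguments is_pneq {O P C D fo go} F G {c} s.

Definition pn_id {O P} {C : bicat O} {D : bicat P} {fo}
    (F : forall A B, hom C A B -> hom D (fo A) (fo B)) :
    pn C D F F (fun A => id1 D (fo A)) :=
  Pn C D F F (fun A => id1 D (fo A))
    (fun A B f => run (F A B f) • luni (F A B f))
    (fun A B f => lun (F A B f) • runi (F A B f)).

Definition pn_comp {O P} {C : bicat O} {D : bicat P} {fo go ho}
    {F : forall A B, hom C A B -> hom D (fo A) (fo B)}
    {G : forall A B, hom C A B -> hom D (go A) (go B)}
    {H : forall A B, hom C A B -> hom D (ho A) (ho B)} {c d}
    (s : pn C D F G c) (t : pn C D G H d) : pn C D F H (fun A => c A · d A) :=
  Pn C D F H (fun A => c A · d A)
    (fun A B f => associ _ _ _ • ((nat1 s f ▷ d B) • (assoc _ _ _ •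
       ((c A ◁ nat1 t f) • associ _ _ _))))
    (fun A B f => assoc _ _ _ • ((c A ◁ nat1i t f) • (associ _ _ _ •
       ((nat1i s f ▷ d B) • assoc _ _ _)))).

Definition pn_post {O P Q} {C : bicat O} {D : bicat P} {E : bicat Q} {fo go ko}
    (K : pf D E ko)
    {F : forall A B, hom C A B -> hom D (fo A) (fo B)}
    {G : forall A B, hom C A B -> hom D (go A) (go B)} {c}
    (s : pn C D F G c) :
    pn C E (fun A B f => K @1 (F A B f)) (fun A B f => K @1 (G A B f))
       (fun A => K @1 (c A)) :=
  Pn C E (fun A B f => K @1 (F A B f)) (fun A B f => K @1 (G A B f))
    (fun A => K @1 (c A))
    (fun A B f => fc K (F A B f) (c B) • (K @2 (nat1 s f) • fci K (c A) (G A B f)))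
    (fun A B f => fc K (c A) (G A B f) • (K @2 (nat1i s f) • fci K (F A B f) (c B))).

Definition pn_pre {O P Q} {X : bicat O} {C : bicat P} {D : bicat Q} {fo go qo}
    {F : forall A B, hom C A B -> hom D (fo A) (fo B)}
    {G : forall A B, hom C A B -> hom D (go A) (go B)} {c}
    (s : pn C D F G c) (K : forall A B, hom X A B -> hom C (qo A) (qo B)) :
    pn X D (fun A B f => F _ _ (K A B f)) (fun A B f => G _ _ (K A B f))
       (fun A => c (qo A)) :=
  Pn X D (fun A B f => F _ _ (K A B f)) (fun A B f => G _ _ (K A B f))
    (fun A => c (qo A))
    (fun A B f => nat1 s (K A B f))
    (fun A B f => nat1i s (K A B f)).

Definition pn_pair {O P Q} {X : bicat O} {C : bicat P} {D : bicat Q} {fo go fo' go'}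
    {F : forall A B, hom X A B -> hom C (fo A) (fo B)}
    {G : forall A B, hom X A B -> hom C (go A) (go B)} {c}
    {F' : forall A B, hom X A B -> hom D (fo' A) (fo' B)}
    {G' : forall A B, hom X A B -> hom D (go' A) (go' B)} {c'}
    (s : pn X C F G c) (t : pn X D F' G' c') :
    @pn _ _ X (bprod C D) (fun A => (fo A, fo' A)) (fun A => (go A, go' A))
      (fun A B f => (F A B f, F' A B f)) (fun A B f => (G A B f, G' A B f))
      (fun A => (c A, c' A)) :=
  @Pn _ _ X (bprod C D) (fun A => (fo A, fo' A)) (fun A => (go A, go' A))
    (fun A B f => (F A B f, F' A B f)) (fun A B f => (G A B f, G' A B f))
    (fun A => (c A, c' A))
    (fun A B f => (nat1 s f, nat1 t f))
    (fun A B f => (nat1i s f, nat1i t f)).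

Definition is_mod {O P} {C : bicat O} {D : bicat P} {fo go}
    {F : forall A B, hom C A B -> hom D (fo A) (fo B)}
    {G : forall A B, hom C A B -> hom D (go A) (go B)} {c d}
    (s : pn C D F G c) (t : pn C D F G d) (m : forall A, cell D (c A) (d A)) : Prop :=
  forall A B (f : hom C A B),
    nat1 s f • (m A ▷ G A B f) = (F A B f ◁ m B) • nat1 t f.

(* Pasting a 2-cell onto two or three consecutive 1-cells of a path; paths are
   bracketed to the right. *)

Section Pasting.
Context {O : Type} {C : bicat O}.

Definition at22 {A B1 B2 D E} {x : hom C A B1} {y : hom C B1 D} {z : hom C A B2}
    {w : hom C B2 D} (a : cell C (x · y) (z · w)) (t : hom C D E) :
    cell C (x · (y · t)) (z · (w · t)) :=
  associ _ _ _ • ((a ▷ t) • assoc _ _ _).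

Definition at21 {A B D E} {x : hom C A B} {y : hom C B D} {z : hom C A D}
    (a : cell C (x · y) z) (t : hom C D E) : cell C (x · (y · t)) (z · t) :=
  associ _ _ _ • (a ▷ t).

Definition at32 {A B1 B2 B3 D E} {x : hom C A B1} {y : hom C B1 B2} {z : hom C B2 D}
    {v : hom C A B3} {w : hom C B3 D} (a : cell C (x · (y · z)) (v · w))
    (t : hom C D E) : cell C (x · (y · (z · t))) (v · (w · t)) :=
  (x ◁ associ _ _ _) • (associ _ _ _ • ((a ▷ t) • assoc _ _ _)).

Definition map21 {fo : O -> O} (F : pf C C fo) {A B D} {x : hom C A B} {y : hom C B D}
    {z : hom C A D} (a : cell C (x · y) z) : cell C (F @1 x · F @1 y) (F @1 z) :=
  fc F x y • F @2 a.

Definition map32 {fo : O -> O} (F : pf C C fo) {A B1 B2 B3 D} {x : hom C A B1}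
    {y : hom C B1 B2} {z : hom C B2 D} {v : hom C A B3} {w : hom C B3 D}
    (a : cell C (x · (y · z)) (v · w)) :
    cell C (F @1 x · (F @1 y · F @1 z)) (F @1 v · F @1 w) :=
  (F @1 x ◁ fc F y z) • (fc F x (y · z) • (F @2 a • fci F v w)).

End Pasting.

Record bbin {O} (C : bicat O) := BBin {
  btens : O -> O -> O;
  blt : forall A, pf C C (btens A);                       (* A ⋉ - *)
  brt : forall B, pf C C (fun A => btens A B) }.          (* - ⋊ B *)

Arguments BBin {O C} btens blt brt.
Arguments btens {O C} b A B : rename.
Arguments blt {O C} b A : rename.
Arguments brt {O C} b B : rename.

Definition bbrev {O} {C : bicat O} (b : bbin C) : bbin C :=
  BBin (fun A B => btens b B A) (fun A => brt b A) (fun B => blt b B).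

Definition is_bbin {O} {C : bicat O} (b : bbin C) : Prop :=
  (forall A, is_pf (blt b A)) /\ (forall B, is_pf (brt b B)).

(* The three transformations [a1], [a2], [a3] are the associativity constraint
   in its first, second and third variable. *)
Record bconstr {O} {C : bicat O} (b : bbin C) := BConstr {
  bI : O;
  basc : forall A B D, hom C (btens b (btens b A B) D) (btens b A (btens b B D));
  ba1 : forall B D, pn_of (pf_comp (brt b B) (brt b D)) (brt b (btens b B D))
    (fun A => basc A B D);
  ba2 : forall A D, pn_of (pf_comp (blt b A) (brt b D)) (pf_comp (brt b D) (blt b A))
    (fun B => basc A B D);
  ba3 : forall A B, pn_of (blt b (btens b A B)) (pf_comp (blt b B) (blt b A))
    (fun D => basc A B D);
  blam : forall A, hom C (btens b bI A) A;
  blamT : pn_of (blt b bI) (pf_id C) blam;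
  brho : forall A, hom C (btens b A bI) A;
  brhoT : pn_of (brt b bI) (pf_id C) brho }.

Arguments bI {O C b} K : rename.
Arguments basc {O C b} K A B D : rename.
Arguments ba1 {O C b} K B D : rename.
Arguments ba2 {O C b} K A D : rename.
Arguments ba3 {O C b} K A B : rename.
Arguments blam {O C b} K A : rename.
Arguments blamT {O C b} K : rename.
Arguments brho {O C b} K A : rename.
Arguments brhoT {O C b} K : rename.

Record bcoh {O} {C : bicat O} {b : bbin C} (K : bconstr b) := BCoh {
  cp : forall W X Y Z, cell C
    (brt b Z @1 basc K W X Y · (basc K W (btens b X Y) Z · blt b W @1 basc K X Y Z))
    (basc K (btens b W X) Y Z · basc K W X (btens b Y Z));
  cm : forall W Y, cell C (basc K W (bI K) Y · blt b W @1 blam K Y)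
    (brt b Y @1 brho K W);
  cl : forall W Y, cell C (basc K (bI K) W Y · blam K (btens b W Y))
    (brt b Y @1 blam K W);
  cr : forall W Y, cell C (basc K W Y (bI K) · blt b W @1 brho K Y)
    (brho K (btens b W Y)) }.

Arguments cp {O C b K} c W X Y Z : rename.
Arguments cm {O C b K} c W Y : rename.
Arguments cl {O C b K} c W Y : rename.
Arguments cr {O C b K} c W Y : rename.

(* The three equations of a monoidal bicategory (one-object tricategory): the
   nonabelian 4-cocycle condition and the two normalization conditions. *)
Section CoherenceEquations.
Context {O : Type} {C : bicat O} {b : bbin C} (K : bconstr b) (c : bcoh K).
Local Notation "A ⊗ B" := (btens b A B) (at level 39, left associativity).
Local Notation α := (basc K).
Local Notation "A ⋉ f" := (blt b A @1 f) (at level 30, right associativity).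
Local Notation "f ⋊ A" := (brt b A @1 f) (at level 29, left associativity).

Definition cocycle_eq : Prop := forall V W X Y Z,
  at32 (map32 (brt b Z) (cp c V W X Y))
       (α V (W ⊗ (X ⊗ Y)) Z · (V ⋉ α W (X ⊗ Y) Z · V ⋉ W ⋉ α X Y Z))
  • ((_ ◁ at32 (cp c V W (X ⊗ Y) Z) (V ⋉ W ⋉ α X Y Z))
  • ((_ ◁ (_ ◁ nat1i (ba3 K V W) (α X Y Z)))
  • at32 (cp c (V ⊗ W) X Y Z) (α V W (X ⊗ (Y ⊗ Z)))))
  =
  (_ ◁ (_ ◁ at22 (nat1 (ba2 K V Z) (α W X Y))
                  (V ⋉ α W (X ⊗ Y) Z · V ⋉ W ⋉ α X Y Z)))
  • ((_ ◁ (_ ◁ (_ ◁ map32 (blt b V) (cp c W X Y Z))))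
  • ((_ ◁ at32 (cp c V (W ⊗ X) Y Z) (V ⋉ α W X (Y ⊗ Z)))
  • (at22 (nat1 (ba1 K Y Z) (α V W X)) (α V (W ⊗ X) (Y ⊗ Z) · V ⋉ α W X (Y ⊗ Z))
  • (_ ◁ cp c V W X (Y ⊗ Z))))).

Definition left_norm_eq : Prop := forall A B D,
  (_ ◁ (_ ◁ map21 (blt b A) (cl c B D)))
  • ((_ ◁ nat1i (ba2 K A D) (blam K B))
  • at21 (map21 (brt b D) (cm c A B)) (α A B D))
  =
  at32 (cp c A (bI K) B D) (A ⋉ blam K (B ⊗ D))
  • ((_ ◁ cm c A (B ⊗ D))
  • nat1i (ba1 K B D) (brho K A)).

Definition right_norm_eq : Prop := forall A B D,
  (_ ◁ (_ ◁ map21 (blt b A) (cm c B D)))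
  • ((_ ◁ nat1i (ba2 K A D) (brho K B))
  • at21 (map21 (brt b D) (cr c A B)) (α A B D))
  =
  at32 (cp c A B (bI K) D) (A ⋉ B ⋉ blam K D)
  • ((_ ◁ nat1i (ba3 K A B) (blam K D))
  • at21 (cm c (A ⊗ B) D) (α A B D)).

Definition coh_invertible : Prop :=
  (forall W X Y Z, iso2 (cp c W X Y Z)) /\ (forall W Y, iso2 (cm c W Y)) /\
  (forall W Y, iso2 (cl c W Y)) /\ (forall W Y, iso2 (cr c W Y)).

Definition monoidal_eqs : Prop := cocycle_eq /\ left_norm_eq /\ right_norm_eq.

End CoherenceEquations.

Definition left_cen {O} {C : bicat O} (b : bbin C) {A A'} (k : hom C A A') : Type :=
  pn_of (blt b A) (blt b A') (fun B => brt b B @1 k).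

Definition right_cen {O} {C : bicat O} (b : bbin C) {A A'} (k : hom C A A') : Type :=
  pn_of (brt b A) (brt b A') (fun B => blt b B @1 k).

Definition is_left_cen {O} {C : bicat O} (b : bbin C) {A A'} {k : hom C A A'}
    (s : left_cen b k) : Prop := is_pn (blt b A) (blt b A') s.

Definition is_right_cen {O} {C : bicat O} (b : bbin C) {A A'} {k : hom C A A'}
    (s : right_cen b k) : Prop := is_pn (brt b A) (brt b A') s.

Record bccen {O} {C : bicat O} {b : bbin C} (K : bconstr b) := BCCen {
  lc_asc : forall A B D, left_cen b (basc K A B D);
  rc_asc : forall A B D, right_cen b (basc K A B D);
  lc_lam : forall A, left_cen b (blam K A);
  rc_lam : forall A, right_cen b (blam K A);
  lc_rho : forall A, left_cen b (brho K A);
  rc_rho : forall A, right_cen b (brho K A) }.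

Arguments lc_asc {O C b K} z A B D : rename.
Arguments rc_asc {O C b K} z A B D : rename.
Arguments lc_lam {O C b K} z A : rename.
Arguments rc_lam {O C b K} z A : rename.
Arguments lc_rho {O C b K} z A : rename.
Arguments rc_rho {O C b K} z A : rename.

Section Premonoidal.
Context {O : Type} {C : bicat O} {b : bbin C} (K : bconstr b) (z : bccen K) (c : bcoh K).
Local Notation "A ⊗ B" := (btens b A B) (at level 39, left associativity).
Local Notation lt A := (blt b A).
Local Notation rt A := (brt b A).

Record is_constr : Prop := {
  ic_a1 : forall B D, is_pneq (pf_comp (rt B) (rt D)) (rt (B ⊗ D)) (ba1 K B D);
  ic_a2 : forall A D, is_pneq (pf_comp (lt A) (rt D)) (pf_comp (rt D) (lt A)) (ba2 K A D);
  ic_a3 : forall A B, is_pneq (lt (A ⊗ B)) (pf_comp (lt B) (lt A)) (ba3 K A B);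
  ic_lam : is_pneq (lt (bI K)) (pf_id C) (blamT K);
  ic_rho : is_pneq (rt (bI K)) (pf_id C) (brhoT K) }.

Record is_ccen : Prop := {
  cen_lasc : forall A B D, is_left_cen (lc_asc z A B D);
  cen_rasc : forall A B D, is_right_cen (rc_asc z A B D);
  cen_llam : forall A, is_left_cen (lc_lam z A);
  cen_rlam : forall A, is_right_cen (rc_lam z A);
  cen_lrho : forall A, is_left_cen (lc_rho z A);
  cen_rrho : forall A, is_right_cen (rc_rho z A) }.

Record coh_modif : Prop := {
  cp_mod1 : forall X Y Z, is_mod
    (pn_comp (pn_post (rt Z) (ba1 K X Y)) (pn_comp (ba1 K (X ⊗ Y) Z) (rc_asc z X Y Z)))
    (pn_comp (pn_pre (ba1 K Y Z) (on1 (rt X))) (ba1 K X (Y ⊗ Z)))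
    (fun W => cp c W X Y Z);
  cp_mod2 : forall W Y Z, is_mod
    (pn_comp (pn_post (rt Z) (ba2 K W Y))
      (pn_comp (pn_pre (ba2 K W Z) (on1 (rt Y))) (pn_post (lt W) (ba1 K Y Z))))
    (pn_comp (pn_pre (ba1 K Y Z) (on1 (lt W))) (ba2 K W (Y ⊗ Z)))
    (fun X => cp c W X Y Z);
  cp_mod3 : forall W X Z, is_mod
    (pn_comp (pn_post (rt Z) (ba3 K W X))
      (pn_comp (pn_pre (ba2 K W Z) (on1 (lt X))) (pn_post (lt W) (ba2 K X Z))))
    (pn_comp (ba2 K (W ⊗ X) Z) (pn_pre (ba3 K W X) (on1 (rt Z))))
    (fun Y => cp c W X Y Z);
  cp_mod4 : forall W X Y, is_mod
    (pn_comp (lc_asc z W X Y) (pn_comp (ba3 K W (X ⊗ Y)) (pn_post (lt W) (ba3 K X Y))))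
    (pn_comp (ba3 K (W ⊗ X) Y) (pn_pre (ba3 K W X) (on1 (lt Y))))
    (fun Z => cp c W X Y Z);
  cm_mod1 : forall Y, is_mod
    (pn_comp (ba1 K (bI K) Y) (rc_lam z Y)) (pn_post (rt Y) (brhoT K))
    (fun W => cm c W Y);
  cm_mod2 : forall W, is_mod
    (pn_comp (ba3 K W (bI K)) (pn_post (lt W) (blamT K))) (lc_rho z W)
    (fun Y => cm c W Y);
  cl_mod1 : forall Y, is_mod
    (pn_comp (ba2 K (bI K) Y) (pn_pre (blamT K) (on1 (rt Y))))
    (pn_post (rt Y) (blamT K))
    (fun W => cl c W Y);
  cl_mod2 : forall W, is_mod
    (pn_comp (ba3 K (bI K) W) (pn_pre (blamT K) (on1 (lt W)))) (lc_lam z W)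
    (fun Y => cl c W Y);
  cr_mod1 : forall Y, is_mod
    (pn_comp (ba1 K Y (bI K)) (rc_rho z Y)) (pn_pre (brhoT K) (on1 (rt Y)))
    (fun W => cr c W Y);
  cr_mod2 : forall W, is_mod
    (pn_comp (ba2 K W (bI K)) (pn_post (lt W) (brhoT K)))
    (pn_pre (brhoT K) (on1 (lt W)))
    (fun Y => cr c W Y) }.

Record is_premonoidal : Prop := {
  pm_bicat : is_bicat C;
  pm_bin : is_bbin b;
  pm_constr : is_constr;
  pm_cen : is_ccen;
  pm_inv : coh_invertible c;
  pm_modif : coh_modif;
  pm_eqs : monoidal_eqs c }.

End Premonoidal.

Inductive side := LeftCentral | RightCentral | PurelyCentral.

(* Chosen left centrality structures on all 1-cells.  Applied to [bbrev b] these
   are chosen right centrality structures. *)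
Definition blcs {O} {C : bicat O} (b : bbin C) : Type :=
  forall A A' (k : hom C A A'), left_cen b k.

Definition blcs_laws {O} {C : bicat O} (b : bbin C) (L : blcs b) : Prop :=
  (forall A A' (k : hom C A A'), is_left_cen (L A A' k)) /\
  (forall A A' (k k' : hom C A A') (a : cell C k k'),
     is_mod (L A A' k) (L A A' k') (fun B => brt b B @2 a)).

(* [A ↦ A ⋉ -], [k ↦ k ⋉ -] is a pseudofunctor from [C] to its pseudofunctors
   and pseudonatural transformations, with compositor and unitor those of the
   [- ⋊ B]; its remaining axioms hold componentwise by those of [- ⋊ B]. *)
Definition blcs_functor {O} {C : bicat O} (b : bbin C) (L : blcs b) : Prop :=
  (forall A A' A'' (k : hom C A A') (k' : hom C A' A''),
     is_mod (pn_comp (L _ _ k) (L _ _ k')) (L _ _ (k · k')) (fun B => fc (brt b B) k k'))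
  /\ (forall A, is_mod (pn_id (on1 (blt b A))) (L _ _ (id1 C A)) (fun B => fu (brt b B) A)).

(* [f ⋉ -|_g = (- ⋊ g|_f)^{-1}] *)
Definition bexchange {O} {C : bicat O} (b : bbin C) (L : blcs b) (R : blcs (bbrev b)) : Prop :=
  forall A A' (f : hom C A A') B B' (g : hom C B B'),
    nat1 (L _ _ f) g = nat1i (R _ _ g) f /\ nat1i (L _ _ f) g = nat1 (R _ _ g) f.

(* In the left (right) central case only [L] ([R]) is given, the other family
   being the one it determines. *)
Definition is_bcentral {O} {C : bicat O} (s : side) (b : bbin C) (L : blcs b)
    (R : blcs (bbrev b)) : Prop :=
  bexchange L R /\
  match s with
  | LeftCentral => blcs_laws L /\ blcs_functor L
  | RightCentral => blcs_laws R /\ blcs_functor R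
  | PurelyCentral => blcs_laws L /\ blcs_laws R
  end.

(* Compatibility of associativity with the exchange cells [p ⋉ -|_q]. *)
Record basc_exchange {O} {C : bicat O} {b : bbin C} (K : bconstr b) (L : blcs b) : Prop := {
  bae12 : forall A A' (p : hom C A A') D, is_mod
    (pn_comp (pn_post (brt b D) (L _ _ p)) (ba2 K A' D))
    (pn_comp (ba2 K A D) (pn_pre (L _ _ p) (on1 (brt b D))))
    (fun B => nat1 (ba1 K B D) p);
  bae13 : forall A A' (p : hom C A A') B, is_mod
    (pn_comp (L _ _ (brt b B @1 p)) (ba3 K A' B))
    (pn_comp (ba3 K A B) (pn_pre (L _ _ p) (on1 (blt b B))))
    (fun D => nat1 (ba1 K B D) p);
  bae23 : forall A B B' (p : hom C B B'), is_mod
    (pn_comp (L _ _ (blt b A @1 p)) (ba3 K A B'))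
    (pn_comp (ba3 K A B) (pn_post (blt b A) (L _ _ p)))
    (fun D => nat1 (ba2 K A D) p) }.

(* The constraint components carry their chosen centrality structures. *)
Definition chosen_ccen {O} {C : bicat O} {b : bbin C} (K : bconstr b) (L : blcs b)
    (R : blcs (bbrev b)) : bccen K := {|
  lc_asc := fun A B D => L _ _ (basc K A B D);
  rc_asc := fun A B D => R _ _ (basc K A B D);
  lc_lam := fun A => L _ _ (blam K A);
  rc_lam := fun A => R _ _ (blam K A);
  lc_rho := fun A => L _ _ (brho K A);
  rc_rho := fun A => R _ _ (brho K A) |}.

Definition is_central_premonoidal_bicat {O} {C : bicat O} (s : side) (b : bbin C)
    (K : bconstr b) (c : bcoh K) (L : blcs b) (R : blcs (bbrev b)) : Prop :=
  is_premonoidal (chosen_ccen K L R) c /\ is_bcentral s L R /\ basc_exchange K L.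

Section Monoidal.
Context {O : Type} (C : bicat O).

Definition F_lassoc {tens : O -> O -> O}
    (T : pf (bprod C C) C (fun X => tens (fst X) (snd X))) :=
  pf_comp (pf_pair (pf_comp (@pf_fst _ _ (bprod C C) C) T) pf_snd) T.

Definition F_rassoc {tens : O -> O -> O}
    (T : pf (bprod C C) C (fun X => tens (fst X) (snd X))) :=
  pf_comp (pf_pair (pf_comp (@pf_fst _ _ (bprod C C) C) pf_fst)
    (pf_comp (pf_pair (pf_comp (@pf_fst _ _ (bprod C C) C) pf_snd) pf_snd) T)) T.

(* [A ⊗ -], that is [1_A ⊗ -] on 1-cells, and [- ⊗ B] *)
Definition T_lt {tens : O -> O -> O}
    (T : pf (bprod C C) C (fun X => tens (fst X) (snd X))) (A : O) : pf C C (tens A) :=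
  Pf C C (tens A)
    (fun B B' f => on1 T (A, B) (A, B') (id1 C A, f))
    (fun B B' f g a => on2 T (A, B) (A, B') (id1 C A, f) (id1 C A, g) (id2 (id1 C A), a))
    (fun B B' B'' f g =>
       @fc _ _ _ _ _ T (A, B) (A, B') (A, B'') (id1 C A, f) (id1 C A, g) •
       on2 T (A, B) (A, B'') (_, _) (_, _) (lun (id1 C A), id2 (f · g)))
    (fun B B' B'' f g =>
       on2 T (A, B) (A, B'') (_, _) (_, _) (luni (id1 C A), id2 (f · g)) •
       @fci _ _ _ _ _ T (A, B) (A, B') (A, B'') (id1 C A, f) (id1 C A, g))
    (fun B => fu T (A, B))
    (fun B => fui T (A, B)).

Definition T_rt {tens : O -> O -> O}
    (T : pf (bprod C C) C (fun X => tens (fst X) (snd X))) (B : O) :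
    pf C C (fun A => tens A B) :=
  Pf C C (fun A => tens A B)
    (fun A A' f => on1 T (A, B) (A', B) (f, id1 C B))
    (fun A A' f g a => on2 T (A, B) (A', B) (f, id1 C B) (g, id1 C B) (a, id2 (id1 C B)))
    (fun A A' A'' f g =>
       @fc _ _ _ _ _ T (A, B) (A', B) (A'', B) (f, id1 C B) (g, id1 C B) •
       on2 T (A, B) (A'', B) (_, _) (_, _) (id2 (f · g), lun (id1 C B)))
    (fun A A' A'' f g =>
       on2 T (A, B) (A'', B) (_, _) (_, _) (id2 (f · g), luni (id1 C B)) •
       @fci _ _ _ _ _ T (A, B) (A', B) (A'', B) (f, id1 C B) (g, id1 C B))
    (fun A => fu T (A, B))
    (fun A => fui T (A, B)).

Record mon (tens : O -> O -> O) (I : O) := Mon {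
  mT : pf (bprod C C) C (fun X => tens (fst X) (snd X));
  masc : forall A B D, hom C (tens (tens A B) D) (tens A (tens B D));
  mascT : pn_of (F_lassoc mT) (F_rassoc mT)
    (fun X => masc (fst (fst X)) (snd (fst X)) (snd X));
  mlam : forall A, hom C (tens I A) A;
  mlamT : pn_of (T_lt mT I) (pf_id C) mlam;
  mrho : forall A, hom C (tens A I) A;
  mrhoT : pn_of (T_rt mT I) (pf_id C) mrho }.

End Monoidal.

Arguments T_lt {O C tens} T A.
Arguments T_rt {O C tens} T B.
Arguments F_lassoc {O C tens} T.
Arguments F_rassoc {O C tens} T.
Arguments Mon {O C tens I} mT masc mascT mlam mlamT mrho mrhoT.
Arguments mT {O C tens I} M : rename.
Arguments masc {O C tens I} M A B D : rename.
Arguments mascT {O C tens I} M : rename.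
Arguments mlam {O C tens I} M A : rename.
Arguments mlamT {O C tens I} M : rename.
Arguments mrho {O C tens I} M A : rename.
Arguments mrhoT {O C tens I} M : rename.

Section MonoidalLaws.
Context {O : Type} {C : bicat O} {tens : O -> O -> O} {I : O} (M : mon C tens I).
Local Notation "A ⊗ B" := (tens A B) (at level 39, left associativity).
Local Notation T := (mT M).

Definition mon_bin : bbin C := BBin tens (T_lt T) (T_rt T).

(* The associativity constraint in each variable separately; an identity on a
   tensor product is replaced by a tensor product of identities along the unitor
   of the tensor product. *)
Definition mon_a1 B D : pn_of (pf_comp (T_rt T B) (T_rt T D)) (T_rt T (B ⊗ D))
    (fun A => masc M A B D) :=
  Pn C C (on1 (pf_comp (T_rt T B) (T_rt T D))) (on1 (T_rt T (B ⊗ D)))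
    (fun A => masc M A B D)
    (fun A A' f => @nat1 _ _ _ _ _ _ _ _ _ (mascT M) (A, B, D) (A', B, D)
         (f, id1 C B, id1 C D) •
       (masc M A B D ◁ on2 T (A, B ⊗ D) (A', B ⊗ D) (f, _) (f, _) (id2 f, fui T (B, D))))
    (fun A A' f =>
       (masc M A B D ◁ on2 T (A, B ⊗ D) (A', B ⊗ D) (f, _) (f, _) (id2 f, fu T (B, D))) •
       @nat1i _ _ _ _ _ _ _ _ _ (mascT M) (A, B, D) (A', B, D) (f, id1 C B, id1 C D)).

Definition mon_a2 A D :
    pn_of (pf_comp (T_lt T A) (T_rt T D)) (pf_comp (T_rt T D) (T_lt T A))
    (fun B => masc M A B D) :=
  Pn C C (on1 (pf_comp (T_lt T A) (T_rt T D))) (on1 (pf_comp (T_rt T D) (T_lt T A)))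
    (fun B => masc M A B D)
    (fun B B' f => @nat1 _ _ _ _ _ _ _ _ _ (mascT M) (A, B, D) (A, B', D)
       (id1 C A, f, id1 C D))
    (fun B B' f => @nat1i _ _ _ _ _ _ _ _ _ (mascT M) (A, B, D) (A, B', D)
       (id1 C A, f, id1 C D)).

Definition mon_a3 A B : pn_of (T_lt T (A ⊗ B)) (pf_comp (T_lt T B) (T_lt T A))
    (fun D => masc M A B D) :=
  Pn C C (on1 (T_lt T (A ⊗ B))) (on1 (pf_comp (T_lt T B) (T_lt T A)))
    (fun D => masc M A B D)
    (fun D D' f =>
       (on2 T (A ⊗ B, D) (A ⊗ B, D') (_, f) (_, f) (fu T (A, B), id2 f) ▷ masc M A B D') •
       @nat1 _ _ _ _ _ _ _ _ _ (mascT M) (A, B, D) (A, B, D') (id1 C A, id1 C B, f))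
    (fun D D' f =>
       @nat1i _ _ _ _ _ _ _ _ _ (mascT M) (A, B, D) (A, B, D') (id1 C A, id1 C B, f) •
       (on2 T (A ⊗ B, D) (A ⊗ B, D') (_, f) (_, f) (fui T (A, B), id2 f) ▷ masc M A B D')).

Definition mon_constr : bconstr mon_bin :=
  @BConstr _ _ mon_bin I (masc M) mon_a1 mon_a2 mon_a3
    (mlam M) (mlamT M) (mrho M) (mrhoT M).

Local Notation C2 := (bprod C C).
Local Notation C3 := (bprod C2 C).
Local Notation C4 := (bprod C3 C).

(* [p], [m], [l], [r] are modifications jointly in all their variables. *)
Record mon_modif (c : bcoh mon_constr) : Prop := {
  mp_mod : @is_mod _ _ C4 C _ _ _ _ _ _
    (pn_comp
      (pn_post T (pn_pair (pn_pre (mascT M) (on1 (@pf_fst _ _ C3 C)))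
                          (pn_id (on1 (@pf_snd _ _ C3 C)))))
    (pn_comp
      (@pn_pre _ _ _ C4 C3 C _ _ (fun X => (fst (fst (fst X)),
           snd (fst (fst X)) ⊗ snd (fst X), snd X)) _ _ _ (mascT M)
         (fun X Y f => (fst (fst (fst f)),
            on1 T (_, _) (_, _) (snd (fst (fst f)), snd (fst f)), snd f)))
      (pn_post T (pn_pair
         (@pn_id _ _ C4 C _ (fun X Y f => fst (fst (fst f))))
         (@pn_pre _ _ _ C4 C3 C _ _
            (fun X => (snd (fst (fst X)), snd (fst X), snd X)) _ _ _ (mascT M)
            (fun X Y f => (snd (fst (fst f)), snd (fst f), snd f)))))))
    (pn_comp
      (@pn_pre _ _ _ C4 C3 C _ _ (fun X => (fst (fst (fst X)) ⊗ snd (fst (fst X)),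
           snd (fst X), snd X)) _ _ _ (mascT M)
         (fun X Y f => (T @1 (fst (fst f)), snd (fst f), snd f)))
      (@pn_pre _ _ _ C4 C3 C _ _ (fun X => (fst (fst X), snd (fst X) ⊗ snd X))
         _ _ _ (mascT M)
         (fun X Y f => (fst (fst f), on1 T (_, _) (_, _) (snd (fst f), snd f)))))
    (fun X => cp c (fst (fst (fst X))) (snd (fst (fst X))) (snd (fst X)) (snd X));
  mm_mod : @is_mod _ _ C2 C _ _ _ _ _ _
    (pn_comp
      (@pn_pre _ _ _ C2 C3 C _ _ (fun X => (fst X, I, snd X)) _ _ _ (mascT M)
         (fun X Y f => (fst f, id1 C I, snd f)))
      (pn_post T (pn_pair (pn_id (on1 (@pf_fst _ _ C C)))
                          (pn_pre (mlamT M) (on1 (@pf_snd _ _ C C))))))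
    (pn_post T (pn_pair (pn_pre (mrhoT M) (on1 (@pf_fst _ _ C C)))
                        (pn_id (on1 (@pf_snd _ _ C C)))))
    (fun X => cm c (fst X) (snd X));
  ml_mod : @is_mod _ _ C2 C _ _ _ _ _ _
    (pn_comp
      (@pn_pre _ _ _ C2 C3 C _ _ (fun X => (I, fst X, snd X)) _ _ _ (mascT M)
         (fun X Y f => (id1 C I, fst f, snd f)))
      (@pn_pre _ _ _ C2 C C _ _ (fun X => fst X ⊗ snd X) _ _ _ (mlamT M)
         (fun X Y f => on1 T (_, _) (_, _) (fst f, snd f))))
    (pn_post T (pn_pair (pn_pre (mlamT M) (on1 (@pf_fst _ _ C C)))
                        (pn_id (on1 (@pf_snd _ _ C C)))))
    (fun X => cl c (fst X) (snd X));
  mr_mod : @is_mod _ _ C2 C _ _ _ _ _ _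
    (pn_comp
      (@pn_pre _ _ _ C2 C3 C _ _ (fun X => (fst X, snd X, I)) _ _ _ (mascT M)
         (fun X Y f => (fst f, snd f, id1 C I)))
      (pn_post T (pn_pair (pn_id (on1 (@pf_fst _ _ C C)))
                          (pn_pre (mrhoT M) (on1 (@pf_snd _ _ C C))))))
    (@pn_pre _ _ _ C2 C C _ _ (fun X => fst X ⊗ snd X) _ _ _ (mrhoT M)
         (fun X Y f => on1 T (_, _) (_, _) (fst f, snd f)))
    (fun X => cr c (fst X) (snd X)) }.

Record is_monoidal (c : bcoh mon_constr) : Prop := {
  mo_bicat : is_bicat C;
  mo_T : is_pf T;
  mo_asc : is_pneq (F_lassoc T) (F_rassoc T) (mascT M);
  mo_lam : is_pneq (T_lt T I) (pf_id C) (mlamT M);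
  mo_rho : is_pneq (T_rt T I) (pf_id C) (mrhoT M);
  mo_inv : coh_invertible c;
  mo_modif : mon_modif c;
  mo_eqs : monoidal_eqs c }.

End MonoidalLaws.

(* [chosen s A B] consists of 1-cells of [C] together with their chosen
   structure [s]; the 2-cells are those satisfying [Q]. *)

Record chosen {O} {C : bicat O} {S : forall A B, hom C A B -> Type}
    (s : forall A B k, S A B k) (A B : O) := Chosen {
  ch : hom C A B;
  ch_str : S A B ch;
  ch_eq : ch_str = s A B ch }.

Arguments chosen {O C S} s A B.
Arguments Chosen {O C S s A B} ch ch_str ch_eq.

Definition choose {O} {C : bicat O} {S : forall A B, hom C A B -> Type}
    (s : forall A B k, S A B k) {A B} (k : hom C A B) : chosen s A B :=
  Chosen k (s A B k) eq_refl.

Section ChosenBicat.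
Context {O : Type} {C : bicat O} {S : forall A B, hom C A B -> Type}
  (s : forall A B k, S A B k)
  (Q : forall A B (f g : chosen s A B), cell C (ch f) (ch g) -> Prop).
Arguments Q {A B} f g _.

Definition ch_comp {A B D} (f : chosen s A B) (g : chosen s B D) : chosen s A D :=
  choose s (ch f · ch g).

Definition ch_id A : chosen s A A := choose s (id1 C A).

(* The 2-cells satisfying [Q] form a locally full sub-bicategory. *)
Record closed2 : Prop := {
  q_id : forall A B (f : chosen s A B), Q f f (id2 (ch f));
  q_comp : forall A B (f g h : chosen s A B) a b, Q f g a -> Q g h b -> Q f h (a • b);
  q_wl : forall A B D (f : chosen s A B) (g h : chosen s B D) a,
    Q g h a -> Q (ch_comp f g) (ch_comp f h) (ch f ◁ a);
  q_wr : forall A B D (f g : chosen s A B) (h : chosen s B D) a,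
    Q f g a -> Q (ch_comp f h) (ch_comp g h) (a ▷ ch h);
  q_assoc : forall A B D E (f : chosen s A B) (g : chosen s B D) (h : chosen s D E),
    Q (ch_comp (ch_comp f g) h) (ch_comp f (ch_comp g h)) (assoc (ch f) (ch g) (ch h));
  q_associ : forall A B D E (f : chosen s A B) (g : chosen s B D) (h : chosen s D E),
    Q (ch_comp f (ch_comp g h)) (ch_comp (ch_comp f g) h) (associ (ch f) (ch g) (ch h));
  q_lun : forall A B (f : chosen s A B), Q (ch_comp (ch_id A) f) f (lun (ch f));
  q_luni : forall A B (f : chosen s A B), Q f (ch_comp (ch_id A) f) (luni (ch f));
  q_run : forall A B (f : chosen s A B), Q (ch_comp f (ch_id B)) f (run (ch f));
  q_runi : forall A B (f : chosen s A B), Q f (ch_comp f (ch_id B)) (runi (ch f)) }.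

Definition chosen_bicat (q : closed2) : bicat O := {|
  hom := chosen s;
  cell := fun A B f g => {a : cell C (ch f) (ch g) | Q f g a};
  id1 := ch_id;
  comp1 := @ch_comp;
  id2 := fun A B f => exist _ (id2 (ch f)) (q_id q f);
  comp2 := fun A B f g h a b =>
    exist _ (proj1_sig a • proj1_sig b) (q_comp q (proj2_sig a) (proj2_sig b));
  whiskl := fun A B D f g h a => exist _ (ch f ◁ proj1_sig a) (q_wl q f (proj2_sig a));
  whiskr := fun A B D f g h a => exist _ (proj1_sig a ▷ ch h) (q_wr q h (proj2_sig a));
  assoc := fun A B D E f g h => exist _ (assoc (ch f) (ch g) (ch h)) (q_assoc q f g h);
  associ := fun A B D E f g h => exist _ (associ (ch f) (ch g) (ch h)) (q_associ q f g h);
  lun := fun A B f => exist _ (lun (ch f)) (q_lun q f);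
  luni := fun A B f => exist _ (luni (ch f)) (q_luni q f);
  run := fun A B f => exist _ (run (ch f)) (q_run q f);
  runi := fun A B f => exist _ (runi (ch f)) (q_runi q f) |}.

Definition chosen_forget (q : closed2) : pf (chosen_bicat q) C (fun A => A) :=
  Pf (chosen_bicat q) C (fun A => A)
    (fun A B f => ch f)
    (fun A B f g a => proj1_sig a)
    (fun A B D f g => id2 (ch f · ch g))
    (fun A B D f g => id2 (ch f · ch g))
    (fun A => id2 (id1 C A))
    (fun A => id2 (id1 C A)).

End ChosenBicat.

Arguments chosen_bicat {O C S s} Q q.
Arguments chosen_forget {O C S s} Q q.

Section PureMaps.
Context {O : Type} {C : bicat O} {b : bbin C} (L : blcs b) (R : blcs (bbrev b)).

Definition Cp_str A A' (k : hom C A A') : Type := (left_cen b k * right_cen b k)%type.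

Definition Cp_sel A A' (k : hom C A A') : Cp_str k := (@L A A' k, @R A A' k).

Definition Cp_cell A A' (f g : chosen Cp_sel A A') (a : cell C (ch f) (ch g)) : Prop :=
  is_mod (fst (ch_str f)) (fst (ch_str g)) (fun B => brt b B @2 a) /\
  is_mod (snd (ch_str f)) (snd (ch_str g)) (fun B => blt b B @2 a).

Definition Cp (q : closed2 Cp_cell) : bicat O := chosen_bicat Cp_cell q.

End PureMaps.

Definition is_strict {O} {C D : bicat O} (J : pf C D (fun A => A)) : Prop :=
  is_pf J /\
  (forall A B E (f : hom C A B) (g : hom C B E), celleq (fc J f g) (id2 (J @1 (f · g)))) /\
  (forall A, celleq (fu J A) (id2 (J @1 (id1 C A)))).

Section StrictMonoidal.
Context {O : Type} {C D : bicat O} {tens : O -> O -> O} {I : O}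
  (J : pf C D (fun A => A)) (M : mon C tens I) (c : bcoh (mon_constr M))
  (N : mon D tens I) (d : bcoh (mon_constr N)).

Local Notation J2 f := (on1 J _ _ (fst f), on1 J _ _ (snd f)).
Local Notation J3 f :=
  (on1 J _ _ (fst (fst f)), on1 J _ _ (snd (fst f)), on1 J _ _ (snd f)).

Record is_strict_monoidal : Prop := {
  sm_strict : is_strict J;
  sm_T1 : forall X Y (f : hom (bprod C C) X Y),
    J @1 (mT M @1 f) = on1 (mT N) X Y (J2 f);
  sm_T2 : forall X Y (f g : hom (bprod C C) X Y) (a : cell _ f g),
    celleq (J @2 (mT M @2 a))
      (on2 (mT N) X Y (J2 f) (J2 g) (J @2 (fst a), J @2 (snd a)));
  sm_fc : forall X Y Z (f : hom (bprod C C) X Y) (g : hom (bprod C C) Y Z),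
    celleq (J @2 (fc (mT M) f g))
      (@fc _ _ _ _ _ (mT N) X Y Z (J2 f) (J2 g));
  sm_fu : forall X, celleq (J @2 (fu (mT M) X)) (fu (mT N) X);
  sm_asc : forall A B E, J @1 (masc M A B E) = masc N A B E;
  sm_ascT : forall X Y (f : hom (bprod (bprod C C) C) X Y),
    celleq (J @2 (nat1 (mascT M) f))
      (@nat1 _ _ _ _ _ _ _ _ _ (mascT N) X Y (J3 f));
  sm_lam : forall A, J @1 (mlam M A) = mlam N A;
  sm_lamT : forall A B (f : hom C A B),
    celleq (J @2 (nat1 (mlamT M) f)) (nat1 (mlamT N) (J @1 f));
  sm_rho : forall A, J @1 (mrho M A) = mrho N A;
  sm_rhoT : forall A B (f : hom C A B),
    celleq (J @2 (nat1 (mrhoT M) f)) (nat1 (mrhoT N) (J @1 f));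
  sm_p : forall W X Y Z, celleq (J @2 (cp c W X Y Z)) (cp d W X Y Z);
  sm_m : forall W Y, celleq (J @2 (cm c W Y)) (cm d W Y);
  sm_l : forall W Y, celleq (J @2 (cl c W Y)) (cl d W Y);
  sm_r : forall W Y, celleq (J @2 (cr c W Y)) (cr d W Y) }.

End StrictMonoidal.

(* [sq f u v g] are the squares with top [f], left [u], right [v], bottom [g]. *)

Record dbl_data := DblData {
  ob :> Type;
  hor : ob -> ob -> Type;
  ver : ob -> ob -> Type;
  sq : forall A B A' B', hor A B -> ver A A' -> ver B B' -> hor A' B' -> Type;
  hid : forall A, hor A A;
  hcomp : forall A B D, hor A B -> hor B D -> hor A D;
  vid : forall A, ver A A;
  vcomp : forall A B D, ver A B -> ver B D -> ver A D;
  sqh : forall A B (f : hor A B), sq f (vid A) (vid B) f;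
  sqv : forall A B (u : ver A B), sq (hid A) u u (hid B);
  hc : forall A B D A' B' D' (f : hor A B) (f' : hor B D) (u : ver A A') (v : ver B B')
    (w : ver D D') (g : hor A' B') (g' : hor B' D'),
    sq f u v g -> sq f' v w g' -> sq (hcomp f f') u w (hcomp g g');
  vc : forall A B A' B' A'' B'' (f : hor A B) (u : ver A A') (v : ver B B')
    (g : hor A' B') (u' : ver A' A'') (v' : ver B' B'') (h : hor A'' B''),
    sq f u v g -> sq g u' v' h -> sq f (vcomp u u') (vcomp v v') h }.

Arguments hor {d} A B : rename.
Arguments ver {d} A B : rename.
Arguments sq {d A B A' B'} f u v g : rename.
Arguments hid {d} A : rename.
Arguments vid {d} A : rename.
Arguments sqh {d A B} f : rename.
Arguments sqv {d A B} u : rename.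

Declare Scope dbl_scope.
Notation "f · g" := (hcomp f g) : dbl_scope.
Notation "u ⇣ v" := (vcomp u v) : dbl_scope.
Notation "a ∥ b" := (hc a b) : dbl_scope.    (* [a|b] *)
Notation "a ⫽ b" := (vc a b) : dbl_scope.    (* a/b *)
Local Open Scope dbl_scope.

(* Equality of squares whose boundaries are only propositionally equal. *)
Inductive sqeq {B : dbl_data} {A1 A2 A3 A4 : B} {f : hor A1 A2} {u : ver A1 A3}
    {v : ver A2 A4} {g : hor A3 A4} (s : sq f u v g) :
    forall {f' : hor A1 A2} {u' : ver A1 A3} {v' : ver A2 A4} {g' : hor A3 A4},
    sq f' u' v' g' -> Prop :=
  sqeq_refl : sqeq s s.
Notation "a ≈ b" := (sqeq a b) : dbl_scope.

Record is_dbl (B : dbl_data) : Prop := {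
  hcompA : forall (A1 A2 A3 A4 : B) (f : hor A1 A2) (g : hor A2 A3) (h : hor A3 A4),
    (f · g) · h = f · (g · h);
  hidl : forall (A1 A2 : B) (f : hor A1 A2), hid A1 · f = f;
  hidr : forall (A1 A2 : B) (f : hor A1 A2), f · hid A2 = f;
  vcompA : forall (A1 A2 A3 A4 : B) (u : ver A1 A2) (v : ver A2 A3) (w : ver A3 A4),
    (u ⇣ v) ⇣ w = u ⇣ (v ⇣ w);
  vidl : forall (A1 A2 : B) (u : ver A1 A2), vid A1 ⇣ u = u;
  vidr : forall (A1 A2 : B) (u : ver A1 A2), u ⇣ vid A2 = u;
  hc_assoc : forall (A1 A2 A3 A4 D1 D2 D3 D4 : B)
    (f1 : hor A1 A2) (f2 : hor A2 A3) (f3 : hor A3 A4)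
    (g1 : hor D1 D2) (g2 : hor D2 D3) (g3 : hor D3 D4)
    (u1 : ver A1 D1) (u2 : ver A2 D2) (u3 : ver A3 D3) (u4 : ver A4 D4)
    (a : sq f1 u1 u2 g1) (b : sq f2 u2 u3 g2) (c : sq f3 u3 u4 g3),
    (a ∥ b) ∥ c ≈ a ∥ (b ∥ c);
  hc_idl : forall (A1 A2 D1 D2 : B) (f : hor A1 A2) (u : ver A1 D1) (v : ver A2 D2)
    (g : hor D1 D2) (a : sq f u v g), sqv u ∥ a ≈ a;
  hc_idr : forall (A1 A2 D1 D2 : B) (f : hor A1 A2) (u : ver A1 D1) (v : ver A2 D2)
    (g : hor D1 D2) (a : sq f u v g), a ∥ sqv v ≈ a;
  vc_assoc : forall (A1 A2 A3 A4 D1 D2 D3 D4 : B)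
    (f1 : hor A1 D1) (f2 : hor A2 D2) (f3 : hor A3 D3) (f4 : hor A4 D4)
    (u1 : ver A1 A2) (u2 : ver A2 A3) (u3 : ver A3 A4)
    (v1 : ver D1 D2) (v2 : ver D2 D3) (v3 : ver D3 D4)
    (a : sq f1 u1 v1 f2) (b : sq f2 u2 v2 f3) (c : sq f3 u3 v3 f4),
    (a ⫽ b) ⫽ c ≈ a ⫽ (b ⫽ c);
  vc_idl : forall (A1 A2 D1 D2 : B) (f : hor A1 A2) (u : ver A1 D1) (v : ver A2 D2)
    (g : hor D1 D2) (a : sq f u v g), sqh f ⫽ a ≈ a;
  vc_idr : forall (A1 A2 D1 D2 : B) (f : hor A1 A2) (u : ver A1 D1) (v : ver A2 D2)
    (g : hor D1 D2) (a : sq f u v g), a ⫽ sqh g ≈ a;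
  dbl_interchange : forall (A1 A2 A3 D1 D2 D3 E1 E2 E3 : B)
    (f1 : hor A1 A2) (f2 : hor A2 A3) (g1 : hor D1 D2) (g2 : hor D2 D3)
    (h1 : hor E1 E2) (h2 : hor E2 E3)
    (u1 : ver A1 D1) (u2 : ver A2 D2) (u3 : ver A3 D3)
    (v1 : ver D1 E1) (v2 : ver D2 E2) (v3 : ver D3 E3)
    (a : sq f1 u1 u2 g1) (b : sq f2 u2 u3 g2) (c : sq g1 v1 v2 h1) (d : sq g2 v2 v3 h2),
    (a ∥ b) ⫽ (c ∥ d) = (a ⫽ c) ∥ (b ⫽ d);
  sqh_comp : forall (A1 A2 A3 : B) (f : hor A1 A2) (g : hor A2 A3),
    sqh (f · g) = sqh f ∥ sqh g;
  sqv_comp : forall (A1 A2 A3 : B) (u : ver A1 A2) (v : ver A2 A3),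
    sqv (u ⇣ v) = sqv u ⫽ sqv v;
  sqh_sqv : forall A : B, sqh (hid A) = sqv (vid A) }.

Record dbl := Dbl { dbl_car :> dbl_data; dbl_ax : is_dbl dbl_car }.

Definition sq_cast {B : dbl_data} {A1 A2 A3 A4 : B} {f f' : hor A1 A2} {u u' : ver A1 A3}
    {v v' : ver A2 A4} {g g' : hor A3 A4} (ef : f = f') (eu : u = u') (ev : v = v')
    (eg : g = g') (s : sq f u v g) : sq f' u' v' g' :=
  match ef in _ = x return sq x u' v' g' with eq_refl =>
  match eu in _ = x return sq f x v' g' with eq_refl =>
  match ev in _ = x return sq f u x g' with eq_refl =>
  match eg in _ = x return sq f u v x with eq_refl => s end end end end.

Definition sqid {B : dbl_data} {A1 A2 : B} {f g : hor A1 A2} (e : f = g) :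
    sq f (vid A1) (vid A2) g := sq_cast eq_refl eq_refl eq_refl e (sqh f).

Section Horizontal.
Context (B : dbl).
Let ax := dbl_ax B.

Definition HB : bicat B := {|
  hom := fun A1 A2 => @hor B A1 A2;
  cell := fun A1 A2 f g => sq f (vid A1) (vid A2) g;
  id1 := @hid B;
  comp1 := fun A1 A2 A3 f g => f · g;
  id2 := fun A1 A2 f => sqh f;
  comp2 := fun A1 A2 f g h a b =>
    sq_cast eq_refl (vidl ax _) (vidl ax _) eq_refl (a ⫽ b);
  whiskl := fun A1 A2 A3 f g h a => sqh f ∥ a;
  whiskr := fun A1 A2 A3 f g h a => a ∥ sqh h;
  assoc := fun A1 A2 A3 A4 f g h => sqid (hcompA ax f g h);
  associ := fun A1 A2 A3 A4 f g h => sqid (eq_sym (hcompA ax f g h));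
  lun := fun A1 A2 f => sqid (hidl ax f);
  luni := fun A1 A2 f => sqid (eq_sym (hidl ax f));
  run := fun A1 A2 f => sqid (hidr ax f);
  runi := fun A1 A2 f => sqid (eq_sym (hidr ax f)) |}.

End Horizontal.

Record pdf (B : dbl) (fo : B -> B) := Pdf {
  fh : forall A A' : B, hor A A' -> hor (fo A) (fo A');
  fv : forall A A' : B, ver A A' -> ver (fo A) (fo A');
  fs : forall (A1 A2 A3 A4 : B) (f : hor A1 A2) (u : ver A1 A3) (v : ver A2 A4)
    (g : hor A3 A4), sq f u v g -> sq (fh f) (fv u) (fv v) (fh g);
  fv_id : forall A, fv (vid A) = vid (fo A);
  fv_comp : forall (A A' A'' : B) (u : ver A A') (v : ver A' A''),
    fv (u ⇣ v) = fv u ⇣ fv v;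
  dfc : forall (A A' A'' : B) (f : hor A A') (g : hor A' A''),
    sq (fh f · fh g) (vid _) (vid _) (fh (f · g));
  dfci : forall (A A' A'' : B) (f : hor A A') (g : hor A' A''),
    sq (fh (f · g)) (vid _) (vid _) (fh f · fh g);
  dfu : forall A, sq (hid (fo A)) (vid _) (vid _) (fh (hid A));
  dfui : forall A, sq (fh (hid A)) (vid _) (vid _) (hid (fo A)) }.

Arguments pdf B fo : clear implicits.
Arguments fh {B fo} p {A A'} f : rename.
Arguments fv {B fo} p {A A'} u : rename.
Arguments fs {B fo} p {A1 A2 A3 A4 f u v g} a : rename.
Arguments fv_id {B fo} p A : rename.
Arguments fv_comp {B fo} p {A A' A''} u v : rename.
Arguments dfc {B fo} p {A A' A''} f g : rename.
Arguments dfci {B fo} p {A A' A''} f g : rename.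
Arguments dfu {B fo} p A : rename.
Arguments dfui {B fo} p A : rename.

(* [F] on horizontally globular squares *)
Definition fsg {B : dbl} {fo} (F : pdf B fo) {A A' : B} {f g : hor A A'}
    (a : sq f (vid A) (vid A') g) : sq (fh F f) (vid (fo A)) (vid (fo A')) (fh F g) :=
  sq_cast eq_refl (fv_id F A) (fv_id F A') eq_refl (fs F a).

Definition Hpf {B : dbl} {fo} (F : pdf B fo) : pf (HB B) (HB B) fo :=
  Pf (HB B) (HB B) fo
    (fun A A' f => fh F f)
    (fun A A' f g a => fsg F a)
    (fun A A' A'' f g => dfc F f g)
    (fun A A' A'' f g => dfci F f g)
    (fun A => dfu F A)
    (fun A => dfui F A).

Record is_pdf {B : dbl} {fo} (F : pdf B fo) : Prop := {
  pdf_H : is_pf (Hpf F);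
  pdf_sqh : forall (A A' : B) (f : hor A A'), fs F (sqh f) ≈ sqh (fh F f);
  pdf_vc : forall (A1 A2 A3 A4 A5 A6 : B) (f : hor A1 A2) (u : ver A1 A3) (v : ver A2 A4)
    (g : hor A3 A4) (u' : ver A3 A5) (v' : ver A4 A6) (h : hor A5 A6)
    (a : sq f u v g) (b : sq g u' v' h), fs F (a ⫽ b) ≈ fs F a ⫽ fs F b;
  pdf_dfc : forall (A1 A2 A3 D1 D2 D3 : B) (f : hor A1 A2) (f' : hor A2 A3)
    (g : hor D1 D2) (g' : hor D2 D3) (u : ver A1 D1) (v : ver A2 D2) (w : ver A3 D3)
    (a : sq f u v g) (b : sq f' v w g'),
    (fs F a ∥ fs F b) ⫽ dfc F g g' ≈ dfc F f f' ⫽ fs F (a ∥ b);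
  pdf_dfu : forall (A A' : B) (u : ver A A'),
    sqv (fv F u) ⫽ dfu F A' ≈ dfu F A ⫽ fs F (sqv u) }.

Definition pdf_id (B : dbl) : pdf B (fun A => A) :=
  @Pdf B (fun A => A) (fun A A' f => f) (fun A A' u => u)
    (fun A1 A2 A3 A4 f u v g a => a) (fun A => eq_refl) (fun A A' A'' u v => eq_refl)
    (fun A A' A'' f g => sqh (f · g)) (fun A A' A'' f g => sqh (f · g))
    (fun A => sqh (hid A)) (fun A => sqh (hid A)).

(* [F] followed by [G] *)
Definition pdf_comp {B : dbl} {fo go} (F : pdf B fo) (G : pdf B go) :
    pdf B (fun A => go (fo A)) :=
  @Pdf B (fun A => go (fo A))
    (fun A A' f => fh G (fh F f))
    (fun A A' u => fv G (fv F u))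
    (fun A1 A2 A3 A4 f u v g a => fs G (fs F a))
    (fun A => eq_trans (f_equal (fv G) (fv_id F A)) (fv_id G (fo A)))
    (fun A A' A'' u v => eq_trans (f_equal (fv G) (fv_comp F u v))
                                  (fv_comp G (fv F u) (fv F v)))
    (fun A A' A'' f g => @fc _ _ _ _ _ (pf_comp (Hpf F) (Hpf G)) A A' A'' f g)
    (fun A A' A'' f g => @fci _ _ _ _ _ (pf_comp (Hpf F) (Hpf G)) A A' A'' f g)
    (fun A => fu (pf_comp (Hpf F) (Hpf G)) A)
    (fun A => fui (pf_comp (Hpf F) (Hpf G)) A).

(* As for bicategories, the raw data of transformations only mention the actions
   of the functors on 1h- and 1v-cells. *)

Record hpt (B : dbl) {fo go : B -> B}
    (Fh : forall A A' : B, hor A A' -> hor (fo A) (fo A'))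
    (Fv : forall A A' : B, ver A A' -> ver (fo A) (fo A'))
    (Gh : forall A A' : B, hor A A' -> hor (go A) (go A'))
    (Gv : forall A A' : B, ver A A' -> ver (go A) (go A'))
    (c : forall A, hor (fo A) (go A)) := Hpt {
  hv : forall (A A' : B) (u : ver A A'), sq (c A) (Fv A A' u) (Gv A A' u) (c A');
  hd : forall (A A' : B) (f : hor A A'),
    sq (Fh A A' f · c A') (vid _) (vid _) (c A · Gh A A' f);
  hdi : forall (A A' : B) (f : hor A A'),
    sq (c A · Gh A A' f) (vid _) (vid _) (Fh A A' f · c A') }.

Arguments hpt B {fo go} Fh Fv Gh Gv c.
Arguments Hpt {B fo go} Fh Fv Gh Gv c hv hd hdi.
Arguments hv {B fo go Fh Fv Gh Gv c} h {A A'} u : rename.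
Arguments hd {B fo go Fh Fv Gh Gv c} h {A A'} f : rename.
Arguments hdi {B fo go Fh Fv Gh Gv c} h {A A'} f : rename.

Notation "'hpt_of' F G c" :=
  (hpt _ (@fh _ _ F) (@fv _ _ F) (@fh _ _ G) (@fv _ _ G) c)
  (at level 10, F at level 9, G at level 9, c at level 9).

Definition Hpn {B : dbl} {fo go : B -> B} {Fh Fv Gh Gv c}
    (s : @hpt B fo go Fh Fv Gh Gv c) : @pn _ _ (HB B) (HB B) fo go Fh Gh c :=
  @Pn _ _ (HB B) (HB B) fo go Fh Gh c
    (fun A A' f => hd s f) (fun A A' f => hdi s f).

Record is_hpt {B : dbl} {fo go} (F : pdf B fo) (G : pdf B go) {c}
    (s : hpt_of F G c) : Prop := {
  hpt_H : is_pn (Hpf F) (Hpf G) (Hpn s);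
  hpt_vid : forall A, hv s (vid A) ≈ sqh (c A);
  hpt_vcomp : forall (A A' A'' : B) (u : ver A A') (v : ver A' A''),
    hv s (u ⇣ v) ≈ hv s u ⫽ hv s v;
  hpt_nat : forall (A1 A2 A3 A4 : B) (f : hor A1 A2) (u : ver A1 A3) (v : ver A2 A4)
    (g : hor A3 A4) (a : sq f u v g),
    (fs F a ∥ hv s v) ⫽ hd s g ≈ hd s f ⫽ (hv s u ∥ fs G a) }.

Definition hpt_id {B : dbl} {fo} (F : pdf B fo) : hpt_of F F (fun A => hid (fo A)) :=
  Hpt _ _ _ _ (fun A => hid (fo A))
    (fun A A' u => sqv (fv F u))
    (fun A A' f => nat1 (pn_id (on1 (Hpf F))) f)
    (fun A A' f => nat1i (pn_id (on1 (Hpf F))) f).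

Definition hpt_comp {B : dbl} {fo go ho : B -> B} {Fh Fv Gh Gv Kh Kv c d}
    (s : @hpt B fo go Fh Fv Gh Gv c) (t : @hpt B go ho Gh Gv Kh Kv d) :
    @hpt B fo ho Fh Fv Kh Kv (fun A => c A · d A) :=
  Hpt Fh Fv Kh Kv (fun A => c A · d A)
    (fun A A' u => hv s u ∥ hv t u)
    (fun A A' f => nat1 (pn_comp (Hpn s) (Hpn t)) f)
    (fun A A' f => nat1i (pn_comp (Hpn s) (Hpn t)) f).

Definition hpt_post {B : dbl} {fo go ko : B -> B} (K : pdf B ko) {Fh Fv Gh Gv c}
    (s : @hpt B fo go Fh Fv Gh Gv c) :
    @hpt B (fun A => ko (fo A)) (fun A => ko (go A))
      (fun A A' f => fh K (Fh A A' f)) (fun A A' u => fv K (Fv A A' u))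
      (fun A A' f => fh K (Gh A A' f)) (fun A A' u => fv K (Gv A A' u))
      (fun A => fh K (c A)) :=
  Hpt (fun A A' f => fh K (Fh A A' f)) (fun A A' u => fv K (Fv A A' u))
      (fun A A' f => fh K (Gh A A' f)) (fun A A' u => fv K (Gv A A' u))
      (fun A => fh K (c A))
    (fun A A' u => fs K (hv s u))
    (fun A A' f => nat1 (pn_post (Hpf K) (Hpn s)) f)
    (fun A A' f => nat1i (pn_post (Hpf K) (Hpn s)) f).

Definition hpt_pre {B : dbl} {fo go ko : B -> B} {Fh Fv Gh Gv c}
    (s : @hpt B fo go Fh Fv Gh Gv c) (K : pdf B ko) :
    @hpt B (fun A => fo (ko A)) (fun A => go (ko A))
      (fun A A' f => Fh _ _ (fh K f)) (fun A A' u => Fv _ _ (fv K u))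
      (fun A A' f => Gh _ _ (fh K f)) (fun A A' u => Gv _ _ (fv K u))
      (fun A => c (ko A)) :=
  Hpt (fun A A' f => Fh _ _ (fh K f)) (fun A A' u => Fv _ _ (fv K u))
      (fun A A' f => Gh _ _ (fh K f)) (fun A A' u => Gv _ _ (fv K u))
      (fun A => c (ko A))
    (fun A A' u => hv s (fv K u))
    (fun A A' f => hd s (fh K f))
    (fun A A' f => hdi s (fh K f)).

Record vpt (B : dbl) {fo go : B -> B}
    (Fh : forall A A' : B, hor A A' -> hor (fo A) (fo A'))
    (Fv : forall A A' : B, ver A A' -> ver (fo A) (fo A'))
    (Gh : forall A A' : B, hor A A' -> hor (go A) (go A'))
    (Gv : forall A A' : B, ver A A' -> ver (go A) (go A'))
    (c : forall A, ver (fo A) (go A)) := Vpt {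
  vh : forall (A A' : B) (f : hor A A'), sq (Fh A A' f) (c A) (c A') (Gh A A' f);
  vd : forall (A A' : B) (u : ver A A'),
    sq (hid _) (c A ⇣ Gv A A' u) (Fv A A' u ⇣ c A') (hid _);
  vdi : forall (A A' : B) (u : ver A A'),
    sq (hid _) (Fv A A' u ⇣ c A') (c A ⇣ Gv A A' u) (hid _) }.

Arguments vpt B {fo go} Fh Fv Gh Gv c.
Arguments Vpt {B fo go} Fh Fv Gh Gv c vh vd vdi.
Arguments vh {B fo go Fh Fv Gh Gv c} v {A A'} f : rename.
Arguments vd {B fo go Fh Fv Gh Gv c} v {A A'} u : rename.
Arguments vdi {B fo go Fh Fv Gh Gv c} v {A A'} u : rename.

Notation "'vpt_of' F G c" :=
  (vpt _ (@fh _ _ F) (@fv _ _ F) (@fh _ _ G) (@fv _ _ G) c)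
  (at level 10, F at level 9, G at level 9, c at level 9).

Record is_vpt {B : dbl} {fo go} (F : pdf B fo) (G : pdf B go) {c}
    (s : vpt_of F G c) : Prop := {
  vpt_inv : forall (A A' : B) (u : ver A A'), vd s u ∥ vdi s u ≈ sqv (c A ⇣ fv G u);
  vpt_invi : forall (A A' : B) (u : ver A A'), vdi s u ∥ vd s u ≈ sqv (fv F u ⇣ c A');
  vpt_dfc : forall (A A' A'' : B) (f : hor A A') (g : hor A' A''),
    dfc F f g ⫽ vh s (f · g) ≈ (vh s f ∥ vh s g) ⫽ dfc G f g;
  vpt_dfu : forall A, dfu F A ⫽ vh s (hid A) ≈ sqv (c A) ⫽ dfu G A;
  vpt_vid : forall A, vd s (vid A) ≈ sqv (c A);
  vpt_vcomp : forall (A A' A'' : B) (u : ver A A') (v : ver A' A''),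
    vd s (u ⇣ v) ≈
    sq_cast eq_refl eq_refl (vcompA (dbl_ax B) _ _ _) eq_refl (vd s u ⫽ sqv (fv G v))
    ∥ (sqv (fv F u) ⫽ vd s v);
  vpt_nat : forall (A1 A2 A3 A4 : B) (f : hor A1 A2) (u : ver A1 A3) (v : ver A2 A4)
    (g : hor A3 A4) (a : sq f u v g),
    vd s u ∥ (fs F a ⫽ vh s g) ≈ (vh s f ⫽ fs G a) ∥ vd s v }.

Arguments is_hpt {B fo go} F G {c} s.
Arguments is_vpt {B fo go} F G {c} s.

Definition is_strict_vpt {B : dbl} {fo go : B -> B} {Fh Fv Gh Gv c}
    (s : @vpt B fo go Fh Fv Gh Gv c) : Prop :=
  forall (A A' : B) (u : ver A A'), vd s u ≈ sqv (c A ⇣ Gv A A' u).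

Definition vpt_eq {B : dbl} {fo go : B -> B} {Fh Fv Gh Gv c Fh' Fv' Gh' Gv' c'}
    (s : @vpt B fo go Fh Fv Gh Gv c) (t : @vpt B fo go Fh' Fv' Gh' Gv' c') : Prop :=
  (forall A, c A = c' A) /\
  (forall (A A' : B) (f : hor A A'), vh s f ≈ vh t f) /\
  (forall (A A' : B) (u : ver A A'), vd s u ≈ vd t u).

Definition vpt_id {B : dbl} {fo} (F : pdf B fo) : vpt_of F F (fun A => vid (fo A)) :=
  Vpt _ _ _ _ (fun A => vid (fo A))
    (fun A A' f => sqh (fh F f))
    (fun A A' u => sq_cast eq_refl (eq_sym (vidl (dbl_ax B) _))
       (eq_sym (vidr (dbl_ax B) _)) eq_refl (sqv (fv F u)))
    (fun A A' u => sq_cast eq_refl (eq_sym (vidr (dbl_ax B) _))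
       (eq_sym (vidl (dbl_ax B) _)) eq_refl (sqv (fv F u))).

Definition vpt_comp {B : dbl} {fo go ho : B -> B} {Fh Fv Gh Gv Kh Kv c d}
    (s : @vpt B fo go Fh Fv Gh Gv c) (t : @vpt B go ho Gh Gv Kh Kv d) :
    @vpt B fo ho Fh Fv Kh Kv (fun A => c A ⇣ d A) :=
  let ax := dbl_ax B in
  Vpt Fh Fv Kh Kv (fun A => c A ⇣ d A)
    (fun A A' f => vh s f ⫽ vh t f)
    (fun A A' u => sq_cast (hidl ax _) eq_refl eq_refl (hidl ax _)
       (sq_cast eq_refl (eq_sym (vcompA ax _ _ _)) (eq_sym (vcompA ax _ _ _)) eq_refl
          (sqv (c A) ⫽ vd t u)
        ∥ sq_cast eq_refl eq_refl (vcompA ax _ _ _) eq_refl (vd s u ⫽ sqv (d A'))))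
    (fun A A' u => sq_cast (hidl ax _) eq_refl eq_refl (hidl ax _)
       (sq_cast eq_refl (vcompA ax _ _ _) eq_refl eq_refl (vdi s u ⫽ sqv (d A'))
        ∥ sq_cast eq_refl (eq_sym (vcompA ax _ _ _)) (eq_sym (vcompA ax _ _ _)) eq_refl
          (sqv (c A) ⫽ vdi t u))).

Lemma fv_comp_pad {B : dbl} {ko} (K : pdf B ko) {A1 A2 A3 : B} (u : ver A1 A2)
    (v : ver A2 A3) :
  (vid _ ⇣ fv K (u ⇣ v)) ⇣ vid _ = fv K u ⇣ fv K v.
Proof.
  now rewrite (vidr (dbl_ax B)), (vidl (dbl_ax B)), fv_comp.
Qed.

Definition vpt_post {B : dbl} {fo go ko : B -> B} (K : pdf B ko) {Fh Fv Gh Gv c}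
    (s : @vpt B fo go Fh Fv Gh Gv c) :
    @vpt B (fun A => ko (fo A)) (fun A => ko (go A))
      (fun A A' f => fh K (Fh A A' f)) (fun A A' u => fv K (Fv A A' u))
      (fun A A' f => fh K (Gh A A' f)) (fun A A' u => fv K (Gv A A' u))
      (fun A => fv K (c A)) :=
  Vpt (fun A A' f => fh K (Fh A A' f)) (fun A A' u => fv K (Fv A A' u))
      (fun A A' f => fh K (Gh A A' f)) (fun A A' u => fv K (Gv A A' u))
      (fun A => fv K (c A))
    (fun A A' f => fs K (vh s f))
    (fun A A' u => sq_cast eq_refl (fv_comp_pad K _ _) (fv_comp_pad K _ _) eq_refl
       (dfu K (fo A) ⫽ fs K (vd s u) ⫽ dfui K (go A')))
    (fun A A' u => sq_cast eq_refl (fv_comp_pad K _ _) (fv_comp_pad K _ _) eq_refl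
       (dfu K (fo A) ⫽ fs K (vdi s u) ⫽ dfui K (go A'))).

Definition vpt_pre {B : dbl} {fo go ko : B -> B} {Fh Fv Gh Gv c}
    (s : @vpt B fo go Fh Fv Gh Gv c) (K : pdf B ko) :
    @vpt B (fun A => fo (ko A)) (fun A => go (ko A))
      (fun A A' f => Fh _ _ (fh K f)) (fun A A' u => Fv _ _ (fv K u))
      (fun A A' f => Gh _ _ (fh K f)) (fun A A' u => Gv _ _ (fv K u))
      (fun A => c (ko A)) :=
  Vpt (fun A A' f => Fh _ _ (fh K f)) (fun A A' u => Fv _ _ (fv K u))
      (fun A A' f => Gh _ _ (fh K f)) (fun A A' u => Gv _ _ (fv K u))
      (fun A => c (ko A))
    (fun A A' f => vh s (fh K f))
    (fun A A' u => vd s (fv K u))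
    (fun A A' u => vdi s (fv K u)).

(* Inverse 1v-components together with vertical inverses of the squares [vh s f];
   the inverse 1v-components [ci] are inverse to the components because the
   equations below compare the vertical sides too. *)
Definition vinv {B : dbl} {fo go : B -> B}
    (Fh : forall A A' : B, hor A A' -> hor (fo A) (fo A'))
    (Gh : forall A A' : B, hor A A' -> hor (go A) (go A'))
    (ci : forall A, ver (go A) (fo A)) : Type :=
  forall (A A' : B) (f : hor A A'), sq (Gh A A' f) (ci A) (ci A') (Fh A A' f).

Definition is_vinv {B : dbl} {fo go : B -> B} {Fh Fv Gh Gv c}
    (s : @vpt B fo go Fh Fv Gh Gv c) {ci} (i : vinv Fh Gh ci) : Prop :=
  forall (A A' : B) (f : hor A A'),
    vh s f ⫽ i A A' f ≈ sqh (Fh A A' f) /\ i A A' f ⫽ vh s f ≈ sqh (Gh A A' f).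

(* Modifications, with horizontal boundaries [s] (top) and [t] (bottom) and
   vertical boundaries [x] (left) and [y] (right). *)
Definition is_modif {B : dbl} {fo go fo' go' : B -> B}
    {Fh Fv Gh Gv Fh' Fv' Gh' Gv' c d x' y'}
    (s : @hpt B fo go Fh Fv Gh Gv c) (t : @hpt B fo' go' Fh' Fv' Gh' Gv' d)
    (x : @vpt B fo fo' Fh Fv Fh' Fv' x') (y : @vpt B go go' Gh Gv Gh' Gv' y')
    (m : forall A, sq (c A) (x' A) (y' A) (d A)) : Prop :=
  (forall (A A' : B) (f : hor A A'),
     (vh x f ∥ m A') ⫽ hd t f ≈ hd s f ⫽ (m A ∥ vh y f)) /\
  (forall (A A' : B) (u : ver A A'),
     (m A ⫽ hv t u) ∥ vd y u ≈ vd x u ∥ (hv s u ⫽ m A')).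

Definition is_hmodif {B : dbl} {fo go : B -> B} (F : pdf B fo) (G : pdf B go) {c d}
    (s : hpt_of F G c) (t : hpt_of F G d)
    (m : forall A, sq (c A) (vid _) (vid _) (d A)) : Prop :=
  is_modif s t (vpt_id F) (vpt_id G) m.

Arguments is_hmodif {B fo go} F G {c d} s t m.

Record companion {B : dbl} {A A' : B} (u : ver A A') := Companion {
  comp_h : hor A A';
  comp_eps : sq comp_h u (vid A') (hid A');
  comp_eta : sq (hid A) (vid A) u comp_h;
  comp_hc : comp_eta ∥ comp_eps ≈ sqh comp_h;
  comp_vc : comp_eta ⫽ comp_eps ≈ sqv u }.

Arguments comp_h {B A A' u} c.
Arguments comp_eps {B A A' u} c.
Arguments comp_eta {B A A' u} c.

(* [[η_u | s | ε_v]] *)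
Definition lift_sq {B : dbl} {A1 A2 A3 A4 : B} {f : hor A1 A2} {u : ver A1 A3}
    {v : ver A2 A4} {g : hor A3 A4} (cu : companion u) (cv : companion v)
    (s : sq f u v g) : sq (f · comp_h cv) (vid A1) (vid A4) (comp_h cu · g) :=
  let ax := dbl_ax B in
  sq_cast (f_equal (fun h => h · comp_h cv) (hidl ax f)) eq_refl eq_refl (hidr ax _)
    ((comp_eta cu ∥ s) ∥ comp_eps cv).

(* The inverse of [lift_sq s], for a vertical inverse [i] of [s]: the companion of
   an invertible 1v-cell is a conjoint of its inverse. *)
Definition lift_sqi {B : dbl} {A1 A2 A3 A4 : B} {f : hor A1 A2} {u : ver A1 A3}
    {v : ver A2 A4} {g : hor A3 A4} (cu : companion u) (cv : companion v)
    {ui : ver A3 A1} {vi : ver A4 A2} (eu : u ⇣ ui = vid A1) (ev : vi ⇣ v = vid A4)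
    (i : sq g ui vi f) : sq (comp_h cu · g) (vid A1) (vid A4) (f · comp_h cv) :=
  let ax := dbl_ax B in
  sq_cast (hidr ax _) eq_refl eq_refl (f_equal (fun h => h · comp_h cv) (hidl ax f))
    ((sq_cast eq_refl eu (vidl ax ui) eq_refl (comp_eps cu ⫽ sqv ui) ∥ i)
     ∥ sq_cast eq_refl (vidr ax vi) ev eq_refl (sqv vi ⫽ comp_eta cv)).

Definition lift {B : dbl} {fo go : B -> B} {Fh Fv Gh Gv c}
    (s : @vpt B fo go Fh Fv Gh Gv c) {ci} (i : vinv Fh Gh ci)
    (cc : forall A, companion (c A))
    (e1 : forall A, c A ⇣ ci A = vid _) (e2 : forall A, ci A ⇣ c A = vid _) :
    @pn _ _ (HB B) (HB B) fo go Fh Gh (fun A => comp_h (cc A)) :=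
  @Pn _ _ (HB B) (HB B) fo go Fh Gh (fun A => comp_h (cc A))
    (fun A A' f => lift_sq (cc A) (cc A') (vh s f))
    (fun A A' f => lift_sqi (cc A) (cc A') (e1 A) (e2 A') (i A A' f)).

Record bin (B : dbl) := Bin {
  tens : B -> B -> B;
  lt : forall X, pdf B (tens X);                       (* X ⋉ - *)
  rt : forall Y, pdf B (fun X => tens X Y) }.          (* - ⋊ Y *)

Arguments Bin {B} tens lt rt.
Arguments tens {B} b X Y : rename.
Arguments lt {B} b X : rename.
Arguments rt {B} b Y : rename.

Definition brev {B : dbl} (b : bin B) : bin B :=
  Bin (fun X Y => tens b Y X) (fun X => rt b X) (fun Y => lt b Y).

Definition is_bin {B : dbl} (b : bin B) : Prop :=
  (forall X, is_pdf (lt b X)) /\ (forall Y, is_pdf (rt b Y)).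

Definition Hbin {B : dbl} (b : bin B) : bbin (HB B) :=
  @BBin _ (HB B) (tens b) (fun X => Hpf (lt b X)) (fun Y => Hpf (rt b Y)).

Definition left_hcen {B : dbl} (b : bin B) {X X' : B} (k : hor X X') : Type :=
  hpt_of (lt b X) (lt b X') (fun Y => fh (rt b Y) k).
Definition right_hcen {B : dbl} (b : bin B) {X X' : B} (k : hor X X') : Type :=
  hpt_of (rt b X) (rt b X') (fun Y => fh (lt b Y) k).
Definition left_vcen {B : dbl} (b : bin B) {X X' : B} (u : ver X X') : Type :=
  vpt_of (lt b X) (lt b X') (fun Y => fv (rt b Y) u).
Definition right_vcen {B : dbl} (b : bin B) {X X' : B} (u : ver X X') : Type :=
  vpt_of (rt b X) (rt b X') (fun Y => fv (lt b Y) u).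

Record invcen {B : dbl} (b : bin B) {X X' : B} (u : ver X X') := InvCen {
  iv : ver X' X;
  iv_r : u ⇣ iv = vid X;
  iv_l : iv ⇣ u = vid X';
  ic_l : left_vcen b u;
  ic_r : right_vcen b u;
  ic_il : left_vcen b iv;
  ic_ir : right_vcen b iv }.

Arguments iv {B b X X' u} i : rename.
Arguments iv_r {B b X X' u} i : rename.
Arguments iv_l {B b X X' u} i : rename.
Arguments ic_l {B b X X' u} i : rename.
Arguments ic_r {B b X X' u} i : rename.
Arguments ic_il {B b X X' u} i : rename.
Arguments ic_ir {B b X X' u} i : rename.

Record is_invcen {B : dbl} {b : bin B} {X X' : B} {u : ver X X'} (i : invcen b u) : Prop := {
  iic_l : is_vpt (lt b X) (lt b X') (ic_l i);
  iic_r : is_vpt (rt b X) (rt b X') (ic_r i);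
  iic_il : is_vpt (lt b X') (lt b X) (ic_il i);
  iic_ir : is_vpt (rt b X') (rt b X) (ic_ir i);
  iic_linv : is_vinv (ic_l i) (fun Y Y' k => vh (ic_il i) k);
  iic_rinv : is_vinv (ic_r i) (fun Y Y' k => vh (ic_ir i) k) }.

Record pmd {B : dbl} (b : bin B) := Pmd {
  dI : B;
  dasc : forall X Y Z, ver (tens b (tens b X Y) Z) (tens b X (tens b Y Z));
  dascC : forall X Y Z, invcen b (dasc X Y Z);
  da1 : forall Y Z, vpt_of (pdf_comp (rt b Y) (rt b Z)) (rt b (tens b Y Z))
    (fun X => dasc X Y Z);
  da2 : forall X Z, vpt_of (pdf_comp (lt b X) (rt b Z)) (pdf_comp (rt b Z) (lt b X))
    (fun Y => dasc X Y Z);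
  da3 : forall X Y, vpt_of (lt b (tens b X Y)) (pdf_comp (lt b Y) (lt b X))
    (fun Z => dasc X Y Z);
  da1i : forall Y Z, vinv (@fh _ _ (pdf_comp (rt b Y) (rt b Z)))
    (@fh _ _ (rt b (tens b Y Z))) (fun X => iv (dascC X Y Z));
  da2i : forall X Z, vinv (@fh _ _ (pdf_comp (lt b X) (rt b Z)))
    (@fh _ _ (pdf_comp (rt b Z) (lt b X))) (fun Y => iv (dascC X Y Z));
  da3i : forall X Y, vinv (@fh _ _ (lt b (tens b X Y)))
    (@fh _ _ (pdf_comp (lt b Y) (lt b X))) (fun Z => iv (dascC X Y Z));
  dlam : forall X, ver (tens b dI X) X;
  dlamC : forall X, invcen b (dlam X);
  dlamT : vpt_of (lt b dI) (pdf_id B) dlam;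
  dlamTi : vinv (@fh _ _ (lt b dI)) (@fh _ _ (pdf_id B)) (fun X => iv (dlamC X));
  drho : forall X, ver (tens b X dI) X;
  drhoC : forall X, invcen b (drho X);
  drhoT : vpt_of (rt b dI) (pdf_id B) drho;
  drhoTi : vinv (@fh _ _ (rt b dI)) (@fh _ _ (pdf_id B)) (fun X => iv (drhoC X)) }.

Arguments dI {B b} P : rename.
Arguments dasc {B b} P X Y Z : rename.
Arguments dascC {B b} P X Y Z : rename.
Arguments da1 {B b} P Y Z : rename.
Arguments da2 {B b} P X Z : rename.
Arguments da3 {B b} P X Y : rename.
Arguments da1i {B b} P Y Z : rename.
Arguments da2i {B b} P X Z : rename.
Arguments da3i {B b} P X Y : rename.
Arguments dlam {B b} P X : rename.
Arguments dlamC {B b} P X : rename.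
Arguments dlamT {B b} P : rename.
Arguments dlamTi {B b} P : rename.
Arguments drho {B b} P X : rename.
Arguments drhoC {B b} P X : rename.
Arguments drhoT {B b} P : rename.
Arguments drhoTi {B b} P : rename.

Definition is_inv_strict {B : dbl} {fo go : B -> B} (F : pdf B fo) (G : pdf B go) {c ci}
    (s : vpt_of F G c) (i : vinv (@fh _ _ F) (@fh _ _ G) ci) : Prop :=
  is_vpt F G s /\ is_strict_vpt s /\ is_vinv s i.

Arguments is_inv_strict {B fo go} F G {c ci} s i.

Record is_pmd {B : dbl} {b : bin B} (P : pmd b) : Prop := {
  pmd_bin : is_bin b;
  pmd_ascC : forall X Y Z, is_invcen (dascC P X Y Z);
  pmd_lamC : forall X, is_invcen (dlamC P X);
  pmd_rhoC : forall X, is_invcen (drhoC P X);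
  pmd_a1 : forall Y Z, is_inv_strict (pdf_comp (rt b Y) (rt b Z)) (rt b (tens b Y Z))
    (da1 P Y Z) (da1i P Y Z);
  pmd_a2 : forall X Z, is_inv_strict (pdf_comp (lt b X) (rt b Z))
    (pdf_comp (rt b Z) (lt b X)) (da2 P X Z) (da2i P X Z);
  pmd_a3 : forall X Y, is_inv_strict (lt b (tens b X Y)) (pdf_comp (lt b Y) (lt b X))
    (da3 P X Y) (da3i P X Y);
  pmd_lam : is_inv_strict (lt b (dI P)) (pdf_id B) (dlamT P) (dlamTi P);
  pmd_rho : is_inv_strict (rt b (dI P)) (pdf_id B) (drhoT P) (drhoTi P);
  pmd_pent1 : forall X Y Z, vpt_eq
    (vpt_comp (vpt_comp (vpt_post (rt b Z) (da1 P X Y)) (da1 P (tens b X Y) Z))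
              (ic_r (dascC P X Y Z)))
    (vpt_comp (vpt_pre (da1 P Y Z) (rt b X)) (da1 P X (tens b Y Z)));
  pmd_pent2 : forall W Y Z, vpt_eq
    (vpt_comp (vpt_comp (vpt_post (rt b Z) (da2 P W Y)) (vpt_pre (da2 P W Z) (rt b Y)))
              (vpt_post (lt b W) (da1 P Y Z)))
    (vpt_comp (vpt_pre (da1 P Y Z) (lt b W)) (da2 P W (tens b Y Z)));
  pmd_pent3 : forall W X Z, vpt_eq
    (vpt_comp (vpt_comp (vpt_post (rt b Z) (da3 P W X)) (vpt_pre (da2 P W Z) (lt b X)))
              (vpt_post (lt b W) (da2 P X Z)))
    (vpt_comp (da2 P (tens b W X) Z) (vpt_pre (da3 P W X) (rt b Z)));
  pmd_pent4 : forall W X Y, vpt_eq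
    (vpt_comp (vpt_comp (ic_l (dascC P W X Y)) (da3 P W (tens b X Y)))
              (vpt_post (lt b W) (da3 P X Y)))
    (vpt_comp (da3 P (tens b W X) Y) (vpt_pre (da3 P W X) (lt b Y)));
  (* [α_{W,I,Y} / W λ_Y = ρ_W Y] *)
  pmd_tri1 : forall Y, vpt_eq (vpt_comp (da1 P (dI P) Y) (ic_r (dlamC P Y)))
    (vpt_post (rt b Y) (drhoT P));
  pmd_tri2 : forall W, vpt_eq (vpt_comp (da3 P W (dI P)) (vpt_post (lt b W) (dlamT P)))
    (ic_l (drhoC P W));
  (* [α_{I,W,Y} / λ_{WY} = λ_W Y] *)
  pmd_lun1 : forall Y, vpt_eq (vpt_comp (da2 P (dI P) Y) (vpt_pre (dlamT P) (rt b Y)))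
    (vpt_post (rt b Y) (dlamT P));
  pmd_lun2 : forall W, vpt_eq (vpt_comp (da3 P (dI P) W) (vpt_pre (dlamT P) (lt b W)))
    (ic_l (dlamC P W));
  (* [α_{W,Y,I} / W ρ_Y = ρ_{WY}] *)
  pmd_run1 : forall Y, vpt_eq (vpt_comp (da1 P Y (dI P)) (ic_r (drhoC P Y)))
    (vpt_pre (drhoT P) (rt b Y));
  pmd_run2 : forall W, vpt_eq (vpt_comp (da2 P W (dI P)) (vpt_post (lt b W) (drhoT P)))
    (vpt_pre (drhoT P) (lt b W)) }.

(* Chosen left centrality structures on all 1-cells; applied to [brev b], chosen
   right centrality structures. *)
Record lcs {B : dbl} (b : bin B) := Lcs {
  lh : forall (X X' : B) (k : hor X X'), left_hcen b k;
  lv : forall (X X' : B) (u : ver X X'), left_vcen b u }.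

Arguments lh {B b} L {X X'} k : rename.
Arguments lv {B b} L {X X'} u : rename.

Record lcs_laws {B : dbl} {b : bin B} (L : lcs b) : Prop := {
  lcs_h : forall (X X' : B) (k : hor X X'), is_hpt (lt b X) (lt b X') (lh L k);
  lcs_v : forall (X X' : B) (u : ver X X'), is_vpt (lt b X) (lt b X') (lv L u);
  lcs_s : forall (X1 X2 X3 X4 : B) (f : hor X1 X2) (u : ver X1 X3) (v : ver X2 X4)
    (g : hor X3 X4) (a : sq f u v g),
    is_modif (lh L f) (lh L g) (lv L u) (lv L v) (fun Y => fs (rt b Y) a) }.

(* [X ↦ X ⋉ -], [p ↦ p ⋉ -] is a pseudodouble functor to the double category of
   pseudodouble endofunctors, strict on 1v-cells, and with compositor and unitor
   those of the [- ⋊ Y].  The remaining axioms of a pseudodouble functor are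
   equations of squares that hold componentwise by those of [- ⋊ Y]. *)
Record lcs_functor {B : dbl} {b : bin B} (L : lcs b) : Prop := {
  lcf_comp : forall (X X' X'' : B) (k : hor X X') (k' : hor X' X''),
    is_hmodif (lt b X) (lt b X'') (hpt_comp (lh L k) (lh L k')) (lh L (k · k'))
      (fun Y => dfc (rt b Y) k k');
  lcf_unit : forall X,
    is_hmodif (lt b X) (lt b X) (hpt_id (lt b X)) (lh L (hid X)) (fun Y => dfu (rt b Y) X);
  lcf_vcomp : forall (X X' X'' : B) (u : ver X X') (u' : ver X' X''),
    vpt_eq (lv L (u ⇣ u')) (vpt_comp (lv L u) (lv L u'));
  lcf_vid : forall X, vpt_eq (lv L (vid X)) (vpt_id (lt b X)) }.

(* [K ⋉ -|_k = (- ⋊ k|_K)^{-1}], [U ⋉ -|_u = (- ⋊ u|_U)^{-1}],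
   [K ⋉ -|_u = - ⋊ u|_K], [U ⋉ -|_k = - ⋊ k|_U] *)
Record exchange {B : dbl} {b : bin B} (L : lcs b) (R : lcs (brev b)) : Prop := {
  ex_hh : forall (X X' Y Y' : B) (K : hor X X') (k : hor Y Y'),
    hd (lh L K) k = hdi (lh R k) K /\ hdi (lh L K) k = hd (lh R k) K;
  ex_vv : forall (X X' Y Y' : B) (U : ver X X') (u : ver Y Y'),
    vd (lv L U) u = vdi (lv R u) U /\ vdi (lv L U) u = vd (lv R u) U;
  ex_hv : forall (X X' Y Y' : B) (K : hor X X') (u : ver Y Y'),
    hv (lh L K) u = vh (lv R u) K;
  ex_vh : forall (X X' Y Y' : B) (U : ver X X') (k : hor Y Y'),
    vh (lv L U) k = hv (lh R k) U }.

(* In the left (right) central case only [L] ([R]) is given, the other family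
   being the one it determines. *)
Definition is_central {B : dbl} (s : side) {b : bin B} (L : lcs b) (R : lcs (brev b)) : Prop :=
  exchange L R /\
  match s with
  | LeftCentral => lcs_laws L /\ lcs_functor L
  | RightCentral => lcs_laws R /\ lcs_functor R
  | PurelyCentral => lcs_laws L /\ lcs_laws R
  end.

Definition agrees {B : dbl} {b : bin B} (L : lcs b) (R : lcs (brev b)) {X X' : B}
    {u : ver X X'} (i : invcen b u) : Prop :=
  ic_l i = lv L u /\ ic_r i = lv R u /\ ic_il i = lv L (iv i) /\ ic_ir i = lv R (iv i).

(* Compatibility of associativity with the exchange cells [p ⋉ -|_q], for [p] a
   1h-cell (modifications) and for [p] a 1v-cell (equations of vertical
   transformations). *)
Record asc_exchange {B : dbl} {b : bin B} (P : pmd b) (L : lcs b) : Prop := {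
  ae12h : forall (X X' : B) (p : hor X X') Z, is_modif
    (hpt_post (rt b Z) (lh L p)) (hpt_pre (lh L p) (rt b Z)) (da2 P X Z) (da2 P X' Z)
    (fun Y => vh (da1 P Y Z) p);
  ae13h : forall (X X' : B) (p : hor X X') Y, is_modif
    (lh L (fh (rt b Y) p)) (hpt_pre (lh L p) (lt b Y)) (da3 P X Y) (da3 P X' Y)
    (fun Z => vh (da1 P Y Z) p);
  ae23h : forall X (Y Y' : B) (p : hor Y Y'), is_modif
    (lh L (fh (lt b X) p)) (hpt_post (lt b X) (lh L p)) (da3 P X Y) (da3 P X Y')
    (fun Z => vh (da2 P X Z) p);
  ae12v : forall (X X' : B) (p : ver X X') Z, vpt_eq
    (vpt_comp (vpt_post (rt b Z) (lv L p)) (da2 P X' Z))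
    (vpt_comp (da2 P X Z) (vpt_pre (lv L p) (rt b Z)));
  ae13v : forall (X X' : B) (p : ver X X') Y, vpt_eq
    (vpt_comp (lv L (fv (rt b Y) p)) (da3 P X' Y))
    (vpt_comp (da3 P X Y) (vpt_pre (lv L p) (lt b Y)));
  ae23v : forall X (Y Y' : B) (p : ver Y Y'), vpt_eq
    (vpt_comp (lv L (fv (lt b X) p)) (da3 P X Y'))
    (vpt_comp (da3 P X Y) (vpt_post (lt b X) (lv L p))) }.

Record is_central_premonoidal_dbl {B : dbl} (s : side) {b : bin B} (P : pmd b) (L : lcs b)
    (R : lcs (brev b)) : Prop := {
  cpd_pm : is_pmd P;
  cpd_cen : is_central s L R;
  cpd_asc : forall X Y Z, agrees L R (dascC P X Y Z);
  cpd_lam : forall X, agrees L R (dlamC P X);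
  cpd_rho : forall X, agrees L R (drhoC P X);
  cpd_ae : asc_exchange P L }.

Record liftable {B : dbl} {b : bin B} (P : pmd b) := Liftable {
  asc_c : forall X Y Z, companion (dasc P X Y Z);
  lam_c : forall X, companion (dlam P X);
  rho_c : forall X, companion (drho P X) }.

(* The existence of companions of the 1v-components of a constraint does not make
   its companion-lift an equivalence: for this the inverse transformation has to
   be liftable as well. *)
Definition inv_liftable {B : dbl} {b : bin B} (P : pmd b) : Prop :=
  (forall X Y Z, inhabited (companion (iv (dascC P X Y Z)))) /\
  (forall X, inhabited (companion (iv (dlamC P X)))) /\
  (forall X, inhabited (companion (iv (drhoC P X)))).

Arguments asc_c {B b P} l X Y Z : rename.
Arguments lam_c {B b P} l X : rename.
Arguments rho_c {B b P} l X : rename.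

Definition Hlcs {B : dbl} {b : bin B} (L : lcs b) : blcs (Hbin b) :=
  fun X X' k => Hpn (lh L k).

Definition Hconstr {B : dbl} {b : bin B} (P : pmd b) (l : liftable P) :
    bconstr (Hbin b) :=
  @BConstr _ (HB B) (Hbin b) (dI P)
    (fun X Y Z => comp_h (asc_c l X Y Z))
    (fun Y Z => lift (da1 P Y Z) (da1i P Y Z) (fun X => asc_c l X Y Z)
       (fun X => iv_r (dascC P X Y Z)) (fun X => iv_l (dascC P X Y Z)))
    (fun X Z => lift (da2 P X Z) (da2i P X Z) (fun Y => asc_c l X Y Z)
       (fun Y => iv_r (dascC P X Y Z)) (fun Y => iv_l (dascC P X Y Z)))
    (fun X Y => lift (da3 P X Y) (da3i P X Y) (fun Z => asc_c l X Y Z)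
       (fun Z => iv_r (dascC P X Y Z)) (fun Z => iv_l (dascC P X Y Z)))
    (fun X => comp_h (lam_c l X))
    (lift (dlamT P) (dlamTi P) (fun X => lam_c l X)
       (fun X => iv_r (dlamC P X)) (fun X => iv_l (dlamC P X)))
    (fun X => comp_h (rho_c l X))
    (lift (drhoT P) (drhoTi P) (fun X => rho_c l X)
       (fun X => iv_r (drhoC P X)) (fun X => iv_l (drhoC P X))).

Section Tensor.
Context {B : dbl} {b : bin B} (L : lcs b) (R : lcs (brev b)).
Let ax := dbl_ax B.

Definition tr_h {X X' Y Y' : B} (K : hor X X') (k : hor Y Y') :
    hor (tens b X Y) (tens b X' Y') := fh (rt b Y) K · fh (lt b X') k.

Definition tr_v {X Z Y W : B} (U : ver X Z) (u : ver Y W) :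
    ver (tens b X Y) (tens b Z W) := fv (rt b Y) U ⇣ fv (lt b Z) u.

(* [[(σ ⋊ Y) / (- ⋊ u|_K̃) | (- ⋊ k|_{U'}) / (Ã' ⋉ δ)]] *)
Definition tr_s {X X' Z Z' Y Y' W W' : B} {K : hor X X'} {U : ver X Z} {U' : ver X' Z'}
    {K' : hor Z Z'} {k : hor Y Y'} {u : ver Y W} {u' : ver Y' W'} {k' : hor W W'}
    (σ : sq K U U' K') (δ : sq k u u' k') :
    sq (tr_h K k) (tr_v U u) (tr_v U' u') (tr_h K' k') :=
  (fs (rt b Y) σ ⫽ vh (lv R u) K') ∥ (hv (lh R k) U' ⫽ fs (lt b Z') δ).

Lemma tr_v_id (X Y : B) : tr_v (vid X) (vid Y) = vid (tens b X Y).
Proof. unfold tr_v. now rewrite !fv_id, (vidl (dbl_ax B)). Qed.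

Local Notation HB := (HB B).
Local Notation pr X := (tens b (fst X) (snd X)).
Local Notation "a ** c" := (comp2 HB a c) (at level 60, right associativity).
Local Notation wl f a := (@whiskl _ HB _ _ _ f _ _ a).
Local Notation wr a f := (@whiskr _ HB _ _ _ _ _ f a).
Local Notation as_ f g h := (@assoc _ HB _ _ _ _ f g h).
Local Notation asi f g h := (@associ _ HB _ _ _ _ f g h).

(* The compositor of [⊗_r]: the exchange cell [K' ⋉ -|_k] followed by the
   compositors of [- ⋊ Y] and [X'' ⋉ -]. *)
Definition tr_fc {X X' X'' Y Y' Y'' : B} (K : hor X X') (K' : hor X' X'')
    (k : hor Y Y') (k' : hor Y' Y'') :
    cell HB (tr_h K k · tr_h K' k') (tr_h (K · K') (k · k')) :=
  as_ (fh (rt b Y) K) (fh (lt b X') k) (tr_h K' k') **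
  wl (fh (rt b Y) K)
    (asi (fh (lt b X') k) (fh (rt b Y') K') (fh (lt b X'') k') **
     wr (hd (lh L K') k) (fh (lt b X'') k') **
     as_ (fh (rt b Y) K') (fh (lt b X'') k) (fh (lt b X'') k')) **
  asi (fh (rt b Y) K) (fh (rt b Y) K') (fh (lt b X'') k · fh (lt b X'') k') **
  (dfc (rt b Y) K K' ∥ dfc (lt b X'') k k').

Definition tr_fci {X X' X'' Y Y' Y'' : B} (K : hor X X') (K' : hor X' X'')
    (k : hor Y Y') (k' : hor Y' Y'') :
    cell HB (tr_h (K · K') (k · k')) (tr_h K k · tr_h K' k') :=
  (dfci (rt b Y) K K' ∥ dfci (lt b X'') k k') **
  as_ (fh (rt b Y) K) (fh (rt b Y) K') (fh (lt b X'') k · fh (lt b X'') k') **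
  wl (fh (rt b Y) K)
    (asi (fh (rt b Y) K') (fh (lt b X'') k) (fh (lt b X'') k') **
     wr (hdi (lh L K') k) (fh (lt b X'') k') **
     as_ (fh (lt b X') k) (fh (rt b Y') K') (fh (lt b X'') k')) **
  asi (fh (rt b Y) K) (fh (lt b X') k) (tr_h K' k').

Definition Htens : pf (bprod HB HB) HB (fun X => pr X) :=
  Pf (bprod HB HB) HB (fun X => pr X)
    (fun X Y (f : hom (bprod HB HB) X Y) => tr_h (fst f) (snd f))
    (fun X Y (f g : hom (bprod HB HB) X Y) (a : cell _ f g) =>
       sq_cast eq_refl (tr_v_id _ _) (tr_v_id _ _) eq_refl (tr_s (fst a) (snd a)))
    (fun X Y Z (f : hom (bprod HB HB) X Y) (g : hom (bprod HB HB) Y Z) =>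
       tr_fc (fst f) (fst g) (snd f) (snd g))
    (fun X Y Z (f : hom (bprod HB HB) X Y) (g : hom (bprod HB HB) Y Z) =>
       tr_fci (fst f) (fst g) (snd f) (snd g))
    (fun X => @luni _ HB _ _ (hid (pr X)) **
       (dfu (rt b (snd X)) (fst X) ∥ dfu (lt b (fst X)) (snd X)))
    (fun X => (dfui (rt b (snd X)) (fst X) ∥ dfui (lt b (fst X)) (snd X)) **
       @lun _ HB _ _ (hid (pr X))).

Context (P : pmd b) (l : liftable P).

Lemma pad3 {A1 A2 : B} (u : ver A1 A2) : ((vid _ ⇣ u) ⇣ vid _) ⇣ vid _ = u.
Proof. now rewrite !(vidr (dbl_ax B)), (vidl (dbl_ax B)). Qed.

Section Assoc.
Context {X X' Y Y' Z Z' : B} (f : hor X X') (g : hor Y Y') (h : hor Z Z').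

(* [α_f], [α_g], [α_h] side by side, between [(f ⊗_r g) ⊗_r h] and
   [f ⊗_r (g ⊗_r h)] *)
Definition tr_asc : sq (tr_h (tr_h f g) h) (dasc P X Y Z) (dasc P X' Y' Z')
    (tr_h f (tr_h g h)) :=
  sq_cast eq_refl (pad3 _) (pad3 _) eq_refl
   ((((dfci (rt b Z) (fh (rt b Y) f) (fh (lt b X') g) ∥
       sqh (fh (lt b (tens b X' Y')) h))
     ⫽ ((vh (da1 P Y Z) f ∥ vh (da2 P X' Z) g) ∥ vh (da3 P X' Y') h))
     ⫽ as_ (fh (rt b (tens b Y Z)) f) (fh (lt b X') (fh (rt b Z) g))
           (fh (lt b X') (fh (lt b Y') h)))
     ⫽ (sqh (fh (rt b (tens b Y Z)) f) ∥
        dfc (lt b X') (fh (rt b Z) g) (fh (lt b Y') h))).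

Lemma pad3' {A1 A2 : B} (u : ver A1 A2) : vid _ ⇣ (vid _ ⇣ (u ⇣ vid _)) = u.
Proof. now rewrite (vidr (dbl_ax B)), !(vidl (dbl_ax B)). Qed.

Definition tr_asci : sq (tr_h f (tr_h g h)) (iv (dascC P X Y Z)) (iv (dascC P X' Y' Z'))
    (tr_h (tr_h f g) h) :=
  sq_cast eq_refl (pad3' _) (pad3' _) eq_refl
   ((sqh (fh (rt b (tens b Y Z)) f) ∥
      dfci (lt b X') (fh (rt b Z) g) (fh (lt b Y') h))
    ⫽ (asi (fh (rt b (tens b Y Z)) f) (fh (lt b X') (fh (rt b Z) g))
           (fh (lt b X') (fh (lt b Y') h))
    ⫽ (((da1i P Y Z _ _ f ∥ da2i P X' Z _ _ g) ∥ da3i P X' Y' _ _ h)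
    ⫽ (dfc (rt b Z) (fh (rt b Y) f) (fh (lt b X') g) ∥
       sqh (fh (lt b (tens b X' Y')) h))))).

End Assoc.

(* [λ_k] on [I ⊗_r k = (I ⋉ k)(1_I ⋊ Y)] and [ρ_k] on [k ⊗_r I = (Y' ⋉ 1_I)(k ⋊ I)] *)
Definition tr_lam {Y Y' : B} (k : hor Y Y') :
    sq (tr_h (hid (dI P)) k) (dlam P Y) (dlam P Y') k :=
  sq_cast eq_refl eq_refl eq_refl (hidl ax _)
    (sq_cast eq_refl (vidl ax _) (vidl ax _) eq_refl
       (dfui (rt b Y) (dI P) ⫽ sqv (dlam P Y)) ∥ vh (dlamT P) k).

Definition tr_lami {Y Y' : B} (k : hor Y Y') :
    sq k (iv (dlamC P Y)) (iv (dlamC P Y')) (tr_h (hid (dI P)) k) :=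
  sq_cast (hidl ax _) eq_refl eq_refl eq_refl
    (sq_cast eq_refl (vidr ax _) (vidr ax _) eq_refl
       (sqv (iv (dlamC P Y)) ⫽ dfu (rt b Y) (dI P)) ∥ dlamTi P _ _ k).

Definition tr_rho {Y Y' : B} (k : hor Y Y') :
    sq (tr_h k (hid (dI P))) (drho P Y) (drho P Y') k :=
  sq_cast eq_refl eq_refl eq_refl (hidr ax _)
    (vh (drhoT P) k ∥
     sq_cast eq_refl (vidl ax _) (vidl ax _) eq_refl
       (dfui (lt b Y') (dI P) ⫽ sqv (drho P Y'))).

Definition tr_rhoi {Y Y' : B} (k : hor Y Y') :
    sq k (iv (drhoC P Y)) (iv (drhoC P Y')) (tr_h k (hid (dI P))) :=
  sq_cast (hidr ax _) eq_refl eq_refl eq_refl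
    (drhoTi P _ _ k ∥
     sq_cast eq_refl (vidr ax _) (vidr ax _) eq_refl
       (sqv (iv (drhoC P Y')) ⫽ dfu (lt b Y') (dI P))).

Definition Hmon : mon HB (tens b) (dI P) :=
  @Mon _ HB (tens b) (dI P) Htens
    (fun X Y Z => comp_h (asc_c l X Y Z))
    (@Pn _ _ (bprod (bprod HB HB) HB) HB _ _
       (on1 (F_lassoc Htens)) (on1 (F_rassoc Htens)) _
       (fun X Y f => lift_sq (asc_c l (fst (fst X)) (snd (fst X)) (snd X))
          (asc_c l (fst (fst Y)) (snd (fst Y)) (snd Y))
          (tr_asc (fst (fst f)) (snd (fst f)) (snd f)))
       (fun X Y f => lift_sqi (asc_c l (fst (fst X)) (snd (fst X)) (snd X))
          (asc_c l (fst (fst Y)) (snd (fst Y)) (snd Y))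
          (iv_r (dascC P _ _ _)) (iv_l (dascC P _ _ _))
          (tr_asci (fst (fst f)) (snd (fst f)) (snd f))))
    (fun X => comp_h (lam_c l X))
    (@Pn _ _ HB HB _ _ (on1 (T_lt Htens (dI P))) (on1 (pf_id HB)) _
       (fun X Y f => lift_sq (lam_c l X) (lam_c l Y) (tr_lam f))
       (fun X Y f => lift_sqi (lam_c l X) (lam_c l Y) (iv_r (dlamC P X))
          (iv_l (dlamC P Y)) (tr_lami f)))
    (fun X => comp_h (rho_c l X))
    (@Pn _ _ HB HB _ _ (on1 (T_rt Htens (dI P))) (on1 (pf_id HB)) _
       (fun X Y f => lift_sq (rho_c l X) (rho_c l Y) (tr_rho f))
       (fun X Y f => lift_sqi (rho_c l X) (rho_c l Y) (iv_r (drhoC P X))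
          (iv_l (drhoC P Y)) (tr_rhoi f))).

End Tensor.

Section PureCenter.
Context {B : dbl} {b : bin B} (L : lcs b) (R : lcs (brev b)).

Definition Z_str X X' (k : hom (HB B) X X') : Type :=
  (left_hcen b k * right_hcen b k)%type.

Definition Z_sel X X' (k : hom (HB B) X X') : Z_str k := (lh L k, lh R k).

(* The 2-cells: horizontally globular squares [a] for which [a ⋉ -] and [- ⋊ a]
   are horizontal modifications. *)
Definition Z_cell X X' (f g : chosen Z_sel X X') (a : cell (HB B) (ch f) (ch g)) : Prop :=
  is_hmodif (lt b X) (lt b X') (fst (ch_str f)) (fst (ch_str g))
    (fun Y => fsg (rt b Y) a) /\
  is_hmodif (rt b X) (rt b X') (snd (ch_str f)) (snd (ch_str g))
    (fun Y => fsg (lt b Y) a).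

Definition HZ (q : closed2 Z_cell) : bicat B := chosen_bicat Z_cell q.

Definition HCp_cell := @Cp_cell _ (HB B) (Hbin b) (Hlcs L) (Hlcs R).

Definition HCp (q : closed2 HCp_cell) : bicat B := Cp q.

Definition hor_p1 {X X' : B} (f : chosen Z_sel X X') :
    chosen (@Cp_sel _ (HB B) (Hbin b) (Hlcs L) (Hlcs R)) X X' :=
  Chosen (ch f) (Hpn (fst (ch_str f)), Hpn (snd (ch_str f)))
    (f_equal (fun x : Z_str (ch f) => (Hpn (fst x), Hpn (snd x))) (ch_eq f)).

Definition hor_p_cells : Prop :=
  forall X X' (f g : chosen Z_sel X X') (a : cell (HB B) (ch f) (ch g)),
  @Z_cell X X' f g a -> @HCp_cell X X' (hor_p1 f) (hor_p1 g) a.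

Definition hor_p (qZ : closed2 Z_cell) (qC : closed2 HCp_cell) (w : hor_p_cells) :
    pf (HZ qZ) (HCp qC) (fun X => X) :=
  Pf (HZ qZ) (HCp qC) (fun X => X)
    (fun X X' f => hor_p1 f)
    (fun X X' f g a => exist _ (proj1_sig a) (w _ _ _ _ _ (proj2_sig a)))
    (fun X X' X'' f g => id2 _)
    (fun X X' X'' f g => id2 _)
    (fun X => id2 _)
    (fun X => id2 _).

End PureCenter.

(* Main.v *)
(* In the horizontal bicategory all structure cells are determined by companions: two companions
   of one vertical cell are connected by a unique cell compatible with their counits, and a
   companion-lift is the unique cell compatible with the square it lifts.  The pentagon and triangle
   equations of vertical transformations thus yield invertible modifications p, m, l, r, and the
   equations between these hold since both sides are comparisons of the same two companions; as the
   2-cells -⋊u|_U are trivial, the exchange cells of companions are comparisons, too.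

   The structure of ⊗_r is an instance of a construction for bicategories: the exchange cells make
   K⊗k = (K⋊Y)·(X'⋉k) a pseudofunctor, associativity of the tensor product is the paste of the three
   one-variable constraints, and its modifications are those of the premonoidal bicategory.  All
   horizontally globular 2-cells are pure, so that both bicategories of pure maps only add chosen,
   hence unique, structure to the 1-cells, and inherit the monoidal structure. *)

(* Two formal obstacles shape the proof. In a weak bicategory, every equation of pastings is buried
   under associators. Here a 2-cell between composites of 1-cells is whiskered with an arbitrary
   1-cell, the tail, and conjugated to a cell between right-bracketed composites; coherence cells
   become identities, and equations turn into rewriting in lists of whiskered atoms. In a strict
   double category, composites that ought to be equal have boundaries that agree only
   propositionally. All squares are therefore placed in one type with an error value, where both
   compositions are associative without side conditions and boundaries are checked only for
   interchange and unit laws.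

   Uniqueness of comparisons decides equations all of whose 1-cells are companions, such as the
   cocycle equation. Naturality and the modification axioms involve arbitrary 1h-cells; there
   uniqueness of companion-lifts takes its place, both sides being lifts of the same square. The
   modification axioms of the tensor product, joint in all variables, are assembled from those in
   each variable separately. *)
From Stdlib Require Import ClassicalEpsilon Classical_Prop Eqdep FunctionalExtensionality.
Require Import Defs.
Set Implicit Arguments.
Unset Strict Implicit.

Local Open Scope bicat_scope.

(** * Chains of whiskered 2-cells *)

Section Tails.
Context {O : Type} (C : bicat O) (H : is_bicat C).

Lemma comp2_assoc A B (f g h k : hom C A B) (a : cell C f g) (b : cell C g h) (c : cell C h k) :
  (a • b) • c = a • (b • c).
Proof. symmetry; apply (bc_assoc H). Qed.

Lemma cancel_l A B (f g h : hom C A B) (a : cell C f g) (b : cell C g f) (x y : cell C g h) :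
  b • a = id2 _ -> a • x = a • y -> x = y.
Proof.
  intros E F. rewrite <- (bc_idl H x), <- (bc_idl H y), <- E, !comp2_assoc.
  now rewrite F.
Qed.

Lemma cancel_r A B (f g h : hom C A B) (a : cell C g h) (b : cell C h g) (x y : cell C f g) :
  a • b = id2 _ -> x • a = y • a -> x = y.
Proof.
  intros E F. rewrite <- (bc_idr H x), <- (bc_idr H y), <- E, <- !comp2_assoc.
  now rewrite F.
Qed.

Lemma whiskr_id_inj A B (f g : hom C A B) (a b : cell C f g) :
  a ▷ id1 C B = b ▷ id1 C B -> a = b.
Proof.
  intro E. apply (cancel_l (bc_runi_run H f)).
  rewrite <- !(bc_run H). now rewrite E.
Qed.

Lemma whiskl_id_inj A B (f g : hom C A B) (a b : cell C f g) :
  id1 C A ◁ a = id1 C A ◁ b -> a = b.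
Proof.
  intro E. apply (cancel_l (bc_luni_lun H f)).
  rewrite <- !(bc_lun H). now rewrite E.
Qed.

(* Kelly's consequence of the triangle and pentagon axioms. *)
Lemma assoc_lun A B D (f : hom C A B) (g : hom C B D) :
  assoc (id1 C A) f g • lun (f · g) = lun f ▷ g.
Proof.
  apply whiskl_id_inj.
  apply (cancel_l (a := assoc (id1 C A) (id1 C A · f) g) (bc_associ_assoc H _ _ _)).
  apply (cancel_l (a := assoc (id1 C A) (id1 C A) f ▷ g)
           (b := associ (id1 C A) (id1 C A) f ▷ g)).
  { now rewrite <- (bc_wr_comp H), (bc_associ_assoc H), (bc_wr_id H). }
  rewrite (bc_wl_comp H), (bc_wl_wr H), (bc_assoc H).
  rewrite (bc_assoc H (assoc (id1 C A) (id1 C A) f ▷ g)), <- (bc_wr_comp H).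
  rewrite (bc_triangle H), <- (bc_wr_wr H), <- (bc_triangle H (id1 C A) (f · g)).
  rewrite !(bc_assoc H).  f_equal.
  rewrite (bc_pentagon H). now rewrite !(bc_assoc H).
Qed.

Lemma assoc_run A B D (f : hom C A B) (g : hom C B D) :
  assoc f g (id1 C D) • (f ◁ run g) = run (f · g).
Proof.
  apply whiskr_id_inj.
  apply (cancel_r (a := assoc f g (id1 C D)) (b := associ _ _ _) (bc_assoc_associ H _ _ _)).
  rewrite (bc_wr_comp H), comp2_assoc, <- (bc_wl_wr H), <- (bc_triangle H g).
  rewrite (bc_wl_comp H).
  rewrite (bc_assoc H (assoc f (g · id1 C D) _)), (bc_assoc H (assoc f g _ ▷ _)).
  rewrite <- (bc_pentagon H), comp2_assoc.
  rewrite (bc_wl_wl H), <- (bc_triangle H (f · g)). apply (bc_assoc H).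
Qed.

(** The triangle axiom and [assoc_run] reduce the claim to the naturality of the right unitor along
    itself. The left unit constraint of the tensor product relies on it: [T_lt] contracts two
    identities with [lun], whereas exchange with an identity produces [run]. *)
Lemma lun_run_id A : lun (id1 C A) = run (id1 C A).
Proof.
  apply whiskl_id_inj.
  apply (cancel_l (a := assoc (id1 C A) (id1 C A) (id1 C A)) (bc_associ_assoc H _ _ _)).
  rewrite (bc_triangle H), (assoc_run (id1 C A) (id1 C A)).
  apply (cancel_r (a := run (id1 C A)) (bc_run_runi H _)).
  apply (bc_run H).
Qed.

End Tails.

(* Formal composites of 1-cells.  [flat p t] is the composite [p] followed by [t],
   bracketed to the right and without identities. *)
Inductive pth {O} (C : bicat O) : O -> O -> Type :=
| pid A : pth C A A
| pat A B (f : hom C A B) : pth C A B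
| pcomp A B D (p : pth C A B) (q : pth C B D) : pth C A D.
Arguments pid {O C} A.
Arguments pat {O C A B} f.
Arguments pcomp {O C A B D} p q.

Section Flat.
Context {O : Type} {C : bicat O} (H : is_bicat C).

Fixpoint ev {A B} (p : pth C A B) : hom C A B :=
  match p with
  | pid A => id1 C A
  | pat f => f
  | pcomp p q => ev p · ev q
  end.

Fixpoint flat {A B} (p : pth C A B) : forall {X}, hom C B X -> hom C A X :=
  match p with
  | pid A => fun X t => t
  | pat f => fun X t => f · t
  | pcomp p q => fun X t => flat p (flat q t)
  end.

Fixpoint flatw {A B} (p : pth C A B) :
    forall {X} {t t' : hom C B X}, cell C t t' -> cell C (flat p t) (flat p t') :=
  match p with
  | pid A => fun X t t' s => s
  | pat f => fun X t t' s => f ◁ s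
  | pcomp p q => fun X t t' s => flatw p (flatw q s)
  end.

Fixpoint can {A B} (p : pth C A B) : forall {X} (t : hom C B X), cell C (ev p · t) (flat p t) :=
  match p with
  | pid A => fun X t => lun t
  | pat f => fun X t => id2 (f · t)
  | pcomp p q => fun X t => assoc (ev p) (ev q) t • ((ev p ◁ can q t) • can p (flat q t))
  end.

Fixpoint cani {A B} (p : pth C A B) : forall {X} (t : hom C B X), cell C (flat p t) (ev p · t) :=
  match p with
  | pid A => fun X t => luni t
  | pat f => fun X t => id2 (f · t)
  | pcomp p q => fun X t => cani p (flat q t) • ((ev p ◁ cani q t) • associ (ev p) (ev q) t)
  end.

(* [AT] is sealed, lest unification unfold it. *)
Definition AT_sig : { F : forall A B (p q : pth C A B) (a : cell C (ev p) (ev q)) X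
    (t : hom C B X), cell C (flat p t) (flat q t) |
    forall A B p q a X t, F A B p q a X t = cani p t • ((a ▷ t) • can q t) }.
Proof. now exists (fun A B p q a X t => cani p t • ((a ▷ t) • can q t)). Qed.

Definition AT {A B} (p q : pth C A B) (a : cell C (ev p) (ev q)) {X} (t : hom C B X) :
    cell C (flat p t) (flat q t) := proj1_sig AT_sig A B p q a X t.

Arguments AT {A B} p q a {X} t.
Lemma AT_eq A B (p q : pth C A B) a X (t : hom C B X) :
  AT p q a t = cani p t • ((a ▷ t) • can q t).
Proof. exact (proj2_sig AT_sig A B p q a X t). Qed.

Local Notation ca := (comp2_assoc H).

Lemma cani_can A B (p : pth C A B) X (t : hom C B X) : cani p t • can p t = id2 _.
Proof.
  revert X t; induction p as [A|A B f|A B D p IHp q IHq]; intros X t; simpl.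
  - apply (bc_luni_lun H).
  - apply (bc_idl H).
  - rewrite !ca, (bc_assoc H (associ _ _ _)), (bc_associ_assoc H), (bc_idl H).
    rewrite (bc_assoc H (_ ◁ _)), <- (bc_wl_comp H), IHq, (bc_wl_id H), (bc_idl H).
    apply IHp.
Qed.

Lemma can_cani A B (p : pth C A B) X (t : hom C B X) : can p t • cani p t = id2 _.
Proof.
  revert X t; induction p as [A|A B f|A B D p IHp q IHq]; intros X t; simpl.
  - apply (bc_lun_luni H).
  - apply (bc_idl H).
  - rewrite !ca, (bc_assoc H (can p _)), IHp, (bc_idl H).
    rewrite (bc_assoc H (_ ◁ _)), <- (bc_wl_comp H), IHq, (bc_wl_id H), (bc_idl H).
    apply (bc_assoc_associ H).
Qed.

Lemma flatw_id A B (p : pth C A B) X (t : hom C B X) : flatw p (id2 t) = id2 _.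
Proof.
  revert X t; induction p; intros X t; simpl; auto.
  - apply (bc_wl_id H).
  - now rewrite IHp2, IHp1.
Qed.

Lemma flatw_comp A B (p : pth C A B) X (t t' t'' : hom C B X) (a : cell C t t') (b : cell C t' t'') :
  flatw p (a • b) = flatw p a • flatw p b.
Proof.
  revert X t t' t'' a b; induction p; intros; simpl; auto.
  - apply (bc_wl_comp H).
  - now rewrite IHp2, IHp1.
Qed.

Lemma can_nat A B (p : pth C A B) X (t t' : hom C B X) (s : cell C t t') :
  (ev p ◁ s) • can p t' = can p t • flatw p s.
Proof.
  revert X t t' s; induction p; intros; simpl.
  - apply (bc_lun H).
  - now rewrite (bc_idl H), (bc_idr H).
  - rewrite (bc_assoc H), <- (bc_wl_wl H), !ca. f_equal.
    rewrite (bc_assoc H), <- (bc_wl_comp H), IHp2, (bc_wl_comp H), ca. f_equal.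
    apply IHp1.
Qed.

Lemma AT_id A B (p : pth C A B) X (t : hom C B X) : AT p p (id2 _) t = id2 _.
Proof. rewrite !AT_eq. now rewrite (bc_wr_id H), (bc_idl H), cani_can. Qed.

Lemma AT_comp A B (p r q : pth C A B) (a : cell C (ev p) (ev r)) (b : cell C (ev r) (ev q))
    X (t : hom C B X) : AT p q (a • b) t = AT p r a t • AT r q b t.
Proof.
  rewrite !AT_eq. rewrite (bc_wr_comp H), !ca, (bc_assoc H (can r t)), can_cani, (bc_idl H).
  reflexivity.
Qed.

Lemma AT_nat A B (p q : pth C A B) (a : cell C (ev p) (ev q)) X (t t' : hom C B X)
    (s : cell C t t') : AT p q a t • flatw q s = flatw p s • AT p q a t'.
Proof.
  apply (cancel_l (a := can p t) (b := cani p t) H (cani_can _ _)).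
  rewrite !AT_eq. rewrite !ca, <- (can_nat q), !(bc_assoc H), can_cani, (bc_idl H).
  rewrite <- (can_nat p), !ca, (bc_assoc H (can p t')), can_cani, (bc_idl H).
  rewrite !(bc_assoc H). f_equal. apply (bc_exchange H).
Qed.

(** The case of an empty domain path, stated without the [flatw (pid A)] that matching against a
    chain could not supply. *)
Lemma AT_nat0 A B (q : pth C A A) (a : cell C (id1 C A) (ev q)) (t t' : hom C A B)
    (s : cell C t t') : s • AT (pid A) q a t' = AT (pid A) q a t • flatw q s.
Proof. symmetry. exact (AT_nat (p:=pid A) (q:=q) a s). Qed.

(** The tail absorbs the right factor: [flat (pcomp p r) t] is [flat p (flat r t)] by conversion, so
    whiskering on the right merely lengthens the tail. *)
Lemma AT_whiskr A B D (p q : pth C A B) (r : pth C B D) (a : cell C (ev p) (ev q))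
    X (t : hom C D X) : AT (pcomp p r) (pcomp q r) (a ▷ ev r) t = AT p q a (flat r t).
Proof.
  rewrite !AT_eq; simpl. rewrite !ca. f_equal.
  rewrite (bc_assoc H (_ ▷ _) (assoc _ _ _)), <- (bc_wr_wr H).
  rewrite !(bc_assoc H). rewrite (ca (_ ◁ _)), (bc_associ_assoc H), (bc_idr H).
  f_equal. rewrite ca, (bc_exchange H), (bc_assoc H), <- (bc_wl_comp H), cani_can.
  now rewrite (bc_wl_id H), (bc_idl H).
Qed.

Lemma AT_whiskl A B D (r : pth C A B) (p q : pth C B D) (a : cell C (ev p) (ev q))
    X (t : hom C D X) : AT (pcomp r p) (pcomp r q) (ev r ◁ a) t = flatw r (AT p q a t).
Proof.
  apply (cancel_l (a := can r (flat p t)) (b := cani r _) H (cani_can _ _)).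
  transitivity ((ev r ◁ AT p q a t) • can r (flat q t)); [|exact (can_nat r (AT p q a t))].
  rewrite !AT_eq; simpl.
  rewrite !(bc_assoc H), can_cani, (bc_idl H). f_equal.
  rewrite !(bc_wl_comp H), !ca. f_equal.
  rewrite (bc_assoc H _ (assoc _ _ _)), <- (bc_wl_wr H), !(bc_assoc H).
  now rewrite (bc_associ_assoc H), (bc_idl H).
Qed.

(** The pentagon enters here, together with naturality of the associator in its last argument. *)
Lemma can_assoc A B D E (p : pth C A B) (q : pth C B D) (r : pth C D E) X (t : hom C E X) :
  can (pcomp (pcomp p q) r) t = (assoc (ev p) (ev q) (ev r) ▷ t) • can (pcomp p (pcomp q r)) t.
Proof.
  simpl. rewrite !(bc_wl_comp H), !ca.
  rewrite (bc_assoc H (assoc _ (_ · _) _)), (bc_assoc H (assoc _ _ _ ▷ t)).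
  rewrite <- (bc_pentagon H), !ca. f_equal.
  rewrite (bc_assoc H (_ ◁ _) (assoc _ _ _)), <- (bc_wl_wl H), !ca. reflexivity.
Qed.

(** Both bracketings flatten to the same 1-cell by conversion, so the associator can become an
    identity. With the analogous facts for the unitors, this takes the place of a coherence
    theorem. *)
Lemma AT_assoc A B D E (p : pth C A B) (q : pth C B D) (r : pth C D E) X (t : hom C E X) :
  AT (pcomp (pcomp p q) r) (pcomp p (pcomp q r)) (assoc (ev p) (ev q) (ev r)) t = id2 _.
Proof.
  transitivity (cani (pcomp (pcomp p q) r) t • can (pcomp (pcomp p q) r) t); [|exact (cani_can (pcomp (pcomp p q) r) t)].
  rewrite !AT_eq. exact (f_equal (fun z => _ • z) (eq_sym (can_assoc p q r t))).
Qed.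

Lemma AT_associ A B D E (p : pth C A B) (q : pth C B D) (r : pth C D E) X (t : hom C E X) :
  AT (pcomp p (pcomp q r)) (pcomp (pcomp p q) r) (associ (ev p) (ev q) (ev r)) t = id2 _.
Proof.
  rewrite !AT_eq. rewrite can_assoc, (bc_assoc H (_ ▷ _)), <- (bc_wr_comp H). cbn [ev].
  rewrite (bc_associ_assoc H).
  rewrite (bc_wr_id H), (bc_idl H). exact (cani_can (pcomp p (pcomp q r)) t).
Qed.

(** A unit on the left requires Kelly's [assoc_lun]; for a unit on the right the triangle axiom
    suffices. *)
Lemma can_lun A B (p : pth C A B) X (t : hom C B X) :
  can (pcomp (pid A) p) t = (lun (ev p) ▷ t) • can p t.
Proof.
  simpl. rewrite (bc_lun H), (bc_assoc H). now rewrite (assoc_lun H).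
Qed.

Lemma can_run A B (p : pth C A B) X (t : hom C B X) :
  can (pcomp p (pid B)) t = (run (ev p) ▷ t) • can p t.
Proof. simpl. now rewrite (bc_assoc H), (bc_triangle H). Qed.

Lemma AT_lun A B (p : pth C A B) X (t : hom C B X) :
  AT (pcomp (pid A) p) p (lun (ev p)) t = id2 _.
Proof.
  transitivity (cani (pcomp (pid A) p) t • can (pcomp (pid A) p) t); [|exact (cani_can (pcomp (pid A) p) t)].
  rewrite !AT_eq. exact (f_equal (fun z => _ • z) (eq_sym (can_lun p t))).
Qed.

Lemma AT_run A B (p : pth C A B) X (t : hom C B X) :
  AT (pcomp p (pid B)) p (run (ev p)) t = id2 _.
Proof.
  transitivity (cani (pcomp p (pid B)) t • can (pcomp p (pid B)) t); [|exact (cani_can (pcomp p (pid B)) t)].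
  rewrite !AT_eq. exact (f_equal (fun z => _ • z) (eq_sym (can_run p t))).
Qed.

Lemma AT_luni A B (p : pth C A B) X (t : hom C B X) :
  AT p (pcomp (pid A) p) (luni (ev p)) t = id2 _.
Proof.
  rewrite !AT_eq. rewrite can_lun, (bc_assoc H (_ ▷ _)), <- (bc_wr_comp H). cbn [ev].
  rewrite (bc_luni_lun H).
  rewrite (bc_wr_id H), (bc_idl H). exact (cani_can p t).
Qed.

Lemma AT_runi A B (p : pth C A B) X (t : hom C B X) :
  AT p (pcomp p (pid B)) (runi (ev p)) t = id2 _.
Proof.
  rewrite !AT_eq. rewrite can_run, (bc_assoc H (_ ▷ _)), <- (bc_wr_comp H). cbn [ev].
  rewrite (bc_runi_run H).
  rewrite (bc_wr_id H), (bc_idl H). exact (cani_can p t).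
Qed.

(** The identity as tail is enough, because whiskering with an identity is faithful. *)
Lemma AT_inj A B (p q : pth C A B) (a b : cell C (ev p) (ev q)) :
  (forall X (t : hom C B X), AT p q a t = AT p q b t) -> a = b.
Proof.
  intro E. apply (whiskr_id_inj H).
  specialize (E _ (id1 C B)). rewrite !AT_eq in E.
  apply (cancel_l H (can_cani _ _)) in E. now apply (cancel_r H (can_cani _ _)) in E.
Qed.

End Flat.
Arguments AT {O C A B} p q a {X} t.

(** * Rewriting within chains of whiskered cells *)

Section Chains.
Context {O : Type} {C : bicat O} (H : is_bicat C).

(** Each rule of this family, for a fixed number of slices followed by a rest or under a common
    whisker, is a first-order pattern, so the search tactics below need only unification. *)
Lemma chain_skip A B (f g h : hom C A B) (c : cell C f g) (a b : cell C g h) :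
  a = b -> c • a = c • b.
Proof. now intros ->. Qed.
Lemma chain_head1 A B (f g h : hom C A B) (a b : cell C f g) (r : cell C g h) :
  a = b -> a • r = b • r.
Proof. now intros ->. Qed.
Lemma chain_head2 A B (f g1 g h : hom C A B) (a1 : cell C f g1) (a2 : cell C g1 g)
    (b : cell C f g) (r : cell C g h) :
  a1 • a2 = b -> a1 • (a2 • r) = b • r.
Proof. intros <-. apply (bc_assoc H). Qed.
Lemma chain_head3 A B (f g1 g2 g h : hom C A B) (a1 : cell C f g1) (a2 : cell C g1 g2)
    (a3 : cell C g2 g) (b : cell C f g) (r : cell C g h) :
  a1 • (a2 • a3) = b -> a1 • (a2 • (a3 • r)) = b • r.
Proof. intros <-. now rewrite !(comp2_assoc H). Qed.
Lemma chain_head4 A B (f g1 g2 g3 g h : hom C A B) (a1 : cell C f g1) (a2 : cell C g1 g2)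
    (a3 : cell C g2 g3) (a4 : cell C g3 g) (b : cell C f g) (r : cell C g h) :
  a1 • (a2 • (a3 • a4)) = b -> a1 • (a2 • (a3 • (a4 • r))) = b • r.
Proof. intros <-. now rewrite !(comp2_assoc H). Qed.
Lemma chain_pre1 A B D (x : hom C A B) (f g : hom C B D) (a b : cell C f g) :
  a = b -> x ◁ a = x ◁ b.
Proof. now intros ->. Qed.
Lemma chain_pre2 A B D (x : hom C A B) (f g h : hom C B D) (a1 : cell C f g) (a2 : cell C g h)
    (b : cell C f h) :
  a1 • a2 = b -> (x ◁ a1) • (x ◁ a2) = x ◁ b.
Proof. intros <-. now rewrite (bc_wl_comp H). Qed.
Lemma chain_pre3 A B D (x : hom C A B) (f g g2 h : hom C B D) (a1 : cell C f g)
    (a2 : cell C g g2) (a3 : cell C g2 h) (b : cell C f h) :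
  a1 • (a2 • a3) = b -> (x ◁ a1) • ((x ◁ a2) • (x ◁ a3)) = x ◁ b.
Proof. intros <-. now rewrite !(bc_wl_comp H). Qed.
Lemma chain_pre4 A B D (x : hom C A B) (f g g2 g3 h : hom C B D) (a1 : cell C f g)
    (a2 : cell C g g2) (a3 : cell C g2 g3) (a4 : cell C g3 h) (b : cell C f h) :
  a1 • (a2 • (a3 • a4)) = b ->
  (x ◁ a1) • ((x ◁ a2) • ((x ◁ a3) • (x ◁ a4))) = x ◁ b.
Proof. intros <-. now rewrite !(bc_wl_comp H). Qed.

(** Evaluation in continuation-passing style: [r0] is the chain that follows, already evaluated, so
    the result comes out bracketed to the right; [P] collects the 1-cells that whisker the current
    cell on the left. *)
Lemma cps_comp A' A B (P : pth C A' A) (p r q : pth C A B) (a : cell C (ev p) (ev r))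
    (b : cell C (ev r) (ev q)) X (t : hom C B X) (z : hom C A' X) (r0 : cell C (flat P (flat q t)) z)
    e2 e :
  flatw P (AT r q b t) • r0 = e2 -> flatw P (AT p r a t) • e2 = e ->
  flatw P (AT p q (a • b) t) • r0 = e.
Proof.
  intros <- <-. rewrite (AT_comp H (r:=r)), (flatw_comp H). apply (comp2_assoc H).
Qed.

Lemma cps_whiskr A' A B D (P : pth C A' A) (p q : pth C A B) (r : pth C B D)
    (a : cell C (ev p) (ev q)) X (t : hom C D X) (z : hom C A' X)
    (r0 : cell C (flat P (flat (pcomp q r) t)) z) e :
  flatw P (AT p q a (flat r t)) • r0 = e ->
  flatw P (AT (pcomp p r) (pcomp q r) (a ▷ ev r) t) • r0 = e.
Proof. intros <-. now rewrite (AT_whiskr H). Qed.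

Lemma cps_whiskl A' A B D (P : pth C A' A) (r : pth C A B) (p q : pth C B D)
    (a : cell C (ev p) (ev q)) X (t : hom C D X) (z : hom C A' X)
    (r0 : cell C (flat P (flat (pcomp r q) t)) z) e :
  flatw (pcomp P r) (AT p q a t) • r0 = e ->
  flatw P (AT (pcomp r p) (pcomp r q) (ev r ◁ a) t) • r0 = e.
Proof. intros <-. now rewrite (AT_whiskl H). Qed.

Lemma cps_id A' A X (P : pth C A' A) (f : hom C A X) (a : cell C f f) (e : a = id2 f)
    (z : hom C A' X) (r0 : cell C (flat P f) z) : flatw P a • r0 = r0.
Proof. rewrite e, (flatw_id H). apply (bc_idl H). Qed.

Lemma cps_top A B (p q : pth C A B) (a b : cell C (ev p) (ev q)) X (t : hom C B X) a' b' :
  flatw (pid A) (AT p q a t) • id2 _ = a' -> flatw (pid A) (AT p q b t) • id2 _ = b' ->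
  a' = b' -> AT p q a t = AT p q b t.
Proof. simpl. rewrite !(bc_idr H). now intros <- <-. Qed.

Lemma cps_topi A B (p q : pth C A B) (a b : cell C (ev p) (ev q)) X (t : hom C B X) a' b' :
  flatw (pid A) (AT p q a t) • id2 _ = a' -> flatw (pid A) (AT p q b t) • id2 _ = b' ->
  AT p q a t = AT p q b t -> a' = b'.
Proof. simpl. rewrite !(bc_idr H). now intros <- <-. Qed.

Lemma chain_head5 A B (f g1 g2 g3 g4 g h : hom C A B) (a1 : cell C f g1) (a2 : cell C g1 g2)
    (a3 : cell C g2 g3) (a4 : cell C g3 g4) (a5 : cell C g4 g) (b : cell C f g) (r : cell C g h) :
  a1 • (a2 • (a3 • (a4 • a5))) = b -> a1 • (a2 • (a3 • (a4 • (a5 • r)))) = b • r.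
Proof. intros <-. now rewrite !(comp2_assoc H). Qed.
Lemma chain_pre5 A B D (x : hom C A B) (f g g2 g3 g4 h : hom C B D) (a1 : cell C f g)
    (a2 : cell C g g2) (a3 : cell C g2 g3) (a4 : cell C g3 g4) (a5 : cell C g4 h)
    (b : cell C f h) :
  a1 • (a2 • (a3 • (a4 • a5))) = b ->
  (x ◁ a1) • ((x ◁ a2) • ((x ◁ a3) • ((x ◁ a4) • (x ◁ a5)))) = x ◁ b.
Proof. intros <-. now rewrite !(bc_wl_comp H). Qed.

Lemma norm_comp A B (f g h k : hom C A B) (a : cell C f g) (b : cell C g h) (r r' : cell C _ k) e :
  b • r = r' -> a • r' = e -> (a • b) • r = e.
Proof. intros <- <-. apply (comp2_assoc H). Qed.
Lemma norm_push A B (f g k : hom C A B) (a a' : cell C f g) (r : cell C g k) e :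
  a = a' -> a' • r = e -> a • r = e.
Proof. now intros <- <-. Qed.
Lemma slide_head A B (f g1 g2 g k : hom C A B) (a1 : cell C f g1) (a2 : cell C g1 g)
    (b1 : cell C f g2) (b2 : cell C g2 g) (r : cell C g k) :
  a1 • a2 = b1 • b2 -> a1 • (a2 • r) = b1 • (b2 • r).
Proof. intro E. now rewrite !(bc_assoc H), E. Qed.
Lemma slide_pre A B D (x : hom C A B) (f g1 g2 g : hom C B D) (a1 : cell C f g1)
    (a2 : cell C g1 g) (b1 : cell C f g2) (b2 : cell C g2 g) :
  a1 • a2 = b1 • b2 -> (x ◁ a1) • (x ◁ a2) = (x ◁ b1) • (x ◁ b2).
Proof. intro E. now rewrite <- !(bc_wl_comp H), E. Qed.

Lemma nf_eq A B (p q : pth C A B) (a b : cell C (ev p) (ev q)) :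
  a = b -> forall X (t : hom C B X), AT p q a t = AT p q b t.
Proof. now intros ->. Qed.
End Chains.

Notation "⟦ a | t ⟧" := (AT _ _ a t) (only printing).

Ltac reif f :=
  lazymatch f with
  | comp1 ?C ?g ?h => let p := reif g in let q := reif h in constr:(pcomp p q)
  | @id1 _ ?C ?A => constr:(@pid _ C A)
  | _ => lazymatch type of f with hom ?C ?A ?B => constr:(@pat _ C A B f) end
  end.

Ltac core a := lazymatch a with whiskl _ ?s => core s | _ => a end.

Ltac push H :=
  lazymatch goal with
  | |- whiskl _ (comp2 _ _ _) = _ => refine (bc_wl_comp H _ _ _)
  | |- whiskl _ (id2 _) = _ => refine (bc_wl_id H _ _)
  | |- whiskl _ _ = _ => eapply eq_trans; [ eapply chain_pre1; push H | push H ]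
  end.

(* Evaluates a composite of whiskered chains to a chain. *)
Ltac norm H :=
  lazymatch goal with
  | |- comp2 _ ?a ?b = _ =>
    lazymatch core a with
    | comp2 _ _ _ =>
        eapply eq_trans;
        [ lazymatch a with
          | comp2 _ _ _ => refine (comp2_assoc H _ _ _)
          | _ => eapply chain_head1; push H end
        | norm H ]
    | id2 _ =>
        eapply eq_trans;
        [ lazymatch a with
          | id2 _ => refine (bc_idl H _)
          | _ => eapply eq_trans; [ eapply chain_head1; push H | refine (bc_idl H _) ] end
        | norm H ]
    | _ => lazymatch b with
           | id2 _ => refine (bc_idr H _)
           | _ => eapply chain_skip; norm H
           end
    end
  | |- ?a = _ =>
    lazymatch core a with
    | comp2 _ _ _ => eapply eq_trans; [ push H | norm H ]
    | id2 _ => lazymatch a with id2 _ => reflexivity | _ => push H end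
    | _ => reflexivity
    end
  end.

(* Evaluates [flatw P (AT p q c t) • r] to a chain. *)
Ltac cps H :=
  lazymatch goal with
  | |- flatw ?P (AT ?p ?q ?c ?t) • ?r0 = _ =>
    lazymatch c with
    | @comp2 _ _ _ _ ?f ?g ?h ?a ?b =>
        let g := eval cbn [ev] in g in let r := reif g in
        refine (cps_comp H (P:=P) (p:=p) (r:=r) (q:=q) (a:=a) (b:=b) (t:=t) (r0:=r0) _ _);
        [ cps H | cps H ]
    | @whiskr _ _ _ _ _ _ _ _ ?a =>
        lazymatch p with pcomp ?p1 ?r =>
        lazymatch q with pcomp ?q1 _ =>
          refine (cps_whiskr H (P:=P) (p:=p1) (q:=q1) (r:=r) (a:=a) (t:=t) (r0:=r0) _); cps H
        end end
    | @whiskl _ _ _ _ _ _ _ _ ?a =>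
        lazymatch p with pcomp ?r ?p1 =>
        lazymatch q with pcomp _ ?q1 =>
          refine (cps_whiskl H (P:=P) (p:=p1) (q:=q1) (r:=r) (a:=a) (t:=t) (r0:=r0) _); cps H
        end end
    | @assoc _ _ _ _ _ _ _ _ _ =>
        lazymatch q with pcomp ?p1 (pcomp ?p2 ?p3) => refine (@cps_id _ _ H _ _ _ P _ _ (AT_assoc H p1 p2 p3 t) _ r0) end
    | @associ _ _ _ _ _ _ _ _ _ =>
        lazymatch p with pcomp ?p1 (pcomp ?p2 ?p3) => refine (@cps_id _ _ H _ _ _ P _ _ (AT_associ H p1 p2 p3 t) _ r0) end
    | @lun _ _ _ _ _ => refine (@cps_id _ _ H _ _ _ P _ _ (AT_lun H q t) _ r0)
    | @luni _ _ _ _ _ => refine (@cps_id _ _ H _ _ _ P _ _ (AT_luni H p t) _ r0)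
    | @run _ _ _ _ _ => refine (@cps_id _ _ H _ _ _ P _ _ (AT_run H q t) _ r0)
    | @runi _ _ _ _ _ => refine (@cps_id _ _ H _ _ _ P _ _ (AT_runi H p t) _ r0)
    | @id2 _ _ _ _ _ => refine (@cps_id _ _ H _ _ _ P _ _ (AT_id H p t) _ r0)
    | _ => cbn [flat flatw ev]; reflexivity
    end
  end.

(* Evaluates the two sides of an equation of terms [AT p q c t]. *)
Ltac nf H :=
  refine (cps_top H _ _ _);
  [ cps H | cps H | cbn [flat flatw ev]; rewrite ?(comp2_assoc H), ?(bc_idr H), ?(bc_idl H) ].

Ltac pf_cbn := cbn [on1 on2 fc fci fu fui pf_comp pf_id nat1 nat1i pn_comp pn_post pn_pre pn_id].

(* Turns an equation of 2-cells into an equation between chains of whiskered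
   atomic cells on paths bracketed to the right, ending in an arbitrary 1-cell. *)
Ltac to_chains H :=
  pf_cbn;
  lazymatch goal with
  | |- @eq (cell ?C ?f ?g) ?a ?b =>
    let p := reif f in let q := reif g in
    refine (@AT_inj _ C H _ _ p q a b _);
    let X := fresh "X" in let t := fresh "t" in intros X t; nf H
  end.

Ltac chain_of H E :=
  lazymatch type of E with
  | @eq (@cell ?O ?C ?A ?B ?f ?g) ?a ?b =>
    let p := reif f in let q := reif g in
    let X := fresh "X" in let t := fresh "t" in
    constr:(fun (X : O) (t : hom C B X) => ltac:(
      refine (eq_trans (eq_sym _) (eq_trans (@cps_topi O C H A B p q a b X t _ _ _ _
                (@nf_eq O C A B p q a b E X t)) _));
        [ | cps H | cps H | ];
        [ cbn [flat flatw ev]; rewrite ?(comp2_assoc H), ?(bc_idr H), ?(bc_idl H); reflexivity .. ]))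
  end.

(* [F] becomes the equation of chains expressed by the equation [E] of 2-cells. *)
Ltac chain H E F :=
  let E' := fresh in pose proof E as E';
  cbn [on1 on2 fc fci fu fui pf_comp pf_id nat1 nat1i pn_comp pn_post pn_pre pn_id] in E';
  let F' := chain_of H E' in pose proof F' as F; clear E'.

(* Evaluates [a • r], for a whiskered chain [a], to a chain. *)
Ltac norm_head H :=
  lazymatch goal with
  | |- comp2 _ ?a _ = _ =>
    lazymatch core a with
    | comp2 _ _ _ =>
        lazymatch a with
        | comp2 _ _ _ => eapply (norm_comp H); [ norm_head H | norm_head H ]
        | _ => eapply norm_push; [ push H | norm_head H ] end
    | id2 _ =>
        lazymatch a with
        | id2 _ => refine (bc_idl H _)
        | _ => eapply norm_push; [ push H | refine (bc_idl H _) ] end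
    | _ => reflexivity
    end
  end.

Ltac at1 H E := first [ eapply E | eapply (chain_pre1 (C:=_)); at1 H E ].
Ltac at2 H E := first [ eapply E | eapply (chain_pre2 H); at2 H E ].
Ltac at3 H E := first [ eapply E | eapply (chain_pre3 H); at3 H E ].
Ltac at4 H E := first [ eapply E | eapply (chain_pre4 H); at4 H E ].
Ltac at5 H E := first [ eapply E | eapply (chain_pre5 H); at5 H E ].
Ltac eval_all H := cbn [flat flatw ev]; norm H.
Ltac eval_head H := cbn [flat flatw ev]; norm_head H.
Ltac find1 H E := first
  [ eapply eq_trans; [ eapply (chain_head1 (C:=_)); at1 H E | eval_head H ]
  | eapply eq_trans; [ at1 H E | eval_all H ]
  | eapply (chain_skip (C:=_)); find1 H E ].
Ltac find2 H E := first
  [ eapply eq_trans; [ eapply (chain_head2 H); at2 H E | eval_head H ]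
  | eapply eq_trans; [ at2 H E | eval_all H ]
  | eapply (chain_skip (C:=_)); find2 H E ].
Ltac find3 H E := first
  [ eapply eq_trans; [ eapply (chain_head3 H); at3 H E | eval_head H ]
  | eapply eq_trans; [ at3 H E | eval_all H ]
  | eapply (chain_skip (C:=_)); find3 H E ].
Ltac find4 H E := first
  [ eapply eq_trans; [ eapply (chain_head4 H); at4 H E | eval_head H ]
  | eapply eq_trans; [ at4 H E | eval_all H ]
  | eapply (chain_skip (C:=_)); find4 H E ].
Ltac find5 H E := first
  [ eapply eq_trans; [ eapply (chain_head5 H); at5 H E | eval_head H ]
  | eapply eq_trans; [ at5 H E | eval_all H ]
  | eapply (chain_skip (C:=_)); find5 H E ].
(* [id2] may be left as the last slice. *)
Ltac drop_id H := lazymatch goal with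
  | |- ?a = _ => lazymatch a with
    | context [comp2 _ _ (id2 _)] => rewrite (bc_idr H)
    | _ => idtac end end.
(* Rewrite with an equation of chains whose left-hand side has [k] slices. *)
Ltac rw1 H E := eapply eq_trans; [ find1 H E | drop_id H ].
Ltac rw2 H E := eapply eq_trans; [ find2 H E | drop_id H ].
Ltac rw3 H E := eapply eq_trans; [ find3 H E | drop_id H ].
Ltac rw4 H E := eapply eq_trans; [ find4 H E | drop_id H ].
Ltac rw5 H E := eapply eq_trans; [ find5 H E | drop_id H ].

Ltac slide_right H :=
  lazymatch goal with |- AT ?p ?q ?c _ • _ = _ =>
    eapply eq_trans; [ refine (@AT_nat _ _ H _ _ p q c _ _ _ _) | cbn [flat flatw ev]; reflexivity ]
  end.
Ltac slide_left H :=
  lazymatch goal with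
  | |- _ • AT (pid _) ?q ?c _ = _ =>
    eapply eq_trans; [ refine (@AT_nat0 _ _ H _ _ q c _ _ _) | cbn [flat flatw ev]; reflexivity ]
  | |- _ • AT ?p ?q ?c _ = _ =>
    eapply eq_trans;
      [ refine (eq_sym (@AT_nat _ _ H _ _ p q c _ _ _ _)) | cbn [flat flatw ev]; reflexivity ]
  end.
Ltac slide_here H := first [ slide_right H | slide_left H | eapply (slide_pre H); slide_here H ].
Ltac skip n tac :=
  lazymatch n with
  | S ?m => eapply (chain_skip (C:=_)); skip m tac
  | O => tac
  end.
(* Interchange slices number [n] and [n+1] of the left-hand side. *)
Ltac slide H n :=
  eapply eq_trans;
  [ skip n ltac:(first [ eapply (slide_head H); slide_here H | slide_here H ]) | ].

Ltac rwE1 H E := let F := fresh in chain H E F; rw1 H F; clear F.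
Ltac rwE2 H E := let F := fresh in chain H E F; rw2 H F; clear F.
Ltac rwE3 H E := let F := fresh in chain H E F; rw3 H F; clear F.
Ltac rwE4 H E := let F := fresh in chain H E F; rw4 H F; clear F.
Ltac rwE5 H E := let F := fresh in chain H E F; rw5 H F; clear F.

(** An insertion sort that moves slices acting on an earlier part of the path to the front, giving
    independent slices the same order on both sides of an equation. *)
Ltac sort_here H := first [ slide_left H | eapply (slide_pre H); sort_here H ].
Ltac insert_slice H :=
  first
  [ eapply eq_trans; [ eapply (slide_head H); sort_here H | eapply chain_skip; insert_slice H ]
  | sort_here H
  | reflexivity ].
Ltac sort_slices H :=
  lazymatch goal with
  | |- comp2 _ _ _ = _ =>
    eapply eq_trans; [ eapply chain_skip; sort_slices H | insert_slice H ]
  | |- _ => reflexivity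
  end.
Ltac sort_lhs H := eapply eq_trans; [ sort_slices H | ].
(* Proves equations of chains that hold by interchange alone. *)
Ltac interch H := sort_lhs H; symmetry; sort_lhs H; reflexivity.
(* As [slide], when both orders of interchange are possible: the second slice moves to the left. *)
Ltac slideL H n :=
  eapply eq_trans;
  [ skip n ltac:(first [ eapply (slide_head H); sort_here H | sort_here H ]) | ].

(* [up H k i]: move slice [k] of the left-hand side up to position [i]; [down] is the converse. *)
Ltac up_here H n :=
  lazymatch n with
  | O => reflexivity
  | S O => first [ eapply (slide_head H); slide_here H | slide_here H ]
  | S ?m => eapply eq_trans;
      [ eapply chain_skip; up_here H m | eapply (slide_head H); slide_here H ]
  end.
Ltac up H k i :=
  let n := eval compute in (k - i) in
  eapply eq_trans; [ skip i ltac:(idtac; up_here H n) | ].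
Ltac down_here H n :=
  lazymatch n with
  | O => reflexivity
  | S O => first [ eapply (slide_head H); slide_here H | slide_here H ]
  | S ?m => eapply eq_trans;
      [ eapply (slide_head H); slide_here H | eapply chain_skip; down_here H m ]
  end.
Ltac down H i k :=
  let n := eval compute in (k - i) in
  eapply eq_trans; [ skip i ltac:(idtac; down_here H n) | ].

(** * Images of pastings under a pseudofunctor *)

Section Images.
Context {O P : Type} {C : bicat O} {D : bicat P} (HC : is_bicat C) (H : is_bicat D) {fo} (F : pf C D fo) (HF : is_pf F).

Fixpoint pmap {A B} (p : pth C A B) : pth D (fo A) (fo B) :=
  match p with
  | pid A => pid (fo A)
  | pat f => pat (F @1 f)
  | pcomp p q => pcomp (pmap p) (pmap q)
  end.

Fixpoint FC {A B} (p : pth C A B) : cell D (ev (pmap p)) (F @1 (ev p)) :=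
  match p with
  | pid A => fu F A
  | pat f => id2 (F @1 f)
  | pcomp p q => (FC p ▷ ev (pmap q)) • ((F @1 (ev p) ◁ FC q) • fc F (ev p) (ev q))
  end.

Fixpoint FCi {A B} (p : pth C A B) : cell D (F @1 (ev p)) (ev (pmap p)) :=
  match p with
  | pid A => fui F A
  | pat f => id2 (F @1 f)
  | pcomp p q => fci F (ev p) (ev q) • ((F @1 (ev p) ◁ FCi q) • (FCi p ▷ ev (pmap q)))
  end.

(** Conjugation by the composite compositors makes [F] behave like a strict functor: whiskerings,
    associators and unitors are carried to those of the target. *)
Definition FM {A B} (p q : pth C A B) (a : cell C (ev p) (ev q)) :
    cell D (ev (pmap p)) (ev (pmap q)) := FC p • (F @2 a • FCi q).

Arguments FM {A B} p q a.
Local Notation ca := (comp2_assoc H).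

Lemma FC_FCi A B (p : pth C A B) : FC p • FCi p = id2 _.
Proof.
  induction p; simpl.
  - apply (pf_fu_fui HF).
  - apply (bc_idl H).
  - rewrite !ca, (bc_assoc H (fc F _ _)), (pf_fc_fci HF), (bc_idl H).
    rewrite (bc_assoc H (_ ◁ _)), <- (bc_wl_comp H), IHp2, (bc_wl_id H), (bc_idl H).
    now rewrite <- (bc_wr_comp H), IHp1, (bc_wr_id H).
Qed.

Lemma FCi_FC A B (p : pth C A B) : FCi p • FC p = id2 _.
Proof.
  induction p; simpl.
  - apply (pf_fui_fu HF).
  - apply (bc_idl H).
  - rewrite !ca, (bc_assoc H (_ ▷ _)), <- (bc_wr_comp H), IHp1, (bc_wr_id H), (bc_idl H).
    rewrite (bc_assoc H (_ ◁ _)), <- (bc_wl_comp H), IHp2, (bc_wl_id H), (bc_idl H).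
    apply (pf_fci_fc HF).
Qed.

Lemma image_eq A B (p q : pth C A B) (a : cell C (ev p) (ev q)) :
  F @2 a = FCi p • (FM p q a • FC q).
Proof.
  unfold FM. rewrite !ca, FCi_FC, (bc_idr H), (bc_assoc H), FCi_FC. now rewrite (bc_idl H).
Qed.

Lemma FM_def A B (p q : pth C A B) (a : cell C (ev p) (ev q)) (c : cell D (ev (pmap p)) (ev (pmap q))) :
  FC p • F @2 a = c • FC q -> FM p q a = c.
Proof.
  intro E. unfold FM. rewrite (bc_assoc H), E, ca, FC_FCi. apply (bc_idr H).
Qed.

Lemma FM_id A B (p : pth C A B) : FM p p (id2 _) = id2 _.
Proof. apply FM_def. now rewrite (pf_id2 HF), (bc_idl H), (bc_idr H). Qed.

Lemma FM_comp A B (p r q : pth C A B) (a : cell C (ev p) (ev r)) (a' : cell C (ev r) (ev q)) :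
  FM p q (a • a') = FM p r a • FM r q a'.
Proof.
  unfold FM. rewrite (pf_comp2 HF), !ca, (bc_assoc H (FCi r)), FCi_FC. now rewrite (bc_idl H).
Qed.

Lemma FM_whiskr A B E (p q : pth C A B) (r : pth C B E) (a : cell C (ev p) (ev q)) :
  FM (pcomp p r) (pcomp q r) (a ▷ ev r) = FM p q a ▷ ev (pmap r).
Proof.
  apply FM_def; simpl. rewrite !ca, <- (pf_fc_natl HF).
  rewrite (bc_assoc H (_ ◁ _)), <- (bc_exchange H), !(bc_assoc H). do 2 f_equal.
  rewrite <- !(bc_wr_comp H). f_equal. unfold FM.
  rewrite !ca, FCi_FC. now rewrite (bc_idr H).
Qed.

Lemma FM_whiskl A B E (r : pth C A B) (p q : pth C B E) (a : cell C (ev p) (ev q)) :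
  FM (pcomp r p) (pcomp r q) (ev r ◁ a) = ev (pmap r) ◁ FM p q a.
Proof.
  apply FM_def; simpl. rewrite !ca, <- (pf_fc_natr HF), !(bc_assoc H). f_equal.
  rewrite <- (bc_exchange H), !ca. f_equal.
  rewrite <- !(bc_wl_comp H). f_equal. unfold FM.
  rewrite !ca, FCi_FC. now rewrite (bc_idr H).
Qed.

Lemma FM_assoc A B E G (p : pth C A B) (q : pth C B E) (r : pth C E G) :
  FM (pcomp (pcomp p q) r) (pcomp p (pcomp q r)) (assoc (ev p) (ev q) (ev r)) = assoc _ _ _.
Proof.
  apply FM_def; simpl. to_chains H.
  slide H 2. rwE3 H (pf_assoc HF (ev p) (ev q) (ev r)). interch H.
Qed.

(** By functoriality of [FM], the image of an inverse is the inverse of the image; this handles the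
    inverse coherence cells. *)
Lemma FM_inv A B (p q : pth C A B) (a : cell C (ev p) (ev q)) (a' : cell C (ev q) (ev p)) c c' :
  a • a' = id2 _ -> c • c' = id2 _ -> c' • c = id2 _ -> FM p q a = c -> FM q p a' = c'.
Proof.
  intros E1 E2 E3 E. apply (cancel_l H E3).
  rewrite E2, <- E, <- FM_comp, E1. apply FM_id.
Qed.

Lemma FM_associ A B E G (p : pth C A B) (q : pth C B E) (r : pth C E G) :
  FM (pcomp p (pcomp q r)) (pcomp (pcomp p q) r) (associ (ev p) (ev q) (ev r)) = associ _ _ _.
Proof. exact (FM_inv (p:=pcomp (pcomp p q) r) (q:=pcomp p (pcomp q r)) (bc_assoc_associ HC _ _ _) (bc_assoc_associ H _ _ _) (bc_associ_assoc H _ _ _) (FM_assoc p q r)). Qed.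

Lemma FM_lun A B (p : pth C A B) : FM (pcomp (pid A) p) p (lun (ev p)) = lun _.
Proof.
  apply FM_def; simpl. to_chains H.
  slide H 0. rwE3 H (pf_lun HF (ev p)). reflexivity.
Qed.

Lemma FM_run A B (p : pth C A B) : FM (pcomp p (pid B)) p (run (ev p)) = run _.
Proof.
  apply FM_def; simpl. to_chains H.
  rwE3 H (pf_run HF (ev p)). reflexivity.
Qed.

Lemma FM_luni A B (p : pth C A B) : FM p (pcomp (pid A) p) (luni (ev p)) = luni _.
Proof. exact (FM_inv (p:=pcomp (pid A) p) (q:=p) (bc_lun_luni HC _) (bc_lun_luni H _) (bc_luni_lun H _) (FM_lun p)). Qed.

Lemma FM_runi A B (p : pth C A B) : FM p (pcomp p (pid B)) (runi (ev p)) = runi _.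
Proof. exact (FM_inv (p:=pcomp p (pid B)) (q:=p) (bc_run_runi HC _) (bc_run_runi H _) (bc_runi_run H _) (FM_run p)). Qed.
End Images.
Arguments FM {O P C D fo} F {A B} p q a.

Lemma cps_conv {O} (C : bicat O) A' A B (P : pth C A' A) (p q : pth C A B)
    (a a' : cell C (ev p) (ev q)) X (t : hom C B X) (z : hom C A' X)
    (r0 : cell C (flat P (flat q t)) z) e :
  a = a' -> flatw P (AT p q a' t) • r0 = e -> flatw P (AT p q a t) • r0 = e.
Proof. now intros ->. Qed.

Ltac is_pf_of F := constr:(ltac:(
  first
  [ lazymatch goal with HF : is_pf F |- _ => exact HF end
  | lazymatch goal with Hb : is_bbin _ |- _ =>
    first [ exact (proj1 Hb _) | exact (proj2 Hb _) ] end ]) : is_pf F).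
Ltac is_bicat_of C := lazymatch goal with H : is_bicat C |- _ => constr:(H) end.

Ltac FM_rule HC H HF F p q a :=
  lazymatch a with
  | @comp2 _ _ _ _ ?f ?g ?h ?a ?a' =>
      let r := reif g in constr:(FM_comp H HF (p:=p) (r:=r) (q:=q) a a')
  | @whiskr _ _ _ _ _ _ _ _ ?a =>
      lazymatch p with pcomp ?p1 ?r => lazymatch q with pcomp ?q1 _ =>
        constr:(FM_whiskr H HF (p:=p1) (q:=q1) r a) end end
  | @whiskl _ _ _ _ _ _ _ _ ?a =>
      lazymatch p with pcomp ?r ?p1 => lazymatch q with pcomp _ ?q1 =>
        constr:(FM_whiskl H HF r (p:=p1) (q:=q1) a) end end
  | @assoc _ _ _ _ _ _ _ _ _ =>
      lazymatch q with pcomp ?p1 (pcomp ?p2 ?p3) => constr:(FM_assoc H HF p1 p2 p3) end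
  | @associ _ _ _ _ _ _ _ _ _ =>
      lazymatch p with pcomp ?p1 (pcomp ?p2 ?p3) => constr:(FM_associ HC H HF p1 p2 p3) end
  | @lun _ _ _ _ _ => constr:(FM_lun H HF q)
  | @luni _ _ _ _ _ => constr:(FM_luni HC H HF p)
  | @run _ _ _ _ _ => constr:(FM_run H HF q)
  | @runi _ _ _ _ _ => constr:(FM_runi HC H HF p)
  | @id2 _ _ _ _ _ => constr:(FM_id H HF p)
  | _ =>
      let c := constr:(FC F p • (on2 F _ _ _ _ a • FCi F q)) in
      let c := eval cbn [FC FCi pmap ev] in c in
      constr:(eq_refl : FM F p q a = c)
  end.

(* Adds the images of composite 2-cells under pseudofunctors. *)
Ltac cps H ::=
  lazymatch goal with
  | |- flatw ?P (AT ?p ?q ?c ?t) • ?r0 = _ =>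
    lazymatch c with
    | @comp2 _ _ _ _ ?f ?g ?h ?a ?b =>
        let g := eval cbn [ev pmap] in g in let r := reif g in
        refine (cps_comp H (P:=P) (p:=p) (r:=r) (q:=q) (a:=a) (b:=b) (t:=t) (r0:=r0) _ _);
        [ cps H | cps H ]
    | @whiskr _ _ _ _ _ _ _ _ ?a =>
        lazymatch p with pcomp ?p1 ?r =>
        lazymatch q with pcomp ?q1 _ =>
          refine (cps_whiskr H (P:=P) (p:=p1) (q:=q1) (r:=r) (a:=a) (t:=t) (r0:=r0) _); cps H
        end end
    | @whiskl _ _ _ _ _ _ _ _ ?a =>
        lazymatch p with pcomp ?r ?p1 =>
        lazymatch q with pcomp _ ?q1 =>
          refine (cps_whiskl H (P:=P) (p:=p1) (q:=q1) (r:=r) (a:=a) (t:=t) (r0:=r0) _); cps H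
        end end
    | @assoc _ _ _ _ _ _ _ _ _ =>
        lazymatch q with pcomp ?p1 (pcomp ?p2 ?p3) => refine (@cps_id _ _ H _ _ _ P _ _ (AT_assoc H p1 p2 p3 t) _ r0) end
    | @associ _ _ _ _ _ _ _ _ _ =>
        lazymatch p with pcomp ?p1 (pcomp ?p2 ?p3) => refine (@cps_id _ _ H _ _ _ P _ _ (AT_associ H p1 p2 p3 t) _ r0) end
    | @lun _ _ _ _ _ => refine (@cps_id _ _ H _ _ _ P _ _ (AT_lun H q t) _ r0)
    | @luni _ _ _ _ _ => refine (@cps_id _ _ H _ _ _ P _ _ (AT_luni H p t) _ r0)
    | @run _ _ _ _ _ => refine (@cps_id _ _ H _ _ _ P _ _ (AT_run H q t) _ r0)
    | @runi _ _ _ _ _ => refine (@cps_id _ _ H _ _ _ P _ _ (AT_runi H p t) _ r0)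
    | @id2 _ _ _ _ _ => refine (@cps_id _ _ H _ _ _ P _ _ (AT_id H p t) _ r0)
    | @FM ?O ?P0 ?C ?D ?fo ?F ?A ?B ?p0 ?q0 ?a =>
        let HF := is_pf_of F in let HC := is_bicat_of C in
        let e := FM_rule HC H HF F p0 q0 a in
        refine (cps_conv (P:=P) (p:=p) (q:=q) (a:=c) (t:=t) (r0:=r0) e _); cps H
    | _ => cbn [flat flatw ev]; reflexivity
    end
  end.

Ltac is_composite a :=
  lazymatch a with
  | comp2 _ _ _ => idtac | whiskr _ _ => idtac | whiskl _ _ => idtac | assoc _ _ _ => idtac
  | associ _ _ _ => idtac | lun _ => idtac | luni _ => idtac | run _ => idtac
  | runi _ => idtac | id2 _ => idtac
  end.

(* Evaluates one occurrence of [F @2 a], [a] composite, on the left-hand side. *)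
Ltac image H :=
  match goal with
  | |- ?lhs = _ =>
    match lhs with
    | context [AT (pat _) (pat _) (@on2 ?O ?P ?C ?D ?fo ?F ?A ?B ?f ?g ?a) _] =>
      is_composite a;
      let HF := is_pf_of F in
      let p := reif f in let q := reif g in
      let E := fresh in
      pose proof (@image_eq O P C D H fo F HF A B p q a) as E;
      cbn [FC FCi pmap ev] in E;
      rwE1 H E; clear E
    end
  end.

(* Cancels an adjacent pair of mutually inverse compositors on the left-hand side. *)
Ltac cancel_fc H :=
  match goal with
  | |- ?lhs = _ =>
    match lhs with
    | context [@fc ?O ?P ?C ?D ?fo ?F ?A ?B ?E ?f ?g] =>
      let HF := is_pf_of F in
      first [ rwE2 H (@pf_fc_fci O P C D fo F HF A B E f g)
            | rwE2 H (@pf_fci_fc O P C D fo F HF A B E f g) ]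
    end
  end.

(** * The tensor product of a central premonoidal bicategory *)

Section Tensor.
Context {O : Type} {C : bicat O} (H : is_bicat C) {b : bbin C} (Hb : is_bbin b).
Context (L : blcs b) (HL : blcs_laws L) (FL : blcs_functor L).
Local Notation lt X := (blt b X).
Local Notation rt X := (brt b X).
Local Notation x K k := (nat1 (@L _ _ K) k).
Local Notation xi K k := (nat1i (@L _ _ K) k).

Definition bt_1 {X X' Y Y'} (K : hom C X X') (k : hom C Y Y') :
    hom C (btens b X Y) (btens b X' Y') := rt Y @1 K · lt X' @1 k.

Definition bt_2 {X X' Y Y'} {K K' : hom C X X'} {k k' : hom C Y Y'}
    (a : cell C K K') (d : cell C k k') : cell C (bt_1 K k) (bt_1 K' k') :=
  (rt Y @2 a ▷ lt X' @1 k) • (rt Y @1 K' ◁ lt X' @2 d).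

Definition bt_fc {X X' X'' Y Y' Y''} (K : hom C X X') (K' : hom C X' X'')
    (k : hom C Y Y') (k' : hom C Y' Y'') :
    cell C (bt_1 K k · bt_1 K' k') (bt_1 (K · K') (k · k')) :=
  assoc (rt Y @1 K) (lt X' @1 k) (bt_1 K' k') •
  (rt Y @1 K ◁ (associ (lt X' @1 k) (rt Y' @1 K') (lt X'' @1 k') •
                (x K' k ▷ lt X'' @1 k') •
                assoc (rt Y @1 K') (lt X'' @1 k) (lt X'' @1 k'))) •
  associ (rt Y @1 K) (rt Y @1 K') (lt X'' @1 k · lt X'' @1 k') •
  (fc (rt Y) K K' ▷ (lt X'' @1 k · lt X'' @1 k')) •
  (rt Y @1 (K · K') ◁ fc (lt X'') k k').

Definition bt_fci {X X' X'' Y Y' Y''} (K : hom C X X') (K' : hom C X' X'')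
    (k : hom C Y Y') (k' : hom C Y' Y'') :
    cell C (bt_1 (K · K') (k · k')) (bt_1 K k · bt_1 K' k') :=
  (rt Y @1 (K · K') ◁ fci (lt X'') k k') •
  (fci (rt Y) K K' ▷ (lt X'' @1 k · lt X'' @1 k')) •
  assoc (rt Y @1 K) (rt Y @1 K') (lt X'' @1 k · lt X'' @1 k') •
  (rt Y @1 K ◁ (associ (rt Y @1 K') (lt X'' @1 k) (lt X'' @1 k') •
                (xi K' k ▷ lt X'' @1 k') •
                assoc (lt X' @1 k) (rt Y' @1 K') (lt X'' @1 k'))) •
  associ (rt Y @1 K) (lt X' @1 k) (bt_1 K' k').

Definition bt_fu X Y : cell C (id1 C (btens b X Y)) (bt_1 (id1 C X) (id1 C Y)) :=
  luni (id1 C (btens b X Y)) • (fu (rt Y) X ▷ id1 C _) • (rt Y @1 id1 C X ◁ fu (lt X) Y).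

Definition bt_fui X Y : cell C (bt_1 (id1 C X) (id1 C Y)) (id1 C (btens b X Y)) :=
  (fui (rt Y) X ▷ lt X @1 id1 C Y) • (id1 C _ ◁ fui (lt X) Y) • lun (id1 C (btens b X Y)).

Definition bT : pf (bprod C C) C (fun X => btens b (fst X) (snd X)) :=
  Pf (bprod C C) C (fun X => btens b (fst X) (snd X))
    (fun X Y (f : hom (bprod C C) X Y) => bt_1 (fst f) (snd f))
    (fun X Y (f g : hom (bprod C C) X Y) (a : cell _ f g) => bt_2 (fst a) (snd a))
    (fun X Y Z (f : hom (bprod C C) X Y) (g : hom (bprod C C) Y Z) =>
       bt_fc (fst f) (fst g) (snd f) (snd g))
    (fun X Y Z (f : hom (bprod C C) X Y) (g : hom (bprod C C) Y Z) =>
       bt_fci (fst f) (fst g) (snd f) (snd g))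
    (fun X => bt_fu (fst X) (snd X)) (fun X => bt_fui (fst X) (snd X)).

Let Hlt X := proj1 Hb X.
Let Hrt X := proj2 Hb X.
Let HLp X X' (K : hom C X X') := proj1 HL X X' K.
Let HLm X X' (K K' : hom C X X') (a : cell C K K') := proj2 HL X X' K K' a.

Lemma bt_id X X' Y Y' (K : hom C X X') (k : hom C Y Y') : bt_2 (id2 K) (id2 k) = id2 (bt_1 K k).
Proof.
  unfold bt_2. rewrite (pf_id2 (Hlt _)), (pf_id2 (Hrt _)), (bc_wr_id H), (bc_wl_id H).
  apply (bc_idl H).
Qed.

Lemma bt_comp X X' Y Y' (K K' K'' : hom C X X') (k k' k'' : hom C Y Y')
  (a : cell C K K') (a' : cell C K' K'') (d : cell C k k') (d' : cell C k' k'') :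
  bt_2 (a • a') (d • d') = bt_2 a d • bt_2 a' d'.
Proof.
  unfold bt_2, bt_1. to_chains H.
  rwE1 H (pf_comp2 (Hrt Y) a a'). rwE1 H (pf_comp2 (Hlt X') d d'). interch H.
Qed.

(** In the first pair, [d] moves through the exchange cell by naturality of [g ⋉ -]. In the second
    pair, treated next, [a] moves through it because the cells [a ⋊ Y] form a modification. *)
Lemma bt_fc_natl X X' X'' Y Y' Y'' (f f' : hom C X X') (g : hom C X' X'')
  (h h' : hom C Y Y') (k : hom C Y' Y'') (a : cell C f f') (d : cell C h h') :
  (bt_2 a d ▷ bt_1 g k) • bt_fc f' g h' k = bt_fc f g h k • bt_2 (a ▷ g) (d ▷ k).
Proof.
  unfold bt_2, bt_fc, bt_1. to_chains H.
  rwE2 H (pn_nat2 (HLp g) d). symmetry.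
  slide H 2. rwE2 H (eq_sym (pf_fc_natl (Hrt Y) g a)).
  rwE2 H (eq_sym (pf_fc_natl (Hlt X'') k d)). interch H.
Qed.

Lemma bt_fc_natr X X' X'' Y Y' Y'' (f : hom C X X') (g g' : hom C X' X'')
  (h : hom C Y Y') (k k' : hom C Y' Y'') (a : cell C g g') (d : cell C k k') :
  (bt_1 f h ◁ bt_2 a d) • bt_fc f g' h k' = bt_fc f g h k • bt_2 (f ◁ a) (h ◁ d).
Proof.
  unfold bt_2, bt_fc, bt_1. to_chains H.
  slide H 1. rwE2 H (eq_sym (HLm a h)). symmetry.
  slide H 2. rwE2 H (eq_sym (pf_fc_natr (Hrt Y) f a)).
  rwE2 H (eq_sym (pf_fc_natr (Hlt X'') h d)). interch H.
Qed.

Lemma bt_fc_fci X X' X'' Y Y' Y'' (f : hom C X X') (g : hom C X' X'')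
  (h : hom C Y Y') (k : hom C Y' Y'') : bt_fc f g h k • bt_fci f g h k = id2 _.
Proof.
  unfold bt_fc, bt_fci, bt_1. to_chains H.
  rwE2 H (pf_fc_fci (Hlt X'') h k). rwE2 H (pf_fc_fci (Hrt Y) f g).
  rwE2 H (pn_inv (HLp g) h). reflexivity.
Qed.

Lemma bt_fci_fc X X' X'' Y Y' Y'' (f : hom C X X') (g : hom C X' X'')
  (h : hom C Y Y') (k : hom C Y' Y'') : bt_fci f g h k • bt_fc f g h k = id2 _.
Proof.
  unfold bt_fc, bt_fci, bt_1. to_chains H.
  rwE2 H (pn_invi (HLp g) h). rwE2 H (pf_fci_fc (Hrt Y) f g).
  rwE2 H (pf_fci_fc (Hlt X'') h k). reflexivity.
Qed.

(** Exchanging [h] with [f' · g'] splits by pseudonaturality of [h ⋉ -], exchanging [g · h] with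
    [f'] by functoriality of [k ↦ k ⋉ -]. Both sides then contain the same three exchange cells, and
    associativity of the compositors in each variable remains. *)
Lemma bt_assoc X0 X1 X2 X3 Y0 Y1 Y2 Y3 (f : hom C X0 X1) (g : hom C X1 X2) (h : hom C X2 X3)
   (f' : hom C Y0 Y1) (g' : hom C Y1 Y2) (h' : hom C Y2 Y3) :
  (bt_fc f g f' g' ▷ bt_1 h h') •
    (bt_fc (f · g) h (f' · g') h' • bt_2 (assoc f g h) (assoc f' g' h'))
  = assoc (bt_1 f f') (bt_1 g g') (bt_1 h h') •
    ((bt_1 f f' ◁ bt_fc g h g' h') • bt_fc f (g · h) f' (g' · h')).
Proof.
  unfold bt_fc, bt_2, bt_1. to_chains H.
  rwE2 H (pn_fc (HLp h) f' g').
  slide H 1. slide H 2. slide H 3. slide H 6.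
  rwE3 H (pf_assoc (Hrt Y0) f g h).
  slide H 3. slide H 4. rwE3 H (pf_assoc (Hlt X3) f' g' h').
  symmetry. slide H 2. rwE2 H (eq_sym (proj1 FL _ _ _ g h _ _ f')).
  interch H.
Qed.

Lemma bt_lun X X' Y Y' (f : hom C X X') (h : hom C Y Y') :
  (bt_fu X Y ▷ bt_1 f h) • (bt_fc (id1 C X) f (id1 C Y) h • bt_2 (lun f) (lun h))
  = lun (bt_1 f h).
Proof.
  unfold bt_fu, bt_fc, bt_2, bt_1. to_chains H.
  rwE2 H (pn_fu (HLp f) Y). slide H 1. slide H 3. slide H 2. rwE3 H (pf_lun (Hrt Y) f).
  rwE3 H (pf_lun (Hlt X') h).
  reflexivity.
Qed.

(** Here the exchange cell is that of an identity 1-cell, governed by the unit law of [k ↦ k ⋉ -];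
    in [bt_lun] it was taken at an identity argument, where pseudonaturality applies. *)
Lemma bt_run X X' Y Y' (f : hom C X X') (h : hom C Y Y') :
  (bt_1 f h ◁ bt_fu X' Y') • (bt_fc f (id1 C X') h (id1 C Y') • bt_2 (run f) (run h))
  = run (bt_1 f h).
Proof.
  unfold bt_fu, bt_fc, bt_2, bt_1. to_chains H.
  slide H 1. rwE2 H (eq_sym (proj2 FL X' _ _ h)).
  slide H 1. slide H 3. slide H 2. rwE3 H (pf_run (Hrt Y) f). rwE3 H (pf_run (Hlt X') h).
  reflexivity.
Qed.

Lemma bt_fu_fui X Y : bt_fu X Y • bt_fui X Y = id2 _.
Proof.
  unfold bt_fu, bt_fui, bt_1. to_chains H.
  slide H 1. rwE2 H (pf_fu_fui (Hrt Y) X). rwE2 H (pf_fu_fui (Hlt X) Y). reflexivity.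
Qed.

Lemma bt_fui_fu X Y : bt_fui X Y • bt_fu X Y = id2 _.
Proof.
  unfold bt_fu, bt_fui, bt_1. to_chains H.
  slideL H 1. rwE2 H (pf_fui_fu (Hrt Y) X). rwE2 H (pf_fui_fu (Hlt X) Y). reflexivity.
Qed.

Lemma bT_pf : is_pf bT.
Proof.
  constructor; cbn; intros.
  - apply bt_id.
  - apply bt_comp.
  - apply bt_fc_natl.
  - apply bt_fc_natr.
  - apply bt_fc_fci.
  - apply bt_fci_fc.
  - apply bt_fu_fui.
  - apply bt_fui_fu.
  - apply bt_assoc.
  - destruct A, B. apply bt_lun.
  - destruct A, B. apply bt_run.
Qed.
End Tensor.

(** A tensor product of 1-cells is read as a path of two factors, so that its cells decompose into
    cells of the two one-variable functors. *)
Ltac reif f ::=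
  lazymatch f with
  | comp1 ?C ?g ?h => let p := reif g in let q := reif h in constr:(pcomp p q)
  | bt_1 _ _ => let f' := eval unfold bt_1 in f in reif f'
  | @id1 _ ?C ?A => constr:(@pid _ C A)
  | _ => lazymatch type of f with hom ?C ?A ?B => constr:(@pat _ C A B f) end
  end.

(** * Associativity and unit constraints of the tensor product *)

Section TensorAssoc.
Context {O : Type} {C : bicat O} (H : is_bicat C) {b : bbin C} (Hb : is_bbin b).
Context (L : blcs b) (HL : blcs_laws L) (FL : blcs_functor L).
Context (K : bconstr b) (HK : is_constr K) (AE : basc_exchange K L).
Local Notation lt X := (blt b X).
Local Notation rt X := (brt b X).
Local Notation "X ⊗ Y" := (btens b X Y) (at level 39, left associativity).
Local Notation x K k := (nat1 (@L _ _ K) k).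
Local Notation xi K k := (nat1i (@L _ _ K) k).
Local Notation α := (basc K).

Definition bt_asc {X X' Y Y' Z Z'} (f : hom C X X') (g : hom C Y Y') (h : hom C Z Z') :
    cell C (bt_1 (bt_1 f g) h · α X' Y' Z') (α X Y Z · bt_1 f (bt_1 g h)) :=
  ((fci (rt Z) (rt Y @1 f) (lt X' @1 g) ▷ lt (X' ⊗ Y') @1 h) ▷ α X' Y' Z') •
  assoc _ _ _ • (_ ◁ nat1 (ba3 K X' Y') h) •
  assoc _ _ _ • (_ ◁ (associ _ _ _ • (nat1 (ba2 K X' Z) g ▷ _) • assoc _ _ _)) •
  associ _ _ _ • (nat1 (ba1 K Y Z) f ▷ _) • assoc _ _ _ •
  (α X Y Z ◁ (_ ◁ fc (lt X') (rt Z @1 g) (lt Y' @1 h))).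

Definition bt_asci {X X' Y Y' Z Z'} (f : hom C X X') (g : hom C Y Y') (h : hom C Z Z') :
    cell C (α X Y Z · bt_1 f (bt_1 g h)) (bt_1 (bt_1 f g) h · α X' Y' Z') :=
  (α X Y Z ◁ (_ ◁ fci (lt X') (rt Z @1 g) (lt Y' @1 h))) •
  associ _ _ _ • (nat1i (ba1 K Y Z) f ▷ _) • assoc _ _ _ •
  (_ ◁ (associ _ _ _ • (nat1i (ba2 K X' Z) g ▷ _) • assoc _ _ _)) • associ _ _ _ •
  (_ ◁ nat1i (ba3 K X' Y') h) • associ _ _ _ •
  ((fc (rt Z) (rt Y @1 f) (lt X' @1 g) ▷ lt (X' ⊗ Y') @1 h) ▷ α X' Y' Z').

Definition bt_lam {Y Y'} (k : hom C Y Y') :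
    cell C (bt_1 (id1 C (bI K)) k · blam K Y') (blam K Y · k) :=
  (((fui (rt Y) (bI K) ▷ _) • lun _) ▷ blam K Y') • nat1 (blamT K) k.
Definition bt_lami {Y Y'} (k : hom C Y Y') :
    cell C (blam K Y · k) (bt_1 (id1 C (bI K)) k · blam K Y') :=
  nat1i (blamT K) k • ((luni _ • (fu (rt Y) (bI K) ▷ _)) ▷ blam K Y').
Definition bt_rho {Y Y'} (k : hom C Y Y') :
    cell C (bt_1 k (id1 C (bI K)) · brho K Y') (brho K Y · k) :=
  (((_ ◁ fui (lt Y') (bI K)) • run _) ▷ brho K Y') • nat1 (brhoT K) k.
Definition bt_rhoi {Y Y'} (k : hom C Y Y') :
    cell C (brho K Y · k) (bt_1 k (id1 C (bI K)) · brho K Y') :=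
  nat1i (brhoT K) k • ((runi _ • (_ ◁ fu (lt Y') (bI K))) ▷ brho K Y').

Definition bmon : mon C (btens b) (bI K) :=
  @Mon _ C (btens b) (bI K) (bT L)
    (fun X Y Z => α X Y Z)
    (@Pn _ _ (bprod (bprod C C) C) C _ _
       (on1 (F_lassoc (bT L))) (on1 (F_rassoc (bT L))) _
       (fun X Y f => bt_asc (fst (fst f)) (snd (fst f)) (snd f))
       (fun X Y f => bt_asci (fst (fst f)) (snd (fst f)) (snd f)))
    (fun X => blam K X)
    (@Pn _ _ C C _ _ (on1 (T_lt (bT L) (bI K))) (on1 (pf_id C)) _
       (fun X Y f => bt_lam f) (fun X Y f => bt_lami f))
    (fun X => brho K X)
    (@Pn _ _ C C _ _ (on1 (T_rt (bT L) (bI K))) (on1 (pf_id C)) _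
       (fun X Y f => bt_rho f) (fun X Y f => bt_rhoi f)).

Let Hlt X := proj1 Hb X.
Let Hrt X := proj2 Hb X.
Let HLp X X' (k : hom C X X') := proj1 HL X X' k.
Let HLm X X' (k k' : hom C X X') (a : cell C k k') := proj2 HL X X' k k' a.
Let H1 Y Z := proj1 (ic_a1 HK Y Z).
Let H2 Y Z := proj1 (ic_a2 HK Y Z).
Let H3 Y Z := proj1 (ic_a3 HK Y Z).

Lemma bt_asc_asci X X' Y Y' Z Z' (f : hom C X X') (g : hom C Y Y') (h : hom C Z Z') :
  bt_asc f g h • bt_asci f g h = id2 _.
Proof.
  unfold bt_asc, bt_asci, bt_1. to_chains H.
  rwE2 H (pf_fc_fci (Hlt X') (rt Z @1 g) (lt Y' @1 h)).
  rwE2 H (pn_inv (H1 Y Z) f). rwE2 H (pn_inv (H2 X' Z) g). rwE2 H (pn_inv (H3 X' Y') h).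
  rwE2 H (pf_fci_fc (Hrt Z) (rt Y @1 f) (lt X' @1 g)). reflexivity.
Qed.

Lemma bt_asci_asc X X' Y Y' Z Z' (f : hom C X X') (g : hom C Y Y') (h : hom C Z Z') :
  bt_asci f g h • bt_asc f g h = id2 _.
Proof.
  unfold bt_asc, bt_asci, bt_1. to_chains H.
  rwE2 H (pf_fc_fci (Hrt Z) (rt Y @1 f) (lt X' @1 g)).
  rwE2 H (pn_invi (H3 X' Y') h). rwE2 H (pn_invi (H2 X' Z) g). rwE2 H (pn_invi (H1 Y Z) f).
  rwE2 H (pf_fci_fc (Hlt X') (rt Z @1 g) (lt Y' @1 h)). reflexivity.
Qed.

Lemma bt_asc_nat X X' Y Y' Z Z' (f f' : hom C X X') (g g' : hom C Y Y') (h h' : hom C Z Z')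
    (p : cell C f f') (q : cell C g g') (r : cell C h h') :
  (bt_2 (bt_2 p q) r ▷ α X' Y' Z') • bt_asc f' g' h' = bt_asc f g h • (α X Y Z ◁ bt_2 p (bt_2 q r)).
Proof.
  unfold bt_asc, bt_2, bt_1. to_chains H.
image H. slide H 3.
  rwE2 H (pf_fc_fci (Hrt Z) (rt Y @1 f') (lt X' @1 g')).
  rwE2 H (pn_nat2 (H3 X' Y') r). slide H 2.
  slide H 3. rwE2 H (pn_nat2 (H2 X' Z) q). slide H 1. slide H 2. slide H 3. slide H 4.
  rwE2 H (pn_nat2 (H1 Y Z) p).
  symmetry. image H. slide H 4.
  rwE2 H (pf_fc_fci (Hlt X') (rt Z @1 g) (lt Y' @1 h)). interch H.
Qed.

Lemma L_comp X X' X'' Y Y' (k : hom C X X') (k' : hom C X' X'') (g : hom C Y Y') :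
  x (k · k') g = (lt X @1 g ◁ fci (rt Y') k k') •
    (nat1 (pn_comp (@L _ _ k) (@L _ _ k')) g • (fc (rt Y) k k' ▷ lt X'' @1 g)).
Proof.
  to_chains H. symmetry. rwE3 H (proj1 FL _ _ _ k k' _ _ g).
  rwE2 H (pf_fci_fc (Hrt Y') k k'). reflexivity.
Qed.

(** The constraint cell of each variable splits at composites. The cells of [f], [g], [h] must then
    be sorted against those of [f2], [g2], [h2]: three exchanges, one for each pair of variables,
    are moved across associativity by [bae23], [bae12] and [bae13]. *)
Lemma bt_asc_fc X X' X'' Y Y' Y'' Z Z' Z'' (f : hom C X X') (f2 : hom C X' X'')
    (g : hom C Y Y') (g2 : hom C Y' Y'') (h : hom C Z Z') (h2 : hom C Z' Z'') :
  ((bt_fc L (bt_1 f g) (bt_1 f2 g2) h h2 •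
    bt_2 (bt_fc L f f2 g g2) (id2 (h · h2))) ▷ α X'' Y'' Z'') • bt_asc (f · f2) (g · g2) (h · h2)
  = assoc _ _ _ • ((_ ◁ bt_asc f2 g2 h2) • (associ _ _ _ •
     ((bt_asc f g h ▷ _) • (assoc _ _ _ • (α X Y Z ◁ (bt_fc L f f2 (bt_1 g h) (bt_1 g2 h2) •
         bt_2 (id2 (f · f2)) (bt_fc L g g2 h h2))))))).
Proof.
  unfold bt_asc, bt_2. rewrite !(pf_id2 (Hlt _)), !(pf_id2 (Hrt _)).
  unfold bt_fc, bt_1. to_chains H.
  rwE1 H (L_comp (rt Y' @1 f2) (lt X'' @1 g2) h). slide H 4. image H.
  rwE2 H (pf_fc_fci (Hrt Z) (rt Y @1 f · lt X' @1 g) (rt Y' @1 f2 · lt X'' @1 g2)).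
  slide H 3. rwE2 H (pf_fc_fci (Hrt Z) (rt Y' @1 f2) (lt X'' @1 g2)).
  rwE2 H (pf_fc_fci (Hrt Z) (rt Y @1 (f · f2)) (lt X'' @1 (g · g2))).
  down H 3 11. rwE2 H (pn_fc (H3 X'' Y'') h h2).
  down H 10 14. down H 9 13. rwE3 H (pn_fc (H2 X'' Z) g g2).
  down H 8 16. down H 7 15. rwE3 H (pn_fc (H1 Y Z) f f2).
  up H 7 1. up H 8 4. up H 11 5. rwE3 H (bae23 AE X'' g2 h).
  slide H 2. up H 14 12. up H 17 13. rwE5 H (bae12 AE f2 Z g).
  up H 9 5. rwE3 H (bae13 AE f2 Y' h).
  symmetry.
  (* On this side [f2] is exchanged with the tensor product of [g] and [h], hence with each of them
     in turn. *)
  rwE2 H (pn_fc (HLp f2) (rt Z @1 g) (lt Y' @1 h)). image H.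
  rwE2 H (pf_fc_fci (Hlt X'') (rt Z @1 g · lt Y' @1 h) (rt Z' @1 g2 · lt Y'' @1 h2)).
  slide H 11. down H 4 12.
  rwE2 H (pf_fc_fci (Hlt X'') (rt Z' @1 g2) (lt Y'' @1 h2)).
  rwE2 H (pf_fc_fci (Hlt X'') (rt Z @1 g) (lt Y' @1 h)).
  interch H.
Qed.

Lemma bt_asc_fu X Y Z :
  ((bt_fu (X ⊗ Y) Z • bt_2 (bt_fu X Y) (id2 (id1 C Z))) ▷ α X Y Z) •
    bt_asc (id1 C X) (id1 C Y) (id1 C Z)
  = lun _ • (runi _ • (α X Y Z ◁ (bt_fu X (Y ⊗ Z) • bt_2 (id2 (id1 C X)) (bt_fu Y Z)))).
Proof.
  unfold bt_asc, bt_2. rewrite !(pf_id2 (Hlt _)), !(pf_id2 (Hrt _)).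
  unfold bt_fu, bt_1. to_chains H. image H.
  up H 2 1. rwE2 H (pf_fu_fui (Hrt Z) (X ⊗ Y)).
  rwE2 H (pf_fc_fci (Hrt Z) (rt Y @1 id1 C X) (lt X @1 id1 C Y)).
  down H 0 4. rwE2 H (pn_fu (H3 X Y) Z).

  down H 3 5. down H 2 4. rwE3 H (pn_fu (H2 X Z) Y). down H 1 5. down H 0 4.
  rwE3 H (pn_fu (H1 Y Z) X).

  symmetry. image H.
  rwE2 H (pf_fu_fui (Hlt X) (Y ⊗ Z)).
  interch H.
Qed.

Lemma L_unit X Y Y' (g : hom C Y Y') :
  x (id1 C X) g = (lt X @1 g ◁ fui (rt Y') X) • (run _ • (luni _ • (fu (rt Y) X ▷ lt X @1 g))).
Proof.
  to_chains H. symmetry. rwE1 H (proj2 FL X _ _ g). rwE2 H (pf_fui_fu (Hrt Y') X). reflexivity.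
Qed.

(** The compositor of [T_lt] contains the exchange cell of the identity of the unit object, which
    [L_unit] replaces by unitors; the axioms of [blamT] remain. For the right unit below, the
    identity is the argument of the exchange, and [L_id] is used. *)
Lemma bt_lam_pn : is_pn (T_lt (bT L) (bI K)) (pf_id C) (mlamT bmon).
Proof.
  constructor; cbn; intros; unfold bt_lam, bt_lami, bt_fc, bt_fu, bt_2, bt_1;
    rewrite ?(pf_id2 (Hlt _)), ?(pf_id2 (Hrt _)), ?(lun_run_id H); to_chains H.
  - rwE2 H (pn_inv (proj1 (ic_lam HK)) f). rwE2 H (pf_fui_fu (Hrt A) (bI K)). reflexivity.
  - rwE2 H (pf_fu_fui (Hrt A) (bI K)). rwE2 H (pn_invi (proj1 (ic_lam HK)) f). reflexivity.
  - slide H 0. rwE2 H (pn_nat2 (proj1 (ic_lam HK)) a). reflexivity.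
  - rwE1 H (L_unit (bI K) f). slide H 3. rwE3 H (pf_run (Hrt A) (id1 C (bI K))). slide H 1.
    rwE2 H (pn_fc (proj1 (ic_lam HK)) f g). interch H.
  - up H 2 1. rwE2 H (pf_fu_fui (Hrt A) (bI K)). rwE2 H (pn_fu (proj1 (ic_lam HK)) A). reflexivity.
Qed.

Lemma L_id X X' Y (k : hom C X X') :
  x k (id1 C Y) = (fui (lt X) Y ▷ rt Y @1 k) • (lun _ • (runi _ • (rt Y @1 k ◁ fu (lt X') Y))).
Proof.
  to_chains H. symmetry. rwE1 H (eq_sym (pn_fu (HLp k) Y)).
  rwE2 H (pf_fui_fu (Hlt X) Y). reflexivity.
Qed.

Lemma bt_rho_pn : is_pn (T_rt (bT L) (bI K)) (pf_id C) (mrhoT bmon).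
Proof.
  constructor; cbn; intros; unfold bt_rho, bt_rhoi, bt_fc, bt_fu, bt_2, bt_1;
    rewrite ?(pf_id2 (Hlt _)), ?(pf_id2 (Hrt _)), ?(lun_run_id H); to_chains H.
  - rwE2 H (pn_inv (proj1 (ic_rho HK)) f). rwE2 H (pf_fui_fu (Hlt B) (bI K)). reflexivity.
  - rwE2 H (pf_fu_fui (Hlt B) (bI K)). rwE2 H (pn_invi (proj1 (ic_rho HK)) f). reflexivity.
  - slide H 0. rwE2 H (pn_nat2 (proj1 (ic_rho HK)) a). interch H.
  - rewrite <- (lun_run_id H). rwE1 H (L_id (bI K) g). slide H 1.
    rwE3 H (pf_lun (Hlt E) (id1 C (bI K))). slide H 1.
    rwE2 H (pn_fc (proj1 (ic_rho HK)) f g). interch H.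
  - rwE2 H (pf_fu_fui (Hlt A) (bI K)). rwE2 H (pn_fu (proj1 (ic_rho HK)) A). reflexivity.
Qed.

Lemma bmon_asc : is_pn (F_lassoc (bT L)) (F_rassoc (bT L)) (mascT bmon).
Proof.
  constructor; cbn; intros.
  - apply bt_asc_asci.
  - apply bt_asci_asc.
  - apply bt_asc_nat.
  - repeat first [ rewrite (bc_idr H) | rewrite (bt_id H Hb) ]. apply bt_asc_fc.
  - repeat first [ rewrite (bc_idr H) | rewrite (bt_id H Hb) ]. apply bt_asc_fu.
Qed.
End TensorAssoc.

(** * Pasting of squares in a bicategory *)

Section Squares.
Context {O : Type} {C : bicat O} (H : is_bicat C).

(* Horizontal and vertical pasting, and change of the horizontal or of the vertical sides,
   of squares [f · p' ⇒ p · f'] in a bicategory. *)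
Definition paste {A A' A'' D D' D''} {f : hom C A A'} {g : hom C A' A''} {f' : hom C D D'}
    {g' : hom C D' D''} {p0 : hom C A D} {p1 : hom C A' D'} {p2 : hom C A'' D''}
    (P : cell C (f · p1) (p0 · f')) (P' : cell C (g · p2) (p1 · g')) :
    cell C ((f · g) · p2) (p0 · (f' · g')) :=
  assoc _ _ _ • ((f ◁ P') • (associ _ _ _ • ((P ▷ g') • assoc _ _ _))).

Definition stack {A A' D D' E E'} {f : hom C A A'} {f' : hom C D D'} {f'' : hom C E E'}
    {p0 : hom C A D} {p1 : hom C A' D'} {q0 : hom C D E} {q1 : hom C D' E'}
    (P : cell C (f · p1) (p0 · f')) (Q : cell C (f' · q1) (q0 · f'')) :
    cell C (f · (p1 · q1)) ((p0 · q0) · f'') :=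
  associ _ _ _ • ((P ▷ q1) • (assoc _ _ _ • ((p0 ◁ Q) • associ _ _ _))).

Definition hside {A A' D D'} {f1 f : hom C A A'} {f' f1' : hom C D D'}
    {p0 : hom C A D} {p1 : hom C A' D'} (u : cell C f1 f) (u' : cell C f' f1')
    (P : cell C (f · p1) (p0 · f')) : cell C (f1 · p1) (p0 · f1') :=
  (u ▷ p1) • (P • (p0 ◁ u')).

Definition vside {A A' D D'} {f : hom C A A'} {f' : hom C D D'}
    {q0 p0 : hom C A D} {q1 p1 : hom C A' D'} (u : cell C q1 p1) (u' : cell C p0 q0)
    (P : cell C (f · p1) (p0 · f')) : cell C (f · q1) (q0 · f') :=
  (f ◁ u) • (P • (u' ▷ f')).

Lemma stack_paste {A A' A'' D D' D'' E E' E''} {f : hom C A A'} {g : hom C A' A''}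
    {f' : hom C D D'} {g' : hom C D' D''} {f'' : hom C E E'} {g'' : hom C E' E''}
    {p0 : hom C A D} {p1 : hom C A' D'} {p2 : hom C A'' D''}
    {q0 : hom C D E} {q1 : hom C D' E'} {q2 : hom C D'' E''}
    (P : cell C (f · p1) (p0 · f')) (P' : cell C (g · p2) (p1 · g'))
    (Q : cell C (f' · q1) (q0 · f'')) (Q' : cell C (g' · q2) (q1 · g'')) :
  stack (paste P P') (paste Q Q') = paste (stack P Q) (stack P' Q').
Proof. unfold stack, paste. to_chains H. interch H. Qed.

Lemma stack_hside {A A' D D' E E'} {f1 f : hom C A A'} {f' f1' : hom C D D'}
    {f'' f1'' : hom C E E'}
    {p0 : hom C A D} {p1 : hom C A' D'} {q0 : hom C D E} {q1 : hom C D' E'}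
    (u : cell C f1 f) (u' : cell C f' f1') (v : cell C f1' f') (v' : cell C f'' f1'')
    (P : cell C (f · p1) (p0 · f')) (Q : cell C (f' · q1) (q0 · f'')) :
  u' • v = id2 _ ->
  stack (hside u u' P) (hside v v' Q) = hside u v' (stack P Q).
Proof. intro E1. unfold stack, hside. to_chains H. rwE2 H E1. interch H. Qed.

(** The modification condition localized at a single 1-cell, with arbitrary squares in place of the
    cells of transformations; this makes it amenable to pasting. *)
Definition sq_mod {A A' D D'} {f : hom C A A'} {f' : hom C D D'}
    {p0 q0 : hom C A D} {p1 q1 : hom C A' D'} (P : cell C (f · p1) (p0 · f'))
    (Q : cell C (f · q1) (q0 · f')) (c0 : cell C p0 q0) (c1 : cell C p1 q1) : Prop :=
  P • (c0 ▷ f') = (f ◁ c1) • Q.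

Lemma sq_mod_paste {A A' A'' D D' D''} {f : hom C A A'} {g : hom C A' A''} {f' : hom C D D'}
    {g' : hom C D' D''} {p0 q0 : hom C A D} {p1 q1 : hom C A' D'} {p2 q2 : hom C A'' D''}
    (P : cell C (f · p1) (p0 · f')) (P' : cell C (g · p2) (p1 · g'))
    (Q : cell C (f · q1) (q0 · f')) (Q' : cell C (g · q2) (q1 · g')) c0 c1 c2 :
  sq_mod P Q c0 c1 -> sq_mod P' Q' c1 c2 -> sq_mod (paste P P') (paste Q Q') c0 c2.
Proof.
  unfold sq_mod, paste. intros E1 E2. to_chains H. rwE2 H E1. rwE2 H E2. reflexivity.
Qed.

Lemma sq_mod_hside {A A' D D'} {f1 f : hom C A A'} {f' f1' : hom C D D'}
    {p0 q0 : hom C A D} {p1 q1 : hom C A' D'} (u : cell C f1 f) (u' : cell C f' f1')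
    (P : cell C (f · p1) (p0 · f')) (Q : cell C (f · q1) (q0 · f')) c0 c1 :
  sq_mod P Q c0 c1 -> sq_mod (hside u u' P) (hside u u' Q) c0 c1.
Proof. unfold sq_mod, hside. intros E1. to_chains H. slide H 2. rwE2 H E1. interch H. Qed.

(** The shape of the pentagon, three stacked squares against one. The vertical sides of the first
    and the last are changed along invertible cells, as happens when [- ⋊ Z] and [W ⋉ -] are
    replaced by tensoring with an identity. *)
Lemma sq_mod_pent {A A' D D' E E' B B'} {f : hom C A A'} {f' : hom C D D'} {f'' : hom C E E'}
    {f3 : hom C B B'} {p0 p0' : hom C A D} {p1 p1' : hom C A' D'} {q0 : hom C D E} {q1 : hom C D' E'}
    {r0 r0' : hom C E B} {r1 r1' : hom C E' B'} {s0 : hom C A B} {s1 : hom C A' B'}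
    (u1 : cell C p1' p1) (u0 : cell C p0' p0) (ui : cell C p0 p0')
    (v1 : cell C r1' r1) (v0 : cell C r0' r0) (vi : cell C r0 r0')
    (P : cell C (f · p1) (p0 · f')) (Q : cell C (f' · q1) (q0 · f''))
    (R : cell C (f'' · r1) (r0 · f3)) (S : cell C (f · s1) (s0 · f3)) c0 c1 :
  ui • u0 = id2 _ -> vi • v0 = id2 _ ->
  sq_mod (stack P (stack Q R)) S c0 c1 ->
  sq_mod (stack (vside u1 ui P) (stack Q (vside v1 vi R))) S
    ((u0 ▷ (q0 · r0')) • ((p0 ◁ (q0 ◁ v0)) • c0)) ((u1 ▷ (q1 · r1')) • ((p1 ◁ (q1 ◁ v1)) • c1)).
Proof.
  unfold sq_mod, vside, stack. intros E1 E2 E3. to_chains H.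
  down H 2 6. rwE2 H E1. rwE2 H E2. up H 3 1. rwE4 H E3. reflexivity.
Qed.

Lemma hside_hside {A A' D D'} {f2 f1 f : hom C A A'} {f' f1' f2' : hom C D D'}
    {p0 : hom C A D} {p1 : hom C A' D'} (w : cell C f2 f1) (w' : cell C f1' f2')
    (u : cell C f1 f) (u' : cell C f' f1') (P : cell C (f · p1) (p0 · f')) :
  hside w w' (hside u u' P) = hside (w • u) (u' • w') P.
Proof. unfold hside. to_chains H. reflexivity. Qed.

Lemma paste_hside_l {A A' A'' D D' D''} {f1 f : hom C A A'} {g : hom C A' A''}
    {f' f1' : hom C D D'} {g' : hom C D' D''}
    {p0 : hom C A D} {p1 : hom C A' D'} {p2 : hom C A'' D''}
    (u : cell C f1 f) (u' : cell C f' f1')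
    (P : cell C (f · p1) (p0 · f')) (P' : cell C (g · p2) (p1 · g')) :
  paste (hside u u' P) P' = hside (u ▷ g) (u' ▷ g') (paste P P').
Proof. unfold paste, hside. to_chains H. interch H. Qed.

Lemma paste_hside_r {A A' A'' D D' D''} {f : hom C A A'} {g1 g : hom C A' A''}
    {f' : hom C D D'} {g' g1' : hom C D' D''}
    {p0 : hom C A D} {p1 : hom C A' D'} {p2 : hom C A'' D''}
    (v : cell C g1 g) (v' : cell C g' g1')
    (P : cell C (f · p1) (p0 · f')) (P' : cell C (g · p2) (p1 · g')) :
  paste P (hside v v' P') = hside (f ◁ v) (f' ◁ v') (paste P P').
Proof. unfold paste, hside. to_chains H. interch H. Qed.

Lemma paste_assoc {A0 A1 A2 A3 D0 D1 D2 D3} {f : hom C A0 A1} {g : hom C A1 A2} {h : hom C A2 A3}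
    {f' : hom C D0 D1} {g' : hom C D1 D2} {h' : hom C D2 D3}
    {p0 : hom C A0 D0} {p1 : hom C A1 D1} {p2 : hom C A2 D2} {p3 : hom C A3 D3}
    (P : cell C (f · p1) (p0 · f')) (Q : cell C (g · p2) (p1 · g'))
    (R : cell C (h · p3) (p2 · h')) :
  paste P (paste Q R) = hside (associ _ _ _) (assoc _ _ _) (paste (paste P Q) R).
Proof. unfold paste, hside. to_chains H. interch H. Qed.

Definition post {fo} (F : pf C C fo) {A A' D D'} {f : hom C A A'} {f' : hom C D D'}
    {p0 : hom C A D} {p1 : hom C A' D'} (P : cell C (f · p1) (p0 · f')) :
    cell C (F @1 f · F @1 p1) (F @1 p0 · F @1 f') :=
  fc F f p1 • (F @2 P • fci F p0 f').

Lemma post_hside {fo} (F : pf C C fo) (HF : is_pf F) {A A' D D'} {f1 f : hom C A A'}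
    {f' f1' : hom C D D'} {p0 : hom C A D} {p1 : hom C A' D'} (u : cell C f1 f)
    (u' : cell C f' f1') (P : cell C (f · p1) (p0 · f')) :
  post F (hside u u' P) = hside (F @2 u) (F @2 u') (post F P).
Proof.
  unfold post, hside. to_chains H. image H. do 2 cancel_fc H. reflexivity.
Qed.

Lemma post_paste {fo} (F : pf C C fo) (HF : is_pf F)
    {A A' A'' D D' D''} {f : hom C A A'} {g : hom C A' A''}
    {f' : hom C D D'} {g' : hom C D' D''}
    {p0 : hom C A D} {p1 : hom C A' D'} {p2 : hom C A'' D''}
    (P : cell C (f · p1) (p0 · f')) (P' : cell C (g · p2) (p1 · g')) :
  post F (paste P P') = hside (fci F f g) (fc F f' g') (paste (post F P) (post F P')).
Proof.
  unfold post, hside, paste. to_chains H. image H. do 2 cancel_fc H. reflexivity. Qed.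

Lemma pn_split {fo go} {F : pf C C fo} {G : pf C C go} {d} {s : pn_of F G d} (Hs : is_pn F G s)
    A B E (f : hom C A B) (g : hom C B E) (e : fci F f g • fc F f g = id2 _) :
  nat1 s (f · g) = (fci F f g ▷ d E) •
    (assoc _ _ _ • ((F @1 f ◁ nat1 s g) • (associ _ _ _ •
        ((nat1 s f ▷ G @1 g) • (assoc _ _ _ • (d A ◁ fc G f g)))))).
Proof.
  rewrite <- (pn_fc Hs), (bc_assoc H), <- (bc_wr_comp H), e, (bc_wr_id H).
  symmetry; apply (bc_idl H).
Qed.

Lemma nat1_comp {fo go} {F : pf C C fo} {G : pf C C go} {d} {s : pn_of F G d} (Hs : is_pn F G s)
    A B E (f : hom C A B) (g : hom C B E) (e : fci F f g • fc F f g = id2 _) :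
  nat1 s (f · g) = hside (fci F f g) (fc G f g) (paste (nat1 s f) (nat1 s g)).
Proof.
  rewrite (pn_split Hs e). unfold hside, paste. to_chains H. interch H.
Qed.

(** Changes of horizontal sides cancel between consecutive squares, and the outermost ones are
    common to both stacks. *)
Lemma sq_mod_pent_hside {A A' D D' E E' B B' G G'}
    {f a : hom C A A'} {f' a' : hom C D D'} {f'' b' : hom C E E'}
    {f3 d' : hom C B B'} {g e' : hom C G G'}
    {p0 : hom C A D} {p1 : hom C A' D'} {q0 : hom C D E} {q1 : hom C D' E'}
    {r0 : hom C E B} {r1 : hom C E' B'} {s0 : hom C A G} {s1 : hom C A' G'}
    {t0 : hom C G B} {t1 : hom C G' B'}
    (u1 u5 : cell C a f) (u1' : cell C f' a') (u2 : cell C a' f') (u2' : cell C f'' b')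
    (u3 : cell C b' f'') (u3' u6' : cell C f3 d') (u5' : cell C g e') (u6 : cell C e' g)
    (P : cell C (f · p1) (p0 · f')) (Q : cell C (f' · q1) (q0 · f''))
    (R : cell C (f'' · r1) (r0 · f3)) (S : cell C (f · s1) (s0 · g))
    (T : cell C (g · t1) (t0 · f3)) c0 c1 :
  u1' • u2 = id2 _ -> u2' • u3 = id2 _ -> u5' • u6 = id2 _ -> u1 = u5 -> u3' = u6' ->
  sq_mod (stack P (stack Q R)) (stack S T) c0 c1 ->
  sq_mod (stack (hside u1 u1' P) (stack (hside u2 u2' Q) (hside u3 u3' R)))
    (stack (hside u5 u5' S) (hside u6 u6' T)) c0 c1.
Proof.
  intros E1 E2 E3 <- <- E6. rewrite (stack_hside _ _ _ _ E2), (stack_hside _ _ _ _ E1),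
    (stack_hside _ _ _ _ E3). now apply sq_mod_hside.
Qed.

(** Pentagons glue along a common component [c1]. This is what reduces the joint modification axiom
    to the axioms in the single variables. *)
Lemma sq_mod_pent_paste {A A' A'' D D' D'' E E' E'' B B' B'' G G' G''}
    {f1 : hom C A A'} {f2 : hom C D D'} {f3 : hom C E E'} {f4 : hom C B B'} {f5 : hom C G G'}
    {g1 : hom C A' A''} {g2 : hom C D' D''} {g3 : hom C E' E''} {g4 : hom C B' B''}
    {g5 : hom C G' G''}
    {p0 : hom C A D} {p1 : hom C A' D'} {p2 : hom C A'' D''}
    {q0 : hom C D E} {q1 : hom C D' E'} {q2 : hom C D'' E''}
    {r0 : hom C E B} {r1 : hom C E' B'} {r2 : hom C E'' B''}
    {s0 : hom C A G} {s1 : hom C A' G'} {s2 : hom C A'' G''}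
    {t0 : hom C G B} {t1 : hom C G' B'} {t2 : hom C G'' B''}
    (P : cell C (f1 · p1) (p0 · f2)) (Q : cell C (f2 · q1) (q0 · f3))
    (R : cell C (f3 · r1) (r0 · f4)) (S : cell C (f1 · s1) (s0 · f5))
    (T : cell C (f5 · t1) (t0 · f4))
    (P' : cell C (g1 · p2) (p1 · g2)) (Q' : cell C (g2 · q2) (q1 · g3))
    (R' : cell C (g3 · r2) (r1 · g4)) (S' : cell C (g1 · s2) (s1 · g5))
    (T' : cell C (g5 · t2) (t1 · g4)) c0 c1 c2 :
  sq_mod (stack P (stack Q R)) (stack S T) c0 c1 ->
  sq_mod (stack P' (stack Q' R')) (stack S' T') c1 c2 ->
  sq_mod (stack (paste P P') (stack (paste Q Q') (paste R R')))
    (stack (paste S S') (paste T T')) c0 c2.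
Proof. intros E1 E2. rewrite !stack_paste. now apply (sq_mod_paste (c1 := c1)). Qed.
End Squares.

(** * Coherence modifications of the tensor product *)

Section TensorCoh.
Context {O : Type} {C : bicat O} (H : is_bicat C) {b : bbin C} (Hb : is_bbin b).
Context (L : blcs b) (R : blcs (bbrev b)) (ex : bexchange L R)
  (HL : blcs_laws L) (HR : blcs_laws R) (FL : blcs_functor L).
Context (K : bconstr b) (HK : is_constr K) (AE : basc_exchange K L)
  (c : bcoh K) (Hc : coh_invertible c) (Hm : coh_modif (chosen_ccen K L R) c).
Local Notation lt X := (blt b X).
Local Notation rt X := (brt b X).
Local Notation "X ⊗ Y" := (btens b X Y) (at level 39, left associativity).
Local Notation x K k := (nat1 (@L _ _ K) k).
Local Notation xi K k := (nat1i (@L _ _ K) k).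
Local Notation α := (basc K).

Definition bt_l W {Y Y'} (f : hom C Y Y') : cell C (bt_1 (id1 C W) f) (lt W @1 f) :=
  (fui (rt Y) W ▷ _) • lun _.
Definition bt_li W {Y Y'} (f : hom C Y Y') : cell C (lt W @1 f) (bt_1 (id1 C W) f) :=
  luni _ • (fu (rt Y) W ▷ _).
Definition bt_r {X X'} (f : hom C X X') Z : cell C (bt_1 f (id1 C Z)) (rt Z @1 f) :=
  (_ ◁ fui (lt X') Z) • run _.
Definition bt_ri {X X'} (f : hom C X X') Z : cell C (rt Z @1 f) (bt_1 f (id1 C Z)) :=
  runi _ • (_ ◁ fu (lt X') Z).

(** [mon_constr] whiskers by tensoring with identity 1-cells, which agrees with [W ⋉ f] and [f ⋊ Z]
    only up to the unitors in [bt_l] and [bt_r]; the premonoidal cells are adjusted by these. *)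
Definition bt_coh : bcoh (mon_constr (bmon L K)) :=
  @BCoh _ _ _ (mon_constr (bmon L K))
  (fun W X Y Z => (bt_r (α W X Y) Z ▷ _) • (_ ◁ (_ ◁ bt_l W (α X Y Z))) • cp c W X Y Z)
  (fun W Y => (_ ◁ bt_l W (blam K Y)) • cm c W Y • bt_ri (brho K W) Y)
  (fun W Y => cl c W Y • bt_ri (blam K W) Y)
  (fun W Y => (_ ◁ bt_l W (brho K Y)) • cr c W Y).

Let Hlt X := proj1 Hb X.
Let Hrt X := proj2 Hb X.
Let HLp X X' (k : hom C X X') := proj1 HL X X' k.
Let HLm X X' (k k' : hom C X X') (a : cell C k k') := proj2 HL X X' k k' a.
Let H1 Y Z := proj1 (ic_a1 HK Y Z).
Let H2 Y Z := proj1 (ic_a2 HK Y Z).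
Let H3 Y Z := proj1 (ic_a3 HK Y Z).

Lemma fc_run {fo} (F : pf C C fo) (HF : is_pf F) A B (f : hom C A B) :
  fc F f (id1 C B) • F @2 run f = (F @1 f ◁ fui F B) • run _.
Proof.
  apply (cancel_l (a := F @1 f ◁ fu F B) (b := F @1 f ◁ fui F B) H).
  - now rewrite <- (bc_wl_comp H), (pf_fui_fu HF), (bc_wl_id H).
  - rewrite (pf_run HF), (bc_assoc H), <- (bc_wl_comp H), (pf_fu_fui HF), (bc_wl_id H).
    symmetry; apply (bc_idl H).
Qed.

Lemma fc_lun {fo} (F : pf C C fo) (HF : is_pf F) A B (f : hom C A B) :
  fc F (id1 C A) f • F @2 lun f = (fui F A ▷ F @1 f) • lun _.
Proof.
  apply (cancel_l (a := fu F A ▷ F @1 f) (b := fui F A ▷ F @1 f) H).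
  - now rewrite <- (bc_wr_comp H), (pf_fui_fu HF), (bc_wr_id H).
  - rewrite (pf_lun HF), (bc_assoc H), <- (bc_wr_comp H), (pf_fu_fui HF), (bc_wr_id H).
    symmetry; apply (bc_idl H).
Qed.

Lemma luni_fci {fo} (F : pf C C fo) (HF : is_pf F) A B (f : hom C A B) :
  F @2 luni f • fci F (id1 C A) f = luni _ • (fu F A ▷ F @1 f).
Proof.
  apply (cancel_l (a := fc F (id1 C A) f • F @2 lun f) (b := F @2 luni f • fci F (id1 C A) f) H).
  - rewrite (comp2_assoc H), (bc_assoc H (fci F _ _)), (pf_fci_fc HF), (bc_idl H).
    rewrite <- (pf_comp2 HF), (bc_luni_lun H). apply (pf_id2 HF).
  - transitivity (id2 (F @1 id1 C A · F @1 f)).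
    + rewrite (comp2_assoc H), (bc_assoc H (F @2 lun f)), <- (pf_comp2 HF), (bc_lun_luni H).
      rewrite (pf_id2 HF), (bc_idl H). apply (pf_fc_fci HF).
    + rewrite (fc_lun HF), (comp2_assoc H), (bc_assoc H (lun _)), (bc_lun_luni H), (bc_idl H).
      now rewrite <- (bc_wr_comp H), (pf_fui_fu HF), (bc_wr_id H).
Qed.

Lemma inverse_eq {A B} {f g : hom C A B} {a : cell C f g} {a1 a2 : cell C g f} :
  a1 • a = id2 _ -> a • a2 = id2 _ -> a1 = a2.
Proof.
  intros E1 E2. rewrite <- (bc_idr H a1), <- E2, (bc_assoc H), E1. apply (bc_idl H).
Qed.

Lemma Li_id X X' Y (k : hom C X X') :
  xi k (id1 C Y) = (rt Y @1 k ◁ fui (lt X') Y) • (run _ • (luni _ • (fu (lt X) Y ▷ rt Y @1 k))).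
Proof.
  apply (inverse_eq (pn_invi (HLp k) (id1 C Y))). to_chains H.
  rwE1 H (L_id H Hb HL Y k). rwE2 H (pf_fu_fui (Hlt X') Y). rwE2 H (pf_fui_fu (Hlt X) Y).
  reflexivity.
Qed.

(* The component at [(f, k)] of the tensor product of a transformation, having component
   [S] at [f], with an identity. *)
Lemma tensor_id_r X X' X'' V Z Z' (a : hom C X X') (d' : hom C X' X'') (d : hom C X V)
    (a' : hom C V X'') (S : cell C (a · d') (d · a')) (k : hom C Z Z') :
  bt_fc L a d' k (id1 C Z') • (bt_2 S (run k • luni k) • bt_fci L d a' (id1 C Z) k)
  = (bt_1 a k ◁ bt_r d' Z') • (assoc _ _ _ • ((rt Z @1 a ◁ x d' k) • (associ _ _ _ •
     (((fc (rt Z) a d' • (rt Z @2 S • fci (rt Z) d a')) ▷ lt X'' @1 k) • (assoc _ _ _ •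
     (bt_ri d Z ▷ bt_1 a' k)))))).
Proof.
  unfold bt_fc, bt_fci, bt_2, bt_r, bt_ri, bt_1. to_chains H.
  rwE1 H (pf_comp2 (Hlt X'') (run k) (luni k)).
  down H 2 3. rwE2 H (fc_run (Hlt X'') k). rwE2 H (luni_fci (Hlt X'') k).
  rwE1 H (Li_id Z a'). slide H 5. rwE2 H (pf_fu_fui (Hlt X'') Z). interch H.
Qed.

(** Mirror image of the preceding lemma. The exchange cell of [f] with [d] now enters inverted, and
    can be read as a right centrality cell of [d]. *)
Lemma tensor_id_l W W' Y Y' Y'' V (f : hom C W W') (a : hom C Y Y') (d' : hom C Y' Y'')
    (d : hom C Y V) (a' : hom C V Y'') (S : cell C (a · d') (d · a')) :
  bt_fc L f (id1 C W') a d' • (bt_2 (run f • luni f) S • bt_fci L (id1 C W) f d a')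
  = (bt_1 f a ◁ bt_l W' d') • (assoc _ _ _ •
     ((_ ◁ (fc (lt W') a d' • (lt W' @2 S • fci (lt W') d a'))) • (associ _ _ _ •
     ((xi f d ▷ lt W' @1 a') • (assoc _ _ _ • (bt_li W d ▷ bt_1 f a')))))).
Proof.
  unfold bt_fc, bt_fci, bt_2, bt_l, bt_li, bt_1. to_chains H.
  rwE1 H (pf_comp2 (Hrt Y) (run f) (luni f)).
  rwE1 H (L_unit H Hb FL W' a). slide H 3. rwE2 H (fc_run (Hrt Y) f).
  rwE2 H (pf_fu_fui (Hrt Y) W'). down H 2 4. rwE2 H (luni_fci (Hrt Y) f). interch H.
Qed.

Lemma bt_ri_r X X' (f : hom C X X') Z : bt_ri f Z • bt_r f Z = id2 _.
Proof.
  unfold bt_r, bt_ri, bt_1. to_chains H. rwE2 H (pf_fu_fui (Hlt X') Z). reflexivity.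
Qed.
Lemma bt_li_l W Y Y' (f : hom C Y Y') : bt_li W f • bt_l W f = id2 _.
Proof.
  unfold bt_l, bt_li, bt_1. to_chains H. rwE2 H (pf_fu_fui (Hrt Y) W). reflexivity.
Qed.

Lemma pn_unit {fo go} {F : pf C C fo} {G : pf C C go} {d} {s : pn_of F G d} (Hs : is_pn F G s)
    A (e : fui F A • fu F A = id2 _) :
  nat1 s (id1 C A) = (fui F A ▷ d A) • (lun _ • (runi _ • (d A ◁ fu G A))).
Proof.
  rewrite <- (pn_fu Hs), (bc_assoc H), <- (bc_wr_comp H), e, (bc_wr_id H).
  symmetry; apply (bc_idl H).
Qed.

Lemma on2_inv {fo} {F : pf C C fo} (HF : is_pf F) {A B} {f g : hom C A B} {a : cell C f g} {a'} :
  a • a' = id2 _ -> F @2 a • F @2 a' = id2 _.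
Proof. intro E. now rewrite <- (pf_comp2 HF), E, (pf_id2 HF). Qed.

Lemma fci_fc_comp {fo go} {F : pf C C fo} {G : pf C C go} (HF : is_pf F) (HG : is_pf G)
    A B E (f : hom C A B) (g : hom C B E) :
  fci (pf_comp F G) f g • fc (pf_comp F G) f g = id2 _.
Proof.
  cbn. rewrite (comp2_assoc H), (bc_assoc H (fci G _ _)), (pf_fci_fc HG), (bc_idl H).
  apply (on2_inv HG), (pf_fci_fc HF).
Qed.

Lemma fui_fu_comp {fo go} {F : pf C C fo} {G : pf C C go} (HF : is_pf F) (HG : is_pf G) A :
  fui (pf_comp F G) A • fu (pf_comp F G) A = id2 _.
Proof.
  cbn. rewrite (comp2_assoc H), (bc_assoc H (fui G _)), (pf_fui_fu HG), (bc_idl H).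
  apply (on2_inv HG), (pf_fui_fu HF).
Qed.

Lemma xi_R X X' Y Y' (f : hom C X X') (g : hom C Y Y') : xi f g = nat1 (@R _ _ g) f.
Proof. apply (proj2 (ex f g)). Qed.

Lemma asc_hside W W' X X' Y Y' (f : hom C W W') (g : hom C X X') (h : hom C Y Y') :
  bt_asc K f g h = hside (fci (rt Y) (rt X @1 f) (lt W' @1 g) ▷ lt (W' ⊗ X') @1 h)
     (assoc _ _ _ • (rt (X ⊗ Y) @1 f ◁ fc (lt W') (rt Y @1 g) (lt X' @1 h)))
     (paste (paste (nat1 (ba1 K X Y) f) (nat1 (ba2 K W' Y) g)) (nat1 (ba3 K W' X') h)).
Proof. unfold bt_asc, hside, paste, bt_1. to_chains H. interch H. Qed.

Lemma post_asc {fo} (F : pf C C fo) (HF : is_pf F) W W' X X' Y Y'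
    (f : hom C W W') (g : hom C X X') (h : hom C Y Y') :
  post F (bt_asc K f g h) =
  hside ((F @2 (fci (rt Y) (rt X @1 f) (lt W' @1 g) ▷ lt (W' ⊗ X') @1 h) • fci F _ _) • (fci F _ _ ▷ _))
    ((fc F _ _ ▷ _) • (fc F _ _ • F @2 (assoc _ _ _ • (rt (X ⊗ Y) @1 f ◁ fc (lt W') (rt Y @1 g) (lt X' @1 h)))))
  (paste (paste (post F (nat1 (ba1 K X Y) f)) (post F (nat1 (ba2 K W' Y) g))) (post F (nat1 (ba3 K W' X') h))).
Proof.
  rewrite asc_hside, (post_hside H HF), (post_paste H HF), (post_paste H HF), (paste_hside_l H), !(hside_hside H). reflexivity.
Qed.

(** The tensor factor [g ⊗ h] is split into its two 1-cells, so that there is one square for each of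
    the four variables. With [asc_tens_l], [asc_tens_r] and the two lemmas on images, all five faces
    of the pentagon become pastes of four columns. *)
Lemma asc_tens_mid W W' X X' Y Y' Z Z' (f : hom C W W') (g : hom C X X') (h : hom C Y Y')
    (k : hom C Z Z') :
  bt_asc K f (bt_1 g h) k
  = hside
     ((fci (rt Z) (rt (X ⊗ Y) @1 f) (lt W' @1 (bt_1 g h)) ▷ _) •
      (((_ ◁ (rt Z @2 fci (lt W') (rt Y @1 g) (lt X' @1 h) • fci (rt Z) _ _)) •
        associ _ _ _) ▷ _))
     (((assoc _ _ _ • (_ ◁ (fc (lt W') _ _ • lt W' @2 fc (rt Z) (rt Y @1 g) (lt X' @1 h)))) ▷ _) •
      (assoc _ _ _ • (_ ◁ fc (lt W') (rt Z @1 (bt_1 g h)) (lt (X' ⊗ Y') @1 k))))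
     (paste (paste (paste (nat1 (ba1 K (X ⊗ Y) Z) f) (nat1 (ba2 K W' Z) (rt Y @1 g)))
        (nat1 (ba2 K W' Z) (lt X' @1 h))) (nat1 (ba3 K W' (X' ⊗ Y')) k)).
Proof.
  rewrite asc_hside. unfold bt_1.
  rewrite (nat1_comp H (H2 W' Z) (fci_fc_comp (Hlt W') (Hrt Z) (rt Y @1 g) (lt X' @1 h))).
  rewrite (paste_hside_r H), (paste_assoc H), (hside_hside H), (paste_hside_l H), (hside_hside H).
  reflexivity.
Qed.

Lemma asc_tens_l W W' X X' Y Y' Z Z' (f : hom C W W') (g : hom C X X') (h : hom C Y Y')
    (k : hom C Z Z') :
  bt_asc K (bt_1 f g) h k
  = hside
     ((fci (rt Z) (rt Y @1 (bt_1 f g)) (lt (W' ⊗ X') @1 h) ▷ _) •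
      (((rt Z @2 fci (rt Y) (rt X @1 f) (lt W' @1 g) • fci (rt Z) _ _) ▷ _) ▷ _))
     (((fc (rt (Y ⊗ Z)) (rt X @1 f) (lt W' @1 g) ▷ _) ▷ _) •
      (assoc _ _ _ • (_ ◁ fc (lt (W' ⊗ X')) (rt Z @1 h) (lt Y' @1 k))))
     (paste (paste (paste (nat1 (ba1 K Y Z) (rt X @1 f)) (nat1 (ba1 K Y Z) (lt W' @1 g)))
        (nat1 (ba2 K (W' ⊗ X') Z) h)) (nat1 (ba3 K (W' ⊗ X') Y') k)).
Proof.
  rewrite asc_hside. unfold bt_1.
  rewrite (nat1_comp H (H1 Y Z) (fci_fc_comp (Hrt Y) (Hrt Z) (rt X @1 f) (lt W' @1 g))).
  rewrite (paste_hside_l H), (paste_hside_l H), (hside_hside H).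
  reflexivity.
Qed.

Lemma asc_tens_r W W' X X' Y Y' Z Z' (f : hom C W W') (g : hom C X X') (h : hom C Y Y')
    (k : hom C Z Z') :
  bt_asc K f g (bt_1 h k)
  = hside
     (((fci (rt (Y ⊗ Z)) (rt X @1 f) (lt W' @1 g) ▷ _) •
       (_ ◁ fci (lt (W' ⊗ X')) (rt Z @1 h) (lt Y' @1 k))) • associ _ _ _)
     (assoc _ _ _ • ((_ ◁ (fc (lt W') _ _ • lt W' @2 fc (lt X') (rt Z @1 h) (lt Y' @1 k))) •
      (assoc _ _ _ • (_ ◁ fc (lt W') (rt (Y ⊗ Z) @1 g) (lt X' @1 (bt_1 h k))))))
     (paste (paste (paste (nat1 (ba1 K X (Y ⊗ Z)) f) (nat1 (ba2 K W' (Y ⊗ Z)) g))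
        (nat1 (ba3 K W' X') (rt Z @1 h))) (nat1 (ba3 K W' X') (lt Y' @1 k))).
Proof.
  rewrite asc_hside. unfold bt_1.
  rewrite (nat1_comp H (H3 W' X') (pf_fci_fc (Hlt (W' ⊗ X')) (rt Z @1 h) (lt Y' @1 k))).
  rewrite (paste_hside_r H), (paste_assoc H), !(hside_hside H).
  reflexivity.
Qed.

Lemma paste_post_asc {fo} (F : pf C C fo) (HF : is_pf F) W W' X X' Y Y'
    (f : hom C W W') (g : hom C X X') (h : hom C Y Y')
    A D {k : hom C _ A} {k' : hom C _ D} {p} (S : cell C (k · p) (F @1 α W' X' Y' · k')) :
  paste (post F (bt_asc K f g h)) S
  = hside
     (((F @2 (fci (rt Y) (rt X @1 f) (lt W' @1 g) ▷ _) • fci F _ _) • (fci F _ _ ▷ _)) ▷ k)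
     (((fc F _ _ ▷ _) • (fc F _ _ • F @2 (assoc _ _ _ • (_ ◁ fc (lt W') (rt Y @1 g) (lt X' @1 h))))) ▷ k')
     (paste (paste (paste (post F (nat1 (ba1 K X Y) f)) (post F (nat1 (ba2 K W' Y) g)))
        (post F (nat1 (ba3 K W' X') h))) S).
Proof. rewrite (post_asc HF), (paste_hside_l H). reflexivity. Qed.

Lemma paste_asc_post {fo} (F : pf C C fo) (HF : is_pf F) W W' X X' Y Y'
    (f : hom C W W') (g : hom C X X') (h : hom C Y Y')
    A D {k : hom C A _} {k' : hom C D _} {p} (S : cell C (k · F @1 α W X Y) (p · k')) :
  paste S (post F (bt_asc K f g h))
  = hside
     (((k ◁ (((F @2 (fci (rt Y) (rt X @1 f) (lt W' @1 g) ▷ _) • fci F _ _) • (fci F _ _ ▷ _)))) •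
       associ _ _ _) • (associ _ _ _ ▷ _))
     ((assoc _ _ _ ▷ _) • (assoc _ _ _ •
      (k' ◁ ((fc F _ _ ▷ _) • (fc F _ _ • F @2 (assoc _ _ _ • (_ ◁ fc (lt W') (rt Y @1 g) (lt X' @1 h))))))))
     (paste (paste (paste S (post F (nat1 (ba1 K X Y) f))) (post F (nat1 (ba2 K W' Y) g)))
        (post F (nat1 (ba3 K W' X') h))).
Proof.
  rewrite (post_asc HF), (paste_hside_r H), (paste_assoc H), (paste_assoc H), (paste_hside_l H), !(hside_hside H).
  reflexivity.
Qed.

(** Once all five faces have four columns, the columns are the modification axioms of [cp] in its
    four variables, applied while the objects change one at a time. *)
Lemma sq_mod_asc W W' X X' Y Y' Z Z' (f : hom C W W') (g : hom C X X') (h : hom C Y Y')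
    (k : hom C Z Z') :
  sq_mod
    (stack (paste (post (rt Z) (bt_asc K f g h)) (x (α W' X' Y') k))
      (stack (bt_asc K f (bt_1 g h) k)
         (paste (xi f (α X Y Z)) (post (lt W') (bt_asc K g h k)))))
    (stack (bt_asc K (bt_1 f g) h k) (bt_asc K f g (bt_1 h k)))
    (cp c W X Y Z) (cp c W' X' Y' Z').
Proof.
  rewrite (paste_post_asc (Hrt Z)), asc_tens_mid, (paste_asc_post (Hlt W')), asc_tens_l, asc_tens_r.
  apply (sq_mod_pent_hside H).
  (* The goal about the squares comes first; the other five say that the compositors along common
     horizontal sides cancel or coincide. *)
  all: cycle 5.
  { apply (sq_mod_pent_paste H (c1 := cp c W' X' Y' Z)).
    - apply (sq_mod_pent_paste H (c1 := cp c W' X' Y Z)).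
      + apply (sq_mod_pent_paste H (c1 := cp c W' X Y Z)).
        * rewrite (xi_R f (α X Y Z)). exact (cp_mod1 Hm X Y Z f).
        * exact (cp_mod2 Hm W' Y Z g).
      + exact (cp_mod3 Hm W' X' Z h).
    - exact (cp_mod4 Hm W' X' Y' k). }
  all: unfold bt_1.
  - to_chains H. image H. do 3 cancel_fc H.
    rwE2 H (on2_inv (Hrt Z) (pf_fc_fci (Hlt W') (rt Y @1 g) (lt X' @1 h))). cancel_fc H.
    reflexivity.
  - to_chains H. image H. do 2 cancel_fc H.
    rwE2 H (on2_inv (Hlt W') (pf_fc_fci (Hrt Z) (rt Y @1 g) (lt X' @1 h))).
    do 2 cancel_fc H. reflexivity.
  - to_chains H. slide H 1. do 2 cancel_fc H. reflexivity.
  - to_chains H. image H. do 2 cancel_fc H. reflexivity.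
  - to_chains H. image H. do 2 cancel_fc H. interch H.
Qed.
Lemma bt_modif : mon_modif bt_coh.
Proof.
  constructor.
  - intros [[[W X] Y] Z] [[[W' X'] Y'] Z'] [[[f g] h] k].
    cbn [fst snd] in f, g, h, k.
    (* Tensoring the constraint with an identity adds to its image under [- ⋊ Z] a column for [k]:
       the exchange of [k] with the component of the constraint. *)
    assert (TP : bt_fc L (bt_1 (bt_1 f g) h) (α W' X' Y') k (id1 C Z') •
      (bt_2 (bt_asc K f g h) (run k • luni k)
        • bt_fci L (α W X Y) (bt_1 f (bt_1 g h)) (id1 C Z) k)
      = vside (bt_r (α W' X' Y') Z') (bt_ri (α W X Y) Z)
         (paste (post (rt Z) (bt_asc K f g h)) (x (α W' X' Y') k))).
    { rewrite tensor_id_r. unfold vside, paste. rewrite !(comp2_assoc H). reflexivity. }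
    assert (TR : bt_fc L f (id1 C W') (bt_1 (bt_1 g h) k) (α X' Y' Z') •
      (bt_2 (run f • luni f) (bt_asc K g h k)
        • bt_fci L (id1 C W) f (α X Y Z) (bt_1 g (bt_1 h k)))
      = vside (bt_l W' (α X' Y' Z')) (bt_li W (α X Y Z))
         (paste (xi f (α X Y Z)) (post (lt W') (bt_asc K g h k)))).
    { rewrite tensor_id_l. unfold vside, paste. rewrite !(comp2_assoc H). reflexivity. }
    (* By conversion, the modification condition is one on stacks of squares. *)
    match type of TP with ?P = _ => match type of TR with ?Q = _ =>
      change (sq_mod (stack P (stack (bt_asc K f (bt_1 g h) k) Q))
        (stack (bt_asc K (bt_1 f g) h k) (bt_asc K f g (bt_1 h k)))
        ((bt_r (α W X Y) Z ▷ _) • (_ ◁ (_ ◁ bt_l W (α X Y Z))) • cp c W X Y Z)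
        ((bt_r (α W' X' Y') Z' ▷ _) • (_ ◁ (_ ◁ bt_l W' (α X' Y' Z'))) • cp c W' X' Y' Z'))
    end end.
    rewrite TP, TR.
    apply (sq_mod_pent H); [ apply bt_ri_r | apply bt_li_l | apply sq_mod_asc ].
  - intros [W Y] [W' Y'] [f g]; cbn.
    rewrite tensor_id_r. rewrite tensor_id_l.
    unfold bt_asc, bt_lam, bt_rho, bt_1 in *. to_chains H. image H.
    do 2 cancel_fc H. slide H 4. cancel_fc H. rwE2 H (bt_li_l W (blam K Y)).
    (* The middle variable carries the identity of the unit object, so its constraint cell reduces
       to unitors. *)
    rwE1 H (pn_unit (H2 W' Y) (fui_fu_comp (Hlt W') (Hrt Y) (bI K))).
    (* [cm_mod1] is phrased with the right centrality of the component, to which the inverted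
       exchange cell of [f] has to be converted. *)
    rwE1 H (xi_R f (blam K Y)).
    down H 5 7. rwE2 H (on2_inv (Hlt W') (pf_fu_fui (Hrt Y) (bI K))).
    down H 4 6. rwE2 H (pf_fu_fui (Hlt W') (bI K ⊗ Y)).
    down H 4 8. rwE3 H (cm_mod1 Hm Y f).
    down H 1 4. rwE5 H (cm_mod2 Hm W' g).
    symmetry. image H.
    rwE2 H (bt_ri_r (brho K W') Y').
    do 2 cancel_fc H. interch H.
  - intros [W Y] [W' Y'] [f g]; cbn.
    rewrite tensor_id_r.
    unfold bt_asc, bt_lam, bt_rho, bt_1 in *. to_chains H.
    rwE1 H (pn_unit (H1 W Y) (fui_fu_comp (Hrt W) (Hrt Y) (bI K))).
    slide H 6. rwE2 H (pf_fu_fui (Hrt (W ⊗ Y)) (bI K)).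
    rwE2 H (pn_fc (proj1 (ic_lam HK)) (rt Y @1 f) (lt W' @1 g)).
    down H 2 5. rwE3 H (cl_mod1 Hm Y f).
    down H 1 3. rwE3 H (cl_mod2 Hm W' g).
    symmetry. image H.
    rwE2 H (bt_ri_r (blam K W') Y').
    do 2 cancel_fc H. interch H.
  - intros [W Y] [W' Y'] [f g]; cbn.
    rewrite tensor_id_l.
    unfold bt_asc, bt_lam, bt_rho, bt_1 in *. to_chains H. image H.
    do 2 cancel_fc H. slide H 4. cancel_fc H.
    rwE2 H (bt_li_l W (brho K Y)).
    rwE1 H (pn_unit (H3 W' Y') (pf_fui_fu (Hlt (W' ⊗ Y')) (bI K))).
    rwE1 H (xi_R f (brho K Y)).
    down H 3 6. rwE2 H (on2_inv (Hlt W') (pf_fu_fui (Hlt Y') (bI K))).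
    down H 2 5. rwE2 H (pf_fu_fui (Hlt W') (Y' ⊗ bI K)).
    down H 3 7. rwE3 H (cr_mod1 Hm Y f).
    down H 2 3. rwE5 H (cr_mod2 Hm W' g).
    symmetry.
    rwE1 H (pn_split H (proj1 (ic_rho HK)) (pf_fci_fc (Hrt (bI K)) (rt Y @1 f) (lt W' @1 g))).
    interch H.
Qed.
End TensorCoh.

Local Open Scope dbl_scope.

(** * Squares without boundaries *)

Section Untyped.
Context {B : dbl}.
Let ax := dbl_ax B.

(* Squares of all boundaries, with an error value: the compositions become total
   functions that are strictly associative. *)
Record psq := PS {
  p_A1 : B; p_A2 : B; p_A3 : B; p_A4 : B;
  p_f : hor p_A1 p_A2; p_u : ver p_A1 p_A3; p_v : ver p_A2 p_A4; p_g : hor p_A3 p_A4;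
  p_s : sq p_f p_u p_v p_g }.

Definition T := option psq.

Definition J {A1 A2 A3 A4 : B} {f : hor A1 A2} {u : ver A1 A3} {v : ver A2 A4}
    {g : hor A3 A4} (s : sq f u v g) : T := Some (PS s).

Lemma J_inj {A1 A2 A3 A4 : B} {f : hor A1 A2} {u : ver A1 A3} {v : ver A2 A4}
    {g : hor A3 A4} (s t : sq f u v g) : J s = J t -> s = t.
Proof.
  unfold J. intro E. injection E. intro E'.
  repeat match goal with H : existT _ _ _ = existT _ _ _ |- _ => apply inj_pair2 in H end.
  exact E'.
Qed.

Lemma J_eq {A1 A2 A3 A4 : B} {f f' : hor A1 A2} {u u' : ver A1 A3} {v v' : ver A2 A4}
    {g g' : hor A3 A4} (s : sq f u v g) (t : sq f' u' v' g') : s ≈ t -> J s = J t.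
Proof. now intros []. Qed.

Lemma J_cast {A1 A2 A3 A4 : B} {f f' : hor A1 A2} {u u' : ver A1 A3} {v v' : ver A2 A4}
    {g g' : hor A3 A4} (ef : f = f') (eu : u = u') (ev : v = v') (eg : g = g')
    (s : sq f u v g) : J (sq_cast ef eu ev eg s) = J s.
Proof. now destruct ef, eu, ev, eg. Qed.

Lemma sqeq_J {A1 A2 A3 A4 : B} {f f' : hor A1 A2} {u u' : ver A1 A3} {v v' : ver A2 A4}
    {g g' : hor A3 A4} (s : sq f u v g) (t : sq f' u' v' g') : J s = J t -> s ≈ t.
Proof.
  unfold J. intro E. injection E. intros _ Eg Ev Eu Ef.
  repeat match goal with H : existT _ _ _ = existT _ _ _ |- _ => apply inj_pair2 in H end.
  subst. apply J_inj in E. subst. constructor.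
Qed.

Definition bd (a : T) {A1 A2 A3 A4 : B} (f : hor A1 A2) (u : ver A1 A3) (v : ver A2 A4)
    (g : hor A3 A4) : Prop := exists x : sq f u v g, a = J x.

Definition hrel (a b c : T) : Prop :=
  exists (A1 A2 A3 D1 D2 D3 : B) (f : hor A1 A2) (f' : hor A2 A3) (g : hor D1 D2)
    (g' : hor D2 D3) (u : ver A1 D1) (v : ver A2 D2) (w : ver A3 D3)
    (x : sq f u v g) (y : sq f' v w g'), a = J x /\ b = J y /\ c = J (x ∥ y).

Definition vrel (a b c : T) : Prop :=
  exists (A1 A2 A3 D1 D2 D3 : B) (u : ver A1 A2) (u' : ver A2 A3) (v : ver D1 D2)
    (v' : ver D2 D3) (f : hor A1 D1) (g : hor A2 D2) (h : hor A3 D3)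
    (x : sq f u v g) (y : sq g u' v' h), a = J x /\ b = J y /\ c = J (x ⫽ y).

(** A partial composition is made total by choice: some composite where one exists, the error value
    otherwise. That there is at most one follows from injectivity of dependent pairs, in [hT_J] and
    [vT_J]. *)
Definition tot (r : T -> T -> T -> Prop) (a b : T) : T :=
  epsilon (inhabits None) (fun c => r a b c \/ ((forall c', ~ r a b c') /\ c = None)).

Definition hT := tot hrel.
Definition vT := tot vrel.

Lemma tot_spec r a b :
  r a b (tot r a b) \/ ((forall c', ~ r a b c') /\ tot r a b = None).
Proof.
  apply (epsilon_spec (inhabits None) (fun c => r a b c \/ ((forall c', ~ r a b c') /\ c = None))).
  destruct (classic (exists c, r a b c)) as [[c h]|n].
  - exists c. now left.
  - exists None. right. split; [ intros c' h; apply n; now exists c' | reflexivity ].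
Qed.

Ltac inj := repeat match goal with
  | E : Some _ = Some _ |- _ => injection E; clear E; intros
  | H : existT _ _ _ = existT _ _ _ |- _ => apply inj_pair2 in H
  | H : ?x = ?y |- _ => first [subst x | subst y] end.

Lemma hT_J {A1 A2 A3 D1 D2 D3 : B} {f : hor A1 A2} {f' : hor A2 A3} {g : hor D1 D2}
    {g' : hor D2 D3} {u : ver A1 D1} {v : ver A2 D2} {w : ver A3 D3}
    (x : sq f u v g) (y : sq f' v w g') : hT (J x) (J y) = J (x ∥ y).
Proof.
  destruct (tot_spec hrel (J x) (J y)) as [h|[n _]].
  - unfold hT. revert h. generalize (tot hrel (J x) (J y)). intros c h.
    destruct h as (a1&a2&a3&d1&d2&d3&f1&f1'&g1&g1'&u1&v1&w1&x1&y1&E1&E2&->).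
    unfold J in *. injection E1. injection E2. intros. inj. reflexivity.
  - exfalso. apply (n (J (x ∥ y))). repeat eexists.
Qed.

Lemma vT_J {A1 A2 A3 D1 D2 D3 : B} {u : ver A1 A2} {u' : ver A2 A3} {v : ver D1 D2}
    {v' : ver D2 D3} {f : hor A1 D1} {g : hor A2 D2} {h : hor A3 D3}
    (x : sq f u v g) (y : sq g u' v' h) : vT (J x) (J y) = J (x ⫽ y).
Proof.
  destruct (tot_spec vrel (J x) (J y)) as [h'|[n _]].
  - unfold vT. revert h'. generalize (tot vrel (J x) (J y)). intros c h'.
    destruct h' as (a1&a2&a3&d1&d2&d3&f1&f1'&g1&g1'&u1&v1&w1&x1&y1&E1&E2&->).
    unfold J in *. injection E1. injection E2. intros. inj. reflexivity.
  - exfalso. apply (n (J (x ⫽ y))). repeat eexists.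
Qed.

Lemma hT_def a b : hT a b <> None -> hrel a b (hT a b).
Proof. destruct (tot_spec hrel a b) as [h|[_ h]]; [ intros _; exact h | now intros [] ]. Qed.

Lemma vT_def a b : vT a b <> None -> vrel a b (vT a b).
Proof. destruct (tot_spec vrel a b) as [h|[_ h]]; [ intros _; exact h | now intros [] ]. Qed.

(** No boundaries have to be supplied: if one side is defined, its matching boundaries make the
    other side defined, and otherwise both are the error value. *)
Lemma hT_assoc a b c : hT (hT a b) c = hT a (hT b c).
Proof.
  destruct (classic (hT (hT a b) c = None)) as [E|n].
  - rewrite E. destruct (classic (hT a (hT b c) = None)) as [E'|n]; [ now rewrite E' | exfalso ].
    apply hT_def in n.
    destruct n as (a1&a2&a3&d1&d2&d3&f1&f1'&g1&g1'&u1&v1&w1&x1&y1&E1&E2&_).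
    assert (n : hT b c <> None) by (rewrite E2; discriminate).
    apply hT_def in n.
    destruct n as (a4&a5&a6&d4&d5&d6&f4&f4'&g4&g4'&u4&v4&w4&x4&y4&E4&E5&E6).
    rewrite E6 in E2. subst a b c. unfold J in E2. injection E2. intros. inj.
    change (hT (hT (J x1) (J x4)) (J y4) = None) in E. rewrite !hT_J in E. discriminate.
  - apply hT_def in n.
    destruct n as (a1&a2&a3&d1&d2&d3&f1&f1'&g1&g1'&u1&v1&w1&x1&y1&E1&E2&->).
    assert (n : hT a b <> None) by (rewrite E1; discriminate).
    apply hT_def in n.
    destruct n as (a4&a5&a6&d4&d5&d6&f4&f4'&g4&g4'&u4&v4&w4&x4&y4&E4&E5&E6).
    rewrite E6 in E1. subst a b c. unfold J in E1. injection E1. intros. inj.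
    rewrite !hT_J. apply J_eq, (hc_assoc ax).
Qed.

Lemma vT_assoc a b c : vT (vT a b) c = vT a (vT b c).
Proof.
  destruct (classic (vT (vT a b) c = None)) as [E|n].
  - rewrite E. destruct (classic (vT a (vT b c) = None)) as [E'|n]; [ now rewrite E' | exfalso ].
    apply vT_def in n.
    destruct n as (a1&a2&a3&d1&d2&d3&f1&f1'&g1&g1'&u1&v1&w1&x1&y1&E1&E2&_).
    assert (n : vT b c <> None) by (rewrite E2; discriminate).
    apply vT_def in n.
    destruct n as (a4&a5&a6&d4&d5&d6&f4&f4'&g4&g4'&u4&v4&w4&x4&y4&E4&E5&E6).
    rewrite E6 in E2. subst a b c. unfold J in E2. injection E2. intros. inj.
    change (vT (vT (J x1) (J x4)) (J y4) = None) in E. rewrite !vT_J in E. discriminate.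
  - apply vT_def in n.
    destruct n as (a1&a2&a3&d1&d2&d3&f1&f1'&g1&g1'&u1&v1&w1&x1&y1&E1&E2&->).
    assert (n : vT a b <> None) by (rewrite E1; discriminate).
    apply vT_def in n.
    destruct n as (a4&a5&a6&d4&d5&d6&f4&f4'&g4&g4'&u4&v4&w4&x4&y4&E4&E5&E6).
    rewrite E6 in E1. subst a b c. unfold J in E1. injection E1. intros. inj.
    rewrite !vT_J. apply J_eq, (vc_assoc ax).
Qed.
End Untyped.

(** * Calculation with untyped squares *)

Section Rules.
Context {B : dbl}.
Let ax := dbl_ax B.
Implicit Types a b c d : T (B:=B).

Lemma bd_J {A1 A2 A3 A4 : B} {f : hor A1 A2} {u : ver A1 A3} {v : ver A2 A4}
    {g : hor A3 A4} (x : sq f u v g) : bd (J x) f u v g.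
Proof. now exists x. Qed.

Lemma bd_conv a {A1 A2 A3 A4 : B} {f f' : hor A1 A2} {u u' : ver A1 A3} {v v' : ver A2 A4}
    {g g' : hor A3 A4} : bd a f u v g -> f = f' -> u = u' -> v = v' -> g = g' ->
  bd a f' u' v' g'.
Proof. now intros h <- <- <- <-. Qed.

Lemma bd_h {a b} {A1 A2 A3 D1 D2 D3 : B} {f : hor A1 A2} {f' : hor A2 A3} {g : hor D1 D2}
    {g' : hor D2 D3} {u : ver A1 D1} {v v' : ver A2 D2} {w : ver A3 D3} :
  bd a f u v g -> bd b f' v' w g' -> v = v' -> bd (hT a b) (f · f') u w (g · g').
Proof. intros [x ->] [y ->] <-. rewrite hT_J. apply bd_J. Qed.

Lemma bd_v {a b} {A1 A2 A3 D1 D2 D3 : B} {u : ver A1 A2} {u' : ver A2 A3} {v : ver D1 D2}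
    {v' : ver D2 D3} {f : hor A1 D1} {g g' : hor A2 D2} {h : hor A3 D3} :
  bd a f u v g -> bd b g' u' v' h -> g = g' -> bd (vT a b) f (u ⇣ u') (v ⇣ v') h.
Proof. intros [x ->] [y ->] <-. rewrite vT_J. apply bd_J. Qed.

(** Equality of composite boundaries does not split into equality of their factors, so interchange,
    unlike associativity, depends on the boundaries. Their equalities are propositional hypotheses,
    to be discharged by normalizing 1-cells. *)
Lemma IX {a b c d} {A1 A2 A3 D1 D2 D3 E1 E2 E3 : B}
    {f1 : hor A1 A2} {f2 : hor A2 A3} {g1 g1' : hor D1 D2} {g2 g2' : hor D2 D3}
    {h1 : hor E1 E2} {h2 : hor E2 E3}
    {u1 : ver A1 D1} {u2 u2' : ver A2 D2} {u3 : ver A3 D3}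
    {v1 : ver D1 E1} {v2 v2' : ver D2 E2} {v3 : ver D3 E3} :
  bd a f1 u1 u2 g1 -> bd b f2 u2' u3 g2 -> bd c g1' v1 v2 h1 -> bd d g2' v2' v3 h2 ->
  u2 = u2' -> g1 = g1' -> g2 = g2' -> v2 = v2' ->
  vT (hT a b) (hT c d) = hT (vT a c) (vT b d).
Proof.
  intros [x ->] [y ->] [z ->] [t ->] <- <- <- <-. rewrite !hT_J, !vT_J, !hT_J.
  apply f_equal, (dbl_interchange ax).
Qed.

Lemma vT_idl {a} {A1 A2 A3 A4 : B} {f f' : hor A1 A2} {u : ver A1 A3} {v : ver A2 A4}
    {g : hor A3 A4} : bd a f u v g -> f' = f -> vT (J (sqh f')) a = a.
Proof. intros [x ->] ->. rewrite vT_J. apply J_eq, (vc_idl ax). Qed.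

Lemma vT_idr {a} {A1 A2 A3 A4 : B} {f : hor A1 A2} {u : ver A1 A3} {v : ver A2 A4}
    {g g' : hor A3 A4} : bd a f u v g -> g' = g -> vT a (J (sqh g')) = a.
Proof. intros [x ->] ->. rewrite vT_J. apply J_eq, (vc_idr ax). Qed.

Lemma hT_idl {a} {A1 A2 A3 A4 : B} {f : hor A1 A2} {u u' : ver A1 A3} {v : ver A2 A4}
    {g : hor A3 A4} : bd a f u v g -> u' = u -> hT (J (sqv u')) a = a.
Proof. intros [x ->] ->. rewrite hT_J. apply J_eq, (hc_idl ax). Qed.

Lemma hT_idr {a} {A1 A2 A3 A4 : B} {f : hor A1 A2} {u : ver A1 A3} {v v' : ver A2 A4}
    {g : hor A3 A4} : bd a f u v g -> v' = v -> hT a (J (sqv v')) = a.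
Proof. intros [x ->] ->. rewrite hT_J. apply J_eq, (hc_idr ax). Qed.

Lemma J_hid (A : B) : J (sqh (hid A)) = J (sqv (vid A)).
Proof. apply f_equal, (sqh_sqv ax). Qed.

Lemma J_sqh_comp {A1 A2 A3 : B} (f : hor A1 A2) (g : hor A2 A3) :
  J (sqh (f · g)) = hT (J (sqh f)) (J (sqh g)).
Proof. rewrite (sqh_comp ax), hT_J. reflexivity. Qed.

Lemma J_sqv_comp {A1 A2 A3 : B} (u : ver A1 A2) (v : ver A2 A3) :
  J (sqv (u ⇣ v)) = vT (J (sqv u)) (J (sqv v)).
Proof. rewrite (sqv_comp ax), vT_J. reflexivity. Qed.

Lemma J_sqid {A1 A2 : B} {f g : hor A1 A2} (e : f = g) : J (sqid e) = J (sqh f).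
Proof. apply J_cast. Qed.

Lemma J_sqh_eq {A1 A2 : B} {f g : hor A1 A2} (e : f = g) : J (sqh f) = J (sqh g).
Proof. now destruct e. Qed.

Lemma J_sqv_eq {A1 A2 : B} {f g : ver A1 A2} (e : f = g) : J (sqv f) = J (sqv g).
Proof. now destruct e. Qed.

Lemma hcA {A1 A2 A3 A4 : B} (f : hor A1 A2) (g : hor A2 A3) (h : hor A3 A4) :
  (f · g) · h = f · (g · h). Proof. apply (hcompA ax). Qed.
Lemma hil {A1 A2 : B} (f : hor A1 A2) : hid A1 · f = f. Proof. apply (hidl ax). Qed.
Lemma hir {A1 A2 : B} (f : hor A1 A2) : f · hid A2 = f. Proof. apply (hidr ax). Qed.
Lemma vcA {A1 A2 A3 A4 : B} (f : ver A1 A2) (g : ver A2 A3) (h : ver A3 A4) :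
  (f ⇣ g) ⇣ h = f ⇣ (g ⇣ h). Proof. apply (vcompA ax). Qed.
Lemma vil {A1 A2 : B} (f : ver A1 A2) : vid A1 ⇣ f = f. Proof. apply (vidl ax). Qed.
Lemma vir {A1 A2 : B} (f : ver A1 A2) : f ⇣ vid A2 = f. Proof. apply (vidr ax). Qed.

Definition fsT {fo} (F : pdf B fo) a : T :=
  match a with Some x => J (fs F (p_s x)) | None => None end.

Lemma fsT_J {fo} (F : pdf B fo) {A1 A2 A3 A4 : B} {f : hor A1 A2} {u : ver A1 A3}
    {v : ver A2 A4} {g : hor A3 A4} (x : sq f u v g) : fsT F (J x) = J (fs F x).
Proof. reflexivity. Qed.

Lemma bd_fs {fo} (F : pdf B fo) {a} {A1 A2 A3 A4 : B} {f : hor A1 A2} {u : ver A1 A3}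
    {v : ver A2 A4} {g : hor A3 A4} :
  bd a f u v g -> bd (fsT F a) (fh F f) (fv F u) (fv F v) (fh F g).
Proof. intros [x ->]. apply bd_J. Qed.
End Rules.

#[export] Hint Rewrite @hcA @hil @hir @vcA @vil @vir @fv_id @fv_comp : dbl1.

Ltac n1 := first [reflexivity | cbn [HB comp1 id1]; autorewrite with dbl1; first [reflexivity | congruence | assumption] ].

Create HintDb bd discriminated.

(** Infers the boundary of a composite from its constituents, with unknown sides left to
    unification; [bdt] then adjusts it to the expected one. *)
Ltac bdi := lazymatch goal with
  | |- bd (J _) _ _ _ _ => first [ apply bd_J | eassumption ]
  | |- bd (hT _ _) _ _ _ _ => eapply bd_h; [ bdi | bdi | n1 ]
  | |- bd (vT _ _) _ _ _ _ => eapply bd_v; [ bdi | bdi | n1 ]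
  | |- bd (fsT ?F ?a) _ _ _ _ =>
      let H := fresh in eassert (H : bd a _ _ _ _) by bdi; exact (bd_fs F H)
  | |- bd ?a _ _ _ _ => first [ eassumption | solve [eauto with bd nocore] ]
  end.
Ltac bdt := eapply bd_conv; [ bdi | n1 | n1 | n1 | n1 ].

Ltac ixq a b c d E :=
  assert (E : vT (hT a b) (hT c d) = hT (vT a c) (vT b d)) by
    (eapply IX; [ bdi | bdi | bdi | bdi | n1 | n1 | n1 | n1 ]).
Ltac ix := match goal with |- context [vT (hT ?a ?b) (hT ?c ?d)] =>
  let E := fresh in ixq a b c d E; rewrite E; clear E end.
Ltac xi := match goal with |- context [hT (vT ?a ?c) (vT ?b ?d)] =>
  let E := fresh in ixq a b c d E; rewrite <- E; clear E end.

Ltac id1T := match goal with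
  | |- context [vT (J (sqh ?f)) ?a] =>
     let E := fresh in assert (E : vT (J (sqh f)) a = a) by (eapply vT_idl; [ bdi | n1 ]);
     rewrite E; clear E
  | |- context [vT (J (sqv (vid ?A))) ?a] =>
     let E := fresh in assert (E : vT (J (sqv (vid A))) a = a) by
       (rewrite <- J_hid; eapply vT_idl; [ bdi | n1 ]); rewrite E; clear E
  | |- context [vT ?a (J (sqh ?f))] =>
     let E := fresh in assert (E : vT a (J (sqh f)) = a) by (eapply vT_idr; [ bdi | n1 ]);
     rewrite E; clear E
  | |- context [vT ?a (J (sqv (vid ?A)))] =>
     let E := fresh in assert (E : vT a (J (sqv (vid A))) = a) by
       (rewrite <- J_hid; eapply vT_idr; [ bdi | n1 ]); rewrite E; clear E
  | |- context [hT (J (sqv ?f)) ?a] =>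
     let E := fresh in assert (E : hT (J (sqv f)) a = a) by (eapply hT_idl; [ bdi | n1 ]);
     rewrite E; clear E
  | |- context [hT (J (sqh (hid ?A))) ?a] =>
     let E := fresh in assert (E : hT (J (sqh (hid A))) a = a) by
       (rewrite J_hid; eapply hT_idl; [ bdi | n1 ]); rewrite E; clear E
  | |- context [hT ?a (J (sqv ?f))] =>
     let E := fresh in assert (E : hT a (J (sqv f)) = a) by (eapply hT_idr; [ bdi | n1 ]);
     rewrite E; clear E
  | |- context [hT ?a (J (sqh (hid ?A)))] =>
     let E := fresh in assert (E : hT a (J (sqh (hid A))) = a) by
       (rewrite J_hid; eapply hT_idr; [ bdi | n1 ]); rewrite E; clear E
  end.
Ltac idT := repeat id1T.
Ltac idF := repeat first [ rewrite <- J_sqh_comp | id1T ].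

Ltac pushJ := repeat first [ rewrite J_cast | rewrite J_sqid | rewrite <- hT_J | rewrite <- vT_J
  | rewrite J_sqh_comp ].
Ltac toT := apply J_inj; cbn [HB hom cell comp1 comp2 id1 id2 whiskl whiskr assoc associ lun luni run runi];
  pushJ; rewrite ?hT_assoc, ?vT_assoc.

Section HBicat.
Context (B : dbl).

(** The coherence cells are transported identity squares. Without boundaries they are plain
    identities, and every axiom is a matter of unit laws and interchange. *)
Lemma HB_bicat : is_bicat (HB B).
Proof.
  constructor; intros; toT.
  all: repeat (id1T || ix); try reflexivity.
  all: repeat xi; repeat id1T; try reflexivity.
Qed.
End HBicat.

(** * Companions and companion-lifts *)

Section Comp.
Context {B : dbl}.
Let ax := dbl_ax B.
Implicit Types a c d e : T (B:=B).

(* [e] is the counit [ε] of [x] as a companion of [u]. *)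
Definition LC {A A' : B} (x : hor A A') (u : ver A A') e : Prop :=
  bd e x u (vid A') (hid A') /\ exists η, bd η (hid A) (vid A) u x /\
    hT η e = J (sqh x) /\ vT η e = J (sqv u).

Lemma LC_companion {A A' : B} {u : ver A A'} (c : companion u) :
  LC (comp_h c) u (J (comp_eps c)).
Proof.
  split; [ apply bd_J | ]. exists (J (comp_eta c)). split; [ apply bd_J | ].
  rewrite hT_J, vT_J. split; apply J_eq; apply c.
Qed.

Lemma LC_bd {A A' : B} {x : hor A A'} {u : ver A A'} {e} : LC x u e -> bd e x u (vid A') (hid A').
Proof. now intros []. Qed.

(* [m] is the canonical comparison between two companions of the same 1v-cell *)
Definition TH {A A' : B} (x y : hor A A') e e' (m : T (B:=B)) : Prop :=
  bd m x (vid A) (vid A') y /\ vT m e' = e.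

(** Such a cell equals [[η | e]] with [η] the unit of [y]: interchange applied to [n] beside the
    zigzag identity [[η | e'] = Id]. *)
Lemma TH_uniq {A A' : B} {x y : hor A A'} {e e' m m'} {u : ver A A'} : LC y u e' ->
  TH x y e e' m -> TH x y e e' m' -> m = m'.
Proof.
  intros [b [η (b1 & h1 & h2)]] [b2 E2] [b3 E3].
  assert (G : forall n, bd n x (vid A) (vid A') y -> vT n e' = e -> n = hT η e).
  { intros n bn En. rewrite <- En.
    transitivity (vT (hT (J (sqh (hid A))) n) (hT η e')).
    - rewrite h1. idT. reflexivity.
    - ix. idT. reflexivity. }
  rewrite (G m), (G m'); trivial.
Qed.

(** The unit of [y] is pasted to the counit of [x]; the vertical zigzag identity of [y] gives
    compatibility with the counits. *)
Lemma TH_exists {A A' : B} {x y : hor A A'} {e e'} {u : ver A A'} : LC x u e -> LC y u e' ->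
  exists m : sq x (vid A) (vid A') y, TH x y e e' (J m).
Proof.
  intros [b [η (b1 & h1 & h2)]] [b' [η' (b1' & h1' & h2')]].
  assert (G : bd (hT η' e) x (vid A) (vid A') y).
  { bdt. }
  destruct G as [m Em]. exists m. split; [ apply bd_J | ]. rewrite <- Em.
  transitivity (vT (hT η' e) (hT e' (J (sqh (hid A'))))).
  - idT. reflexivity.
  - ix. rewrite h2'. idT. reflexivity.
Qed.

Definition th {A A' : B} {x y : hor A A'} {e e'} {u : ver A A'} (h : LC x u e) (h' : LC y u e') :=
  constructive_indefinite_description _ (TH_exists h h').

Lemma LC_id (A : B) : LC (hid A) (vid A) (J (sqh (hid A))).
Proof.
  split; [ apply bd_conv with (1 := bd_J (sqh (hid A))); reflexivity | ].
  exists (J (sqh (hid A))). repeat split.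
  - apply bd_J.
  - rewrite <- J_sqh_comp. apply J_sqh_eq, hil.
  - rewrite !J_hid, <- J_sqv_comp. apply J_sqv_eq, vil.
Qed.

(* The counit of a composite of companions. *)
Definition cmp {A A' : B} e (y : hor A A') d := vT (hT e (J (sqh y))) d.

Lemma LC_cmp {A A' A'' : B} {x : hor A A'} {u : ver A A'} {e} {y : hor A' A''} {v : ver A' A''} {d} :
  LC x u e -> LC y v d -> LC (x · y) (u ⇣ v) (cmp e y d).
Proof.
  intros [b [η (b1 & h1 & h2)]] [b' [η' (b1' & h1' & h2')]].
  split; [ unfold cmp; bdt | ]. exists (vT η (hT (J (sqh x)) η')). split; [ bdt | split ].
  - unfold cmp. transitivity (vT (hT η (hT e (J (sqh y)))) (hT (hT (J (sqh x)) η') d)).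
    + ix. reflexivity.
    + rewrite <- hT_assoc, h1, hT_assoc, h1', <- !J_sqh_comp. idT. reflexivity.
  - unfold cmp. rewrite vT_assoc, <- (vT_assoc (hT _ η')). ix. idT.
    transitivity (vT η (vT (vT (hT e (J (sqh (hid A')))) (hT (J (sqh (hid A'))) η')) d)).
    + ix. idT. reflexivity.
    + idT. rewrite vT_assoc, h2', <- vT_assoc, h2. symmetry; apply J_sqv_comp.
Qed.

(** Counits of composites are strictly associative, which is why an associator is a comparison. *)
Lemma cmp_assoc {A1 A2 A3 A4 : B} {x : hor A1 A2} {y : hor A2 A3} {z : hor A3 A4} {u v w e d c} :
  LC x u e -> LC y v d -> LC z w c -> cmp (cmp e y d) z c = cmp e (y · z) (cmp d z c).
Proof.
  intros [b _] [b' _] [b'' _]. unfold cmp.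
  rewrite J_sqh_comp, <- vT_assoc, <- hT_assoc.
  transitivity (vT (hT (vT (hT e (J (sqh y))) d) (vT (J (sqh z)) (J (sqh z)))) c).
  - idT. reflexivity.
  - xi. reflexivity.
Qed.

Lemma TH_comp {A A' : B} {x y z : hor A A'} {e e' e'' m n} :
  TH x y e e' m -> TH y z e' e'' n -> TH x z e e'' (vT m n).
Proof.
  intros [b E] [b' E']. split; [ bdt | ]. now rewrite vT_assoc, E', E.
Qed.

Lemma TH_id {A A' : B} {x : hor A A'} {u e} : LC x u e -> TH x x e e (J (sqh x)).
Proof. intros [b _]. split; [ apply bd_J | idT; reflexivity ]. Qed.

Lemma TH_eq {A A' : B} {x y : hor A A'} {u e} : LC x u e -> x = y -> TH x y e e (J (sqh x)).
Proof. intros h <-. now apply (TH_id h). Qed.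

Lemma TH_inv {A A' : B} {x y : hor A A'} {e e' m n u} : LC y u e' ->
  TH x y e e' m -> bd n y (vid A) (vid A') x -> vT n m = J (sqh y) -> TH y x e' e n.
Proof.
  intros [b1 _] [b E] b' E'. split; [ exact b' | ]. rewrite <- E, <- vT_assoc, E'. idT. reflexivity.
Qed.

Lemma TH_wl {A A' A'' : B} {x : hor A A'} {y y' : hor A' A''} {e d d' n u v} :
  LC x u e -> LC y' v d' -> TH y y' d d' n ->
  TH (x · y) (x · y') (cmp e y d) (cmp e y' d') (hT (J (sqh x)) n).
Proof.
  intros [b _] [b' _] [b'' E]. split; [ bdt | ]. unfold cmp. rewrite <- vT_assoc. ix. idT.
  rewrite <- E.
  transitivity (vT (vT (hT e (J (sqh y))) (hT (J (sqh (hid A'))) n)) d').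
  - ix. idT. reflexivity.
  - idT. apply vT_assoc.
Qed.

Lemma TH_wr {A A' A'' : B} {x x' : hor A A'} {y : hor A' A''} {e e' d m u v} :
  LC x' u e' -> LC y v d -> TH x x' e e' m ->
  TH (x · y) (x' · y) (cmp e y d) (cmp e' y d) (hT m (J (sqh y))).
Proof.
  intros [b _] [b' _] [b'' E]. split; [ bdt | ]. unfold cmp. rewrite <- vT_assoc. ix. idT.
  now rewrite E.
Qed.

Lemma TH_assoc {A1 A2 A3 A4 : B} {x : hor A1 A2} {y : hor A2 A3} {z : hor A3 A4} {u v w e d c} :
  LC x u e -> LC y v d -> LC z w c ->
  TH ((x · y) · z) (x · (y · z)) (cmp (cmp e y d) z c) (cmp e (y · z) (cmp d z c)) (J (sqh ((x · y) · z))).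
Proof.
  intros h1 h2 h3. rewrite (cmp_assoc h1 h2 h3).
  apply (TH_eq (u := u ⇣ (v ⇣ w))); [ | apply hcA ].
  rewrite <- (cmp_assoc h1 h2 h3), <- vcA. now repeat apply LC_cmp.
Qed.

Lemma cmp_idl {A A' : B} {y : hor A A'} {v d} : LC y v d -> cmp (J (sqh (hid A))) y d = d.
Proof. intros [b _]. unfold cmp. idT. reflexivity. Qed.

Lemma cmp_idr {A A' : B} {y : hor A A'} {v d} : LC y v d -> cmp d (hid A') (J (sqh (hid A'))) = d.
Proof. intros [b _]. unfold cmp. idT. reflexivity. Qed.

Local Notation HB := (HB B).
Lemma J_comp2 {A A' : B} {f g h : hom HB A A'} (s : cell HB f g) (t : cell HB g h) :
  J (comp2 HB s t) = vT (J s) (J t).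
Proof. etransitivity; [ apply J_cast | symmetry; apply vT_J ]. Qed.
Lemma J_id2 {A A' : B} (f : hom HB A A') : J (id2 f) = J (sqh f).
Proof. reflexivity. Qed.
Lemma J_wl {A A' A'' : B} (f : hom HB A A') {g h : hom HB A' A''} (t : cell HB g h) :
  J (whiskl f t) = hT (J (sqh f)) (J t).
Proof. symmetry. apply hT_J. Qed.
Lemma J_wr {A A' A'' : B} {f g : hom HB A A'} (h : hom HB A' A'') (t : cell HB f g) :
  J (whiskr h t) = hT (J t) (J (sqh h)).
Proof. symmetry. apply hT_J. Qed.
Lemma J_assoc {A A' A'' A3 : B} (f : hom HB A A') (g : hom HB A' A'') (h : hom HB A'' A3) :
  J (assoc f g h) = J (sqh (f · g · h)).
Proof. apply J_sqid. Qed.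
Lemma J_associ {A A' A'' A3 : B} (f : hom HB A A') (g : hom HB A' A'') (h : hom HB A'' A3) :
  J (associ f g h) = J (sqh (f · (g · h))).
Proof. apply J_sqid. Qed.
Lemma J_lun {A A' : B} (f : hom HB A A') : J (lun f) = J (sqh (f : hor A A')).
Proof. etransitivity; [ apply J_sqid | apply J_sqh_eq, hil ]. Qed.
Lemma J_luni {A A' : B} (f : hom HB A A') : J (luni f) = J (sqh (f : hor A A')).
Proof. apply J_sqid. Qed.
Lemma J_run {A A' : B} (f : hom HB A A') : J (run f) = J (sqh (f : hor A A')).
Proof. etransitivity; [ apply J_sqid | apply J_sqh_eq, hir ]. Qed.
Lemma J_runi {A A' : B} (f : hom HB A A') : J (runi f) = J (sqh (f : hor A A')).
Proof. apply J_sqid. Qed.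

Section Functor.
Context {fo : B -> B} (F : pdf B fo) (HF : is_pdf F).
Let HP := pdf_H HF.

Lemma fsT_sqh {A A' : B} (f : hor A A') : fsT F (J (sqh f)) = J (sqh (fh F f)).
Proof. rewrite fsT_J. apply J_eq, (pdf_sqh HF). Qed.

Lemma fsT_v {A1 A2 A3 A4 A5 A6 : B} {a c} {f : hor A1 A2} {u : ver A1 A3} {v : ver A2 A4}
    {g g' : hor A3 A4} {u' : ver A3 A5} {v' : ver A4 A6} {h : hor A5 A6} :
  bd a f u v g -> bd c g' u' v' h -> g = g' -> fsT F (vT a c) = vT (fsT F a) (fsT F c).
Proof.
  intros [x ->] [y ->] <-. rewrite vT_J, !fsT_J, vT_J. apply J_eq, (pdf_vc HF).
Qed.

Lemma fsT_h {A1 A2 A3 D1 D2 D3 : B} {a c} {f : hor A1 A2} {f' : hor A2 A3}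
    {g : hor D1 D2} {g' : hor D2 D3} {u : ver A1 D1} {v v' : ver A2 D2} {w : ver A3 D3} :
  bd a f u v g -> bd c f' v' w g' -> v = v' ->
  vT (hT (fsT F a) (fsT F c)) (J (dfc F g g')) = vT (J (dfc F f f')) (fsT F (hT a c)).
Proof.
  intros [x ->] [y ->] <-. rewrite hT_J, !fsT_J, hT_J, !vT_J. apply J_eq, (pdf_dfc HF).
Qed.

Lemma fsT_sqv {A A' : B} (u : ver A A') :
  vT (J (sqv (fv F u))) (J (dfu F A')) = vT (J (dfu F A)) (fsT F (J (sqv u))).
Proof. rewrite fsT_J, !vT_J. apply J_eq, (pdf_dfu HF). Qed.

Lemma J_fsg {A A' : B} {f g : hor A A'} (s : sq f (vid A) (vid A') g) :
  J (fsg F s) = fsT F (J s).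
Proof. apply J_cast. Qed.

Lemma to_J {A A' : B} {f g : hom HB A A'} {s t : cell HB f g} : s = t -> J s = J t.
Proof. now intros <-. Qed.

Lemma dfu_dfui A : vT (J (dfu F A)) (J (dfui F A)) = J (sqh (hid (fo A))).
Proof. generalize (to_J (pf_fu_fui HP A)). rewrite J_comp2. exact id. Qed.
Lemma dfui_dfu A : vT (J (dfui F A)) (J (dfu F A)) = J (sqh (fh F (hid A))).
Proof. generalize (to_J (pf_fui_fu HP A)). rewrite J_comp2. exact id. Qed.
Lemma dfc_dfci {A1 A2 A3 : B} (f : hor A1 A2) (g : hor A2 A3) :
  vT (J (dfc F f g)) (J (dfci F f g)) = J (sqh (fh F f · fh F g)).
Proof. generalize (to_J (pf_fc_fci HP f g)). rewrite J_comp2. exact id. Qed.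
Lemma dfci_dfc {A1 A2 A3 : B} (f : hor A1 A2) (g : hor A2 A3) :
  vT (J (dfci F f g)) (J (dfc F f g)) = J (sqh (fh F (f · g))).
Proof. generalize (to_J (pf_fci_fc HP f g)). rewrite J_comp2. exact id. Qed.

End Functor.
End Comp.

(* Evaluates [J] on the operations of [HB]; the boundaries recorded in [J] may differ from
   those of the lemmas by conversion. *)
Ltac rJ1 := match goal with
  | |- context [@J ?B ?a1 ?a2 ?a3 ?a4 ?f ?u ?v ?g ?s] =>
    let t := constr:(@J B a1 a2 a3 a4 f u v g s) in
    lazymatch s with
    | comp2 _ ?a ?b => rewrite (J_comp2 a b : t = _)
    | id2 ?f => rewrite (J_id2 f : t = _)
    | whiskl ?f ?a => rewrite (J_wl f a : t = _)
    | whiskr ?f ?a => rewrite (J_wr f a : t = _)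
    | assoc ?f ?g ?h => rewrite (J_assoc f g h : t = _)
    | associ ?f ?g ?h => rewrite (J_associ f g h : t = _)
    | lun ?f => rewrite (J_lun f : t = _)
    | luni ?f => rewrite (J_luni f : t = _)
    | run ?f => rewrite (J_run f : t = _)
    | runi ?f => rewrite (J_runi f : t = _)
    | sq_cast ?p ?q ?r ?w ?a => rewrite (J_cast p q r w a : t = _)
    | hc ?a ?b => rewrite (eq_sym (hT_J a b) : t = _)
    | vc ?a ?b => rewrite (eq_sym (vT_J a b) : t = _)
    | sqid ?e => rewrite (J_sqid e : t = _)
    | fsg ?F ?a => rewrite (J_fsg F a : t = _)
    | on2 (Hpf ?F) _ _ _ _ ?a => rewrite (J_fsg F a : t = _)
    | fc (Hpf ?F) ?x ?y => change t with (J (dfc F x y))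
    | fci (Hpf ?F) ?x ?y => change t with (J (dfci F x y))
    | fu (Hpf ?F) ?x => change t with (J (dfu F x))
    | fui (Hpf ?F) ?x => change t with (J (dfui F x))
    | on2 (blt (Hbin ?b) ?X) _ _ _ _ ?a => rewrite (J_fsg (lt b X) a : t = _)
    | fc (blt (Hbin ?b) ?X) ?x ?y => change t with (J (dfc (lt b X) x y))
    | fci (blt (Hbin ?b) ?X) ?x ?y => change t with (J (dfci (lt b X) x y))
    | fu (blt (Hbin ?b) ?X) ?x => change t with (J (dfu (lt b X) x))
    | fui (blt (Hbin ?b) ?X) ?x => change t with (J (dfui (lt b X) x))
    | on2 (brt (Hbin ?b) ?X) _ _ _ _ ?a => rewrite (J_fsg (rt b X) a : t = _)
    | fc (brt (Hbin ?b) ?X) ?x ?y => change t with (J (dfc (rt b X) x y))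
    | fci (brt (Hbin ?b) ?X) ?x ?y => change t with (J (dfci (rt b X) x y))
    | fu (brt (Hbin ?b) ?X) ?x => change t with (J (dfu (rt b X) x))
    | fui (brt (Hbin ?b) ?X) ?x => change t with (J (dfui (rt b X) x))
    | on2 (pf_comp ?p ?q) _ _ _ _ ?a =>
        change t with (J (on2 q _ _ _ _ (on2 p _ _ _ _ a)))
    | fc (pf_comp ?p ?q) ?x ?y =>
        change t with (J (comp2 _ (fc q (on1 p _ _ x) (on1 p _ _ y)) (on2 q _ _ _ _ (fc p x y))))
    | fci (pf_comp ?p ?q) ?x ?y =>
        change t with (J (comp2 _ (on2 q _ _ _ _ (fci p x y)) (fci q (on1 p _ _ x) (on1 p _ _ y))))
    | fu (pf_comp ?p ?q) ?x =>
        change t with (J (comp2 _ (fu q _) (on2 q _ _ _ _ (fu p x))))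
    | fui (pf_comp ?p ?q) ?x =>
        change t with (J (comp2 _ (on2 q _ _ _ _ (fui p x)) (fui q _)))
    end end.
Ltac rJ := repeat rJ1.

Section Functor.
Context {B : dbl} {fo : B -> B} (F : pdf B fo) (HF : is_pdf F).
Let HP := pdf_H HF.
Implicit Types a c d e : T (B:=B).

Lemma dfu_dfc_l {A A' : B} (f : hor A A') :
  vT (hT (J (dfu F A)) (J (sqh (fh F f)))) (J (dfc F (hid A) f)) = J (sqh (fh F f)).
Proof.
  pose proof (to_J (pf_lun HP f)) as E. revert E. rJ. cbn [Hpf on1 on2 fu fc].
  rewrite (fsT_sqh HF), <- vT_assoc.
  idT. exact id.
Qed.

Lemma dfu_dfc_r {A A' : B} (f : hor A A') :
  vT (hT (J (sqh (fh F f))) (J (dfu F A'))) (J (dfc F f (hid A'))) = J (sqh (fh F f)).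
Proof.
  pose proof (to_J (pf_run HP f)) as E. revert E. rJ. cbn [Hpf on1 on2 fu fc].
  rewrite (fsT_sqh HF), <- vT_assoc.
  idT. exact id.
Qed.

(** The unit axiom solved for the compositor. Counits of images end in a unitor, so this form occurs
    whenever they are composed. *)
Lemma dfc_hid_l {A A' : B} (f : hor A A') :
  J (dfc F (hid A) f) = hT (J (dfui F A)) (J (sqh (fh F f))).
Proof.
  transitivity (vT (vT (hT (J (dfui F A)) (J (sqh (fh F f)))) (hT (J (dfu F A)) (J (sqh (fh F f)))))
     (J (dfc F (hid A) f))).
  - ix. rewrite (dfui_dfu HF). idT. rewrite <- J_sqh_comp. idT. reflexivity.
  - rewrite vT_assoc, dfu_dfc_l. idT. reflexivity.
Qed.

Lemma dfc_hid_r {A A' : B} (f : hor A A') :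
  J (dfc F f (hid A')) = hT (J (sqh (fh F f))) (J (dfui F A')).
Proof.
  transitivity (vT (vT (hT (J (sqh (fh F f))) (J (dfui F A'))) (hT (J (sqh (fh F f))) (J (dfu F A'))))
     (J (dfc F f (hid A')))).
  - ix. rewrite (dfui_dfu HF). idT. rewrite <- J_sqh_comp. idT. reflexivity.
  - rewrite vT_assoc, dfu_dfc_r. idT. reflexivity.
Qed.

Lemma dfci_dfui_r {A A' : B} (f : hor A A') :
  vT (J (dfci F f (hid A'))) (hT (J (sqh (fh F f))) (J (dfui F A'))) = J (sqh (fh F f)).
Proof.
  rewrite <- dfc_hid_r, (dfci_dfc HF). apply J_sqh_eq. f_equal. apply hir.
Qed.

Lemma dfci_dfui_l {A A' : B} (f : hor A A') :
  vT (J (dfci F (hid A) f)) (hT (J (dfui F A)) (J (sqh (fh F f)))) = J (sqh (fh F f)).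
Proof.
  rewrite <- dfc_hid_l, (dfci_dfc HF). apply J_sqh_eq. f_equal. apply hil.
Qed.

Lemma fsT_h' {A1 A2 A3 D1 D2 D3 : B} {a c} {f : hor A1 A2} {f' : hor A2 A3}
    {g : hor D1 D2} {g' : hor D2 D3} {u : ver A1 D1} {v v' : ver A2 D2} {w : ver A3 D3} :
  bd a f u v g -> bd c f' v' w g' -> v = v' ->
  vT (J (dfci F f f')) (hT (fsT F a) (fsT F c)) = vT (fsT F (hT a c)) (J (dfci F g g')).
Proof.
  intros b b' E.
  transitivity (vT (J (dfci F f f')) (vT (vT (hT (fsT F a) (fsT F c)) (J (dfc F g g'))) (J (dfci F g g')))).
  - rewrite (vT_assoc _ (J (dfc F g g'))), (dfc_dfci HF). idT. reflexivity.
  - rewrite (fsT_h HF b b' E), <- !vT_assoc, (dfci_dfc HF). idT. reflexivity.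
Qed.

(* The counit of the image under [F] of a companion. *)
Definition FE e (A' : B) := vT (fsT F e) (J (dfui F A')).

(** The unit is the image of [η] below the unitor. The horizontal zigzag follows from naturality of
    the compositor and the unit axioms, the vertical one from naturality of the unitor in
    1v-cells. *)
Lemma LC_FE {A A' : B} {x : hor A A'} {u e} : LC x u e -> LC (fh F x) (fv F u) (FE e A').
Proof.
  intros [b [η (b1 & h1 & h2)]]. unfold FE.
  split; [ bdt | ]. exists (vT (J (dfu F A)) (fsT F η)). split; [ bdt | split ].
  - transitivity (vT (hT (J (dfu F A)) (J (sqh (fh F x)))) (vT (hT (fsT F η) (fsT F e))
       (hT (J (sqh (fh F x))) (J (dfui F A'))))).
    + ix. idT. ix. idT. reflexivity.
    + transitivity (vT (hT (J (dfu F A)) (J (sqh (fh F x)))) (vT (vT (vT (hT (fsT F η) (fsT F e))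
        (J (dfc F x (hid A')))) (J (dfci F x (hid A'))))
       (hT (J (sqh (fh F x))) (J (dfui F A'))))).
      * rewrite (vT_assoc _ _ (J (dfci F _ _))), (dfc_dfci HF). idT. reflexivity.
      * rewrite (fsT_h HF b1 b eq_refl), h1, (fsT_sqh HF), !vT_assoc, dfci_dfui_r.
        idT. apply dfu_dfc_l.
  - rewrite vT_assoc, <- (vT_assoc (fsT F η)), <- (fsT_v HF b1 b eq_refl), h2.
    rewrite <- vT_assoc, <- (fsT_sqv HF), vT_assoc, (dfu_dfui HF). idT. reflexivity.
Qed.

Lemma TH_F {A A' : B} {x y : hor A A'} {e e' m u} : LC y u e' -> TH x y e e' m ->
  TH (fh F x) (fh F y) (FE e A') (FE e' A') (fsT F m).
Proof.
  intros [b _] [b' E]. unfold FE. split; [ bdt | ].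
  rewrite <- vT_assoc, <- (fsT_v HF b' b eq_refl), E. reflexivity.
Qed.

(** Naturality of the compositor at the counit [e] beside an identity. Thus the structure cells of
    [F] are comparisons whenever their 1h-cells are companions. *)
Lemma TH_dfc {A A' A'' : B} {x : hor A A'} {y : hor A' A''} {e d u v} :
  LC x u e -> LC y v d ->
  TH (fh F x · fh F y) (fh F (x · y)) (cmp (FE e A') (fh F y) (FE d A'')) (FE (cmp e y d) A'') (J (dfc F x y)).
Proof.
  intros [b _] [b' _]. unfold FE, cmp. split; [ apply bd_J | ].
  rewrite (fsT_v HF (bd_h b (bd_J (sqh y)) eq_refl) b'); [ | n1 ].
  rewrite <- !vT_assoc, <- (fsT_h HF b (bd_J (sqh y)) eq_refl), dfc_hid_l, (fsT_sqh HF).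
  ix. idT. reflexivity.
Qed.

Lemma TH_dfci {A A' A'' : B} {x : hor A A'} {y : hor A' A''} {e d u v} :
  LC x u e -> LC y v d ->
  TH (fh F (x · y)) (fh F x · fh F y) (FE (cmp e y d) A'') (cmp (FE e A') (fh F y) (FE d A'')) (J (dfci F x y)).
Proof.
  intros h h'. eapply TH_inv; [ apply (LC_FE (LC_cmp h h')) | apply (TH_dfc h h') | apply bd_J | apply (dfci_dfc HF) ].
Qed.

Lemma TH_dfu (A : B) :
  TH (hid (fo A)) (fh F (hid A)) (J (sqh (hid (fo A)))) (FE (J (sqh (hid A))) A) (J (dfu F A)).
Proof.
  unfold FE. split; [ apply bd_J | ]. rewrite (fsT_sqh HF). idT. apply (dfu_dfui HF).
Qed.

Lemma TH_dfui (A : B) :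
  TH (fh F (hid A)) (hid (fo A)) (FE (J (sqh (hid A))) A) (J (sqh (hid (fo A)))) (J (dfui F A)).
Proof.
  eapply TH_inv; [ apply (LC_FE (LC_id A)) | apply TH_dfu | apply bd_J | apply (dfui_dfu HF) ].
Qed.
End Functor.

(** * Companion-lifts characterized by counits *)

Section Lifts.
Context {B : dbl}.
Implicit Types a c d e : T (B:=B).
Local Notation id f := (J (sqh f)).

(* [φ] is the companion-lift of [S], for companions of the sides of [S] *)
Definition LF {A1 A2 A3 A4 : B} (f : hor A1 A2) (x : hor A1 A3) (y : hor A2 A4) (g : hor A3 A4)
    ex ey (φ S : T (B:=B)) : Prop :=
  bd φ (f · y) (vid A1) (vid A4) (x · g) /\ vT φ (hT ex (id g)) = hT S ey.

(** The unit of [x] recovers [φ] as [[η | S | ey]]. Cells are thereby compared by comparing the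
    squares they lift. *)
Lemma LF_uniq {A1 A2 A3 A4 : B} {f : hor A1 A2} {x : hor A1 A3} {y : hor A2 A4} {g : hor A3 A4}
    {ex ey φ φ' S u} : LC x u ex -> LF f x y g ex ey φ S -> LF f x y g ex ey φ' S -> φ = φ'.
Proof.
  intros [b [η (b1 & h1 & h2)]] [b2 E2] [b3 E3].
  assert (G : forall n, bd n (f · y) (vid A1) (vid A4) (x · g) ->
    vT n (hT ex (id g)) = hT S ey -> n = hT η (hT S ey)).
  { intros n bn En. rewrite <- En.
    transitivity (vT (hT (id (hid A1)) n) (hT (hT η ex) (id g))).
    - rewrite h1, <- J_sqh_comp. idT. reflexivity.
    - rewrite hT_assoc. ix. idT. reflexivity. }
  rewrite (G φ), (G φ'); trivial.
Qed.

Lemma LF_lift {A1 A2 A3 A4 : B} {f : hor A1 A2} {u : ver A1 A3} {v : ver A2 A4} {g : hor A3 A4}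
    (cu : companion u) (cv : companion v) (s : sq f u v g) :
  LF f (comp_h cu) (comp_h cv) g (J (comp_eps cu)) (J (comp_eps cv)) (J (lift_sq cu cv s)) (J s).
Proof.
  split; [ apply bd_J | ]. unfold lift_sq. rewrite J_cast, <- !hT_J, hT_assoc.
  transitivity (vT (hT (J (comp_eta cu)) (hT (J s) (J (comp_eps cv)))) (hT (J (comp_eps cu)) (hT (id g) (id (hid A4))))).
  - rewrite <- J_sqh_comp. f_equal. f_equal. symmetry. apply J_sqh_eq, hir.
  - ix. ix. rewrite vT_J, (J_eq (comp_vc cu)). idT. reflexivity.
Qed.

(** The left-hand side preserves the counit, since [η / ε] is the vertical identity on [v] and
    cancels against [vi]; hence it is the comparison of the companion with itself. *)
Lemma comp_split {A A' : B} {v : ver A A'} {vi : ver A' A} (c : companion v) : vi ⇣ v = vid A' ->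
  v ⇣ vi = vid A ->
  vT (J (comp_eps c)) (vT (J (sqv vi)) (J (comp_eta c))) = id (comp_h c).
Proof.
  intros E E'. eapply (TH_uniq (LC_companion c)).
  - split; [ bdt | ]. rewrite !vT_assoc, (vT_J (comp_eta c)), (J_eq (comp_vc c)), <- J_sqv_comp, E.
    idT. reflexivity.
  - apply (TH_id (LC_companion c)).
Qed.

Section Lifti.
Context {A1 A2 A3 A4 : B} {f : hor A1 A2} {u : ver A1 A3} {v : ver A2 A4} {g : hor A3 A4}
    (cu : companion u) (cv : companion v) (s : sq f u v g)
    {ui : ver A3 A1} {vi : ver A4 A2} (eu : u ⇣ ui = vid A1) (ev : vi ⇣ v = vid A4)
    (eu' : ui ⇣ u = vid A3) (ev' : v ⇣ vi = vid A2)
    (i : sq g ui vi f).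

Lemma J_lift_sqi : J (lift_sqi cu cv eu ev i) = hT (vT (J (comp_eps cu)) (J (sqv ui)))
  (hT (J i) (vT (J (sqv vi)) (J (comp_eta cv)))).
Proof. unfold lift_sqi. rewrite J_cast, <- !hT_J, !J_cast, hT_assoc, <- !vT_J. reflexivity. Qed.

Lemma lift_lifti : vT (J s) (J i) = id f ->
  vT (J (lift_sq cu cv s)) (J (lift_sqi cu cv eu ev i)) = id (f · comp_h cv).
Proof.
  intro E. rewrite J_lift_sqi. unfold lift_sq. rewrite J_cast, <- !hT_J, hT_assoc.
  ix. ix. rewrite E, (comp_split cv ev ev'), <- vT_assoc, (vT_J (comp_eta cu)), (J_eq (comp_vc cu)),
    <- J_sqv_comp, eu, <- J_sqh_comp. idT. reflexivity.
Qed.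

Lemma lifti_lift : vT (J i) (J s) = id g ->
  vT (J (lift_sqi cu cv eu ev i)) (J (lift_sq cu cv s)) = id (comp_h cu · g).
Proof.
  intro E. rewrite J_lift_sqi. unfold lift_sq. rewrite J_cast, <- !hT_J, hT_assoc.
  ix. ix. rewrite E, !vT_assoc, (comp_split cu eu' eu), (vT_J (comp_eta cv)), (J_eq (comp_vc cv)),
    <- J_sqv_comp, ev. idT. rewrite <- J_sqh_comp. reflexivity.
Qed.
End Lifti.

(** Corresponds to [pn_comp], as [LF_paste] below corresponds to the composition axiom [pn_fc] of a
    pseudonatural transformation. *)
Lemma LF_stack {A1 A2 A3 A4 A5 A6 : B} {f : hor A1 A2} {x : hor A1 A3} {y : hor A2 A4}
    {g : hor A3 A4} {x' : hor A3 A5} {y' : hor A4 A6} {h : hor A5 A6} {ex ey ex' ey' φ ψ S S' u v u' v'} :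
  LC x u ex -> LC y v ey -> LC x' u' ex' -> LC y' v' ey' -> bd S f u v g -> bd S' g u' v' h ->
  LF f x y g ex ey φ S -> LF g x' y' h ex' ey' ψ S' ->
  LF f (x · x') (y · y') h (cmp ex x' ex') (cmp ey y' ey') (vT (hT φ (id y')) (hT (id x) ψ)) (vT S S').
Proof.
  intros [b1 _] [b2 _] [b3 _] [b4 _] b5 b6 [b7 E7] [b8 E8]. unfold cmp.
  split; [ bdt | ].
  transitivity (vT (hT φ (id y')) (vT (hT (hT ex (id g)) (id y')) (vT ψ (hT ex' (id h))))).
  - rewrite vT_assoc. f_equal.
    transitivity (vT (hT ex ψ) (hT ex' (id h))).
    + transitivity (vT (hT (id x) ψ) (vT (hT ex (id (x' · h))) (hT ex' (id h)))).
      * f_equal. rewrite J_sqh_comp, <- hT_assoc. ix. idT. reflexivity.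
      * rewrite <- vT_assoc. ix. idT. reflexivity.
    + rewrite <- vT_assoc. f_equal. rewrite hT_assoc, <- J_sqh_comp.
      transitivity (vT (hT ex (id (g · y'))) (hT (id (hid A3)) ψ)).
      * ix. idT. reflexivity.
      * f_equal. idT. reflexivity.
  - rewrite E8, <- vT_assoc. ix. rewrite E7. idT. rewrite hT_assoc. ix. reflexivity.
Qed.

Lemma LF_paste {A1 A2 A3 A4 A5 A6 : B} {f : hor A1 A2} {x : hor A1 A3} {y : hor A2 A4}
    {g : hor A3 A4} {f' : hor A2 A5} {z : hor A5 A6} {g' : hor A4 A6} {ex ey ez φ ψ S S' u v w} :
  LC x u ex -> LC y v ey -> LC z w ez -> bd S f u v g -> bd S' f' v w g' ->
  LF f x y g ex ey φ S -> LF f' y z g' ey ez ψ S' ->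
  LF (f · f') x z (g · g') ex ez (vT (hT (id f) ψ) (hT φ (id g'))) (hT S S').
Proof.
  intros [b1 _] [b2 _] [b3 _] b5 b6 [b7 E7] [b8 E8].
  split; [ bdt | ]. rewrite J_sqh_comp, <- (hT_assoc ex), vT_assoc.
  transitivity (vT (hT (id f) ψ) (hT (vT φ (hT ex (id g))) (id g'))).
  - f_equal. ix. idT. reflexivity.
  - rewrite E7, hT_assoc. ix. rewrite E8. idT. now rewrite hT_assoc.
Qed.

Lemma LF_top {A1 A2 A3 A4 : B} {f f0 : hor A1 A2} {x : hor A1 A3} {y : hor A2 A4}
    {g : hor A3 A4} {ex ey φ S a u v} :
  LC y v ey -> bd S f u v g -> bd a f0 (vid A1) (vid A2) f ->
  LF f x y g ex ey φ S -> LF f0 x y g ex ey (vT (hT a (id y)) φ) (vT a S).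
Proof.
  intros [b1 _] b2 b3 [b4 E]. split; [ bdt | ]. rewrite vT_assoc, E. ix. idT. reflexivity.
Qed.

Lemma LF_bot {A1 A2 A3 A4 : B} {f : hor A1 A2} {x : hor A1 A3} {y : hor A2 A4}
    {g g0 : hor A3 A4} {ex ey φ S a u v} :
  LC x u ex -> LC y v ey -> bd S f u v g -> bd a g (vid A3) (vid A4) g0 ->
  LF f x y g ex ey φ S -> LF f x y g0 ex ey (vT φ (hT (id x) a)) (vT S a).
Proof.
  intros [b0 _] [b1 _] b2 b3 [b4 E]. split; [ bdt | ]. rewrite vT_assoc.
  transitivity (vT φ (vT (hT ex (id g)) (hT (id (hid A3)) a))).
  - f_equal. ix. ix. idT. reflexivity.
  - rewrite <- vT_assoc, E. idT.
    transitivity (vT (hT S ey) (hT a (id (hid A4)))); [ idT; reflexivity | ].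
    ix. idT. reflexivity.
Qed.

Lemma LF_post {A1 A2 A3 A4 : B} {f : hor A1 A2} {x : hor A1 A3} {y : hor A2 A4}
    {g : hor A3 A4} {ex ey φ S u v fo} (F : pdf B fo) (HF : is_pdf F) :
  LC x u ex -> LC y v ey -> bd S f u v g ->
  LF f x y g ex ey φ S ->
  LF (fh F f) (fh F x) (fh F y) (fh F g) (FE F ex A3) (FE F ey A4)
    (vT (J (dfc F f y)) (vT (fsT F φ) (J (dfci F x g)))) (fsT F S).
Proof.
  intros [b0 _] [b1 _] b2 [b4 E]. unfold FE. split; [ bdt | ]. rewrite !vT_assoc.
  transitivity (vT (J (dfc F f y)) (vT (fsT F φ) (vT (J (dfci F x g)) (vT (hT (fsT F ex) (fsT F (id g)))
    (hT (J (dfui F A3)) (id (fh F g))))))).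
  - rewrite (fsT_sqh HF). ix. idT. reflexivity.
  - rewrite <- (vT_assoc (J (dfci F x g))), (fsT_h' HF b0 (bd_J (sqh g)) eq_refl), vT_assoc, (dfci_dfui_l HF).
    idT. rewrite <- (fsT_v HF b4 (bd_h b0 (bd_J (sqh g)) eq_refl) eq_refl), E.
    rewrite <- (fsT_h HF b2 b1 eq_refl), (dfc_hid_r HF). ix. idT. reflexivity.
Qed.

Lemma bd_left {a : T (B:=B)} {A1 A2 A3 A4 : B} {f f' : hor A1 A2} {u u' : ver A1 A3}
    {v v' : ver A2 A4} {g g' : hor A3 A4} : bd a f u v g -> bd a f' u' v' g' -> u = u'.
Proof. intros [x ->] [y E]. now destruct (sqeq_J E). Qed.

(** Both sides are lifts of [S] with respect to the left companion [x'] and the right companion [y];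
    modification axioms are obtained in this way. *)
Lemma LF_cell {A1 A2 A3 A4 : B} {f : hor A1 A2} {x x' : hor A1 A3} {y y' : hor A2 A4}
    {g : hor A3 A4} {ex ey ex' ey' P Q c0 c1 S u v u' v'} :
  LC x' u' ex' -> LC y v ey -> LC y' v' ey' -> bd S f u v g ->
  LF f x y g ex ey P S -> LF f x' y' g ex' ey' Q S ->
  TH x x' ex ex' c0 -> TH y y' ey ey' c1 ->
  vT P (hT c0 (id g)) = vT (hT (id f) c1) Q.
Proof.
  intros h1 [b1 _] [b1' _] b2 [b4 E] [b5 E'] [b6 E6] [b7 E7]. pose proof (LC_bd h1).
  assert (Ev : v' = v).
  { rewrite <- E7 in b1. refine (bd_left _ b1). bdt. }
  subst v'.
  eapply (LF_uniq (S := S) (ey := ey) (f := f) (y := y) (g := g) h1).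
  - split; [ bdt | ]. rewrite vT_assoc. rewrite <- E. f_equal. ix. idT. now rewrite E6.
  - split; [ bdt | ]. rewrite vT_assoc, E'. ix. idT. now rewrite E7.
Qed.

(** If the horizontal sides are companions too, and [S] is compatible with their counits, then the
    lift itself is a comparison. This bridges naturality cells and the uniqueness of comparisons. *)
Lemma LF_TH {A1 A2 A3 A4 : B} {f : hor A1 A2} {x : hor A1 A3} {y : hor A2 A4}
    {g : hor A3 A4} {ex ey ef eg φ S u v w w'} :
  LC x u ex -> LC y v ey -> LC f w ef -> LC g w' eg -> bd S f u v g ->
  vT S eg = vT ef (J (sqv v)) ->
  LF f x y g ex ey φ S -> TH (f · y) (x · g) (cmp ef y ey) (cmp ex g eg) φ.
Proof.
  intros [b0 _] [b1 _] [b2 _] [b3 _] b4 E [b5 E5]. split; [ exact b5 | ]. unfold cmp.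
  rewrite <- vT_assoc, E5.
  transitivity (hT (vT S eg) (vT ey (id (hid A4)))).
  - xi. idT. reflexivity.
  - rewrite E. idT. transitivity (hT (vT ef (J (sqv v))) (vT (id y) ey)).
    + idT. reflexivity.
    + xi. idT. reflexivity.
Qed.
End Lifts.

Ltac jgoal := refine (sqeq_J _); rewrite ?J_cast; rewrite <- ?hT_J, <- ?vT_J.

Ltac cT := cbn [brev lt rt tens Hpf on1 on2 fc fci fu fui Hpn nat1 nat1i pn_comp pn_id pn_post pn_pre
  pf_comp hpt_comp hpt_id hpt_post hpt_pre hv hd hdi vpt_id vpt_comp vpt_post vpt_pre vh vd vdi].
Ltac cF := cbn [brev lt rt tens Hpf on1 on2 fc fci fu fui Hpn nat1 nat1i pn_comp pn_id pn_post pn_pre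
  pf_comp hpt_comp hpt_id hpt_post hpt_pre hv hd hdi vpt_id vpt_comp vpt_post vpt_pre vh vd vdi HB comp1 id1].
Ltac etaT := repeat match goal with
  | |- context [fun x0 : ?T => @tens ?B ?b ?X x0] =>
     progress change (fun x0 : T => @tens B b X x0) with (@tens B b X) end.
Ltac rT := cT; rJ; rewrite ?hT_assoc, ?vT_assoc; cF; etaT.

Ltac rwq lem := let Q := fresh in generalize lem; cF; etaT; intro Q; rewrite Q; clear Q.

(** * Left and right centrality *)

Section Transfer.
Context {B : dbl} {b : bin B} (L : lcs b) (R : lcs (brev b)) (ex : exchange L R).
Local Notation idh f := (J (sqh f)).

Lemma ex1 {X X' Y Y' : B} (K : hor X X') (k : hor Y Y') :
  J (hd (lh L K) k) = J (hdi (lh R k) K).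
Proof. apply f_equal, (ex_hh ex K k). Qed.
Lemma ex2 {X X' Y Y' : B} (K : hor X X') (k : hor Y Y') :
  J (hdi (lh L K) k) = J (hd (lh R k) K).
Proof. apply f_equal, (ex_hh ex K k). Qed.
Lemma ex3 {X X' Y Y' : B} (K : hor X X') (u : ver Y Y') :
  J (hv (lh L K) u) = J (vh (lv R u) K).
Proof. apply f_equal, (ex_hv ex K u). Qed.
Lemma ex4 {X X' Y Y' : B} (U : ver X X') (k : hor Y Y') :
  J (vh (lv L U) k) = J (hv (lh R k) U).
Proof. apply f_equal, (ex_vh ex U k). Qed.

Lemma ex5 {X X' Y Y' : B} (U : ver X X') (u : ver Y Y') :
  J (vdi (lv L U) u) = J (vd (lv R u) U).
Proof. apply f_equal, (ex_vv ex U u). Qed.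

Hypothesis triv : forall (X X' : B) (U : ver X X') (Y Y' : B) (u : ver Y Y'),
  J (vd (lv L U) u) = J (sqv (fv (rt b Y) U ⇣ fv (lt b X') u)) /\
  J (vd (lv R u) U) = J (sqv (fv (lt b X) u ⇣ fv (rt b Y') U)).

Lemma tR (X X' : B) (U : ver X X') (Y Y' : B) (u : ver Y Y') :
  J (vd (lv R u) U) = J (sqv (fv (lt b X) u ⇣ fv (rt b Y') U)).
Proof. apply triv. Qed.

Lemma J_right {A1 A2 A3 A4 : B} {f f' : hor A1 A2} {u u' : ver A1 A3} {v v' : ver A2 A4}
    {g g' : hor A3 A4} (s : sq f u v g) (t : sq f' u' v' g') : J s = J t -> v = v'.
Proof. intro E. now destruct (sqeq_J E). Qed.

(** The two composites are the vertical sides of one exchange cell; an identity square has equal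
    sides. *)
Lemma fv_exch {X X' Y Y' : B} (U : ver X X') (u : ver Y Y') :
  fv (lt b X) u ⇣ fv (rt b Y') U = fv (rt b Y) U ⇣ fv (lt b X') u.
Proof. exact (J_right (proj1 (triv U u))). Qed.

Context (HR : lcs_laws R).

(** The exchange cells of [L] and [R] at 1h-cells are mutually inverse, so an axiom of one family
    becomes an axiom of the other once invertible cells are moved across the equation; [p] and [q]
    stand for identities. *)
Lemma flip {X Y h hi h' hi' p q : T (B:=B)} : vT X h' = vT h Y -> vT hi h = p -> vT h' hi' = q ->
  vT p Y = Y -> vT X q = X -> vT hi X = vT Y hi'.
Proof.
  intros E <- <- E3 E4. rewrite <- E4, <- !vT_assoc, (vT_assoc _ _ h'), E, <- !vT_assoc.
  now rewrite E3.
Qed.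

Lemma R_inv {X X' Y Y' : B} (K : hor X X') (k : hor Y Y') :
  vT (J (hd (lh R k) K)) (J (hdi (lh R k) K)) = J (sqh (fh (rt b Y) K · fh (lt b X') k)).
Proof. generalize (to_J (pn_inv (hpt_H (lcs_h HR k)) K)). rJ. exact (fun h => h). Qed.
Lemma R_invi {X X' Y Y' : B} (K : hor X X') (k : hor Y Y') :
  vT (J (hdi (lh R k) K)) (J (hd (lh R k) K)) = J (sqh (fh (lt b X) k · fh (rt b Y') K)).
Proof. generalize (to_J (pn_invi (hpt_H (lcs_h HR k)) K)). rJ. exact (fun h => h). Qed.

(** Read in the other variable, functoriality of [X ↦ X ⋉ -] is the compatibility of the
    transformations [- ⋊ f] and [- ⋊ u] with compositors, unitors and vertical composition. *)
Lemma transfer_functor : lcs_functor L.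
Proof.
  constructor.
  - intros X X' X'' k k'. split.
    + intros Y Y' f. jgoal. generalize (to_J (pn_fc (hpt_H (lcs_h HR f)) k k')).
      rT. rewrite !ex1. idT. intro E. rewrite <- (vT_assoc (hT _ (J (hd (lh R f) k')))) in E.
      symmetry. rewrite <- vT_assoc. refine (flip E _ (R_inv _ _) _ _).
      * rewrite vT_assoc, <- (vT_assoc (hT _ (J (hdi (lh R f) k')))). ix. rwq (@R_invi). idF.
        ix. rwq (@R_invi). idF. reflexivity.
      * idT. reflexivity.
      * idT. reflexivity.
    + intros Y Y' u. jgoal. generalize (J_eq (vpt_dfc (lcs_v HR u) k k')). rT. rewrite !ex3.
      intros E. idT. exact E.
  - intros X. split.
    + intros Y Y' f. jgoal. generalize (to_J (pn_fu (hpt_H (lcs_h HR f)) X)).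
      rT. rewrite !ex1. idT. intro E.
      rewrite <- E, vT_assoc. rwq (@R_inv). idT. reflexivity.
    + intros Y Y' u. jgoal. generalize (J_eq (vpt_dfu (lcs_v HR u) X)). rT. rewrite !ex3.
      intros E. idT. exact E.
  - intros X X' X'' u u'. split; [ | split ].
    + intros Y. apply (fv_comp (rt b Y)).
    + intros Y Y' f. jgoal. rT. rewrite !ex4. generalize (J_eq (hpt_vcomp (lcs_h HR f) u u')). rT.
      exact (fun h => h).
    + intros Y Y' v. jgoal. rT. rewrite !(proj1 (triv _ _)).
      rewrite <- !J_sqv_comp, vcA, fv_exch. idT. apply J_sqv_eq. n1.
  - intros X. split; [ | split ].
    + intros Y. apply (fv_id (rt b Y)).
    + intros Y Y' f. jgoal. rT. rewrite !ex4. generalize (J_eq (hpt_vid (lcs_h HR f) X)). rT.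
      exact (fun h => h).
    + intros Y Y' v. jgoal. rT. rewrite !(proj1 (triv _ _)).
      apply J_sqv_eq. n1.
Qed.

Context (FR : lcs_functor R).

Lemma R_vid {X X' Y : B} (k : hor X X') : J (vh (lv R (vid Y)) k) = idh (fh (rt b Y) k).
Proof.
  destruct (lcf_vid FR Y) as (_ & E & _). generalize (J_eq (E _ _ k)). rT. exact (fun h => h).
Qed.

(** Conversely, compatibility of [K ⋉ -] with composition comes from functoriality of [R], its
    naturality from the modifications [- ⋊ a], and the modifications [a ⋉ -] from naturality of the
    [- ⋊ k]. *)
Lemma transfer_laws : lcs_laws L.
Proof.
  constructor.
  - intros X X' K. constructor.
    + constructor.
      * intros Y Y' k. apply J_inj. rT. rewrite ex1, ex2. rwq (@R_invi). reflexivity.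
      * intros Y Y' k. apply J_inj. rT. rewrite ex1, ex2. rwq (@R_inv). reflexivity.
      * intros Y Y' k k' a. apply J_inj. rT. rewrite !ex1. symmetry.
        generalize (J_eq (proj1 (lcs_s HR a) _ _ K)). rT. do 2 rwq (@R_vid). intro E.
        rewrite ?fsT_J.
        refine (flip E (R_invi _ _) (R_inv _ _) _ _); idT; reflexivity.
      * intros Y Y' Y'' k k'. apply J_inj. rT. rewrite !ex1.
        generalize (J_eq (proj1 (lcf_comp FR k k') _ _ K)). rT. idT. intro E.
        symmetry. rewrite <- vT_assoc. rewrite <- (vT_assoc (hT _ (idh (fh (lt b X') k')))) in E.
        refine (flip E _ (R_inv _ _) _ _).
        ++ rewrite vT_assoc, <- (vT_assoc (hT _ (idh (fh (lt b X') k')))). ix. rwq (@R_invi). idF.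
           ix. rwq (@R_invi). idF. reflexivity.
        ++ idT; reflexivity.
        ++ idT; reflexivity.
      * intros Y. apply J_inj. rT. rewrite !ex1.
        generalize (J_eq (proj1 (lcf_unit FR Y) _ _ K)). rT. idT. intro E.
        rewrite <- E, vT_assoc. rwq (@R_inv). idT. reflexivity.
    + intros Y. jgoal. rT. rewrite ex3. apply R_vid.
    + intros Y Y' Y'' u v. jgoal. rT. rewrite !ex3.
      destruct (lcf_vcomp FR u v) as (_ & E & _). generalize (J_eq (E _ _ K)). rT. exact (fun h => h).
    + intros Y1 Y2 Y3 Y4 f u v g a. jgoal. rT. rewrite !ex1, !ex3.
      generalize (J_eq (proj1 (lcs_s HR a) _ _ K)). rT. intro E. symmetry.
      refine (flip E (R_invi _ _) (R_inv _ _) _ _); idT; reflexivity.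
  - intros X X' U. constructor.
    + intros Y Y' u. jgoal. rT. rewrite (proj1 (triv _ _)), ex5, (proj2 (triv _ _)), fv_exch.
      idT. reflexivity.
    + intros Y Y' u. jgoal. rT. rewrite (proj1 (triv _ _)), ex5, (proj2 (triv _ _)), fv_exch.
      idT. reflexivity.
    + intros Y Y' Y'' f g. jgoal. rT. rewrite !ex4.
      generalize (J_eq (proj2 (lcf_comp FR f g) _ _ U)). rT. idT. exact (fun h => h).
    + intros Y. jgoal. rT. rewrite !ex4.
      generalize (J_eq (proj2 (lcf_unit FR Y) _ _ U)). rT. idT. exact (fun h => h).
    + intros Y. jgoal. rT. rewrite (proj1 (triv _ _)). apply J_sqv_eq. n1.
    + intros Y Y' Y'' u v. jgoal. rT. rewrite !(proj1 (triv _ _)).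
      rewrite <- !J_sqv_comp, <- (vcA (fv (lt b X) u)), !fv_exch. idT. apply J_sqv_eq. n1.
    + intros Y1 Y2 Y3 Y4 f u v g a. jgoal. rT. rewrite !ex4, !(proj1 (triv _ _)), <- ?fv_exch; idT; rewrite ?fv_exch; idT.
      generalize (J_eq (proj2 (lcs_s HR a) _ _ U)). rT. do 2 rwq (@tR). idT. rewrite ?fv_exch. idT.
      exact (fun h => h).
  - intros X1 X2 X3 X4 f u v g a. split.
    + intros Y Y' k. jgoal. rT. rewrite !ex1, !ex4. symmetry.
      generalize (J_eq (hpt_nat (lcs_h HR k) a)). rT. intro E.
      refine (flip E (R_invi _ _) (R_inv _ _) _ _); idT; reflexivity.
    + intros Y Y' k. jgoal. rT. rewrite !ex3, !(proj1 (triv _ _)), <- ?fv_exch; idT; rewrite ?fv_exch; idT.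
      generalize (J_eq (vpt_nat (lcs_v HR k) a)). rT. do 2 rwq (@tR). idT. rewrite ?fv_exch. idT.
      exact (fun h => h).
Qed.
End Transfer.

Section Central.
Context {B : dbl}.

Definition vd_trivial {b : bin B} (L : lcs b) (R : lcs (brev b)) : Prop :=
  forall (X X' : B) (U : ver X X') (Y Y' : B) (u : ver Y Y'),
  J (vd (lv L U) u) = J (sqv (fv (rt b Y) U ⇣ fv (lt b X') u)) /\
  J (vd (lv R u) U) = J (sqv (fv (lt b X) u ⇣ fv (rt b Y') U)).

Lemma transfer_left {b : bin B} {L : lcs b} {R : lcs (brev b)} : exchange L R -> vd_trivial L R ->
  lcs_laws L -> lcs_functor R /\ (lcs_functor L -> lcs_laws R).
Proof.
  (* For an explicit record, reversing twice gives back the structure by conversion, so the transfer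
     lemmas apply to the reversed one. *)
  intros ex triv HL. destruct b as [t l r].
  assert (ex' : @exchange B (brev (Bin t l r)) R L).
  { split; intros; split || idtac; symmetry; apply ex. }
  assert (triv' : @vd_trivial (brev (Bin t l r)) R L).
  { intros X X' U Y Y' u. split; apply (triv Y Y' u X X' U). }
  split; [ exact (transfer_functor ex' triv' HL) | exact (transfer_laws ex' triv' HL) ].
Qed.

(** The hypothesis concerns the exchange cells of [R] at 1v-cells; those of [L] are their inverses
    and are trivial as well. All three kinds of centrality then provide the laws and functoriality
    of both families. *)
Lemma central_full (s : side) {b : bin B} {L : lcs b} {R : lcs (brev b)} : is_central s L R ->
  (forall (X X' : B) (U : ver X X') (Y Y' : B) (u : ver Y Y'),
       sqeq (vd (lv R u) U) (sqv (vcomp (fv (lt b X) u) (fv (rt b Y') U)))) ->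
  (vd_trivial L R /\ lcs_laws L /\ lcs_functor L) /\ (lcs_laws R /\ lcs_functor R).
Proof.
  intros [ex HS] hvv.
  assert (triv : vd_trivial L R).
  { intros X X' U Y Y' u. pose proof (J_eq (hvv X X' U Y Y' u)) as E. split; [ | exact E ].
    assert (E' : hT (J (vd (lv L U) u)) (J (vd (lv R u) U)) = J (sqv (fv (rt b Y) U ⇣ fv (lt b X') u)) /\
      hT (J (vd (lv R u) U)) (J (vd (lv L U) u)) = J (sqv (fv (lt b X) u ⇣ fv (rt b Y') U))).
    (* Whichever family is known to satisfy its laws supplies the invertibility of these cells. *)
    { assert (H : lcs_laws L \/ lcs_laws R) by (destruct s; tauto).
      destruct (ex_vv ex U u) as [e1 e2].
      destruct H as [H|H]; split.
      - rewrite <- e2, hT_J. apply J_eq. apply (vpt_inv (lcs_v H U) u).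
      - rewrite <- e2, hT_J. apply J_eq. apply (vpt_invi (lcs_v H U) u).
      - rewrite e1, hT_J. apply J_eq. apply (vpt_invi (lcs_v H u) U).
      - rewrite e1, hT_J. apply J_eq. apply (vpt_inv (lcs_v H u) U). }
    revert E E'. cF. etaT. intros E E'. rewrite E in E'. destruct E' as [E1 _]. rewrite <- E1. idT. reflexivity. }
  destruct s.
  - destruct HS as [HL FL]. destruct (transfer_left ex triv HL) as [FR HR]. auto.
  - destruct HS as [HR FR]. split; [ | auto ].
    split; [ exact triv | split; [ exact (transfer_laws ex triv HR FR) | exact (transfer_functor ex triv HR) ] ].
  - destruct HS as [HL HR]. destruct (transfer_left ex triv HL) as [FR _].
    split; [ | auto ].
    split; [ exact triv | split; [ exact HL | exact (transfer_functor ex triv HR) ] ].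
Qed.
End Central.

(** * Lifting vertical transformations and centrality structures *)

Section General.
Context {B : dbl}.
Local Notation idh f := (J (sqh f)).
Local Notation HB := (HB B).

Lemma LF_eq {S S' : T (B:=B)} : S = S' -> forall {A1 A2 A3 A4 : B} {f : hor A1 A2} {x : hor A1 A3}
    {y : hor A2 A4} {g : hor A3 A4} {ex ey φ}, LF f x y g ex ey φ S' -> LF f x y g ex ey φ S.
Proof. now intros ->. Qed.

Lemma TH_iso {A A' : B} {x y : hor A A'} {u e e'} (hx : LC x u e) (hy : LC y u e')
    {m : cell HB x y} : TH x y e e' (J m) -> iso2 m.
Proof.
  intro h. destruct (TH_exists hy hx) as [n hn]. exists n. split; apply J_inj; rJ.
  - exact (TH_uniq hx (TH_comp h hn) (TH_id hx)).
  - exact (TH_uniq hy (TH_comp hn h) (TH_id hy)).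
Qed.

(** Composites of companions are companions of composites, here of identity 1v-cells, and therefore
    isomorphic to identity 1h-cells. A companion of the inverse is required for this. *)
Lemma companion_equiv {A A' : B} {u : ver A A'} {ui : ver A' A} (c : companion u)
    (ci : companion ui) : u ⇣ ui = vid A -> ui ⇣ u = vid A' -> is_equiv (C := HB) (comp_h c).
Proof.
  intros E E'.
  pose proof (LC_cmp (LC_companion c) (LC_companion ci)) as h. rewrite E in h.
  pose proof (LC_cmp (LC_companion ci) (LC_companion c)) as h'. rewrite E' in h'.
  destruct (TH_exists h (LC_id A)) as [m hm]. destruct (TH_exists h' (LC_id A')) as [n hn].
  exists (comp_h ci), m, n. split; [ exact (TH_iso h (LC_id A) hm) | exact (TH_iso h' (LC_id A') hn) ].
Qed.

Section Lift.
Context {fo go : B -> B} (F : pdf B fo) (G : pdf B go)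
  (F2 : forall A A' (f g : hom HB A A'), cell HB f g -> cell HB (fh F f : hom HB (fo A) (fo A')) (fh F g))
  (G2 : forall A A' (f g : hom HB A A'), cell HB f g -> cell HB (fh G f : hom HB (go A) (go A')) (fh G g))
  (HF2 : forall A A' (f g : hom HB A A') (a : cell HB f g), J (@F2 _ _ _ _ a) = fsT F (J a))
  (HG2 : forall A A' (f g : hom HB A A') (a : cell HB f g), J (@G2 _ _ _ _ a) = fsT G (J a)).
Local Notation Fp := (Pf HB HB fo (fun A A' f => fh F f) F2 (fun A A' A'' f g => dfc F f g)
  (fun A A' A'' f g => dfci F f g) (fun A => dfu F A) (fun A => dfui F A)).
Local Notation Gp := (Pf HB HB go (fun A A' f => fh G f) G2 (fun A A' A'' f g => dfc G f g)
  (fun A A' A'' f g => dfci G f g) (fun A => dfu G A) (fun A => dfui G A)).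
Context {c : forall A, ver (fo A) (go A)} {ci : forall A, ver (go A) (fo A)} (s : vpt_of F G c)
  (i : vinv (@fh _ _ F) (@fh _ _ G) ci) (H : is_inv_strict F G s i)
  (cc : forall A, companion (c A))
  (e1 : forall A, c A ⇣ ci A = vid _) (e2 : forall A, ci A ⇣ c A = vid _).

(** Each axiom holds since both sides lift the two sides of the corresponding axiom of [s]. The
    actions [F2] and [G2] on 2-cells are kept abstract because [pf_comp] and the composite of
    pseudodouble functors insert different casts. *)
Lemma lift_pn : is_pn Fp Gp (lift s i cc e1 e2).
Proof.
  destruct H as (Hs & St & Hi). constructor.
  - intros A A' f. apply J_inj. rJ. apply lift_lifti; [ apply e1 | ].
    rewrite vT_J. apply J_eq, Hi.
  - intros A A' f. apply J_inj. rJ. apply lifti_lift; [ apply e2 | ].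
    rewrite vT_J. apply J_eq, Hi.
  - intros A A' f g a. apply J_inj. cbn [on2 lift nat1]. rJ.
    eapply (LF_uniq (LC_companion (cc A))).
    + eapply LF_top; [ apply LC_companion | apply bd_J | | apply LF_lift ].
      rewrite HF2. bdt.
    + rewrite HF2, HG2.
      assert (E : vT (fsT F (J a)) (J (vh s g)) = vT (J (vh s f)) (fsT G (J a))).
      { generalize (J_eq (vpt_nat Hs a)). rJ. rewrite !(J_eq (vpt_vid Hs _)), !fsT_J.
        idT. exact (fun h => h). }
      eapply (LF_eq E), LF_bot; [ apply LC_companion | apply LC_companion | apply bd_J | | apply LF_lift ]. bdt.
  - intros A A' A'' f g. apply J_inj. cbn [fc on1 lift nat1]. rJ.
    eapply (LF_uniq (LC_companion (cc A))).
    + eapply LF_top; [ apply LC_companion | apply bd_J | | apply LF_lift ]. bdt.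
    + idT. rewrite <- vT_assoc.
      pose proof (J_eq (vpt_dfc Hs f g)) as E. revert E. rJ. intros E.
      eapply (LF_eq E), LF_bot; [ apply LC_companion | apply LC_companion | | apply bd_J | ].
      2: { eapply LF_paste; [ apply LC_companion | apply (LC_companion (cc A')) | apply LC_companion | apply bd_J
        | apply bd_J | apply LF_lift | apply LF_lift ]. }
      bdt.
  - intros A. apply J_inj. cbn [fu on1 lift nat1]. rJ.
    eapply (LF_uniq (LC_companion (cc A))).
    + eapply LF_top; [ apply LC_companion | apply bd_J | | apply LF_lift ]. bdt.
    + idT.
      pose proof (J_eq (vpt_dfu Hs A)) as E. revert E. rJ. intros E.
      apply (LF_eq E). split; [ bdt | ]. ix. idT.
      transitivity (vT (J (comp_eps (cc A))) (J (dfu G A))).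
      * transitivity (vT (hT (J (comp_eps (cc A))) (idh (hid (go A)))) (hT (idh (hid (go A))) (J (dfu G A)))).
        -- ix. idT. reflexivity.
        -- idT. reflexivity.
      * transitivity (hT (vT (J (sqv (c A))) (J (dfu G A))) (vT (J (comp_eps (cc A))) (idh (hid (go A))))).
        -- xi. idT. reflexivity.
        -- idT. reflexivity.
Qed.

Lemma lift_pneq (hi : forall A, inhabited (companion (ci A))) : is_pneq Fp Gp (lift s i cc e1 e2).
Proof.
  split; [ apply lift_pn | ]. intro A. destruct (hi A) as [d].
  exact (companion_equiv (cc A) d (e1 A) (e2 A)).
Qed.
End Lift.

(* The lift of a vertical transformation, at the companion of a 1v-cell where it is strict. *)
Lemma vpt_companion {fo go} {F : pdf B fo} {G : pdf B go}
    (HF : forall A, vT (J (dfui F A)) (J (dfu F A)) = J (sqh (fh F (hid A))))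
    (HG : forall A, vT (J (dfu G A)) (J (dfui G A)) = J (sqh (hid (go A)))) {c}
    {s : vpt_of F G c} (Hs : is_vpt F G s) {A A'} {f : hor A A'} {w : ver A A'} {e} :
  LC f w e -> J (vd s w) = J (sqv (c A ⇣ fv G w)) ->
  vT (J (vh s f)) (FE G e A') = vT (FE F e A') (J (sqv (c A'))).
Proof.
  intros [[x ->] _] E. unfold FE. rewrite <- vT_assoc.
  pose proof (J_eq (vpt_nat Hs x)) as N. revert N. rJ. rewrite E, (J_eq (vpt_vid Hs _)).
  rewrite !fsT_J.
  rewrite <- (J_right E). idT. intro N.
  assert (N' : vT (vT (J (vh s f)) (J (fs G x))) (J (dfui G A')) = vT (vT (J (fs F x)) (J (vh s (hid A')))) (J (dfui G A'))).
  { now rewrite N. }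
  rewrite N', !vT_assoc. f_equal.
  pose proof (J_eq (vpt_dfu Hs A')) as M. revert M. rJ. intro M.
  transitivity (vT (vT (J (dfui F A')) (J (dfu F A'))) (vT (J (vh s (hid A'))) (J (dfui G A')))).
  - rewrite HF. idT. reflexivity.
  - rewrite vT_assoc, <- (vT_assoc (J (dfu F A'))), M, vT_assoc, HG. idT. reflexivity.
Qed.

Lemma Hlcs_functor {b : bin B} {L : lcs b} (FL : lcs_functor L) : blcs_functor (Hlcs L).
Proof.
  split.
  - intros X X' X'' k k' Y Y' f. apply J_inj. rJ. generalize (J_eq (proj1 (lcf_comp FL k k') _ _ f)). rT.
    intro E. symmetry. exact E.
  - intros X Y Y' f. apply J_inj. rJ. generalize (J_eq (proj1 (lcf_unit FL X) _ _ f)). rT.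
    intro E. symmetry. exact E.
Qed.

Lemma lcf_vid' {b : bin B} {L : lcs b} (FL : lcs_functor L) {X Y Y' : B} (k : hor Y Y') :
  J (vh (lv L (vid X)) k) = idh (fh (lt b X) k).
Proof. destruct (lcf_vid FL X) as (_ & E & _). exact (J_eq (E _ _ k)). Qed.

Lemma Hlcs_laws {b : bin B} {L : lcs b} (HL : lcs_laws L) (FL : lcs_functor L) : blcs_laws (Hlcs L).
Proof.
  split.
  - intros X X' k. apply (lcs_h HL k).
  - intros X X' k k' a Y Y' f. apply J_inj. rJ. generalize (J_eq (proj1 (lcs_s HL a) _ _ f)). rJ.
    rewrite !(lcf_vid' FL). intro E. symmetry. exact E.
Qed.

(* [û ⋉ -] is the companion-lift of [u ⋉ -] *)
Lemma LF_lcs {b : bin B} (Hb : is_bin b) {L : lcs b} (HL : lcs_laws L) (FL : lcs_functor L) {X X' : B} {x : hor X X'}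
    {u : ver X X'} {e} (h : LC x u e) {Y Y'} (f : hor Y Y') :
  LF (fh (lt b X) f) (fh (rt b Y) x) (fh (rt b Y') x) (fh (lt b X') f)
    (FE (rt b Y) e X') (FE (rt b Y') e X') (J (hd (lh L x) f)) (J (vh (lv L u) f)).
Proof.
  pose proof (LC_FE (proj2 Hb Y) h). pose proof (LC_FE (proj2 Hb Y') h).
  destruct h as [[a ->] _]. split; [ apply bd_J | ]. unfold FE.
  pose proof (J_eq (proj1 (lcs_s HL a) _ _ f)) as E. revert E. rT. rwq (lcf_vid' FL (X:=X') f). intro E.
  transitivity (vT (J (hd (lh L x) f)) (vT (hT (J (fs (rt b Y) a)) (J (sqh (fh (lt b X') f)))) (hT (J (dfui (rt b Y) X')) (J (sqh (fh (lt b X') f)))))).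
  - ix. idT. reflexivity.
  - rewrite <- vT_assoc, <- E.
    pose proof (J_eq (proj1 (lcf_unit FL X') _ _ f)) as N. revert N. rT. idT. intro N.
    (* The unit law [N] with both unitors moved to the other side. *)
    assert (M : vT (J (hd (lh L (hid X')) f)) (hT (J (dfui (rt b Y) X')) (idh (fh (lt b X') f)))
      = hT (idh (fh (lt b X') f)) (J (dfui (rt b Y') X'))).
    { transitivity (vT (vT (hT (idh (fh (lt b X') f)) (J (dfui (rt b Y') X')))
        (hT (idh (fh (lt b X') f)) (J (dfu (rt b Y') X')))) (vT (J (hd (lh L (hid X')) f))
         (hT (J (dfui (rt b Y) X')) (idh (fh (lt b X') f))))).
      - ix. rewrite (dfui_dfu (proj2 Hb Y')). idF. reflexivity.
      - rewrite vT_assoc, <- (vT_assoc (hT _ (J (dfu (rt b Y') X')))). rwq N. ix.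
        rewrite (dfu_dfui (proj2 Hb Y)). idF. reflexivity. }
    rwq M. ix. idT. reflexivity.
Qed.

(** The exchange cell lifts the square of [u ⋉ -] at [y]. Triviality of the exchange of [u] with [v]
    makes that square compatible with the counits of the images of [y], so [LF_TH] applies. *)
Lemma TH_exch {b : bin B} (Hb : is_bin b) {L : lcs b} {R : lcs (brev b)} (triv : vd_trivial L R)
    (HL : lcs_laws L) (FL : lcs_functor L) {X X' : B} {x : hor X X'}
    {u : ver X X'} {e} (h : LC x u e) {Y Y'} {y : hor Y Y'} {v : ver Y Y'} {d} (h' : LC y v d) :
  TH (fh (lt b X) y · fh (rt b Y') x) (fh (rt b Y) x · fh (lt b X') y)
    (cmp (FE (lt b X) d Y') (fh (rt b Y') x) (FE (rt b Y') e X'))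
    (cmp (FE (rt b Y) e X') (fh (lt b X') y) (FE (lt b X') d Y')) (J (hd (lh L x) y)).
Proof.
  eapply LF_TH; [ apply (LC_FE (proj2 Hb Y) h) | apply (LC_FE (proj2 Hb Y') h)
    | apply (LC_FE (proj1 Hb X) h') | apply (LC_FE (proj1 Hb X') h') | apply bd_J | | apply (LF_lcs Hb HL FL h) ].
  apply (vpt_companion (dfui_dfu (proj1 Hb X)) (dfu_dfui (proj1 Hb X')) (lcs_v HL u) h').
  apply triv.
Qed.
End General.

(** * Bicategorical structure cells as comparisons *)

Section CanonicalCells.
Context {B : dbl}.
Local Notation idh f := (J (sqh f)).
Local Notation HB := (HB B).

Lemma LC_eq {A A' : B} {x : hor A A'} {u v : ver A A'} {e} : LC x u e -> u = v -> LC x v e.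
Proof. now intros h <-. Qed.

Lemma FE_comp {fo go} {F : pdf B fo} {G : pdf B go} (HG : is_pdf G)
    {A A' : B} {x : hor A A'} {u e} : LC x u e ->
  FE (pdf_comp F G) e A' = FE G (FE F e A') (fo A').
Proof.
  intros [b _]. unfold FE. rewrite (fsT_v HG (bd_fs F b) (bd_J (dfui F A'))); [ | n1 ].
  rewrite vT_assoc. destruct b as [s ->]. rewrite !fsT_J. f_equal.
  etransitivity; [ exact (J_comp2 _ _) | ]. f_equal. exact (J_fsg G (dfui F A')).
Qed.

Lemma FE_id {A A' : B} {x : hor A A'} {u e} : LC x u e -> FE (pdf_id B) e A' = e.
Proof.
  intros [b _]. unfold FE. destruct b as [s ->]. rewrite fsT_J.
  change (vT (J s) (idh (hid A')) = J s). idT. reflexivity.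
Qed.

Lemma comp_dfui_dfu {fo go} {F : pdf B fo} {G : pdf B go} (HF : is_pdf F) (HG : is_pdf G) A :
  vT (J (dfui (pdf_comp F G) A)) (J (dfu (pdf_comp F G) A)) = J (sqh (fh (pdf_comp F G) (hid A))).
Proof.
  cbn [pdf_comp dfui dfu]. rJ. rewrite vT_assoc, <- (vT_assoc (J (dfui G _))), (dfui_dfu HG).
  idT. rewrite <- (fsT_v HG (bd_J (dfui F A)) (bd_J (dfu F A)) eq_refl), (dfui_dfu HF).
  exact (fsT_sqh HG _).
Qed.

Lemma comp_dfu_dfui {fo go} {F : pdf B fo} {G : pdf B go} (HF : is_pdf F) (HG : is_pdf G) A :
  vT (J (dfu (pdf_comp F G) A)) (J (dfui (pdf_comp F G) A)) = J (sqh (hid (go (fo A)))).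
Proof.
  cbn [pdf_comp dfui dfu]. rJ. rewrite vT_assoc, <- (vT_assoc (fsT G (J (dfu F A)))).
  rewrite <- (fsT_v HG (bd_J (dfu F A)) (bd_J (dfui F A)) eq_refl), (dfu_dfui HF), (fsT_sqh HG).
  idT. apply (dfu_dfui HG).
Qed.

Lemma LF_pn_comp {fo go ho : B -> B} {F : forall A A', hom HB A A' -> hom HB (fo A) (fo A')}
    {G : forall A A', hom HB A A' -> hom HB (go A) (go A')}
    {K : forall A A', hom HB A A' -> hom HB (ho A) (ho A')} {c d}
    (s : pn HB HB F G c) (t : pn HB HB G K d) {A A' : B} (f : hor A A')
    {ex ey ex' ey' S S' u v u' v'} :
  LC (c A) u ex -> LC (c A') v ey -> LC (d A) u' ex' -> LC (d A') v' ey' ->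
  bd S (F A A' f) u v (G A A' f) -> bd S' (G A A' f) u' v' (K A A' f) ->
  LF (F A A' f) (c A) (c A') (G A A' f) ex ey (J (nat1 s f)) S ->
  LF (G A A' f) (d A) (d A') (K A A' f) ex' ey' (J (nat1 t f)) S' ->
  LF (F A A' f) (c A · d A) (c A' · d A') (K A A' f) (cmp ex (d A) ex') (cmp ey (d A') ey')
    (J (nat1 (pn_comp s t) f)) (vT S S').
Proof.
  intros h1 h2 h3 h4 b1 b2 h5 h6. pose proof (LF_stack h1 h2 h3 h4 b1 b2 h5 h6) as h.
  destruct h as [hb hE]. split; [ exact (bd_J (nat1 (pn_comp s t) f)) | ].
  rewrite <- hE. f_equal. cbn [pn_comp nat1]. rJ. idT. reflexivity.
Qed.

Lemma LF_pn_post {fo go ko : B -> B} {F : forall A A', hom HB A A' -> hom HB (fo A) (fo A')}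
    {G : forall A A', hom HB A A' -> hom HB (go A) (go A')} {c}
    {K : pdf B ko} (HK : is_pdf K)
    (s : pn HB HB F G c) {A A' : B} (f : hor A A')
    {ex ey S u v} :
  LC (c A) u ex -> LC (c A') v ey -> bd S (F A A' f) u v (G A A' f) ->
  LF (F A A' f) (c A) (c A') (G A A' f) ex ey (J (nat1 s f)) S ->
  LF (fh K (F A A' f)) (fh K (c A)) (fh K (c A')) (fh K (G A A' f)) (FE K ex (go A)) (FE K ey (go A'))
    (J (nat1 (pn_post (Hpf K) s) f)) (fsT K S).
Proof.
  intros h1 h2 b1 h5. destruct (LF_post HK h1 h2 b1 h5) as [hb hE].
  split; [ exact (bd_J (nat1 (pn_post (Hpf K) s) f)) | ].
  rewrite <- hE. f_equal. cbn [pn_post nat1]. rJ. reflexivity.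
Qed.

Lemma LF_is_mod {fo go : B -> B} {F : forall A A', hom HB A A' -> hom HB (fo A) (fo A')}
    {G : forall A A', hom HB A A' -> hom HB (go A) (go A')} {c d}
    (s : pn HB HB F G c) (t : pn HB HB F G d) (m : forall A, cell HB (c A) (d A))
    {A A' : B} (f : hor A A') {ex ey ex' ey' S u v u' v'} :
  LC (d A) u' ex' -> LC (c A') v ey -> LC (d A') v' ey' -> bd S (F A A' f) u v (G A A' f) ->
  LF (F A A' f) (c A) (c A') (G A A' f) ex ey (J (nat1 s f)) S ->
  LF (F A A' f) (d A) (d A') (G A A' f) ex' ey' (J (nat1 t f)) S ->
  TH (c A) (d A) ex ex' (J (m A)) -> TH (c A') (d A') ey ey' (J (m A')) ->
  comp2 HB (nat1 s f) (whiskr (G A A' f) (m A)) = comp2 HB (whiskl (F A A' f) (m A')) (nat1 t f).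
Proof. intros h1 h2 h3 h4 h5 h6 h7 h8. apply J_inj. rJ. exact (LF_cell h1 h2 h3 h4 h5 h6 h7 h8). Qed.

Lemma THJ_comp {A A' : B} {x y z : hor A A'} {e e' e''} {m : cell HB x y} {n : cell HB y z} :
  TH x y e e' (J m) -> TH y z e' e'' (J n) -> TH x z e e'' (J (comp2 HB m n)).
Proof. intros h h'. rJ. exact (TH_comp h h'). Qed.

Lemma THJ_wl {A A' A'' : B} {x : hor A A'} {y y' : hor A' A''} {e d d' u v} {n : cell HB y y'} :
  LC x u e -> LC y' v d' -> TH y y' d d' (J n) ->
  TH (x · y) (x · y') (cmp e y d) (cmp e y' d') (J (whiskl (b := HB) (x : hom HB A A') n)).
Proof. intros. rJ. eapply TH_wl; eassumption. Qed.

Lemma THJ_wr {A A' A'' : B} {x x' : hor A A'} {y : hor A' A''} {e e' d u v} {m : cell HB x x'} :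
  LC x' u e' -> LC y v d -> TH x x' e e' (J m) ->
  TH (x · y) (x' · y) (cmp e y d) (cmp e' y d) (J (whiskr (b := HB) (y : hom HB A' A'') m)).
Proof. intros. rJ. eapply TH_wr; eassumption. Qed.

Section Assoc.
Context {A1 A2 A3 A4 : B} {x : hor A1 A2} {y : hor A2 A3} {z : hor A3 A4} {u v w e d c}
  (h1 : LC x u e) (h2 : LC y v d) (h3 : LC z w c).

Lemma THJ_assoc : TH ((x · y) · z) (x · (y · z)) (cmp (cmp e y d) z c) (cmp e (y · z) (cmp d z c))
  (J (assoc (b := HB) x y z)).
Proof. rJ. exact (TH_assoc h1 h2 h3). Qed.

Lemma THJ_associ : TH (x · (y · z)) ((x · y) · z) (cmp e (y · z) (cmp d z c)) (cmp (cmp e y d) z c)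
  (J (associ (b := HB) x y z)).
Proof.
  refine (TH_inv _ THJ_assoc (bd_J (associ (b := HB) x y z)) _).
  - exact (LC_cmp h1 (LC_cmp h2 h3)).
  - rJ. idT. apply J_sqh_eq; n1.
Qed.
End Assoc.

Section Unit.
Context {A A' : B} {x : hor A A'} {u e} (h : LC x u e).
Lemma THJ_id : TH x x e e (J (id2 (b := HB) x)).
Proof. rJ. exact (TH_id h). Qed.
Lemma THJ_lun : TH (hid A · x) x (cmp (idh (hid A)) x e) e (J (lun (b := HB) x)).
Proof. rewrite (cmp_idl h). rJ. split; [ bdt | ]. pose proof (LC_bd h). idT. reflexivity. Qed.
Lemma THJ_luni : TH x (hid A · x) e (cmp (idh (hid A)) x e) (J (luni (b := HB) x)).
Proof. rewrite (cmp_idl h). rJ. split; [ bdt | ]. pose proof (LC_bd h). idT. reflexivity. Qed.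
Lemma THJ_run : TH (x · hid A') x (cmp e (hid A') (idh (hid A'))) e (J (run (b := HB) x)).
Proof. rewrite (cmp_idr h). rJ. split; [ bdt | ]. pose proof (LC_bd h). idT. reflexivity. Qed.
Lemma THJ_runi : TH x (x · hid A') e (cmp e (hid A') (idh (hid A'))) (J (runi (b := HB) x)).
Proof. rewrite (cmp_idr h). rJ. split; [ bdt | ]. pose proof (LC_bd h). idT. reflexivity. Qed.
End Unit.

Section Functor.
Context {fo : B -> B} {F : pdf B fo} (HF : is_pdf F).

Lemma THJ_on2 {A A' : B} {x y : hor A A'} {e e' u} {m : cell HB x y} :
  LC y u e' -> TH x y e e' (J m) ->
  TH (fh F x) (fh F y) (FE F e A') (FE F e' A') (J (on2 (Hpf F) _ _ _ _ m)).
Proof. intros h h'. rJ. exact (TH_F HF h h'). Qed.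
End Functor.

Lemma TH_unique {A A' : B} {x y : hor A A'} {e e' u} {m n : cell HB x y} : LC y u e' ->
  TH x y e e' (J m) -> TH x y e e' (J n) -> m = n.
Proof. intros h h1 h2. apply J_inj. exact (TH_uniq h h1 h2). Qed.
End CanonicalCells.

Ltac cbnB := cbn [on1 Hpf Hbin blt brt btens basc blam brho Hconstr bI pf_comp comp1 id1 HB hom bt_1].

(* Computes a companion of a composite of companions and their images; [Hb : is_bin b]. *)
Ltac lc Hb :=
  cbnB;
  lazymatch goal with
  | h : LC ?x _ _ |- LC ?x _ _ => exact h
  | |- LC (hcomp _ _) _ _ => eapply LC_cmp; [ lc Hb | lc Hb ]
  | |- LC (hid _) _ _ => apply LC_id
  | |- LC (comp_h _) _ _ => apply LC_companion
  | |- LC (fh (lt _ ?X) _) _ _ => eapply (LC_FE (proj1 Hb X)); lc Hb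
  | |- LC (fh (rt _ ?X) _) _ _ => eapply (LC_FE (proj2 Hb X)); lc Hb
  | |- LC (fh (pdf_comp ?F ?G) ?x) ?u ?e => change (LC (fh G (fh F x)) u e); lc Hb
  | |- LC (fh (pdf_id _) ?x) ?u ?e => change (LC x u e); lc Hb
  end.

Lemma pdf_id_dfu {B : dbl} A : vT (J (dfu (pdf_id B) A)) (J (dfui (pdf_id B) A)) = J (sqh (hid A)).
Proof. cbn. idT. reflexivity. Qed.

(** * The horizontal premonoidal bicategory *)

Section HorizontalPremonoidal.
Context {B : dbl} {b : bin B} {s : side} {P : pmd b} {L : lcs b} {R : lcs (brev b)}
  (l : liftable P) (hB : is_central_premonoidal_dbl s P L R) (hl : inv_liftable P)
  (hvv : forall (X X' : B) (U : ver X X') (Y Y' : B) (u : ver Y Y'),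
       sqeq (vd (lv R u) U) (sqv (vcomp (fv (lt b X) u) (fv (rt b Y') U)))).
Local Notation HB := (HB B).
Local Notation K := (Hconstr l).
Local Notation idh f := (J (sqh f)).
Local Notation "X ⊗ Y" := (tens b X Y) (at level 39, left associativity).

Let HP := cpd_pm hB.
Let Hb := pmd_bin HP.
Let CF := central_full (cpd_cen hB) hvv.
Let triv := proj1 (proj1 CF).
Let HL := proj1 (proj2 (proj1 CF)).
Let FL := proj2 (proj2 (proj1 CF)).
Let HR := proj1 (proj2 CF).
Let FR := proj2 (proj2 CF).

Lemma Hbin_is_bbin : is_bbin (Hbin b).
Proof. split; intro X; [ apply (proj1 Hb X) | apply (proj2 Hb X) ]. Qed.

Lemma Hbin_is_constr : is_constr K.
Proof.
  constructor.
  - intros Y Z. apply (@lift_pneq B _ _ (pdf_comp (rt b Y) (rt b Z)) (rt b (Y ⊗ Z))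
      (fun A A' f g a => on2 (Hpf (rt b Z)) _ _ _ _ (on2 (Hpf (rt b Y)) _ _ _ _ a))
      (fun A A' f g a => on2 (Hpf (rt b (Y ⊗ Z))) _ _ _ _ a)).
    + intros. rJ. reflexivity.
    + intros. rJ. reflexivity.
    + apply (pmd_a1 HP).
    + intro X. apply hl.
  - intros X Z. apply (@lift_pneq B _ _ (pdf_comp (lt b X) (rt b Z)) (pdf_comp (rt b Z) (lt b X))
      (fun A A' f g a => on2 (Hpf (rt b Z)) _ _ _ _ (on2 (Hpf (lt b X)) _ _ _ _ a))
      (fun A A' f g a => on2 (Hpf (lt b X)) _ _ _ _ (on2 (Hpf (rt b Z)) _ _ _ _ a))).
    + intros. rJ. reflexivity.
    + intros. rJ. reflexivity.
    + apply (pmd_a2 HP).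
    + intro Y. apply hl.
  - intros X Y. apply (@lift_pneq B _ _ (lt b (X ⊗ Y)) (pdf_comp (lt b Y) (lt b X))
      (fun A A' f g a => on2 (Hpf (lt b (X ⊗ Y))) _ _ _ _ a)
      (fun A A' f g a => on2 (Hpf (lt b X)) _ _ _ _ (on2 (Hpf (lt b Y)) _ _ _ _ a))).
    + intros. rJ. reflexivity.
    + intros. rJ. reflexivity.
    + apply (pmd_a3 HP).
    + intro Z. apply hl.
  - apply (@lift_pneq B _ _ (lt b (dI P)) (pdf_id B)
      (fun A A' f g a => on2 (Hpf (lt b (dI P))) _ _ _ _ a) (fun A A' f g a => a)).
    + intros. rJ. reflexivity.
    + intros. reflexivity.
    + apply (pmd_lam HP).
    + intro X. apply hl.
  - apply (@lift_pneq B _ _ (rt b (dI P)) (pdf_id B)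
      (fun A A' f g a => on2 (Hpf (rt b (dI P))) _ _ _ _ a) (fun A A' f g a => a)).
    + intros. rJ. reflexivity.
    + intros. reflexivity.
    + apply (pmd_rho HP).
    + intro X. apply hl.
Qed.

Lemma HL_laws : blcs_laws (Hlcs L). Proof. exact (Hlcs_laws HL FL). Qed.
Lemma HL_functor : blcs_functor (Hlcs L). Proof. exact (Hlcs_functor FL). Qed.
Lemma HR_laws : blcs_laws (b := bbrev (Hbin b)) (Hlcs R). Proof. exact (Hlcs_laws HR FR). Qed.
Lemma HR_functor : blcs_functor (b := bbrev (Hbin b)) (Hlcs R). Proof. exact (Hlcs_functor FR). Qed.

Lemma Hexchange : bexchange (Hlcs L) (Hlcs R).
Proof. intros X X' f Y Y' g. exact (ex_hh (proj1 (cpd_cen hB)) f g). Qed.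

Lemma Hcentral : is_bcentral s (Hlcs L) (Hlcs R).
Proof.
  pose proof HL_laws. pose proof HL_functor. pose proof HR_laws. pose proof HR_functor.
  split; [ apply Hexchange | ]. case s; split; assumption.
Qed.

Lemma HL_ccen : is_ccen (chosen_ccen K (Hlcs L) (Hlcs R)).
Proof.
  constructor; intros; first [ apply (proj1 HL_laws) | apply (proj1 HR_laws) ].
Qed.

(** Strictness of [t] is what [vpt_companion] needs at the 1v-cell [w]. Hence the naturality cells
    of the lifted constraints, and their inverses, are comparisons at companions. *)
Lemma TH_lift {fo go} {F : pdf B fo} {G : pdf B go}
    (HF : forall A, vT (J (dfui F A)) (J (dfu F A)) = J (sqh (fh F (hid A))))
    (HG : forall A, vT (J (dfu G A)) (J (dfui G A)) = J (sqh (hid (go A)))) {c ci}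
    {t : vpt_of F G c} {i : vinv (@fh _ _ F) (@fh _ _ G) ci} (H : is_inv_strict F G t i)
    (cc : forall A, companion (c A))
    (e1 : forall A, c A ⇣ ci A = vid _) (e2 : forall A, ci A ⇣ c A = vid _)
    {A A'} {f : hor A A'} {w : ver A A'} {e} :
  LC f w e -> LC (fh F f) (fv F w) (FE F e A') -> LC (fh G f) (fv G w) (FE G e A') ->
  TH (fh F f · comp_h (cc A')) (comp_h (cc A) · fh G f)
     (cmp (FE F e A') (comp_h (cc A')) (J (comp_eps (cc A'))))
     (cmp (J (comp_eps (cc A))) (fh G f) (FE G e A'))
     (J (nat1 (lift t i cc e1 e2) f)) /\
  TH (comp_h (cc A) · fh G f) (fh F f · comp_h (cc A'))
     (cmp (J (comp_eps (cc A))) (fh G f) (FE G e A'))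
     (cmp (FE F e A') (comp_h (cc A')) (J (comp_eps (cc A'))))
     (J (nat1i (lift t i cc e1 e2) f)).
Proof.
  intros h h1 h2. destruct H as (Ht & St & Hi).
  assert (E : TH (fh F f · comp_h (cc A')) (comp_h (cc A) · fh G f)
     (cmp (FE F e A') (comp_h (cc A')) (J (comp_eps (cc A'))))
     (cmp (J (comp_eps (cc A))) (fh G f) (FE G e A'))
     (J (nat1 (lift t i cc e1 e2) f))).
  { eapply LF_TH; [ apply LC_companion | apply LC_companion | exact h1 | exact h2 | apply bd_J | | apply LF_lift ].
    apply (vpt_companion HF HG Ht h). apply J_eq, St. }
  split; [ exact E | ].
  refine (TH_inv _ E (bd_J _) _).
  - exact (LC_cmp (LC_companion (cc A)) h2).
  - apply lifti_lift; [ apply e2 | ]. rewrite vT_J. apply J_eq, Hi.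
Qed.

Local Notation eA X Y Z := (J (comp_eps (asc_c l X Y Z))).
Local Notation cA X Y Z := (comp_h (asc_c l X Y Z)).

Section Leaves.
Context {A A' : B} {f : hor A A'} {w : ver A A'} {e : T (B:=B)} (h : LC f w e).

Lemma TH_a1 Y Z :
  TH (fh (rt b Z) (fh (rt b Y) f) · cA A' Y Z) (cA A Y Z · fh (rt b (Y ⊗ Z)) f)
    (cmp (FE (rt b Z) (FE (rt b Y) e A') (A' ⊗ Y)) (cA A' Y Z) (eA A' Y Z))
    (cmp (eA A Y Z) (fh (rt b (Y ⊗ Z)) f) (FE (rt b (Y ⊗ Z)) e A')) (J (nat1 (ba1 K Y Z) f)) /\
  TH (cA A Y Z · fh (rt b (Y ⊗ Z)) f) (fh (rt b Z) (fh (rt b Y) f) · cA A' Y Z)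
    (cmp (eA A Y Z) (fh (rt b (Y ⊗ Z)) f) (FE (rt b (Y ⊗ Z)) e A'))
    (cmp (FE (rt b Z) (FE (rt b Y) e A') (A' ⊗ Y)) (cA A' Y Z) (eA A' Y Z)) (J (nat1i (ba1 K Y Z) f)).
Proof.
  rewrite <- (FE_comp (F := rt b Y) (proj2 Hb Z) h).
  apply (TH_lift (F := pdf_comp (rt b Y) (rt b Z)) (G := rt b (Y ⊗ Z))
    (comp_dfui_dfu (proj2 Hb Y) (proj2 Hb Z)) (dfu_dfui (proj2 Hb _)) (pmd_a1 HP Y Z)
    (fun X => asc_c l X Y Z) _ _ h).
  - rewrite (FE_comp (F := rt b Y) (proj2 Hb Z) h). apply (LC_FE (proj2 Hb Z) (LC_FE (proj2 Hb Y) h)).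
  - apply (LC_FE (proj2 Hb _) h).
Qed.

Lemma TH_a2 X Z :
  TH (fh (rt b Z) (fh (lt b X) f) · cA X A' Z) (cA X A Z · fh (lt b X) (fh (rt b Z) f))
    (cmp (FE (rt b Z) (FE (lt b X) e A') (X ⊗ A')) (cA X A' Z) (eA X A' Z))
    (cmp (eA X A Z) (fh (lt b X) (fh (rt b Z) f)) (FE (lt b X) (FE (rt b Z) e A') (A' ⊗ Z))) (J (nat1 (ba2 K X Z) f)) /\
  TH (cA X A Z · fh (lt b X) (fh (rt b Z) f)) (fh (rt b Z) (fh (lt b X) f) · cA X A' Z)
    (cmp (eA X A Z) (fh (lt b X) (fh (rt b Z) f)) (FE (lt b X) (FE (rt b Z) e A') (A' ⊗ Z)))
    (cmp (FE (rt b Z) (FE (lt b X) e A') (X ⊗ A')) (cA X A' Z) (eA X A' Z)) (J (nat1i (ba2 K X Z) f)).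
Proof.
  rewrite <- (FE_comp (F := lt b X) (proj2 Hb Z) h), <- (FE_comp (F := rt b Z) (proj1 Hb X) h).
  apply (TH_lift (F := pdf_comp (lt b X) (rt b Z)) (G := pdf_comp (rt b Z) (lt b X))
    (comp_dfui_dfu (proj1 Hb X) (proj2 Hb Z)) (comp_dfu_dfui (proj2 Hb Z) (proj1 Hb X)) (pmd_a2 HP X Z)
    (fun Y => asc_c l X Y Z) _ _ h).
  - rewrite (FE_comp (F := lt b X) (proj2 Hb Z) h). apply (LC_FE (proj2 Hb Z) (LC_FE (proj1 Hb X) h)).
  - rewrite (FE_comp (F := rt b Z) (proj1 Hb X) h). apply (LC_FE (proj1 Hb X) (LC_FE (proj2 Hb Z) h)).
Qed.

Lemma TH_a3 X Y :
  TH (fh (lt b (X ⊗ Y)) f · cA X Y A') (cA X Y A · fh (lt b X) (fh (lt b Y) f))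
    (cmp (FE (lt b (X ⊗ Y)) e A') (cA X Y A') (eA X Y A'))
    (cmp (eA X Y A) (fh (lt b X) (fh (lt b Y) f)) (FE (lt b X) (FE (lt b Y) e A') (Y ⊗ A'))) (J (nat1 (ba3 K X Y) f)) /\
  TH (cA X Y A · fh (lt b X) (fh (lt b Y) f)) (fh (lt b (X ⊗ Y)) f · cA X Y A')
    (cmp (eA X Y A) (fh (lt b X) (fh (lt b Y) f)) (FE (lt b X) (FE (lt b Y) e A') (Y ⊗ A')))
    (cmp (FE (lt b (X ⊗ Y)) e A') (cA X Y A') (eA X Y A')) (J (nat1i (ba3 K X Y) f)).
Proof.
  rewrite <- (FE_comp (F := lt b Y) (proj1 Hb X) h).
  apply (TH_lift (F := lt b (X ⊗ Y)) (G := pdf_comp (lt b Y) (lt b X))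
    (dfui_dfu (proj1 Hb _)) (comp_dfu_dfui (proj1 Hb Y) (proj1 Hb X)) (pmd_a3 HP X Y)
    (fun Z => asc_c l X Y Z) _ _ h).
  - apply (LC_FE (proj1 Hb _) h).
  - rewrite (FE_comp (F := lt b Y) (proj1 Hb X) h). apply (LC_FE (proj1 Hb X) (LC_FE (proj1 Hb Y) h)).
Qed.

Lemma TH_la :
  TH (fh (lt b (dI P)) f · comp_h (lam_c l A')) (comp_h (lam_c l A) · f)
    (cmp (FE (lt b (dI P)) e A') (comp_h (lam_c l A')) (J (comp_eps (lam_c l A'))))
    (cmp (J (comp_eps (lam_c l A))) f e) (J (nat1 (blamT K) f)) /\
  TH (comp_h (lam_c l A) · f) (fh (lt b (dI P)) f · comp_h (lam_c l A'))
    (cmp (J (comp_eps (lam_c l A))) f e)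
    (cmp (FE (lt b (dI P)) e A') (comp_h (lam_c l A')) (J (comp_eps (lam_c l A'))))
    (J (nat1i (blamT K) f)).
Proof.
  pose proof (TH_lift (dfui_dfu (proj1 Hb (dI P))) (pdf_id_dfu (B := B)) (pmd_lam HP)
    (fun X => lam_c l X) (fun X => iv_r (dlamC P X)) (fun X => iv_l (dlamC P X)) h
    (LC_FE (proj1 Hb _) h)) as E.
  rewrite (FE_id h) in E. exact (E h).
Qed.

Lemma TH_rh :
  TH (fh (rt b (dI P)) f · comp_h (rho_c l A')) (comp_h (rho_c l A) · f)
    (cmp (FE (rt b (dI P)) e A') (comp_h (rho_c l A')) (J (comp_eps (rho_c l A'))))
    (cmp (J (comp_eps (rho_c l A))) f e) (J (nat1 (brhoT K) f)) /\
  TH (comp_h (rho_c l A) · f) (fh (rt b (dI P)) f · comp_h (rho_c l A'))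
    (cmp (J (comp_eps (rho_c l A))) f e)
    (cmp (FE (rt b (dI P)) e A') (comp_h (rho_c l A')) (J (comp_eps (rho_c l A'))))
    (J (nat1i (brhoT K) f)).
Proof.
  pose proof (TH_lift (dfui_dfu (proj2 Hb (dI P))) (pdf_id_dfu (B := B)) (pmd_rho HP)
    (fun X => rho_c l X) (fun X => iv_r (drhoC P X)) (fun X => iv_l (drhoC P X)) h
    (LC_FE (proj2 Hb _) h)) as E.
  rewrite (FE_id h) in E. exact (E h).
Qed.
End Leaves.

Section Exchange.
Context {X X' Y Y' : B} {x : hor X X'} {y : hor Y Y'} {u v d e} (h : LC x u e) (h' : LC y v d).

Lemma TH_L :
  TH (fh (lt b X) y · fh (rt b Y') x) (fh (rt b Y) x · fh (lt b X') y)
    (cmp (FE (lt b X) d Y') (fh (rt b Y') x) (FE (rt b Y') e X'))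
    (cmp (FE (rt b Y) e X') (fh (lt b X') y) (FE (lt b X') d Y')) (J (nat1 (Hlcs L x) y)) /\
  TH (fh (rt b Y) x · fh (lt b X') y) (fh (lt b X) y · fh (rt b Y') x)
    (cmp (FE (rt b Y) e X') (fh (lt b X') y) (FE (lt b X') d Y'))
    (cmp (FE (lt b X) d Y') (fh (rt b Y') x) (FE (rt b Y') e X')) (J (nat1i (Hlcs L x) y)).
Proof.
  pose proof (TH_exch Hb triv HL FL h h') as E. split; [ exact E | ].
  refine (TH_inv _ E (bd_J _) _).
  - exact (LC_cmp (LC_FE (proj2 Hb Y) h) (LC_FE (proj1 Hb X') h')).
  - generalize (to_J (pn_invi (proj1 HL_laws _ _ x) y)). rJ. exact (fun h => h).
Qed.
End Exchange.
End HorizontalPremonoidal.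

(* Proves that a 2-cell is a canonical comparison of companions; [leaf] treats the
   structure cells. *)
Ltac th Hb leaf :=
  lazymatch goal with |- TH _ _ _ _ (J ?t) =>
  lazymatch t with
  | comp2 _ _ _ => eapply THJ_comp; [ th Hb leaf | th Hb leaf ]
  | whiskl _ _ => eapply THJ_wl; [ lc Hb | lc Hb | th Hb leaf ]
  | whiskr _ _ => eapply THJ_wr; [ lc Hb | lc Hb | th Hb leaf ]
  | assoc _ _ _ => eapply THJ_assoc; lc Hb
  | associ _ _ _ => eapply THJ_associ; lc Hb
  | id2 _ => eapply THJ_id; lc Hb
  | lun _ => eapply THJ_lun; lc Hb
  | luni _ => eapply THJ_luni; lc Hb
  | run _ => eapply THJ_run; lc Hb
  | runi _ => eapply THJ_runi; lc Hb
  | on2 (blt _ ?X) _ _ _ _ _ => eapply (THJ_on2 (proj1 Hb X)); [ lc Hb | th Hb leaf ]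
  | on2 (brt _ ?X) _ _ _ _ _ => eapply (THJ_on2 (proj2 Hb X)); [ lc Hb | th Hb leaf ]
  | fc (blt _ ?X) _ _ => eapply (TH_dfc (proj1 Hb X)); lc Hb
  | fc (brt _ ?X) _ _ => eapply (TH_dfc (proj2 Hb X)); lc Hb
  | fci (blt _ ?X) _ _ => eapply (TH_dfci (proj1 Hb X)); lc Hb
  | fci (brt _ ?X) _ _ => eapply (TH_dfci (proj2 Hb X)); lc Hb
  | fu (blt _ ?X) _ => eapply (TH_dfu (proj1 Hb X))
  | fu (brt _ ?X) _ => eapply (TH_dfu (proj2 Hb X))
  | fui (blt _ ?X) _ => eapply (TH_dfui (proj1 Hb X))
  | fui (brt _ ?X) _ => eapply (TH_dfui (proj2 Hb X))
  | _ => leaf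
  end end.

(** * Canonical coherence cells *)

Section HorizontalPremonoidal.
Context {B : dbl} {b : bin B} {s : side} {P : pmd b} {L : lcs b} {R : lcs (brev b)}
  (l : liftable P) (hB : is_central_premonoidal_dbl s P L R) (hl : inv_liftable P)
  (hvv : forall (X X' : B) (U : ver X X') (Y Y' : B) (u : ver Y Y'),
       sqeq (vd (lv R u) U) (sqv (vcomp (fv (lt b X) u) (fv (rt b Y') U)))).
Local Notation HB := (HB B).
Local Notation K := (Hconstr l).
Local Notation idh f := (J (sqh f)).
Local Notation "X ⊗ Y" := (tens b X Y) (at level 39, left associativity).
Local Notation eA X Y Z := (J (comp_eps (asc_c l X Y Z))).
Local Notation cA X Y Z := (comp_h (asc_c l X Y Z)).
Local Notation eL X := (J (comp_eps (lam_c l X))).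
Local Notation cL X := (comp_h (lam_c l X)).
Local Notation eR X := (J (comp_eps (rho_c l X))).
Local Notation cR X := (comp_h (rho_c l X)).

Let HP := cpd_pm hB.
Let Hb := pmd_bin HP.
Let CF := central_full (cpd_cen hB) hvv.
Let triv := proj1 (proj1 CF).
Let HL := proj1 (proj2 (proj1 CF)).
Let FL := proj2 (proj2 (proj1 CF)).
Let HR := proj1 (proj2 CF).
Let FR := proj2 (proj2 CF).

Definition canonical (c : bcoh K) : Prop :=
  (forall W X Y Z, TH
    (fh (rt b Z) (cA W X Y) · (cA W (X ⊗ Y) Z · fh (lt b W) (cA X Y Z)))
    (cA (W ⊗ X) Y Z · cA W X (Y ⊗ Z))
    (cmp (FE (rt b Z) (eA W X Y) (W ⊗ (X ⊗ Y))) (cA W (X ⊗ Y) Z · fh (lt b W) (cA X Y Z))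
       (cmp (eA W (X ⊗ Y) Z) (fh (lt b W) (cA X Y Z)) (FE (lt b W) (eA X Y Z) (X ⊗ (Y ⊗ Z)))))
    (cmp (eA (W ⊗ X) Y Z) (cA W X (Y ⊗ Z)) (eA W X (Y ⊗ Z))) (J (cp c W X Y Z))) /\
  (forall W Y, TH (cA W (dI P) Y · fh (lt b W) (cL Y)) (fh (rt b Y) (cR W))
     (cmp (eA W (dI P) Y) (fh (lt b W) (cL Y)) (FE (lt b W) (eL Y) Y))
     (FE (rt b Y) (eR W) W) (J (cm c W Y))) /\
  (forall W Y, TH (cA (dI P) W Y · cL (W ⊗ Y)) (fh (rt b Y) (cL W))
     (cmp (eA (dI P) W Y) (cL (W ⊗ Y)) (eL (W ⊗ Y))) (FE (rt b Y) (eL W) W) (J (cl c W Y))) /\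
  (forall W Y, TH (cA W Y (dI P) · fh (lt b W) (cR Y)) (cR (W ⊗ Y))
     (cmp (eA W Y (dI P)) (fh (lt b W) (cR Y)) (FE (lt b W) (eR Y) Y)) (eR (W ⊗ Y)) (J (cr c W Y))).

(** Only the 1v-components of the pentagon and triangle equations are used: they make the two
    1h-cells in question companions of one 1v-cell. *)
Lemma canonical_exists : exists c : bcoh K, canonical c.
Proof.
  assert (Ep : forall W X Y Z, exists m : sq (fh (rt b Z) (cA W X Y) · (cA W (X ⊗ Y) Z · fh (lt b W) (cA X Y Z))) (vid _) (vid _)
    (cA (W ⊗ X) Y Z · cA W X (Y ⊗ Z)), TH
    (fh (rt b Z) (cA W X Y) · (cA W (X ⊗ Y) Z · fh (lt b W) (cA X Y Z)))
    (cA (W ⊗ X) Y Z · cA W X (Y ⊗ Z))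
    (cmp (FE (rt b Z) (eA W X Y) (W ⊗ (X ⊗ Y))) (cA W (X ⊗ Y) Z · fh (lt b W) (cA X Y Z))
       (cmp (eA W (X ⊗ Y) Z) (fh (lt b W) (cA X Y Z)) (FE (lt b W) (eA X Y Z) (X ⊗ (Y ⊗ Z)))))
    (cmp (eA (W ⊗ X) Y Z) (cA W X (Y ⊗ Z)) (eA W X (Y ⊗ Z))) (J m)).
  { intros W X Y Z. eapply TH_exists; [ lc Hb | ]. eapply LC_eq; [ lc Hb | ].
    rewrite <- vcA. symmetry. exact (proj1 (pmd_pent1 HP X Y Z) W). }
  assert (Em : forall W Y, exists m : sq (cA W (dI P) Y · fh (lt b W) (cL Y)) (vid _) (vid _) (fh (rt b Y) (cR W)),
    TH (cA W (dI P) Y · fh (lt b W) (cL Y)) (fh (rt b Y) (cR W))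
     (cmp (eA W (dI P) Y) (fh (lt b W) (cL Y)) (FE (lt b W) (eL Y) Y))
     (FE (rt b Y) (eR W) W) (J m)).
  { intros W Y. eapply TH_exists; [ lc Hb | ]. eapply LC_eq; [ lc Hb | ].
    symmetry. exact (proj1 (pmd_tri1 HP Y) W). }
  assert (El : forall W Y, exists m : sq (cA (dI P) W Y · cL (W ⊗ Y)) (vid _) (vid _) (fh (rt b Y) (cL W)),
     TH (cA (dI P) W Y · cL (W ⊗ Y)) (fh (rt b Y) (cL W))
     (cmp (eA (dI P) W Y) (cL (W ⊗ Y)) (eL (W ⊗ Y))) (FE (rt b Y) (eL W) W) (J m)).
  { intros W Y. eapply TH_exists; [ lc Hb | ]. eapply LC_eq; [ lc Hb | ].
    symmetry. exact (proj1 (pmd_lun1 HP Y) W). }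
  assert (Er : forall W Y, exists m : sq (cA W Y (dI P) · fh (lt b W) (cR Y)) (vid _) (vid _) (cR (W ⊗ Y)),
     TH (cA W Y (dI P) · fh (lt b W) (cR Y)) (cR (W ⊗ Y))
     (cmp (eA W Y (dI P)) (fh (lt b W) (cR Y)) (FE (lt b W) (eR Y) Y)) (eR (W ⊗ Y)) (J m)).
  { intros W Y. eapply TH_exists; [ lc Hb | ]. eapply LC_eq; [ lc Hb | ].
    symmetry. exact (proj1 (pmd_run1 HP Y) W). }
  exists (@BCoh _ HB (Hbin b) K
    (fun W X Y Z => proj1_sig (constructive_indefinite_description _ (Ep W X Y Z)))
    (fun W Y => proj1_sig (constructive_indefinite_description _ (Em W Y)))
    (fun W Y => proj1_sig (constructive_indefinite_description _ (El W Y)))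
    (fun W Y => proj1_sig (constructive_indefinite_description _ (Er W Y)))).
  split; [ | split; [ | split ] ].
  - intros W X Y Z. exact (proj2_sig (constructive_indefinite_description _ (Ep W X Y Z))).
  - intros W Y. exact (proj2_sig (constructive_indefinite_description _ (Em W Y))).
  - intros W Y. exact (proj2_sig (constructive_indefinite_description _ (El W Y))).
  - intros W Y. exact (proj2_sig (constructive_indefinite_description _ (Er W Y))).
Qed.

Context {c : bcoh K} (Hc : canonical c).

Lemma canonical_invertible : coh_invertible c.
Proof.
  destruct Hc as (h1 & h2 & h3 & h4).
  split; [ | split; [ | split ] ]; intros.
  - eapply TH_iso; [ | | apply h1 ]; [ eapply LC_eq; [ lc Hb | ] | lc Hb ].
    rewrite <- vcA. exact (proj1 (pmd_pent1 HP X Y Z) W).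
  - eapply TH_iso; [ | | apply h2 ]; [ eapply LC_eq; [ lc Hb | ] | lc Hb ].
    exact (proj1 (pmd_tri1 HP Y) W).
  - eapply TH_iso; [ | | apply h3 ]; [ eapply LC_eq; [ lc Hb | ] | lc Hb ].
    exact (proj1 (pmd_lun1 HP Y) W).
  - eapply TH_iso; [ | | apply h4 ]; [ eapply LC_eq; [ lc Hb | ] | lc Hb ].
    exact (proj1 (pmd_run1 HP Y) W).
Qed.

Ltac leaf1 := first
  [ apply (proj1 Hc) | apply (proj1 (proj2 Hc)) | apply (proj1 (proj2 (proj2 Hc)))
  | apply (proj2 (proj2 (proj2 Hc)))
  | eapply (TH_a1 l hB); lc Hb | eapply (TH_a2 l hB); lc Hb | eapply (TH_a3 l hB); lc Hb
  | eapply (TH_la l hB); lc Hb | eapply (TH_rh l hB); lc Hb].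

(** The naturality cells in these equations are taken at components of the constraints, thus at
    companions, so they too are comparisons. *)
Lemma canonical_eqs : monoidal_eqs c.
Proof.
  split; [ | split ].
  - intros V W X Y Z. unfold at32, map32, at22. eapply TH_unique; [ lc Hb | | ].
    + th Hb leaf1.
    + th Hb leaf1.
  - intros X Y Z. unfold at32, map21, at21. eapply TH_unique; [ lc Hb | | ].
    + th Hb leaf1.
    + th Hb leaf1.
  - intros X Y Z. unfold at32, map21, at21. eapply TH_unique; [ lc Hb | | ].
    + th Hb leaf1.
    + th Hb leaf1.
Qed.

Lemma brev_is_bin : is_bin (brev b).
Proof. exact (conj (proj2 Hb) (proj1 Hb)). Qed.

Ltac lf :=
  lazymatch goal with |- LF _ _ _ _ _ _ (J (nat1 ?t ?f)) _ =>
  lazymatch t with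
  | pn_comp ?p ?q => eapply (LF_pn_comp (s:=p) (t:=q) (f:=f)); [ lc Hb | lc Hb | lc Hb | lc Hb | | | lf | lf ]
  | pn_post (blt _ ?X) ?p => eapply (LF_pn_post (proj1 Hb X) (s:=p) (f:=f)); [ lc Hb | lc Hb | | lf ]
  | pn_post (brt _ ?X) ?p => eapply (LF_pn_post (proj2 Hb X) (s:=p) (f:=f)); [ lc Hb | lc Hb | | lf ]
  | pn_pre ?t ?k => lazymatch goal with |- LF ?f ?x ?y ?g ?ex ?ey (J (nat1 _ ?h)) ?S =>
      change (LF f x y g ex ey (J (nat1 t (k _ _ h))) S); lf end
  | ba1 _ ?Y ?Z => exact (LF_lift (asc_c l _ Y Z) (asc_c l _ Y Z) (vh (da1 P Y Z) f))
  | ba2 _ ?X ?Z => exact (LF_lift (asc_c l X _ Z) (asc_c l X _ Z) (vh (da2 P X Z) f))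
  | ba3 _ ?X ?Y => exact (LF_lift (asc_c l X Y _) (asc_c l X Y _) (vh (da3 P X Y) f))
  | blamT _ => exact (LF_lift (lam_c l _) (lam_c l _) (vh (dlamT P) f))
  | brhoT _ => exact (LF_lift (rho_c l _) (rho_c l _) (vh (drhoT P) f))
  | lc_asc _ ?X ?Y ?Z => exact (LF_lcs Hb HL FL (LC_companion (asc_c l X Y Z)) f)
  | rc_asc _ ?X ?Y ?Z => exact (LF_lcs brev_is_bin HR FR (LC_companion (asc_c l X Y Z)) f)
  | lc_lam _ ?X => exact (LF_lcs Hb HL FL (LC_companion (lam_c l X)) f)
  | rc_lam _ ?X => exact (LF_lcs brev_is_bin HR FR (LC_companion (lam_c l X)) f)
  | lc_rho _ ?X => exact (LF_lcs Hb HL FL (LC_companion (rho_c l X)) f)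
  | rc_rho _ ?X => exact (LF_lcs brev_is_bin HR FR (LC_companion (rho_c l X)) f)
  end end.

(** The axioms of the double category mention the centrality stored in [invcen], the lifts the
    chosen one of [L] and [R]. *)
Ltac agree := repeat first
  [ rewrite (proj1 (cpd_asc hB _ _ _)) | rewrite (proj1 (proj2 (cpd_asc hB _ _ _)))
  | rewrite (proj1 (cpd_lam hB _)) | rewrite (proj1 (proj2 (cpd_lam hB _)))
  | rewrite (proj1 (cpd_rho hB _)) | rewrite (proj1 (proj2 (cpd_rho hB _))) ].

Ltac modif E :=
  let A := fresh "A" in let A' := fresh "A'" in let f := fresh "f" in
  lazymatch goal with |- is_mod ?s ?t ?m =>
    intros A A' f; eapply (@LF_is_mod _ _ _ _ _ _ _ s t m) end;
  [ lc Hb | lc Hb | lc Hb | | lf | eapply LF_eq; [ | lf ] | leaf1 | leaf1 ];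
  lazymatch goal with
  | |- bd _ _ _ _ _ => cbnB; bdt
  | |- _ => generalize (J_eq (proj1 (proj2 E) _ _ f)); agree; rT; rewrite ?fsT_J; exact (fun h => h)
  end.

(** At an arbitrary 1h-cell both transformations are lifts, of squares identified by the pentagon or
    triangle equation for vertical transformations; [LF_cell] turns this into the modification
    axiom. *)
Lemma canonical_modif : coh_modif (chosen_ccen K (Hlcs L) (Hlcs R)) c.
Proof.
  constructor.
  - intros X Y Z. modif (pmd_pent1 HP X Y Z).
  - intros W Y Z. modif (pmd_pent2 HP W Y Z).
  - intros W X Z. modif (pmd_pent3 HP W X Z).
  - intros W X Y. modif (pmd_pent4 HP W X Y).
  - intros Y. modif (pmd_tri1 HP Y).
  - intros W. modif (pmd_tri2 HP W).
  - intros Y. modif (pmd_lun1 HP Y).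
  - intros W. modif (pmd_lun2 HP W).
  - intros Y. modif (pmd_run1 HP Y).
  - intros W. modif (pmd_run2 HP W).
Qed.
End HorizontalPremonoidal.

(** * Compatibility of associativity with exchange *)

Section Cube.
Context {B : dbl}.
Local Notation idh f := (J (sqh f)).
(** Four faces of the cube are lifts, while [P] and [X] are globular. Both sides are lifts of the
    two members of the last hypothesis, an equation between pasted squares. *)
Lemma LF_cube {A0 A1 A0' A1' D0 D1 D0' D1' : B} {F : hor A0 A1} {F' : hor A0' A1'}
    {G : hor D0 D1} {G' : hor D0' D1'} {H0 : hor A0 A0'} {H1 : hor A1 A1'}
    {K0 : hor D0 D0'} {K1 : hor D1 D1'} {a0 : hor A0 D0} {a1 : hor A1 D1}
    {a0' : hor A0' D0'} {a1' : hor A1' D1'} {P X Q Q' M M' SQ SQ' SM SM' e0 e1 e0' e1' u0 u1 u0' u1'} :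
  LC a0 u0 e0 -> LC a1 u1 e1 -> LC a0' u0' e0' -> LC a1' u1' e1' ->
  bd P (F · H1) (vid _) (vid _) (H0 · F') -> bd X (G · K1) (vid _) (vid _) (K0 · G') ->
  bd SQ F' u0' u1' G' -> bd SQ' F u0 u1 G -> bd SM H0 u0 u0' K0 -> bd SM' H1 u1 u1' K1 ->
  LF F' a0' a1' G' e0' e1' Q SQ -> LF F a0 a1 G e0 e1 Q' SQ' ->
  LF H0 a0 a0' K0 e0 e0' M SM -> LF H1 a1 a1' K1 e1 e1' M' SM' ->
  vT (hT SQ' SM') X = vT P (hT SM SQ) ->
  vT (vT (hT P (idh a1')) (hT (idh H0) Q)) (hT M (idh G'))
  = vT (vT (hT (idh F) M') (hT Q' (idh K1))) (hT (idh a0) X).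
Proof.
  intros l0 l1 l0' l1' bP bX b1 b2 b3 b4 h1 h2 h3 h4 E.
  eapply (LF_uniq l0).
  - rewrite vT_assoc. eapply LF_top; [ exact l1' | | exact bP | ].
    2: exact (LF_paste l0 l0' l1' b3 b1 h3 h1). bdt.
  - eapply LF_eq; [ symmetry; exact E | ].
    eapply LF_bot; [ exact l0 | exact l1' | | exact bX | ].
    2: exact (LF_paste l0 l1 l1' b2 b4 h2 h4). bdt.
Qed.

End Cube.

Section HorizontalPremonoidal.
Context {B : dbl} {b : bin B} {s : side} {P : pmd b} {L : lcs b} {R : lcs (brev b)}
  (l : liftable P) (hB : is_central_premonoidal_dbl s P L R) (hl : inv_liftable P)
  (hvv : forall (X X' : B) (U : ver X X') (Y Y' : B) (u : ver Y Y'),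
       sqeq (vd (lv R u) U) (sqv (vcomp (fv (lt b X) u) (fv (rt b Y') U)))).
Local Notation HB := (HB B).
Local Notation K := (Hconstr l).
Local Notation idh f := (J (sqh f)).
Local Notation cA X Y Z := (comp_h (asc_c l X Y Z)).
Local Notation "X ⊗ Y" := (tens b X Y) (at level 39, left associativity).

Let HP := cpd_pm hB.
Let Hb := pmd_bin HP.

Lemma Hasc_exchange : basc_exchange K (Hlcs L).
Proof.
  pose proof (cpd_ae hB) as AE.
  constructor.
  - intros A A' p D X X' f. apply J_inj. generalize (J_eq (proj1 (ae12h AE p D) _ _ f)). rT. idT.
    rewrite <- !vT_assoc. intro E.
    refine (LF_cube (LC_companion (asc_c l A X D)) (LC_companion (asc_c l A X' D))
     (LC_companion (asc_c l A' X D)) (LC_companion (asc_c l A' X' D)) _ (bd_J _) (bd_J _) (bd_J _)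
     (bd_J _) (bd_J _) (LF_lift _ _ (vh (da2 P A' D) f)) (LF_lift _ _ (vh (da2 P A D) f))
     (LF_lift _ _ (vh (da1 P X D) p)) (LF_lift _ _ (vh (da1 P X' D) p)) E).
    cbnB. bdt.
  - intros A A' p Y D D' f. apply J_inj. generalize (J_eq (proj1 (ae13h AE p Y) _ _ f)). rT. idT.
    rewrite <- !vT_assoc. intro E.
    refine (LF_cube (LC_companion (asc_c l A Y D)) (LC_companion (asc_c l A Y D'))
     (LC_companion (asc_c l A' Y D)) (LC_companion (asc_c l A' Y D')) (bd_J _) (bd_J _) (bd_J _) (bd_J _)
     (bd_J _) (bd_J _) (LF_lift _ _ (vh (da3 P A' Y) f)) (LF_lift _ _ (vh (da3 P A Y) f))
     (LF_lift _ _ (vh (da1 P Y D) p)) (LF_lift _ _ (vh (da1 P Y D') p)) E).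
  - intros A Y Y' p D D' f. apply J_inj. generalize (J_eq (proj1 (ae23h AE A p) _ _ f)). rT. idT.
    intro E. match goal with |- vT ?a (vT ?b ?c) = vT ?d (vT ?e ?g) =>
      rewrite <- (vT_assoc a b c), <- (vT_assoc d e g) end.
    refine (LF_cube (LC_companion (asc_c l A Y D)) (LC_companion (asc_c l A Y D'))
     (LC_companion (asc_c l A Y' D)) (LC_companion (asc_c l A Y' D')) (bd_J _) _ (bd_J _) (bd_J _)
     (bd_J _) (bd_J _) (LF_lift _ _ (vh (da3 P A Y') f)) (LF_lift _ _ (vh (da3 P A Y) f))
     (LF_lift _ _ (vh (da2 P A D) p)) (LF_lift _ _ (vh (da2 P A D') p)) E).
    cbnB. bdt.
Qed.

Lemma H_central_premonoidal {c : bcoh K} (Hc : canonical c) :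
  is_central_premonoidal_bicat s c (Hlcs L) (Hlcs R).
Proof.
  split; [ constructor | split ].
  - apply HB_bicat.
  - apply (Hbin_is_bbin hB).
  - apply (Hbin_is_constr l hB hl).
  - apply (HL_ccen l hB hvv).
  - apply (canonical_invertible hB Hc).
  - apply (canonical_modif hB hvv Hc).
  - apply (canonical_eqs hB Hc).
  - apply (Hcentral hB hvv).
  - apply Hasc_exchange.
Qed.
End HorizontalPremonoidal.

(** * The horizontal monoidal bicategory *)

Section HorizontalMonoidal.
Context {B : dbl} {b : bin B} {s : side} {P : pmd b} {L : lcs b} {R : lcs (brev b)}
  (l : liftable P) (hB : is_central_premonoidal_dbl s P L R) (hl : inv_liftable P)
  (hvv : forall (X X' : B) (U : ver X X') (Y Y' : B) (u : ver Y Y'),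
       sqeq (vd (lv R u) U) (sqv (vcomp (fv (lt b X) u) (fv (rt b Y') U)))).
Local Notation HB := (HB B).
Local Notation K := (Hconstr l).
Local Notation idh f := (J (sqh f)).
Local Notation "X ⊗ Y" := (tens b X Y) (at level 39, left associativity).
Local Notation cA X Y Z := (comp_h (asc_c l X Y Z)).

Let HP := cpd_pm hB.
Let Hb := pmd_bin HP.
Let CF := central_full (cpd_cen hB) hvv.
Let triv := proj1 (proj1 CF).
Let HL := proj1 (proj2 (proj1 CF)).
Let FL := proj2 (proj2 (proj1 CF)).
Let HR := proj1 (proj2 CF).
Let FR := proj2 (proj2 CF).
Let HC := Hbin_is_constr l hB hl.
Let HCb := Hbin_is_bbin hB.
Let HLl := HL_laws hB hvv.
Let HLf := HL_functor hB hvv.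
Let AE := Hasc_exchange l hB.

(** On globular squares the exchange parts of [tr_s] are taken at identity 1v-cells, where
    functoriality makes them identities. *)
Lemma tr_2_eq {X X' Y Y' : B} {f f' : hor X X'} {g g' : hor Y Y'}
    (a : cell HB f f') (d : cell HB g g') :
  sq_cast eq_refl (tr_v_id _ _) (tr_v_id _ _) eq_refl (tr_s R a d)
  = bt_2 (b := Hbin b) (X := X) (X' := X') (Y := Y) (Y' := Y') a d.
Proof.
  apply J_inj. unfold bt_2, tr_s. rJ. rewrite !fsT_J. cbn [Hbin blt brt on1 on2 Hpf]. cF.
  rwq (eq_trans (eq_sym (f_equal (fun x => J x) (ex_vh (proj1 (cpd_cen hB)) (vid X') g))) (lcf_vid' FL g)).
  rwq (lcf_vid' (b := brev b) FR (X := Y) f'). ix. reflexivity.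
Qed.

Lemma tr_fc_eq {X X' X'' Y Y' Y'' : B} (f : hor X X') (f' : hor X' X'') (g : hor Y Y') (g' : hor Y' Y'') :
  tr_fc L f f' g g' = bt_fc (b := Hbin b) (Hlcs L) f f' g g'.
Proof.
  apply J_inj. unfold bt_fc, tr_fc. rJ. do 3 (f_equal; []). ix. idT. reflexivity.
Qed.

Lemma tr_fci_eq {X X' X'' Y Y' Y'' : B} (f : hor X X') (f' : hor X' X'') (g : hor Y Y') (g' : hor Y' Y'') :
  tr_fci L f f' g g' = bt_fci (b := Hbin b) (Hlcs L) f f' g g'.
Proof.
  apply J_inj. unfold bt_fci, tr_fci. rJ. match goal with |- _ = vT ?u (vT ?v ?w) => rewrite <- (vT_assoc u v w) end.
  f_equal. ix. idT. reflexivity.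
Qed.

Lemma tr_fu_eq X Y : comp2 HB (@luni _ HB _ _ (hid (X ⊗ Y))) (dfu (rt b Y) X ∥ dfu (lt b X) Y)
  = bt_fu (b := Hbin b) X Y.
Proof.
  apply J_inj. unfold bt_fu. rJ. idT. ix. idT. reflexivity.
Qed.

Lemma tr_fui_eq X Y : comp2 HB (dfui (rt b Y) X ∥ dfui (lt b X) Y) (@lun _ HB _ _ (hid (X ⊗ Y)))
  = bt_fui (b := Hbin b) X Y.
Proof.
  apply J_inj. unfold bt_fui. rJ. idT. ix. idT. reflexivity.
Qed.

Lemma tr_lam_eq {Y Y' : B} (k : hor Y Y') :
  lift_sq (lam_c l Y) (lam_c l Y') (tr_lam P k) = bt_lam K k.
Proof.
  apply J_inj. eapply (LF_uniq (LC_companion (lam_c l Y))); [ apply LF_lift | ].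
  unfold bt_lam. rJ. eapply LF_eq; [ | eapply LF_top; [ apply LC_companion | apply bd_J | | apply LF_lift ] ].
  - unfold tr_lam. rJ. rewrite <- (vT_idl (bd_J (vh (dlamT P) k)) eq_refl) at 1. xi. idT. reflexivity.
  - bdt.
Qed.

Lemma tr_rho_eq {Y Y' : B} (k : hor Y Y') :
  lift_sq (rho_c l Y) (rho_c l Y') (tr_rho P k) = bt_rho K k.
Proof.
  apply J_inj. eapply (LF_uniq (LC_companion (rho_c l Y))); [ apply LF_lift | ].
  unfold bt_rho. rJ. eapply LF_eq; [ | eapply LF_top; [ apply LC_companion | apply bd_J | | apply LF_lift ] ].
  - unfold tr_rho. rJ. rewrite <- (vT_idl (bd_J (vh (drhoT P) k)) eq_refl) at 1. xi. idT. reflexivity.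
  - bdt.
Qed.

(** [bt_asc] is a paste of three lifts between compositors, and therefore lifts the paste of the
    three squares. *)
Lemma tr_asc_eq {X X' Y Y' Z Z' : B} (f : hor X X') (g : hor Y Y') (h : hor Z Z') :
  lift_sq (asc_c l X Y Z) (asc_c l X' Y' Z') (tr_asc P f g h) = bt_asc K f g h.
Proof.
  apply J_inj. rewrite (asc_hside (HB_bicat B)).
  eapply (LF_uniq (LC_companion (asc_c l X Y Z))); [ apply LF_lift | ].
  unfold hside, paste. rJ. idT.
  eapply LF_eq; [ | eapply LF_top; [ apply LC_companion | | | eapply LF_bot;
    [ apply LC_companion | apply LC_companion | | | eapply LF_paste; [ apply LC_companion | apply LC_companion | apply LC_companion | | apply bd_J | eapply LF_paste; [ apply LC_companion | apply LC_companion | apply LC_companion | apply bd_J | apply bd_J | apply LF_lift | apply LF_lift ] | apply LF_lift ] ] ] ].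
  - unfold tr_asc. rJ. idT. rewrite !vT_assoc. reflexivity.
  - cbnB. bdt.
  - cbnB. unfold tr_h. bdt.
  - cbnB. bdt.
  - cbnB. bdt.
  - cbnB. bdt.
Qed.

Local Notation tn := (@tr_h B b _ _ _ _).

Lemma tr_asci_asc {X X' Y Y' Z Z' : B} (f : hor X X') (g : hor Y Y') (h : hor Z Z') :
  vT (J (tr_asci P f g h)) (J (tr_asc P f g h)) = idh (tn f (tn g h)).
Proof.
  assert (E1 := J_eq (proj2 (proj2 (proj2 (pmd_a1 HP Y Z)) _ _ f))).
  assert (E2 := J_eq (proj2 (proj2 (proj2 (pmd_a2 HP X' Z)) _ _ g))).
  assert (E3 := J_eq (proj2 (proj2 (proj2 (pmd_a3 HP X' Y')) _ _ h))).
  rewrite <- vT_J in E1. rewrite <- vT_J in E2. rewrite <- vT_J in E3. unfold tr_asci, tr_asc. rJ. idT. rewrite !vT_assoc.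
  match goal with |- vT ?p (vT ?q (vT ?r (vT ?u (vT ?v ?w)))) = _ =>
    assert (E4 : vT r u = idh (fh (rt b Z) (fh (rt b Y) f) · fh (rt b Z) (fh (lt b X') g) · fh (lt b (X' ⊗ Y')) h)) end.
  { ix. rewrite (dfc_dfci (proj2 Hb Z)). idT. rewrite <- !J_sqh_comp. reflexivity. }
  match goal with |- vT ?p (vT ?q (vT ?r (vT ?u (vT ?v ?w)))) = _ =>
    rewrite <- (vT_assoc r u (vT v w)), E4 end.
  idT. match goal with |- vT ?p (vT ?q (vT ?v ?w)) = _ => rewrite <- (vT_assoc q v w) end. ix. ix.
  rewrite E1, E2, E3, <- !J_sqh_comp. idT. ix. rewrite (dfci_dfc (proj1 Hb X')). idT. symmetry. apply J_sqh_comp.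
Qed.

Lemma tr_lami_lam {Y Y' : B} (k : hor Y Y') :
  vT (J (tr_lami P k)) (J (tr_lam P k)) = idh k.
Proof.
  assert (E := J_eq (proj2 (proj2 (proj2 (pmd_lam HP)) _ _ k))).
  rewrite <- vT_J in E. unfold tr_lami, tr_lam. rJ. ix. rewrite E.
  match goal with |- context [vT (vT ?p ?q) (vT ?r ?u)] =>
    rewrite (vT_assoc p q (vT r u)), <- (vT_assoc q r u) end.
  rewrite (dfu_dfui (proj2 Hb Y)). idT.
  rewrite <- J_sqv_comp, iv_l. idT. reflexivity.
Qed.
Lemma tr_rhoi_rho {Y Y' : B} (k : hor Y Y') :
  vT (J (tr_rhoi P k)) (J (tr_rho P k)) = idh k.
Proof.
  assert (E := J_eq (proj2 (proj2 (proj2 (pmd_rho HP)) _ _ k))).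
  rewrite <- vT_J in E. unfold tr_rhoi, tr_rho. rJ. ix. rewrite E.
  match goal with |- context [vT (vT ?p ?q) (vT ?r ?u)] =>
    rewrite (vT_assoc p q (vT r u)), <- (vT_assoc q r u) end.
  rewrite (dfu_dfui (proj1 Hb Y')). idT.
  rewrite <- J_sqv_comp, iv_l. idT. reflexivity.
Qed.

(** Both cells are inverse to the cell treated in [tr_asc_eq], which avoids a calculation with
    conjoints. *)
Lemma tr_asci_eq {X X' Y Y' Z Z' : B} (f : hor X X') (g : hor Y Y') (h : hor Z Z') :
  lift_sqi (asc_c l X Y Z) (asc_c l X' Y' Z') (iv_r (dascC P _ _ _)) (iv_l (dascC P _ _ _))
    (tr_asci P f g h) = bt_asci K f g h.
Proof.
  eapply (inverse_eq (HB_bicat B)).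
  - apply J_inj. rJ. apply (lifti_lift _ _ (s := tr_asc P f g h)); [ apply iv_l | apply tr_asci_asc ].
  - rewrite tr_asc_eq.
    exact (pn_inv (bmon_asc (HB_bicat B) HCb HLl HLf HC AE) (A := (X, Y, Z)) (B := (X', Y', Z')) (f, g, h)).
Qed.

Lemma tr_lami_eq {Y Y' : B} (k : hor Y Y') :
  lift_sqi (lam_c l Y) (lam_c l Y') (iv_r (dlamC P _)) (iv_l (dlamC P _)) (tr_lami P k) = bt_lami K k.
Proof.
  eapply (inverse_eq (HB_bicat B)).
  - apply J_inj. rJ. apply (lifti_lift _ _ (s := tr_lam P k)); [ apply iv_l | apply tr_lami_lam ].
  - rewrite tr_lam_eq. exact (pn_inv (bt_lam_pn (HB_bicat B) HCb HLf HC) k).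
Qed.

Lemma tr_rhoi_eq {Y Y' : B} (k : hor Y Y') :
  lift_sqi (rho_c l Y) (rho_c l Y') (iv_r (drhoC P _)) (iv_l (drhoC P _)) (tr_rhoi P k) = bt_rhoi K k.
Proof.
  eapply (inverse_eq (HB_bicat B)).
  - apply J_inj. rJ. apply (lifti_lift _ _ (s := tr_rho P k)); [ apply iv_l | apply tr_rhoi_rho ].
  - rewrite tr_rho_eq. exact (pn_inv (bt_rho_pn (HB_bicat B) HCb HLl HC) k).
Qed.

(** The type of the constraints depends on the tensor pseudofunctor. With all operations as separate
    arguments, two structures on the same 1-cells can be compared one operation at a time by
    [f_equal]. *)
Definition raw_mon
  (c2 : forall (X X' Y Y' : B) (f f' : hor X X') (g g' : hor Y Y') (a : cell HB f f') (d : cell HB g g'),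
    cell HB (tn f g) (tn f' g'))
  (cfc : forall (X X' X'' Y Y' Y'' : B) (f : hor X X') (f' : hor X' X'') (g : hor Y Y') (g' : hor Y' Y''),
    cell HB (tn f g · tn f' g') (tn (f · f') (g · g')))
  (cfci : forall (X X' X'' Y Y' Y'' : B) (f : hor X X') (f' : hor X' X'') (g : hor Y Y') (g' : hor Y' Y''),
    cell HB (tn (f · f') (g · g')) (tn f g · tn f' g'))
  (cfu : forall X Y, cell HB (hid (X ⊗ Y)) (tn (hid X) (hid Y)))
  (cfui : forall X Y, cell HB (tn (hid X) (hid Y)) (hid (X ⊗ Y)))
  (ca : forall (X X' Y Y' Z Z' : B) (f : hor X X') (g : hor Y Y') (h : hor Z Z'),
    cell HB (tn (tn f g) h · cA X' Y' Z') (cA X Y Z · tn f (tn g h)))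
  (cai : forall (X X' Y Y' Z Z' : B) (f : hor X X') (g : hor Y Y') (h : hor Z Z'),
    cell HB (cA X Y Z · tn f (tn g h)) (tn (tn f g) h · cA X' Y' Z'))
  (cl : forall (Y Y' : B) (k : hor Y Y'),
    cell HB (tn (hid (dI P)) k · comp_h (lam_c l Y')) (comp_h (lam_c l Y) · k))
  (cli : forall (Y Y' : B) (k : hor Y Y'),
    cell HB (comp_h (lam_c l Y) · k) (tn (hid (dI P)) k · comp_h (lam_c l Y')))
  (cr : forall (Y Y' : B) (k : hor Y Y'),
    cell HB (tn k (hid (dI P)) · comp_h (rho_c l Y')) (comp_h (rho_c l Y) · k))
  (cri : forall (Y Y' : B) (k : hor Y Y'),
    cell HB (comp_h (rho_c l Y) · k) (tn k (hid (dI P)) · comp_h (rho_c l Y'))) :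
  mon HB (tens b) (dI P) :=
  let T := Pf (bprod HB HB) HB (fun X => fst X ⊗ snd X)
    (fun X Y (f : hom (bprod HB HB) X Y) => tn (fst f) (snd f))
    (fun X Y (f g : hom (bprod HB HB) X Y) (a : cell _ f g) => c2 _ _ _ _ _ _ _ _ (fst a) (snd a))
    (fun X Y Z (f : hom (bprod HB HB) X Y) (g : hom (bprod HB HB) Y Z) =>
       cfc _ _ _ _ _ _ (fst f) (fst g) (snd f) (snd g))
    (fun X Y Z (f : hom (bprod HB HB) X Y) (g : hom (bprod HB HB) Y Z) =>
       cfci _ _ _ _ _ _ (fst f) (fst g) (snd f) (snd g))
    (fun X => cfu (fst X) (snd X)) (fun X => cfui (fst X) (snd X)) in
  @Mon _ HB (tens b) (dI P) T
    (fun X Y Z => cA X Y Z)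
    (@Pn _ _ (bprod (bprod HB HB) HB) HB _ _ (on1 (F_lassoc T)) (on1 (F_rassoc T)) _
       (fun X Y f => ca _ _ _ _ _ _ (fst (fst f)) (snd (fst f)) (snd f))
       (fun X Y f => cai _ _ _ _ _ _ (fst (fst f)) (snd (fst f)) (snd f)))
    (fun X => comp_h (lam_c l X))
    (@Pn _ _ HB HB _ _ (on1 (T_lt T (dI P))) (on1 (pf_id HB)) _
       (fun X Y f => cl _ _ f) (fun X Y f => cli _ _ f))
    (fun X => comp_h (rho_c l X))
    (@Pn _ _ HB HB _ _ (on1 (T_rt T (dI P))) (on1 (pf_id HB)) _
       (fun X Y f => cr _ _ f) (fun X Y f => cri _ _ f)).

Lemma Hmon_bmon : Hmon L R l = bmon (Hlcs L) K.
Proof.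
  transitivity (raw_mon
    (fun X X' Y Y' f f' g g' a d =>
      sq_cast eq_refl (tr_v_id _ _) (tr_v_id _ _) eq_refl (tr_s R a d))
    (fun X X' X'' Y Y' Y'' f f' g g' => tr_fc L f f' g g')
    (fun X X' X'' Y Y' Y'' f f' g g' => tr_fci L f f' g g')
    (fun X Y => comp2 HB (@luni _ HB _ _ (hid (X ⊗ Y))) (dfu (rt b Y) X ∥ dfu (lt b X) Y))
    (fun X Y => comp2 HB (dfui (rt b Y) X ∥ dfui (lt b X) Y) (@lun _ HB _ _ (hid (X ⊗ Y))))
    (fun X X' Y Y' Z Z' f g h => lift_sq (asc_c l X Y Z) (asc_c l X' Y' Z') (tr_asc P f g h))
    (fun X X' Y Y' Z Z' f g h => lift_sqi (asc_c l X Y Z) (asc_c l X' Y' Z')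
       (iv_r (dascC P _ _ _)) (iv_l (dascC P _ _ _)) (tr_asci P f g h))
    (fun Y Y' k => lift_sq (lam_c l Y) (lam_c l Y') (tr_lam P k))
    (fun Y Y' k => lift_sqi (lam_c l Y) (lam_c l Y') (iv_r (dlamC P _)) (iv_l (dlamC P _)) (tr_lami P k))
    (fun Y Y' k => lift_sq (rho_c l Y) (rho_c l Y') (tr_rho P k))
    (fun Y Y' k => lift_sqi (rho_c l Y) (rho_c l Y') (iv_r (drhoC P _)) (iv_l (drhoC P _)) (tr_rhoi P k))).
  { reflexivity. }
  transitivity (raw_mon
    (fun X X' Y Y' f f' g g' a d => bt_2 (b := Hbin b) (X := X) (X' := X') (Y := Y) (Y' := Y') a d)
    (fun X X' X'' Y Y' Y'' f f' g g' => bt_fc (b := Hbin b) (Hlcs L) f f' g g')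
    (fun X X' X'' Y Y' Y'' f f' g g' => bt_fci (b := Hbin b) (Hlcs L) f f' g g')
    (fun X Y => bt_fu (b := Hbin b) X Y) (fun X Y => bt_fui (b := Hbin b) X Y)
    (fun X X' Y Y' Z Z' f g h => bt_asc K f g h) (fun X X' Y Y' Z Z' f g h => bt_asci K f g h)
    (fun Y Y' k => bt_lam K k) (fun Y Y' k => bt_lami K k)
    (fun Y Y' k => bt_rho K k) (fun Y Y' k => bt_rhoi K k)).
  2: reflexivity.
  f_equal; repeat (apply functional_extensionality_dep; intro).
  - apply tr_2_eq.
  - apply tr_fc_eq.
  - apply tr_fci_eq.
  - apply tr_fu_eq.
  - apply tr_fui_eq.
  - apply tr_asc_eq.
  - apply tr_asci_eq.
  - apply tr_lam_eq.
  - apply tr_lami_eq.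
  - apply tr_rho_eq.
  - apply tr_rhoi_eq.
Qed.
End HorizontalMonoidal.

(** * Comparisons built with the tensor product *)

Section HorizontalMonoidal.
Context {B : dbl} {b : bin B} {s : side} {P : pmd b} {L : lcs b} {R : lcs (brev b)}
  (l : liftable P) (hB : is_central_premonoidal_dbl s P L R) (hl : inv_liftable P)
  (hvv : forall (X X' : B) (U : ver X X') (Y Y' : B) (u : ver Y Y'),
       sqeq (vd (lv R u) U) (sqv (vcomp (fv (lt b X) u) (fv (rt b Y') U)))).
Local Notation HB := (HB B).
Local Notation K := (Hconstr l).
Local Notation idh f := (J (sqh f)).
Local Notation "X ⊗ Y" := (tens b X Y) (at level 39, left associativity).
Local Notation cA X Y Z := (comp_h (asc_c l X Y Z)).
Local Notation eA X Y Z := (J (comp_eps (asc_c l X Y Z))).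
Local Notation cL X := (comp_h (lam_c l X)).
Local Notation eL X := (J (comp_eps (lam_c l X))).
Local Notation cR X := (comp_h (rho_c l X)).
Local Notation eR X := (J (comp_eps (rho_c l X))).
Local Notation tn := (@tr_h B b _ _ _ _).

Let HP := cpd_pm hB.
Let Hb := pmd_bin HP.

Definition eT {X X' Y Y' : B} (e d : T (B:=B)) (f : hor X X') (g : hor Y Y') : T (B:=B) :=
  cmp (FE (rt b Y) e X') (fh (lt b X') g) (FE (lt b X') d Y').
Local Notation b1 f g := (@bt_1 _ HB (Hbin b) _ _ _ _ f g).

Ltac lf0 := first
  [ eapply (TH_a1 l hB); lc Hb | eapply (TH_a2 l hB); lc Hb | eapply (TH_a3 l hB); lc Hb
  | eapply (TH_la l hB); lc Hb | eapply (TH_rh l hB); lc Hb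
  | eapply (TH_L hB hvv); lc Hb | eassumption ].

Lemma TH_bt_2 {X X' Y Y' : B} {f f' : hor X X'} {g g' : hor Y Y'} {u u' v v' e e' d d'}
   {a : cell HB f f'} {c : cell HB g g'} : LC f u e -> LC f' u' e' -> LC g v d -> LC g' v' d' ->
  TH f f' e e' (J a) -> TH g g' d d' (J c) ->
  TH (b1 f g) (b1 f' g') (eT e d f g) (eT e' d' f' g')
    (J (bt_2 (b := Hbin b) (X := X) (X' := X') (Y := Y) (Y' := Y') a c)).
Proof.
  intros h1 h2 h3 h4 h5 h6. unfold bt_2. th Hb lf0.
Qed.

Section Fc.
Context {X X' X'' Y Y' Y'' : B} {f : hor X X'} {f' : hor X' X''} {g : hor Y Y'} {g' : hor Y' Y''}
  {u u' v v' e e' d d'} (h1 : LC f u e) (h2 : LC f' u' e') (h3 : LC g v d) (h4 : LC g' v' d').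
(** The compositor of the tensor product contains an exchange cell, which is a comparison by [TH_L]
    and so through the triviality of the exchange of 1v-cells. *)
Lemma TH_bt_fc :
  TH (b1 f g · b1 f' g') (b1 (f · f') (g · g')) (cmp (eT e d f g) (b1 f' g') (eT e' d' f' g'))
    (eT (cmp e f' e') (cmp d g' d') (f · f') (g · g'))
    (J (bt_fc (b := Hbin b) (Hlcs L) f f' g g')).
Proof. unfold bt_fc. th Hb lf0. Qed.
Lemma TH_bt_fci :
  TH (b1 (f · f') (g · g')) (b1 f g · b1 f' g')
    (eT (cmp e f' e') (cmp d g' d') (f · f') (g · g')) (cmp (eT e d f g) (b1 f' g') (eT e' d' f' g'))
    (J (bt_fci (b := Hbin b) (Hlcs L) f f' g g')).
Proof. unfold bt_fci. th Hb lf0. Qed.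
End Fc.

Lemma TH_bt_fu X Y : TH (hid (X ⊗ Y)) (b1 (hid X) (hid Y)) (idh (hid (X ⊗ Y)))
  (eT (idh (hid X)) (idh (hid Y)) (hid X) (hid Y)) (J (bt_fu (b := Hbin b) X Y)).
Proof. unfold bt_fu. th Hb lf0. Qed.
Lemma TH_bt_fui X Y : TH (b1 (hid X) (hid Y)) (hid (X ⊗ Y))
  (eT (idh (hid X)) (idh (hid Y)) (hid X) (hid Y)) (idh (hid (X ⊗ Y))) (J (bt_fui (b := Hbin b) X Y)).
Proof. unfold bt_fui. th Hb lf0. Qed.

Section Asc.
Context {X X' Y Y' Z Z' : B} {f : hor X X'} {g : hor Y Y'} {h : hor Z Z'}
  {u v w e d c} (h1 : LC f u e) (h2 : LC g v d) (h3 : LC h w c).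
Lemma TH_bt_asc : TH (b1 (b1 f g) h · cA X' Y' Z') (cA X Y Z · b1 f (b1 g h))
  (cmp (eT (eT e d f g) c (b1 f g) h) (cA X' Y' Z') (eA X' Y' Z'))
  (cmp (eA X Y Z) (b1 f (b1 g h)) (eT e (eT d c g h) f (b1 g h))) (J (bt_asc K f g h)).
Proof. unfold bt_asc. th Hb lf0. Qed.
Lemma TH_bt_asci : TH (cA X Y Z · b1 f (b1 g h)) (b1 (b1 f g) h · cA X' Y' Z')
  (cmp (eA X Y Z) (b1 f (b1 g h)) (eT e (eT d c g h) f (b1 g h)))
  (cmp (eT (eT e d f g) c (b1 f g) h) (cA X' Y' Z') (eA X' Y' Z')) (J (bt_asci K f g h)).
Proof. unfold bt_asci. th Hb lf0. Qed.
End Asc.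

Section Unit.
Context {X X' : B} {f : hor X X'} {u e} (h1 : LC f u e).
Lemma TH_bt_l Y : TH (b1 (hid Y) f) (fh (lt b Y) f) (eT (idh (hid Y)) e (hid Y) f) (FE (lt b Y) e X')
  (J (bt_l (b := Hbin b) Y f)).
Proof. unfold bt_l. th Hb lf0. Qed.
Lemma TH_bt_r Y : TH (b1 f (hid Y)) (fh (rt b Y) f) (eT e (idh (hid Y)) f (hid Y)) (FE (rt b Y) e X')
  (J (bt_r (b := Hbin b) f Y)).
Proof. unfold bt_r. th Hb lf0. Qed.
Lemma TH_bt_ri Y : TH (fh (rt b Y) f) (b1 f (hid Y)) (FE (rt b Y) e X') (eT e (idh (hid Y)) f (hid Y))
  (J (bt_ri (b := Hbin b) f Y)).
Proof. unfold bt_ri. th Hb lf0. Qed.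
End Unit.

Context {c : bcoh K} (Hc : canonical c).

Ltac leaf2 := idtac;
  lazymatch goal with |- TH _ _ _ _ (J ?t) =>
  lazymatch t with
  | bt_2 _ _ => eapply TH_bt_2; [ lc Hb | lc Hb | lc Hb | lc Hb | th Hb leaf2 | th Hb leaf2 ]
  | bt_fc _ _ _ _ _ => eapply TH_bt_fc; lc Hb
  | bt_fci _ _ _ _ _ => eapply TH_bt_fci; lc Hb
  | bt_fu _ _ => eapply TH_bt_fu
  | bt_fui _ _ => eapply TH_bt_fui
  | bt_asc _ _ _ _ => eapply TH_bt_asc; lc Hb
  | bt_asci _ _ _ _ => eapply TH_bt_asci; lc Hb
  | bt_l _ _ => eapply TH_bt_l; lc Hb
  | bt_r _ _ => eapply TH_bt_r; lc Hb
  | bt_ri _ _ => eapply TH_bt_ri; lc Hb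
  | cp c _ _ _ _ => apply (proj1 Hc)
  | cm c _ _ => apply (proj1 (proj2 Hc))
  | cl c _ _ => apply (proj1 (proj2 (proj2 Hc)))
  | cr c _ _ => apply (proj2 (proj2 (proj2 Hc)))
  end end.

Ltac cbnM := unfold at32, map32, at22, map21, at21;
  cbn [mon_constr mon_bin mon_a1 mon_a2 mon_a3 bt_coh bmon mT masc mascT mlam mlamT mrho mrhoT
    T_lt T_rt bT on1 on2 fc fci fu fui nat1 nat1i basc blam brho bI ba1 ba2 ba3 blamT brhoT
    blt brt btens cp cm cl cr fst snd id1 comp1 bprod bt_lam bt_lami
    F_lassoc F_rassoc pf_pair pf_comp pf_fst pf_snd].

(** Conjugating the premonoidal equations with unitors is avoided: the inserted cells [bt_l], [bt_r]
    and [bt_ri] are comparisons as well, and uniqueness applies directly. *)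
Lemma bt_coh_eqs : monoidal_eqs (bt_coh (Hlcs L) c).
Proof.
  split; [ | split ].
  - intros V W X Y Z. cbnM. eapply TH_unique; [ lc Hb | | ].
    + th Hb leaf2.
    + th Hb leaf2.
  - intros X Y Z. cbnM. eapply TH_unique; [ lc Hb | | ].
    + th Hb leaf2.
    + th Hb leaf2.
  - intros X Y Z. cbnM. eapply TH_unique; [ lc Hb | | ].
    + th Hb leaf2.
    + th Hb leaf2.
Qed.

(** A comparison forces [u = v], since its composite with the counit of [y] is the counit of [x],
    whose left side is [u]. *)
Lemma TH_iso2 {A A' : B} {x y : hor A A'} {u v e e'} {m : cell HB x y} :
  LC x u e -> LC y v e' -> TH x y e e' (J m) -> iso2 m.
Proof.
  intros hx hy h. refine (TH_iso hx (LC_eq hy _) h). destruct h as [h0 E].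
  pose proof (LC_bd hx) as h1. pose proof (LC_bd hy) as h2. rewrite <- E in h1.
  refine (bd_left _ h1). bdt.
Qed.

Lemma bt_coh_invertible : coh_invertible (bt_coh (Hlcs L) c).
Proof.
  split; [ | split; [ | split ] ]; intros; cbnM; (eapply TH_iso2; [ | | th Hb leaf2 ]; lc Hb).
Qed.

Lemma bmon_monoidal : is_monoidal (bt_coh (Hlcs L) c).
Proof.
  pose proof (Hbin_is_constr l hB hl) as HC. pose proof (Hbin_is_bbin hB) as HCb.
  pose proof (HL_laws hB hvv) as HLl. pose proof (HL_functor hB hvv) as HLf.
  pose proof (Hasc_exchange l hB) as AE. pose proof (HB_bicat B) as H.
  constructor.
  - exact H.
  - exact (bT_pf H HCb HLl HLf).
  - split; [ exact (bmon_asc H HCb HLl HLf HC AE) | ].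
    intros [[X Y] Z]. exact (proj2 (ic_a1 HC Y Z) X).
  - split; [ exact (bt_lam_pn H HCb HLf HC) | exact (proj2 (ic_lam HC)) ].
  - split; [ exact (bt_rho_pn H HCb HLl HC) | exact (proj2 (ic_rho HC)) ].
  - exact bt_coh_invertible.
  - exact (bt_modif H HCb (Hexchange hB) HLl HLf HC (canonical_modif hB hvv Hc)).
  - exact bt_coh_eqs.
Qed.
End HorizontalMonoidal.

Local Open Scope bicat_scope.

(** * Pure maps *)

Lemma sig_eq {A} {Q : A -> Prop} {x y : {a : A | Q a}} : proj1_sig x = proj1_sig y -> x = y.
Proof. destruct x as [x p], y as [y q]; cbn. intros <-. now rewrite (proof_irrelevance _ p q). Qed.

(* When all 2-cells satisfy [Q], forgetting the chosen structures is an equivalence, along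
   which monoidal structures can be pulled back. *)
Section Pullback.
Context {O : Type} {C : bicat O} {S : forall A B, hom C A B -> Type}
  (s : forall A B k, S A B k)
  (Q : forall A B (f g : chosen s A B), cell C (ch f) (ch g) -> Prop)
  (Qt : forall A B (f g : chosen s A B) a, Q A B f g a).

Lemma closed2_all : closed2 (s := s) Q.
Proof. constructor; intros; apply Qt. Qed.

Context (q : closed2 (s := s) Q).
Local Notation D := (chosen_bicat Q q).

Definition up {A B} {f g : hom D A B} (a : cell C (ch f) (ch g)) : cell D f g :=
  exist _ a (Qt a).
Arguments up {A B f g} & a.

(** The equation [ch_eq] determines the chosen structure by its 1-cell and can be substituted away;
    after that only proofs differ. *)
Lemma celleq_chosen {A B} {f g f' g' : hom D A B} (a : cell D f g) (a' : cell D f' g') :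
  celleq (C := C) (proj1_sig a) (proj1_sig a') -> celleq a a'.
Proof.
  destruct f as [f sf Ef], g as [g sg Eg], f' as [f' sf' Ef'], g' as [g' sg' Eg'].
  destruct a as [a p], a' as [a' p']. cbn in *. subst. destruct 1.
  rewrite (proof_irrelevance _ p' p). apply celleq_refl.
Qed.

Context {tens : O -> O -> O} {I : O} (M : mon C tens I).

Definition pull_T : pf (bprod D D) D (fun X => tens (fst X) (snd X)) :=
  Pf (bprod D D) D (fun X => tens (fst X) (snd X))
    (fun X Y (f : hom (bprod D D) X Y) =>
      choose s (on1 (mT M) X Y (ch (fst f), ch (snd f))))
    (fun X Y (f g : hom (bprod D D) X Y) (a : cell _ f g) =>
      up (on2 (mT M) X Y (_, _) (_, _) (proj1_sig (fst a), proj1_sig (snd a))))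
    (fun X Y Z (f : hom (bprod D D) X Y) (g : hom (bprod D D) Y Z) =>
      up (@fc _ _ _ _ _ (mT M) X Y Z (ch (fst f), ch (snd f)) (ch (fst g), ch (snd g))))
    (fun X Y Z (f : hom (bprod D D) X Y) (g : hom (bprod D D) Y Z) =>
      up (@fci _ _ _ _ _ (mT M) X Y Z (ch (fst f), ch (snd f)) (ch (fst g), ch (snd g))))
    (fun X => up (fu (mT M) X))
    (fun X => up (fui (mT M) X)).

Definition pull_mon : mon D tens I :=
  @Mon _ D tens I pull_T
    (fun X Y Z => choose s (masc M X Y Z))
    (@Pn _ _ (bprod (bprod D D) D) D _ _ (on1 (F_lassoc pull_T)) (on1 (F_rassoc pull_T))
       (fun X => choose s (masc M (fst (fst X)) (snd (fst X)) (snd X)))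
       (fun X Y f => up (@nat1 _ _ _ _ _ _ _ _ _ (mascT M) X Y
          (ch (fst (fst f)), ch (snd (fst f)), ch (snd f))))
       (fun X Y f => up (@nat1i _ _ _ _ _ _ _ _ _ (mascT M) X Y
          (ch (fst (fst f)), ch (snd (fst f)), ch (snd f)))))
    (fun X => choose s (mlam M X))
    (@Pn _ _ D D _ _ (on1 (T_lt pull_T I)) (on1 (pf_id D))
       (fun X => choose s (mlam M X))
       (fun X Y f => up (nat1 (mlamT M) (ch f)))
       (fun X Y f => up (nat1i (mlamT M) (ch f))))
    (fun X => choose s (mrho M X))
    (@Pn _ _ D D _ _ (on1 (T_rt pull_T I)) (on1 (pf_id D))
       (fun X => choose s (mrho M X))
       (fun X Y f => up (nat1 (mrhoT M) (ch f)))
       (fun X Y f => up (nat1i (mrhoT M) (ch f)))).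

Context (c : bcoh (mon_constr M)) (Hc : is_monoidal c).

Definition pull_coh : bcoh (mon_constr pull_mon) :=
  @BCoh _ _ _ (mon_constr pull_mon)
    (fun W X Y Z => up (cp c W X Y Z))
    (fun W Y => up (cm c W Y))
    (fun W Y => up (cl c W Y))
    (fun W Y => up (cr c W Y)).

Lemma pull_iso2 {A B} {f g : hom D A B} (a : cell D f g) : iso2 (C := C) (proj1_sig a) -> iso2 a.
Proof.
  intros (e & E1 & E2). exists (exist _ e (Qt e)). split; apply sig_eq; assumption.
Qed.

Lemma pull_equiv {A B} (f : hom D A B) : is_equiv (C := C) (ch f) -> is_equiv f.
Proof.
  intros (g & x & y & Hx & Hy). exists (choose s g).
  exists (exist _ x (Qt _)), (exist _ y (Qt _)). split; apply pull_iso2; assumption.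
Qed.

Lemma chosen_is_bicat : is_bicat C -> is_bicat D.
Proof. intro H. constructor; intros; apply sig_eq; apply H. Qed.

Lemma chosen_forget_pf : is_bicat C -> is_pf (chosen_forget Q q).
Proof.
  intro H. constructor; intros; cbn.
  1, 2: reflexivity.
  all: rewrite ?(bc_wl_id H), ?(bc_wr_id H), ?(bc_idl H), ?(bc_idr H); reflexivity.
Qed.

Local Notation c2 f := (ch (fst f), ch (snd f)).
Local Notation p2 a := (proj1_sig (fst a), proj1_sig (snd a)).
Local Notation c3 f := (ch (fst (fst f)), ch (snd (fst f)), ch (snd f)).
Local Notation p3 a := (proj1_sig (fst (fst a)), proj1_sig (snd (fst a)), proj1_sig (snd a)).
Local Notation c4 f :=
  (ch (fst (fst (fst f))), ch (snd (fst (fst f))), ch (snd (fst f)), ch (snd f)).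

Lemma pull_pf : is_pf pull_T.
Proof.
  pose proof (mo_T Hc) as H. constructor; intros; apply sig_eq.
  - exact (@pf_id2 _ _ _ _ _ _ H A B (c2 f)).
  - exact (@pf_comp2 _ _ _ _ _ _ H A B (c2 f) (c2 g) (c2 h) (p2 a) (p2 b)).
  - exact (@pf_fc_natl _ _ _ _ _ _ H A B E (c2 f) (c2 f') (c2 g) (p2 a)).
  - exact (@pf_fc_natr _ _ _ _ _ _ H A B E (c2 f) (c2 g) (c2 g') (p2 a)).
  - exact (@pf_fc_fci _ _ _ _ _ _ H A B E (c2 f) (c2 g)).
  - exact (@pf_fci_fc _ _ _ _ _ _ H A B E (c2 f) (c2 g)).
  - exact (@pf_fu_fui _ _ _ _ _ _ H A).
  - exact (@pf_fui_fu _ _ _ _ _ _ H A).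
  - exact (@pf_assoc _ _ _ _ _ _ H A B E G (c2 f) (c2 g) (c2 h)).
  - exact (@pf_lun _ _ _ _ _ _ H A B (c2 f)).
  - exact (@pf_run _ _ _ _ _ _ H A B (c2 f)).
Qed.

(* Comparing the two forms of [pn_fc] with all structure unfolded spares the kernel an
   exponential search. *)
Ltac unfolded t :=
  let t' := eval cbn [F_lassoc F_rassoc pf_comp pf_pair pf_fst pf_snd
    pull_T pull_mon mT masc mascT on1 on2 fc fci nat1 chosen_bicat bprod comp1 comp2 id2 hom cell
    whiskl whiskr assoc associ ch choose ch_comp ch_id proj1_sig up fst snd ch_str] in t in
  t'.

Lemma pull_monoidal : is_monoidal pull_coh.
Proof.
  constructor.
  - exact (chosen_is_bicat (mo_bicat Hc)).
  - exact pull_pf.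
  - split; [ | intro X; apply pull_equiv; apply (proj2 (mo_asc Hc) X) ].
    pose proof (proj1 (mo_asc Hc)) as H. constructor; intros; apply sig_eq.
    + exact (pn_inv H (A := A) (B := B) (c3 f)).
    + exact (pn_invi H (A := A) (B := B) (c3 f)).
    + exact (pn_nat2 H (A := A) (B := B) (f := c3 f) (g := c3 g) (p3 a)).
    + pose proof (pn_fc H (A := A) (B := B) (E := E) (c3 f) (c3 g)) as N.
      let t := type of N in let t' := unfolded t in assert (N' : t') by exact N; clear N.
      lazymatch goal with |- ?t => let t' := unfolded t in enough (N : t') by exact N end.
      exact N'.
    + exact (pn_fu H A).
  - split; [ | intro X; apply pull_equiv; apply (proj2 (mo_lam Hc) X) ].
    pose proof (proj1 (mo_lam Hc)) as H. constructor; intros; apply sig_eq.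
    + exact (pn_inv H (ch f)).
    + exact (pn_invi H (ch f)).
    + exact (pn_nat2 H (proj1_sig a)).
    + exact (pn_fc H (ch f) (ch g)).
    + exact (pn_fu H A).
  - split; [ | intro X; apply pull_equiv; apply (proj2 (mo_rho Hc) X) ].
    pose proof (proj1 (mo_rho Hc)) as H. constructor; intros; apply sig_eq.
    + exact (pn_inv H (ch f)).
    + exact (pn_invi H (ch f)).
    + exact (pn_nat2 H (proj1_sig a)).
    + exact (pn_fc H (ch f) (ch g)).
    + exact (pn_fu H A).
  - destruct (mo_inv Hc) as (h1 & h2 & h3 & h4).
    split; [ | split; [ | split ] ]; intros; apply pull_iso2; [ apply h1 | apply h2 | apply h3 | apply h4 ].
  - pose proof (mo_modif Hc) as H. constructor; intros X Y f; apply sig_eq.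
    + exact (mp_mod H (A := X) (B := Y) (c4 f)).
    + exact (mm_mod H (A := X) (B := Y) (c2 f)).
    + exact (ml_mod H (A := X) (B := Y) (c2 f)).
    + exact (mr_mod H (A := X) (B := Y) (c2 f)).
  - destruct (mo_eqs Hc) as (h1 & h2 & h3).
    split; [ | split ].
    + intros V W X Y Z. apply sig_eq. exact (h1 V W X Y Z).
    + intros W Y Z. apply sig_eq. exact (h2 W Y Z).
    + intros W Y Z. apply sig_eq. exact (h3 W Y Z).
Qed.

Lemma chosen_forget_strict : is_strict_monoidal (chosen_forget Q q) pull_coh c.
Proof.
  constructor; intros; try reflexivity; try apply celleq_refl.
  split; [ exact (chosen_forget_pf (mo_bicat Hc)) | ].
  split; intros; apply celleq_refl.
Qed.
End Pullback.

Local Open Scope dbl_scope.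

(** [lcs_s] gives a modification whose vertical boundaries are the transformations of identity
    1v-cells, and functoriality of [L] identifies these with identities. *)
Lemma hmodif_all {B : dbl} {b : bin B} {L : lcs b} (HL : lcs_laws L) (FL : lcs_functor L)
    {X X' : B} {k k' : hor X X'} (a : cell (HB B) k k') :
  is_hmodif (lt b X) (lt b X') (lh L k) (lh L k') (fun Y => fsg (rt b Y) a).
Proof.
  destruct (lcs_s HL a) as [E1 E2].
  split.
  - intros Y Y' f. apply sqeq_J. generalize (J_eq (E1 _ _ f)). rT.
    rewrite !(lcf_vid' FL). rT. rewrite ?fsT_J. exact (fun h => h).
  - intros Y Y' u. apply sqeq_J. generalize (J_eq (E2 _ _ u)). rT.
    rewrite (J_eq (proj2 (proj2 (lcf_vid FL X)) _ _ u)), (J_eq (proj2 (proj2 (lcf_vid FL X')) _ _ u)).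
    rT. rewrite ?fsT_J. exact (fun h => h).
Qed.

(** * Pure maps of the double category and of its horizontal bicategory *)

Section HorizontalPureMaps.
Context {B : dbl} {b : bin B} {s : side} {P : pmd b} {L : lcs b} {R : lcs (brev b)}
  (l : liftable P) (hB : is_central_premonoidal_dbl s P L R) (hl : inv_liftable P)
  (hvv : forall (X X' : B) (U : ver X X') (Y Y' : B) (u : ver Y Y'),
       sqeq (vd (lv R u) U) (sqv (vcomp (fv (lt b X) u) (fv (rt b Y') U)))).

Let CF := central_full (cpd_cen hB) hvv.

Lemma Z_cell_all X X' (f g : chosen (Z_sel L R) X X') (a : cell (HB B) (ch f) (ch g)) :
  Z_cell a.
Proof.
  destruct CF as [[_ [HL FL]] [HR FR]].
  destruct f as [f sf Ef], g as [g sg Eg]. cbn in a. subst sf sg. split.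
  - exact (hmodif_all HL FL a).
  - exact (hmodif_all HR FR a).
Qed.

Lemma HCp_cell_all X X' (f g : chosen (Cp_sel (b := Hbin b) (Hlcs L) (Hlcs R)) X X')
    (a : cell (HB B) (ch f) (ch g)) : HCp_cell (L := L) (R := R) a.
Proof.
  destruct f as [f sf Ef], g as [g sg Eg]. cbn in a. subst sf sg. split.
  - exact (proj2 (HL_laws hB hvv) _ _ _ _ a).
  - exact (proj2 (HR_laws hB hvv) _ _ _ _ a).
Qed.

Lemma hor_p_cells_all : hor_p_cells L R.
Proof. intros X X' f g a _. apply HCp_cell_all. Qed.

Section Strict.
Context (qZ : closed2 (Z_cell (L := L) (R := R))) (qC : closed2 (HCp_cell (L := L) (R := R)))
  (w : hor_p_cells L R).

Lemma hor_p_strict : is_strict (hor_p qZ qC w).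
Proof.
  pose proof (HB_bicat B) as H.
  split; [ | split; intros; apply celleq_refl ].
  constructor; intros; apply sig_eq; cbn -[HB];
    rewrite ?(bc_wl_id H), ?(bc_wr_id H), ?(bc_idl H), ?(bc_idr H); reflexivity.
Qed.

Context {M : mon (HB B) (tens b) (dI P)} (c : bcoh (mon_constr M)).
(** Both structures are pulled back from the same one on the horizontal bicategory, and [hor_p]
    leaves the underlying cells unchanged. *)
Lemma hor_p_strict_monoidal : is_strict_monoidal (hor_p qZ qC w)
  (pull_coh Z_cell_all qZ c) (pull_coh HCp_cell_all qC c).
Proof.
  constructor; intros; try (apply celleq_chosen).
  - exact hor_p_strict.
  - reflexivity.
  - exact (celleq_refl (on2 (mT M) X Y (ch (fst f), ch (snd f)) (ch (fst g), ch (snd g))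
      (proj1_sig (fst a), proj1_sig (snd a)))).
  - exact (celleq_refl (@fc _ _ _ _ _ (mT M) X Y Z (ch (fst f), ch (snd f)) (ch (fst g), ch (snd g)))).
  - exact (celleq_refl (fu (mT M) X)).
  - reflexivity.
  - exact (celleq_refl (nat1 (mascT M) (A := X) (B := Y)
      (ch (fst (fst f)), ch (snd (fst f)), ch (snd f)))).
  - reflexivity.
  - exact (celleq_refl (nat1 (mlamT M) (ch f))).
  - reflexivity.
  - exact (celleq_refl (nat1 (mrhoT M) (ch f))).
  - exact (celleq_refl (cp c W X Y Z)).
  - exact (celleq_refl (cm c W Y)).
  - exact (celleq_refl (cl c W Y)).
  - exact (celleq_refl (cr c W Y)).
Qed.
End Strict.
End HorizontalPureMaps.

Theorem theorem9p4 (B : dbl) (b : bin B) (s : side) (P : pmd b) (L : lcs b)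
    (R : lcs (brev b)) (l : liftable P)
    (hB : is_central_premonoidal_dbl s P L R)
    (hl : inv_liftable P)
    (hvv : forall (X X' : B) (U : ver X X') (Y Y' : B) (u : ver Y Y'),
       sqeq (vd (lv R u) U) (sqv (vcomp (fv (lt b X) u) (fv (rt b Y') U)))) :
  (exists c : bcoh (Hconstr l),
     is_central_premonoidal_bicat s c (Hlcs L) (Hlcs R)) /\
  (exists c : bcoh (mon_constr (Hmon L R l)),
     is_monoidal c /\
     exists (qZ : closed2 (Z_cell (L := L) (R := R))) (qC : closed2 (HCp_cell (L := L) (R := R)))
       (w : hor_p_cells L R)
       (MZ : mon (HZ qZ) (tens b) (dI P)) (cZ : bcoh (mon_constr MZ))
       (MC : mon (HCp qC) (tens b) (dI P)) (cC : bcoh (mon_constr MC)),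
       is_monoidal cZ /\
       is_strict_monoidal (chosen_forget _ qZ) cZ c /\
       is_monoidal cC /\
       is_strict_monoidal (hor_p qZ qC w) cZ cC).
Proof.
  destruct (canonical_exists l hB) as [c Hc]. split.
  - exists c. exact (H_central_premonoidal hB hl hvv Hc).
  (* The structure defined by squares is replaced by the bicategorical construction, for which the
     axioms are available. *)
  - rewrite (Hmon_bmon l hB hl hvv).
    pose proof (bmon_monoidal hB hl hvv Hc) as M.
    exists (bt_coh (Hlcs L) c). split; [ exact M | ].
    exists (closed2_all (Z_cell_all hB hvv)), (closed2_all (HCp_cell_all hB hvv)),
      (hor_p_cells_all hB hvv).
    exists (pull_mon (Z_cell_all hB hvv) _ _), (pull_coh (Z_cell_all hB hvv) _ (bt_coh (Hlcs L) c)),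
      (pull_mon (HCp_cell_all hB hvv) _ _), (pull_coh (HCp_cell_all hB hvv) _ (bt_coh (Hlcs L) c)).
    split; [ exact (pull_monoidal _ _ M) | split; [ exact (chosen_forget_strict _ _ M) | ] ].
    split; [ exact (pull_monoidal _ _ M) | apply hor_p_strict_monoidal ].
Qed.
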